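(* Assume that for every $t\in[0,T]$ the maps $(x,\bar x,v)\mapsto l(t,x,\bar x,v)$ on $\mathbb R^{n+n}\times U$, $(x,\bar x)\mapsto\phi(x,\bar x)$ and $y\mapsto\varphi(y)$ are convex. Assume that $b(t,v)=\tilde b_tv+\bar b_t$ and $\psi(t,v)=\tilde\psi_tv+\bar\psi_t$, where $\tilde b\in\mathscr L^\infty(0,T;\mathbb R^{n\times k})$, $\bar b\in\mathscr L^\infty(0,T;\mathbb R^n)$, $\tilde\psi\in\mathscr L^\infty(0,T;\mathbb R^{m\times k})$, $\bar\psi\in\mathscr L^\infty(0,T;\mathbb R^m)$. Let $u\in\mathscr U_{ad}$, let $(x^u,y^u,z^u,\tilde z^u)\in\mathscr L^2_{\mathscr F}(0,T;\mathbb R^{n+m+m\times r+m\times\tilde r})$ be the solution of the state equation under $u$, let $(k,p,q,\tilde q)\in\mathscr L^2_{\mathscr F}(0,T;\mathbb R^{m+n+n\times r+n\times\tilde r})$ be the solution of the adjoint equation $$ \left\{\begin{aligned} dk_t=&\ \left(\beta^\top_t k_t+\bar{\beta}^\top_t\mathbb E k_t\right)dt+\left(\gamma^\top_t k_t+\bar{\gamma}^\top_t\mathbb E k_t\right)dw_t+\left(\tilde{\gamma}^\top_t k_t+\bar{\tilde{\gamma}}^\top_t\mathbb E k_t\right)d\tilde{w}_t,\\ -dp_t=&\ \left[a^\top_tp_t+l^\top_x(\Theta^u_t)+\mathbb E\left(\bar a^\top_tp_t+l^\top_{\bar x}(\Theta^u_t)\right)-\alpha^\top_tk_t-\bar{\alpha}^\top_t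 \mathbb E k_t\right]dt-q_tdw_t-\tilde q_td\tilde w_t,\\ k_0=&\ -\varphi^\top_{y}(y^{u}_0),\qquad p_T=\phi^\top_x(\Xi^u_T)+\mathbb E \phi^\top_{\bar x}(\Xi^u_T)-\rho^\top k_T-\bar{\rho}^\top\mathbb E k_T, \end{aligned} \right. $$ and suppose that $$\mathbb E\left[H(t,\Pi^u_t,u_t;k_t,p_t,q_t)\,\big|\,\mathscr F^{Y^u}_t\right]=\inf_{v\in U}\mathbb E\left[H(t,\Pi^u_t,v;k_t,p_t,q_t)\,\big|\,\mathscr F^{Y^u}_t\right].$$ Then $u$ is an optimal control, i.e. $J[u]=\inf_{v\in\mathscr U_{ad}}J[v]$.
   Context: Basic setting. $T>0$; $(\Omega,\mathscr F,(\mathscr F_t)_{0\le t\le T},\mathbb P)$ is a complete filtered probability space, on which are given an $\mathscr F_t$-adapted standard Brownian motion $(w,\tilde w)$ with values in $\mathbb R^{r+\tilde r}$ and a Gaussian $\mathbb R^n$-valued random variable $\xi$ with mean $\mu_0$ and covariance matrix $\sigma_0$, independent of $(w,\tilde w)$. $\mathbb E$ is expectation. $\mathscr L^\infty(0,T;E)$ denotes uniformly bounded deterministic functions $[0,T]\to E$; $\mathscr L^2_{\mathscr F}(0,T;E)$ denotes $\mathscr F_t$-adapted, square-integrable $E$-valued processes on $[0,T]$. Subscripts of functions such as $f_x$ denote partial derivatives, written as row vectors for scalar functions. Coefficients. $a,\bar a\in\mathscr L^\infty(0,T;\mathbb R^{n\times n})$, $c\in\mathscr L^\infty(0,T;\mathbb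 R^{n\times r})$, $\alpha,\bar\alpha\in\mathscr L^\infty(0,T;\mathbb R^{m\times n})$, $\beta,\bar\beta\in\mathscr L^\infty(0,T;\mathbb R^{m\times m})$, $f,\bar f\in\mathscr L^\infty(0,T;\mathbb R^{\tilde r\times n})$, $h,h^{-1}\in\mathscr L^\infty(0,T;\mathbb R^{\tilde r\times\tilde r})$; $\gamma=(\gamma_1,\dots,\gamma_r)$, $\bar\gamma=(\bar\gamma_1,\dots,\bar\gamma_r)$, $\tilde\gamma=(\tilde\gamma_1,\dots,\tilde\gamma_{\tilde r})$, $\bar{\tilde\gamma}=(\bar{\tilde\gamma}_1,\dots,\bar{\tilde\gamma}_{\tilde r})$ with all components in $\mathscr L^\infty(0,T;\mathbb R^{m\times m})$; $\rho,\bar\rho\in\mathbb R^{m\times n}$. For $z=(z_1,\dots,z_r)\in\mathbb R^{m\times r}$, $\gamma_tz:=\sum_{j=1}^r\gamma_{j,t}z_j$ (similarly for $\bar\gamma,\tilde\gamma,\bar{\tilde\gamma}$), and for $k\in\mathbb R^m$, $\gamma_t^\top k:=(\gamma_{1,t}^\top k,\dots,\gamma_{r,t}^\top k)\in\mathbb R^{m\times r}$ (similarly for the others). $g:[0,T]\times\mathbb R^k\to\mathbb R^{\tilde r}$ satisfies $\mathbb E\int_0^T|g(t,v_t)|^2dt<\infty$ for the controls $v$; $b:[0,T]\times\mathbb R^k\to\mathbb R^n$ and $\psi:[0,T]\times\mathbb R^k\to\mathbb R^m$ are continuous in $t$ and continuously differentiable in $v$ with $b_v,\psi_v$ uniformly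 bounded, and in the claim have the affine form stated there. State and observation. For a control $v\in\mathscr L^2_{\mathscr F}(0,T;\mathbb R^k)$, $(x^v,y^v,z^v,\tilde z^v)$ is the unique solution of $$\left\{\begin{aligned} dx^v_t=&\ (a_tx^v_t+\bar a_t\mathbb E x^v_t+b(t,v_t))dt+c_tdw_t,\\ -dy^v_t=&\ (\alpha_tx^v_t+\bar\alpha_t\mathbb E x^v_t+\beta_ty^v_t+\bar\beta_t\mathbb E y^v_t+\gamma_tz^v_t+\bar\gamma_t\mathbb E z^v_t+\tilde\gamma_t\tilde z^v_t+\bar{\tilde\gamma}_t\mathbb E\tilde z^v_t+\psi(t,v_t))dt-z^v_tdw_t-\tilde z^v_td\tilde w_t,\\ x^v_0=&\ \xi,\quad y^v_T=\rho x^v_T+\bar\rho\,\mathbb E x^v_T, \end{aligned}\right.$$ and the observation is $dY^v_t=(f_tx^v_t+\bar f_t\mathbb E x^v_t+g(t,v_t))dt+h_td\tilde w_t$, $Y^v_0=0$. The processes $x^0,Y^0$ are defined by $dx^0_t=(a_tx^0_t+\bar a_t\mathbb E x^0_t)dt+c_tdw_t$, $x^0_0=\xi$, and $dY^0_t=(f_tx^0_t+\bar f_t\mathbb E x^0_t)dt+h_td\tilde w_t$, $Y^0_0=0$. Put $\mathscr F^{Y^v}_t=\sigma\{Y^v_s;0\le s\le t\}$ and $\mathscr F^{Y^0}_t=\sigma\{Y^0_s;0\le s\le t\}$. Admissible controls. $U\subseteq\mathbb R^k$ is nonempty and convex. $\mathscr U^0_{ad}$ is the set of $\mathscr F^{Y^0}_t$-adapted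 $U$-valued processes $v$ with $\mathbb E\sup_{0\le t\le T}|v_t|^2<\infty$; $\mathscr U_{ad}$ is the set of $v\in\mathscr U^0_{ad}$ that are $\mathscr F^{Y^v}_t$-adapted. Cost. $J[v]=\mathbb E\left[\int_0^Tl(t,x^v_t,\mathbb E x^v_t,v_t)dt+\phi(x^v_T,\mathbb E x^v_T)+\varphi(y^v_0)\right]$, where $l:[0,T]\times\mathbb R^{n+n}\times U\to\mathbb R$, $\phi:\mathbb R^{n+n}\to\mathbb R$, $\varphi:\mathbb R^m\to\mathbb R$ are continuously differentiable in $(x,\bar x,v)$, $(x,\bar x)$, $y$ respectively, and for some $C>0$: $|\phi|\le C(1+|x|^2+|\bar x|^2)$, $|\phi_x|+|\phi_{\bar x}|\le C(1+|x|+|\bar x|)$, $|l|\le C(1+|x|^2+|\bar x|^2+|v|^2)$, $|l_\chi|\le C(1+|x|+|\bar x|+|v|)$ for $\chi=x,\bar x,v$, $|\varphi(y)|\le C(1+|y|^2)$, $|\varphi_y(y)|\le C(1+|y|^2)$. Notation. $\Theta^u_t=(t,x^u_t,\mathbb E x^u_t,u_t)$, $\Xi^u_t=(x^u_t,\mathbb E x^u_t)$, $\Pi^u_t=(x^u_t,y^u_t,z^u_t,\tilde z^u_t,\mathbb E x^u_t,\mathbb E y^u_t,\mathbb E z^u_t,\mathbb E\tilde z^u_t)$. The Hamiltonian is $$H(t,x,y,z,\tilde z,\bar x,\bar y,\bar z,\bar{\tilde z},v;k,p,q)=\langle a_tx+\bar a_t\bar x+b(t,v),p\rangle+\langle c_t,q\rangle+l(t,x,\bar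 x,v)-\langle\alpha_tx+\bar\alpha_t\bar x+\beta_ty+\bar\beta_t\bar y+\gamma_tz+\bar\gamma_t\bar z+\tilde\gamma_t\tilde z+\bar{\tilde\gamma}_t\bar{\tilde z}+\psi(t,v),k\rangle.$$ *)

(* Defs.v *)
From HB Require Import structures.
From mathcomp Require Import all_boot all_order all_algebra.
From mathcomp Require Import all_classical all_reals all_analysis.

Set Implicit Arguments.
Unset Strict Implicit.
Unset Printing Implicit Defensive.

Import Order.TTheory GRing.Theory Num.Theory.
Import numFieldNormedType.Exports.

Local Open Scope classical_set_scope.
Local Open Scope ring_scope.

(* Euclidean (Frobenius) structure; the library norm on matrices is the
   sup norm, which is only used below through its topology. *)
Definition inner (R : realType) (p q : nat) (A B : 'M[R]_(p, q)) : R :=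
  \tr (A^T *m B).

Definition sqn (R : realType) (p q : nat) (A : 'M[R]_(p, q)) : R := inner A A.

Definition enorm (R : realType) (p q : nat) (A : 'M[R]_(p, q)) : R :=
  Num.sqrt (sqn A).

Definition grad (R : realType) (N : nat) (f : 'cV[R]_N -> R) (x : 'cV[R]_N) :
  'cV[R]_N := \col_i 'D_(delta_mx i 0) f x.

Definition jac (R : realType) (N p : nat) (f : 'cV[R]_N -> 'cV[R]_p)
  (x : 'cV[R]_N) : 'M[R]_(p, N) := \matrix_(i, j) 'D_(delta_mx j 0) f x i 0.

(* Frechet differentiability relative to a domain D that need not be open. *)
Definition diff_within (R : realType) (V : normedModType R) (D : set V)
    (f : V -> R) (df : V -> V -> R) : Prop :=
  forall x, D x -> forall e : R, 0 < e ->
    \forall y \near within D (nbhs x),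
      `|f y - f x - df x (y - x)| <= e * `|y - x|.

Definition borel (V : topologicalType) : set (set V) := <<s @open V >>.

Definition Linf (R : realType) (T : R) (p q : nat) (A : R -> 'M[R]_(p, q)) :
    Prop :=
  (forall B, borel B ->
     measurable (`[0, T] `&` A @^-1` B : set (measurableTypeR R))) /\
  exists C : R, forall t, 0 <= t <= T -> enorm (A t) <= C.

Section StochasticBasis.
Context (R : realType) (d : measure_display) (Omega : measurableType d)
  (P : probability Omega R).

Definition meas_wrt (V : topologicalType) (G : set (set Omega))
    (X : Omega -> V) : Prop := forall B, borel B -> G (X @^-1` B).

Definition sigma_rv (V : topologicalType) (X : Omega -> V) : set (set Omega) :=
  [set A | exists2 B, borel B & A = X @^-1` B].

Definition sigma_path (V : topologicalType) (Y : R -> Omega -> V) (t : R) :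
    set (set Omega) :=
  <<s [set A | exists s, 0 <= s <= t /\ sigma_rv (Y s) A] >>.

Definition indep (G H : set (set Omega)) : Prop :=
  forall A B, G A -> H B -> P (A `&` B) = (P A * P B)%E.

Definition complete_filtration (T : R) (F : R -> set (set Omega)) : Prop :=
  [/\ measure_is_complete P,
      forall t, 0 <= t <= T -> sigma_algebra setT (F t) /\ F t `<=` measurable,
      forall s t, 0 <= s -> s <= t -> t <= T -> F s `<=` F t
    & P.-negligible `<=` F 0].

Definition mean (p q : nat) (X : Omega -> 'M[R]_(p, q)) : 'M[R]_(p, q) :=
  \matrix_(i, j) fine ('E_P[fun w => X w i j])%E.

(* N(mu, v); the degenerate case v = 0 is a Dirac mass, which normal_prob
   does not cover (its second argument is a nonzero standard deviation). *)
Definition gaussian_rv (X : Omega -> R) (mu v : R) : Prop :=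
  0 <= v /\
  if v == 0 then {ae P, forall w, X w = mu}
  else forall B : set (measurableTypeR R), measurable B ->
         P (X @^-1` B) = normal_prob mu (Num.sqrt v) B.

Definition gaussian_vec (N : nat) (X : Omega -> 'cV[R]_N) (mu : 'cV[R]_N)
    (S : 'M[R]_N) : Prop :=
  [/\ meas_wrt measurable X, S^T = S &
      forall a : 'cV[R]_N,
        gaussian_rv (fun w => inner a (X w)) (inner a mu) (inner a (S *m a))].

Definition adapted (V : topologicalType) (T : R) (F : R -> set (set Omega))
    (X : R -> Omega -> V) : Prop :=
  forall t, 0 <= t <= T -> meas_wrt (F t) (X t).

Definition joint_meas (V : topologicalType) (T : R) (X : R -> Omega -> V) :
    Prop :=
  forall B, borel B ->
    measurable ([set q | 0 <= q.1 <= T /\ B (X q.1 q.2)]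
                : set (measurableTypeR R * Omega)%type).

Definition sqint (T : R) (p q : nat) (X : R -> Omega -> 'M[R]_(p, q)) :
    \bar R :=
  (\int[P]_w \int[lebesgue_measure]_(t in `[0%R, T]) (sqn (X t w))%:E)%E.

Definition L2F (T : R) (F : R -> set (set Omega)) (p q : nat)
    (X : R -> Omega -> 'M[R]_(p, q)) : Prop :=
  [/\ adapted T F X, joint_meas T X & (sqint T X < +oo)%E].

Definition brownian (T : R) (F : R -> set (set Omega)) (N : nat)
    (W : R -> Omega -> 'cV[R]_N) : Prop :=
  [/\ adapted T F W,
      {ae P, forall w, W 0 w = 0},
      {ae P, forall w, {within `[0, T], continuous (fun t => W t w)}}
    & forall s t, 0 <= s -> s < t -> t <= T ->
        indep (F s) (sigma_rv (fun w => W t w - W s w)) /\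
        gaussian_vec (fun w => W t w - W s w) 0 ((t - s)%:M)].

(* The Ito integral is the L2 limit of the integrals of bounded simple
   predictable integrands
     sum_(i < N) phi_i 1_(]tau_i, tau_(i+1)]),  phi_i F_(tau_i)-measurable. *)
Record simple_process (p r : nat) := SimpleProcess {
  sp_size : nat;
  sp_time : nat -> R;
  sp_coef : nat -> Omega -> 'M[R]_(p, r) }.

Definition simple_ok (T : R) (F : R -> set (set Omega)) (p r : nat)
    (S : simple_process p r) : Prop :=
  [/\ 0 <= sp_time S 0,
      forall i, (i < sp_size S)%N -> sp_time S i <= sp_time S i.+1,
      sp_time S (sp_size S) <= T &
      forall i, (i < sp_size S)%N ->
        meas_wrt (F (sp_time S i)) (sp_coef S i) /\
        exists C : R, forall w, enorm (sp_coef S i w) <= C].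

Definition simple_val (p r : nat) (S : simple_process p r) (t : R)
    (w : Omega) : 'M[R]_(p, r) :=
  \sum_(i < sp_size S)
    (if sp_time S i < t <= sp_time S i.+1 then sp_coef S i w else 0).

Definition simple_integral (p r : nat) (W : R -> Omega -> 'cV[R]_r)
    (S : simple_process p r) (t : R) (w : Omega) : 'cV[R]_p :=
  \sum_(i < sp_size S)
    sp_coef S i w *m (W (Num.min t (sp_time S i.+1)) w -
                      W (Num.min t (sp_time S i)) w).

(* I is a continuous version of t |-> int_0^t Z_s dW_s on [0, T]. *)
Definition ito_integral (T : R) (F : R -> set (set Omega)) (p r : nat)
    (W : R -> Omega -> 'cV[R]_r) (Z : R -> Omega -> 'M[R]_(p, r))
    (I : R -> Omega -> 'cV[R]_p) : Prop :=
  [/\ adapted T F I,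
      {ae P, forall w, {within `[0, T], continuous (fun t => I t w)}} &
      exists S : nat -> simple_process p r,
        [/\ forall j, simple_ok T F (S j),
            (fun j => sqint T (fun t w => Z t w - simple_val (S j) t w))
              @ \oo --> 0%E &
            forall t, 0 <= t <= T ->
              (fun j => ('E_P[fun w => sqn (I t w - simple_integral W (S j) t w)])%E)
                @ \oo --> 0%E]].

Definition time_integral (p : nat) (D : R -> 'cV[R]_p) (t : R) : 'cV[R]_p :=
  \col_i \int[lebesgue_measure]_(s in `[0, t]) D s i 0.

(* dX_t = D_t dt + Z_t dw_t + Zt_t dwt_t on [0, T]. *)
Definition has_differential (T : R) (F : R -> set (set Omega)) (r rt : nat)
    (w : R -> Omega -> 'cV[R]_r) (wt : R -> Omega -> 'cV[R]_rt) (p : nat)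
    (X D : R -> Omega -> 'cV[R]_p) (Z : R -> Omega -> 'M[R]_(p, r))
    (Zt : R -> Omega -> 'M[R]_(p, rt)) : Prop :=
  adapted T F X /\
  exists I It, [/\ ito_integral T F w Z I, ito_integral T F wt Zt It &
    {ae P, forall o, forall t, 0 <= t <= T ->
       X t o = X 0 o + time_integral (D^~ o) t + I t o + It t o}].

(* Z is a version of E[X | G]. *)
Definition cond_exp (G : set (set Omega)) (X Z : Omega -> R) : Prop :=
  [/\ P.-integrable setT (EFin \o X), P.-integrable setT (EFin \o Z),
      meas_wrt G Z &
      forall A, G A -> (\int[P]_(w in A) (Z w)%:E = \int[P]_(w in A) (X w)%:E)%E].

(* Infimum, in the lattice of random variables modulo almost sure equality,
   of a possibly uncountable family. *)
Definition is_essential_inf (I : Type) (U : set I) (Z : I -> Omega -> R)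
    (z : Omega -> R) : Prop :=
  (forall v, U v -> {ae P, forall w, z w <= Z v w}) /\
  forall z' : Omega -> R, measurable_fun setT z' ->
    (forall v, U v -> {ae P, forall w, z' w <= Z v w}) ->
    {ae P, forall w, z' w <= z w}.

End StochasticBasis.

(* Deterministic data.  A trailing _b is a bar; mga, mga_b are gamma and
   bar gamma, mgat, mgat_b are tilde gamma and bar tilde gamma. *)
Record model (R : realType) (n m r rt k : nat) := Model {
  mT : R;
  mmu0 : 'cV[R]_n;
  msigma0 : 'M[R]_n;
  ma : R -> 'M[R]_n;
  ma_b : R -> 'M[R]_n;
  mc : R -> 'M[R]_(n, r);
  mal : R -> 'M[R]_(m, n);
  mal_b : R -> 'M[R]_(m, n);
  mbe : R -> 'M[R]_m;
  mbe_b : R -> 'M[R]_m;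
  mf : R -> 'M[R]_(rt, n);
  mf_b : R -> 'M[R]_(rt, n);
  mh : R -> 'M[R]_rt;
  mga : 'I_r -> R -> 'M[R]_m;
  mga_b : 'I_r -> R -> 'M[R]_m;
  mgat : 'I_rt -> R -> 'M[R]_m;
  mgat_b : 'I_rt -> R -> 'M[R]_m;
  mrho : 'M[R]_(m, n);
  mrho_b : 'M[R]_(m, n);
  mg : R -> 'cV[R]_k -> 'cV[R]_rt;
  mb : R -> 'cV[R]_k -> 'cV[R]_n;
  mpsi : R -> 'cV[R]_k -> 'cV[R]_m;
  mU : set 'cV[R]_k;
  ml : R -> 'cV[R]_n -> 'cV[R]_n -> 'cV[R]_k -> R;
  mphi : 'cV[R]_n -> 'cV[R]_n -> R;
  mvphi : 'cV[R]_m -> R }.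

(* gamma_t z = sum_j gamma_(j,t) z_j and
   gamma_t^T k = (gamma_(1,t)^T k, ..., gamma_(r,t)^T k). *)
Definition gapp (R : realType) (m r : nat) (ga : 'I_r -> R -> 'M[R]_m) (t : R)
    (z : 'M[R]_(m, r)) : 'cV[R]_m := \sum_(j < r) ga j t *m col j z.

Definition gappT (R : realType) (m r : nat) (ga : 'I_r -> R -> 'M[R]_m) (t : R)
    (k : 'cV[R]_m) : 'M[R]_(m, r) :=
  \matrix_(i, j) (((ga j t)^T *m k) i 0).

Section Model.
Context (R : realType) (n m r rt k : nat) (M : model R n m r rt k).

Definition lx t x xb v : 'cV[R]_n := grad (fun x' => ml M t x' xb v) x.
Definition lxb t x xb v : 'cV[R]_n := grad (fun xb' => ml M t x xb' v) xb.
Definition phix x xb : 'cV[R]_n := grad (fun x' => mphi M x' xb) x.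
Definition phixb x xb : 'cV[R]_n := grad (fun xb' => mphi M x xb') xb.
Definition vphiy y : 'cV[R]_m := grad (mvphi M) y.

Definition coefficients_ok : Prop :=
  0 < mT M /\
  [/\ Linf (mT M) (ma M), Linf (mT M) (ma_b M) & Linf (mT M) (mc M)] /\
  [/\ Linf (mT M) (mal M), Linf (mT M) (mal_b M),
      Linf (mT M) (mbe M) & Linf (mT M) (mbe_b M)] /\
  [/\ forall j, Linf (mT M) (mga M j), forall j, Linf (mT M) (mga_b M j),
      forall j, Linf (mT M) (mgat M j) & forall j, Linf (mT M) (mgat_b M j)] /\
  [/\ Linf (mT M) (mf M), Linf (mT M) (mf_b M), Linf (mT M) (mh M),
      forall t, 0 <= t <= mT M -> mh M t \in unitmx &
      Linf (mT M) (fun t => invmx (mh M t))] /\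
  (forall B, borel B ->
     borel [set q : (R * 'cV[R]_k)%type | 0 <= q.1 <= mT M /\ B (mg M q.1 q.2)]).

Definition drift_ok (p : nat) (b : R -> 'cV[R]_k -> 'cV[R]_p) : Prop :=
  [/\ forall v, {within `[0, mT M], continuous (b^~ v)},
      forall t, 0 <= t <= mT M ->
        (forall v, differentiable (b t) v) /\ continuous (jac (b t)) &
      exists C : R, forall t v, 0 <= t <= mT M -> enorm (jac (b t) v) <= C].

Definition control_set_ok : Prop := mU M !=set0 /\ convex_set (mU M).

Definition running_cost_ok : Prop :=
  let D := [set q : ('cV[R]_n * 'cV[R]_n * 'cV[R]_k)%type | mU M q.2] in
  (forall x xb v, mU M v ->
     measurable_fun (`[0, mT M] : set (measurableTypeR R))
       (fun t => ml M t x xb v : measurableTypeR R)) /\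
  exists (lv : R -> 'cV[R]_n -> 'cV[R]_n -> 'cV[R]_k -> 'cV[R]_k) (C : R),
    0 < C /\ forall t, 0 <= t <= mT M ->
    [/\ diff_within D (fun q => ml M t q.1.1 q.1.2 q.2)
          (fun q dq => inner (lx t q.1.1 q.1.2 q.2) dq.1.1 +
                       inner (lxb t q.1.1 q.1.2 q.2) dq.1.2 +
                       inner (lv t q.1.1 q.1.2 q.2) dq.2),
        [/\ {within D, continuous (fun q => lx t q.1.1 q.1.2 q.2)},
            {within D, continuous (fun q => lxb t q.1.1 q.1.2 q.2)} &
            {within D, continuous (fun q => lv t q.1.1 q.1.2 q.2)}],
        forall x xb v, mU M v ->
          `|ml M t x xb v| <= C * (1 + sqn x + sqn xb + sqn v) &
        forall x xb v, mU M v ->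
          [/\ enorm (lx t x xb v) <= C * (1 + enorm x + enorm xb + enorm v),
              enorm (lxb t x xb v) <= C * (1 + enorm x + enorm xb + enorm v) &
              enorm (lv t x xb v) <= C * (1 + enorm x + enorm xb + enorm v)]].

Definition terminal_cost_ok : Prop :=
  [/\ forall q : ('cV[R]_n * 'cV[R]_n)%type,
        differentiable (fun q' => mphi M q'.1 q'.2) q,
      continuous (fun q : ('cV[R]_n * 'cV[R]_n)%type => phix q.1 q.2),
      continuous (fun q : ('cV[R]_n * 'cV[R]_n)%type => phixb q.1 q.2) &
      exists2 C : R, 0 < C & forall x xb,
        `|mphi M x xb| <= C * (1 + sqn x + sqn xb) /\
        enorm (phix x xb) + enorm (phixb x xb) <= C * (1 + enorm x + enorm xb)].

Definition initial_cost_ok : Prop :=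
  [/\ forall y, differentiable (mvphi M) y, continuous vphiy &
      exists2 C : R, 0 < C & forall y,
        `|mvphi M y| <= C * (1 + sqn y) /\ enorm (vphiy y) <= C * (1 + sqn y)].

Definition model_ok : Prop :=
  [/\ coefficients_ok, drift_ok (mb M), drift_ok (mpsi M) & control_set_ok] /\
  [/\ running_cost_ok, terminal_cost_ok & initial_cost_ok].

Definition costs_convex : Prop :=
  [/\ forall t, 0 <= t <= mT M ->
        @convex_function R ('cV[R]_n * 'cV[R]_n * 'cV[R]_k)%type
          [set q | mU M q.2] (fun q => ml M t q.1.1 q.1.2 q.2),
      @convex_function R ('cV[R]_n * 'cV[R]_n)%type
        setT (fun q => mphi M q.1 q.2) &
      @convex_function R 'cV[R]_m setT (mvphi M)].

Definition hamiltonian (t : R) (x : 'cV[R]_n) (y : 'cV[R]_m)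
    (z : 'M[R]_(m, r)) (zt : 'M[R]_(m, rt)) (xb : 'cV[R]_n) (yb : 'cV[R]_m)
    (zb : 'M[R]_(m, r)) (ztb : 'M[R]_(m, rt)) (v : 'cV[R]_k)
    (kk : 'cV[R]_m) (p : 'cV[R]_n) (q : 'M[R]_(n, r)) : R :=
  inner (ma M t *m x + ma_b M t *m xb + mb M t v) p
  + inner (mc M t) q
  + ml M t x xb v
  - inner (mal M t *m x + mal_b M t *m xb + mbe M t *m y + mbe_b M t *m yb
           + gapp (mga M) t z + gapp (mga_b M) t zb
           + gapp (mgat M) t zt + gapp (mgat_b M) t ztb + mpsi M t v) kk.

Section Control.
Context (d : measure_display) (Omega : measurableType d)
  (P : probability Omega R) (F : R -> set (set Omega))
  (w : R -> Omega -> 'cV[R]_r) (wt : R -> Omega -> 'cV[R]_rt)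
  (xi : Omega -> 'cV[R]_n).

Definition basis_ok : Prop :=
  let W := fun t o => col_mx (w t o) (wt t o) in
  [/\ complete_filtration P (mT M) F,
      brownian P (mT M) F W,
      gaussian_vec P xi (mmu0 M) (msigma0 M) &
      indep P (sigma_rv xi) (sigma_path W (mT M))].

Let T := mT M.
Let E p q (X : Omega -> 'M[R]_(p, q)) := mean P X.

Definition state_eq (v : R -> Omega -> 'cV[R]_k) (x : R -> Omega -> 'cV[R]_n)
    (y : R -> Omega -> 'cV[R]_m) (z : R -> Omega -> 'M[R]_(m, r))
    (zt : R -> Omega -> 'M[R]_(m, rt)) : Prop :=
  [/\ L2F P T F x, L2F P T F y, L2F P T F z & L2F P T F zt] /\
  [/\ has_differential P T F w wt x
        (fun t o => ma M t *m x t o + ma_b M t *m E (x t) + mb M t (v t o))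
        (fun t o => mc M t) (fun t o => 0),
      has_differential P T F w wt y
        (fun t o => - (mal M t *m x t o + mal_b M t *m E (x t)
                       + mbe M t *m y t o + mbe_b M t *m E (y t)
                       + gapp (mga M) t (z t o) + gapp (mga_b M) t (E (z t))
                       + gapp (mgat M) t (zt t o) + gapp (mgat_b M) t (E (zt t))
                       + mpsi M t (v t o)))
        z zt,
      {ae P, forall o, x 0 o = xi o} &
      {ae P, forall o, y T o = mrho M *m x T o + mrho_b M *m E (x T)}].

Definition obs_eq (v : R -> Omega -> 'cV[R]_k) (x : R -> Omega -> 'cV[R]_n)
    (Y : R -> Omega -> 'cV[R]_rt) : Prop :=
  has_differential P T F w wt Y
    (fun t o => mf M t *m x t o + mf_b M t *m E (x t) + mg M t (v t o))
    (fun t o => 0) (fun t o => mh M t) /\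
  {ae P, forall o, Y 0 o = 0}.

Definition uncontrolled_eq (x0 : R -> Omega -> 'cV[R]_n)
    (Y0 : R -> Omega -> 'cV[R]_rt) : Prop :=
  [/\ L2F P T F x0,
      has_differential P T F w wt x0
        (fun t o => ma M t *m x0 t o + ma_b M t *m E (x0 t))
        (fun t o => mc M t) (fun t o => 0),
      {ae P, forall o, x0 0 o = xi o},
      has_differential P T F w wt Y0
        (fun t o => mf M t *m x0 t o + mf_b M t *m E (x0 t))
        (fun t o => 0) (fun t o => mh M t) &
      {ae P, forall o, Y0 0 o = 0}].

Definition Uad0 (Y0 : R -> Omega -> 'cV[R]_rt) : set (R -> Omega -> 'cV[R]_k) :=
  [set v | [/\ joint_meas T v, adapted T (sigma_path Y0) v,
               forall t o, 0 <= t <= T -> mU M (v t o) &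
               (\int[P]_o ereal_sup [set (sqn (v t o))%:E | t in `[0%R, T]]
                  < +oo)%E]].

(* v belongs to U_ad, with state (x, y, z, zt) = (x^v, y^v, z^v, zt^v) and
   observation Y = Y^v.  State and observation are determined by v only up to
   null sets, and F^(Y^v) is the uncompleted filtration of the given version
   Y. *)
Definition admissible (Y0 : R -> Omega -> 'cV[R]_rt)
    (v : R -> Omega -> 'cV[R]_k) (x : R -> Omega -> 'cV[R]_n)
    (y : R -> Omega -> 'cV[R]_m) (z : R -> Omega -> 'M[R]_(m, r))
    (zt : R -> Omega -> 'M[R]_(m, rt)) (Y : R -> Omega -> 'cV[R]_rt) : Prop :=
  [/\ Uad0 Y0 v, state_eq v x y z zt, obs_eq v x Y &
      adapted T (sigma_path Y) v].

(* J[v], for the state (x, y) = (x^v, y^v). *)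
Definition cost (v : R -> Omega -> 'cV[R]_k) (x : R -> Omega -> 'cV[R]_n)
    (y : R -> Omega -> 'cV[R]_m) : \bar R :=
  ('E_P[(fun o =>
           (\int[lebesgue_measure]_(t in `[0, T])
              ml M t (x t o) (E (x t)) (v t o))
           + mphi M (x T o) (E (x T)) + mvphi M (y 0 o))%R])%E.

Definition adjoint_eq (u : R -> Omega -> 'cV[R]_k) (x : R -> Omega -> 'cV[R]_n)
    (y : R -> Omega -> 'cV[R]_m) (kk : R -> Omega -> 'cV[R]_m)
    (p : R -> Omega -> 'cV[R]_n) (q : R -> Omega -> 'M[R]_(n, r))
    (qt : R -> Omega -> 'M[R]_(n, rt)) : Prop :=
  [/\ L2F P T F kk, L2F P T F p, L2F P T F q & L2F P T F qt] /\
  [/\ has_differential P T F w wt kk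
        (fun t o => (mbe M t)^T *m kk t o + (mbe_b M t)^T *m E (kk t))
        (fun t o => gappT (mga M) t (kk t o) + gappT (mga_b M) t (E (kk t)))
        (fun t o => gappT (mgat M) t (kk t o) + gappT (mgat_b M) t (E (kk t))),
      has_differential P T F w wt p
        (fun t o => - ((ma M t)^T *m p t o + lx t (x t o) (E (x t)) (u t o)
                       + E (fun o' => (ma_b M t)^T *m p t o'
                                      + lxb t (x t o') (E (x t)) (u t o'))
                       - (mal M t)^T *m kk t o - (mal_b M t)^T *m E (kk t)))
        q qt,
      {ae P, forall o, kk 0 o = - vphiy (y 0 o)} &
      {ae P, forall o, p T o = phix (x T o) (E (x T))
                               + E (fun o' => phixb (x T o') (E (x T)))
                               - (mrho M)^T *m kk T o
                               - (mrho_b M)^T *m E (kk T)}].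

(* E[H(t, Pi_t, u_t; ..) | F^Y_t] = inf_(v in U) E[H(t, Pi_t, v; ..) | F^Y_t]
   for almost every t (z, zt, q are only determined for almost every t). *)
Definition minimum_condition (u : R -> Omega -> 'cV[R]_k)
    (x : R -> Omega -> 'cV[R]_n) (y : R -> Omega -> 'cV[R]_m)
    (z : R -> Omega -> 'M[R]_(m, r)) (zt : R -> Omega -> 'M[R]_(m, rt))
    (Y : R -> Omega -> 'cV[R]_rt) (kk : R -> Omega -> 'cV[R]_m)
    (p : R -> Omega -> 'cV[R]_n) (q : R -> Omega -> 'M[R]_(n, r)) : Prop :=
  let H t v o := hamiltonian t (x t o) (y t o) (z t o) (zt t o)
    (E (x t)) (E (y t)) (E (z t)) (E (zt t)) v (kk t o) (p t o) (q t o) in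
  {ae (@lebesgue_measure R), forall t, 0 <= t <= T ->
    exists (Hu : Omega -> R) (Hv : 'cV[R]_k -> Omega -> R),
      [/\ cond_exp P (sigma_path Y t) (fun o => H t (u t o) o) Hu,
          forall v, mU M v -> cond_exp P (sigma_path Y t) (H t v) (Hv v) &
          is_essential_inf P (mU M) Hv Hu]}.

End Control.
End Model.

(* Main.v *)
From HB Require Import structures.
Require Import Defs.
From mathcomp Require Import all_boot all_order all_algebra.
From mathcomp Require Import all_classical all_reals all_analysis.
From mathcomp Require Import measurable_realfun.
From mathcomp Require Import ring lra.
Set Implicit Arguments.
Unset Strict Implicit.
Unset Printing Implicit Defensive.
Import Order.TTheory GRing.Theory Num.Theory.
Import numFieldNormedType.Exports.
Local Open Scope classical_set_scope.
Local Open Scope ring_scope.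

(** Convexity bounds J[v] - J[u] below by its first variation at u in the direction
    (xv - xu, yv - yu, v - u) (cost_le), and the adjoint equation evaluates this
    variation. The product rule, in expectation, for the costate p against the
    forward state and for the multiplier kk against the backward state
    (ito_product) turns the slopes of the terminal and of the initial cost into
    an integral over time (pairing_ends), in which every term in the states
    cancels (pair_int_diff). What remains is the integral of

      E[<bt (v - u), p> - <psit (v - u), kk> + <l_v, v - u>],

    the derivative of the Hamiltonian at u in the direction v - u. It is
    nonnegative at almost every time (stationarity), for the following two
    reasons.

    First, v t may be compared with u t under the filtration of the observation Yu.
    A competitor v is adapted to the observation Y0 without control, and the path
    of Y0 up to t is, up to null sets, a function of the path of Yu
    (observation_filtration). Indeed let h be orthogonal to the events of Yu up
    to t. As u and the drift that it adds to Yu are functions of Yu, testing the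
    linear equation of xu - x0 against h removes the control; the tested
    difference solves a homogeneous linear equation and vanishes by Gronwall's
    lemma, and then h is orthogonal to Y0. By the bipolar argument
    (bipolar_gmeas), Y0 is measurable for the completed filtration of Yu.

    Secondly, the minimum condition speaks of constant controls, and of an
    essential infimum over uncountably many of them. A control measurable for the
    completed sigma-algebra is approximated by nearest points in a dense sequence
    of U; each approximation takes finitely many values, so that the condition can
    be applied value by value (nearest_int), and dominated convergence gives the
    limit (incr_control_ge0). Applied to u + eps (v - u), with eps tending to 0, this
    yields the first-order condition (first_order_ge0).

    The stochastic calculus is kept to what this needs. The Ito integral enters
    through the covariances of simple integrals and their mean-square limits
    (ito_isometry, ito_mart), and the product rule is only proved in
    expectation: the martingale parts are orthogonal to the past, and the drift
    parts are integrated by parts (product_formula). The running cost, continuous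
    in the state and measurable in time, is measurable along processes by
    nearest points again (Caratheodory_meas), and its gradients through
    difference quotients. *)

(** * Integrable and square-integrable functions *)

Notation L1 mu f := (mu.-integrable setT (EFin \o f)).

Section L1.
Context (R : realType) (d : measure_display) (X : measurableType d)
  (mu : {measure set X -> \bar R}).
Implicit Types f g : X -> R.

Lemma L1_meas f : L1 mu f -> measurable_fun setT f.
Proof. by move=> /measurable_int /measurable_EFinP. Qed.

Lemma L1_eq f g : (forall x, f x = g x) -> L1 mu f -> L1 mu g.
Proof. by move=> fg; apply: eq_integrable => // x _ /=; rewrite fg. Qed.

Lemma L1D f g : L1 mu f -> L1 mu g -> L1 mu (fun x => f x + g x).
Proof. by move=> If Ig; apply: L1_eq (integrableD measurableT If Ig). Qed.

Lemma L1Z (c : R) f : L1 mu f -> L1 mu (fun x => c * f x).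
Proof. by move=> If; apply: L1_eq (integrableZl measurableT c If). Qed.

Lemma L1N f : L1 mu f -> L1 mu (fun x => - f x).
Proof. by move=> If; apply: L1_eq (integrableN If). Qed.

Lemma L1B f g : L1 mu f -> L1 mu g -> L1 mu (fun x => f x - g x).
Proof. by move=> If Ig; exact: L1D If (L1N Ig). Qed.

Lemma L1_0 : L1 mu (fun=> 0).
Proof. exact: integrable0. Qed.

Lemma L1_sum (J : Type) (s : seq J) (Q : pred J) (f : J -> X -> R) :
  (forall j, Q j -> L1 mu (f j)) -> L1 mu (fun x => \sum_(j <- s | Q j) f j x).
Proof.
move=> If; elim: s => [|j s IH].
  by apply: L1_eq L1_0 => x; rewrite big_nil.
case Qj: (Q j).
  by apply: L1_eq (L1D (If _ Qj) IH) => x; rewrite big_cons Qj.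
by apply: L1_eq IH => x; rewrite big_cons Qj.
Qed.

Lemma L1_le f g : measurable_fun setT f -> (forall x, `|f x| <= g x) ->
  L1 mu g -> L1 mu f.
Proof.
move=> mf fg; apply: le_integrable => //; first exact/measurable_EFinP.
by move=> x _ /=; rewrite lee_fin (le_trans (fg x)) ?ler_norm.
Qed.

Lemma intD f g : L1 mu f -> L1 mu g ->
  \int[mu]_x (f x + g x) = \int[mu]_x f x + \int[mu]_x g x.
Proof. by move=> *; rewrite RintegralD. Qed.

Lemma intB f g : L1 mu f -> L1 mu g ->
  \int[mu]_x (f x - g x) = \int[mu]_x f x - \int[mu]_x g x.
Proof. by move=> *; rewrite RintegralB. Qed.

Lemma intZ (c : R) f : L1 mu f -> \int[mu]_x (c * f x) = c * \int[mu]_x f x.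
Proof. by move=> *; rewrite RintegralZl. Qed.

Lemma intN f : L1 mu f -> \int[mu]_x (- f x) = - \int[mu]_x f x.
Proof.
move=> If; rewrite -mulN1r -intZ//; apply: eq_Rintegral => x _.
by rewrite mulN1r.
Qed.

Lemma int0 : \int[mu]_x (0 : R) = 0.
Proof. by rewrite /Rintegral integral0. Qed.

Lemma int_sum (J : Type) (s : seq J) (Q : pred J) (f : J -> X -> R) :
  (forall j, Q j -> L1 mu (f j)) ->
  \int[mu]_x (\sum_(j <- s | Q j) f j x) = \sum_(j <- s | Q j) \int[mu]_x f j x.
Proof.
move=> If; elim: s => [|j s IH].
  by rewrite big_nil -[RHS]int0; apply: eq_Rintegral => x _; rewrite big_nil.
rewrite big_cons; case Qj: (Q j).
  rewrite -IH -intD//; [|exact: If|exact: L1_sum].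
  by apply: eq_Rintegral => x _; rewrite big_cons Qj.
by rewrite -IH; apply: eq_Rintegral => x _; rewrite big_cons Qj.
Qed.

Lemma int_le f g : L1 mu f -> L1 mu g -> (forall x, f x <= g x) ->
  \int[mu]_x f x <= \int[mu]_x g x.
Proof. by move=> *; apply: le_Rintegral. Qed.

Lemma EFin_int f : L1 mu f -> (\int[mu]_x f x)%:E = (\int[mu]_x (f x)%:E)%E.
Proof. by move=> If; rewrite /Rintegral fineK//; exact: integrable_fin_num. Qed.

Lemma int_ae_eq f g : measurable_fun setT f -> measurable_fun setT g ->
  {ae mu, forall x, f x = g x} -> \int[mu]_x f x = \int[mu]_x g x.
Proof.
move=> mf mg fg; rewrite /Rintegral; congr fine.
apply: ae_eq_integral => //; [exact/measurable_EFinP|exact/measurable_EFinP|].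
by apply: filterS fg => x /= ->.
Qed.

Lemma L1_ae_eq f g : measurable_fun setT g ->
  {ae mu, forall x, f x = g x} -> L1 mu f -> L1 mu g.
Proof.
move=> mg fg If; have mf := L1_meas If.
apply/integrableP; split; first exact/measurable_EFinP.
have /integrableP[_] := If; congr (_ < _)%E.
apply: ae_eq_integral => //; do ?by apply/measurableT_comp => //; exact/measurable_EFinP.
by apply: filterS fg => x /= ->.
Qed.

Lemma int_ae_le f g : L1 mu f -> L1 mu g -> {ae mu, forall x, f x <= g x} ->
  \int[mu]_x f x <= \int[mu]_x g x.
Proof.
move=> If Ig fg; have mf := L1_meas If; have mg := L1_meas Ig.
have mm : measurable_fun setT (fun x => Num.min (f x) (g x)).
  exact: measurable_minr.
have aem : {ae mu, forall x, f x = Num.min (f x) (g x)}.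
  by apply: filterS fg => x /= ?; rewrite min_l.
rewrite (int_ae_eq mf mm aem); apply: int_le => //.
  exact: L1_ae_eq aem If.
by move=> x; rewrite ge_min lexx orbT.
Qed.

Definition L2 f := measurable_fun setT f /\
  (\int[mu]_x ((f x) ^+ 2)%:E < +oo)%E.

Lemma L2_meas f : L2 f -> measurable_fun setT f. Proof. by case. Qed.

Lemma L2_eq f g : (forall x, f x = g x) -> L2 f -> L2 g.
Proof. by move=> /funext ->. Qed.

Lemma L2_sq f : L2 f -> L1 mu (fun x => f x ^+ 2).
Proof.
case=> mf fi; apply/integrableP; split.
  by apply/measurable_EFinP; exact: measurable_funX.
apply: le_lt_trans fi; rewrite le_eqVlt; apply/orP; left; apply/eqP.
by apply: eq_integral => x _; rewrite /= ger0_norm// sqr_ge0.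
Qed.

Lemma sq_L2 f : measurable_fun setT f -> L1 mu (fun x => f x ^+ 2) -> L2 f.
Proof.
move=> mf /integrableP[_ fi]; split=> //; apply: le_lt_trans fi.
rewrite le_eqVlt; apply/orP; left; apply/eqP.
by apply: eq_integral => x _; rewrite /= ger0_norm// sqr_ge0.
Qed.

Lemma L2M f g : L2 f -> L2 g -> L1 mu (fun x => f x * g x).
Proof.
move=> Lf Lg; have [mf _] := Lf; have [mg _] := Lg.
apply: (L1_le _ _ (L1D (L2_sq Lf) (L2_sq Lg))).
  exact: measurable_funM.
move=> x; rewrite normrM -[f x ^+ 2]real_normK ?num_real//.
rewrite -[g x ^+ 2]real_normK ?num_real//.
have := normr_ge0 (f x); have := normr_ge0 (g x); nra.
Qed.

Lemma L2D f g : L2 f -> L2 g -> L2 (fun x => f x + g x).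
Proof.
move=> Lf Lg; have [mf _] := Lf; have [mg _] := Lg.
apply: sq_L2; first exact: measurable_funD.
apply: (L1_eq _ (L1D (L1D (L2_sq Lf) (L2_sq Lg)) (L1Z 2 (L2M Lf Lg)))) => x.
by ring.
Qed.

Lemma L2_le f g : measurable_fun setT f -> (forall x, `|f x| <= `|g x|) ->
  L2 g -> L2 f.
Proof.
move=> mf fg Lg; apply: sq_L2 => //; apply: (L1_le _ _ (L2_sq Lg)).
  exact: measurable_funX.
by move=> x; rewrite normrX -[leRHS]real_normK ?num_real// lerXn2r ?nnegrE.
Qed.

Lemma L2_bM f g (C : R) : measurable_fun setT f -> (forall x, `|f x| <= C) ->
  L2 g -> L2 (fun x => f x * g x).
Proof.
move=> mf fC Lg; have [mg _] := Lg.
apply: sq_L2; first exact: measurable_funM.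
apply: (L1_le _ _ (L1Z (C ^+ 2) (L2_sq Lg))).
  by apply: measurable_funX; exact: measurable_funM.
move=> x; rewrite exprMn normrM !normrX !real_normK ?num_real//.
rewrite ler_wpM2r ?sqr_ge0// -[f x ^+ 2]real_normK ?num_real//.
rewrite lerXn2r ?nnegrE//.
by rewrite (le_trans _ (fC x)).
Qed.

Lemma L2Z (c : R) f : L2 f -> L2 (fun x => c * f x).
Proof. by move=> Lf; apply: (@L2_bM (fun=> c) f `|c|) => //. Qed.

Lemma L2N f : L2 f -> L2 (fun x => - f x).
Proof. by move=> /(L2Z (-1)); apply: L2_eq => x; rewrite mulN1r. Qed.

Lemma L2B f g : L2 f -> L2 g -> L2 (fun x => f x - g x).
Proof. by move=> Lf Lg; exact: L2D Lf (L2N Lg). Qed.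

Lemma L2_0 : L2 (fun=> 0).
Proof. by apply: sq_L2 => //; apply: L1_eq L1_0 => x; rewrite expr0n. Qed.

Lemma L2_sum (J : Type) (s : seq J) (Q : pred J) (f : J -> X -> R) :
  (forall j, Q j -> L2 (f j)) -> L2 (fun x => \sum_(j <- s | Q j) f j x).
Proof.
move=> If; elim: s => [|j s IH].
  by apply: L2_eq L2_0 => x; rewrite big_nil.
case Qj: (Q j).
  by apply: L2_eq (L2D (If _ Qj) IH) => x; rewrite big_cons Qj.
by apply: L2_eq IH => x; rewrite big_cons Qj.
Qed.

Lemma L2_ae_eq f g : measurable_fun setT g ->
  {ae mu, forall x, f x = g x} -> L2 f -> L2 g.
Proof.
move=> mg fg Lf; apply: sq_L2 => //; apply: L1_ae_eq (L2_sq Lf).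
  exact: measurable_funX.
by apply: filterS fg => x ->.
Qed.

Lemma CauchySchwarz f g : L2 f -> L2 g ->
  (\int[mu]_x (f x * g x)) ^+ 2 <=
  \int[mu]_x (f x ^+ 2) * \int[mu]_x (g x ^+ 2).
Proof.
move=> Lf Lg; set a := \int[mu]_x (f x ^+ 2); set b := \int[mu]_x (g x ^+ 2).
set c := \int[mu]_x _.
have q s t : 0 <= s ^+ 2 * a + 2 * s * t * c + t ^+ 2 * b.
  have -> : s ^+ 2 * a + 2 * s * t * c + t ^+ 2 * b =
      \int[mu]_x ((s * f x + t * g x) ^+ 2).
    rewrite -!intZ; [|exact: L2_sq|exact: L2M|exact: L2_sq].
    rewrite -!intD; do ?[exact: L1D|exact/L1Z/L2_sq|exact/L1Z/L2M].
      by apply: eq_Rintegral => x _; ring.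
    by apply: L1D; [exact/L1Z/L2_sq|exact/L1Z/L2M].
  by apply: Rintegral_ge0 => x _; exact: sqr_ge0.
have a0 : 0 <= a by apply: Rintegral_ge0 => x _; exact: sqr_ge0.
have b0 : 0 <= b by apply: Rintegral_ge0 => x _; exact: sqr_ge0.
have [ab|ab] := ltP (a * b) (c ^+ 2); last by [].
have [a00|ane] := eqVneq a 0; last first.
  have := q (- c) a; have : 0 < a by rewrite lt_neqAle eq_sym ane a0.
  by move=> ? ?; nra.
have := q (- (b + 1)) c; rewrite a00 in ab *.
by move=> ?; nra.
Qed.

Definition cvg2 (fn : nat -> X -> R) f :=
  (fun n => (\int[mu]_x ((f x - fn n x) ^+ 2)%:E)%E) @ \oo --> 0%E.

Lemma cvg2_int (fn : nat -> X -> R) f : cvg2 fn f ->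
  (fun n => \int[mu]_x ((f x - fn n x) ^+ 2)) @ \oo --> 0.
Proof. by move=> /fine_cvgP[]. Qed.

(** Through this continuity of covariances the isometry passes from simple to
    general integrands. *)
Lemma cvg2_mul (fn gn : nat -> X -> R) f g :
  (forall n, L2 (fn n)) -> (forall n, L2 (gn n)) -> L2 f -> L2 g ->
  cvg2 fn f -> cvg2 gn g ->
  (fun n => \int[mu]_x (fn n x * gn n x)) @ \oo --> \int[mu]_x (f x * g x).
Proof.
move=> Lfn Lgn Lf Lg /cvg2_int fnf /cvg2_int gng.
pose A n := \int[mu]_x ((f x - fn n x) ^+ 2).
pose B n := \int[mu]_x ((g x - gn n x) ^+ 2).
pose a := \int[mu]_x (f x ^+ 2); pose b := \int[mu]_x (g x ^+ 2).
have CS u v : L2 u -> L2 v -> `|\int[mu]_x (u x * v x)| <=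
   Num.sqrt (\int[mu]_x (u x ^+ 2) * \int[mu]_x (v x ^+ 2)).
  by move=> Lu Lv; rewrite -sqrtr_sqr ler_wsqrtr// CauchySchwarz.
have bnd n : `|\int[mu]_x (f x * g x) - \int[mu]_x (fn n x * gn n x)| <=
   Num.sqrt (A n * b) + Num.sqrt (a * B n) + Num.sqrt (A n * B n).
  have Lf' := L2B Lf (Lfn n); have Lg' := L2B Lg (Lgn n).
  have -> : \int[mu]_x (f x * g x) - \int[mu]_x (fn n x * gn n x) =
     \int[mu]_x ((f x - fn n x) * g x) + \int[mu]_x (f x * (g x - gn n x))
     - \int[mu]_x ((f x - fn n x) * (g x - gn n x)).
    rewrite -intB; [|exact: L2M|exact: L2M].
    rewrite -intD; [|exact: L2M|exact: L2M].
    rewrite -intB; [|by apply: L1D; exact: L2M|exact: L2M].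
    by apply: eq_Rintegral => x _; ring.
  rewrite (le_trans (ler_normB _ _))// lerD//; last exact: CS.
  by rewrite (le_trans (ler_normD _ _))// lerD//; exact: CS.
have lim0 : (fun n => Num.sqrt (A n * b) + Num.sqrt (a * B n) +
    Num.sqrt (A n * B n)) @ \oo --> (0 : R).
  have c0 (u : nat -> R) : u @ \oo --> (0 : R) ->
      (fun n => Num.sqrt (u n)) @ \oo --> (0 : R).
    move=> u0; rewrite -[X in _ --> X]sqrtr0.
    by apply: continuous_cvg => //; exact: sqrt_continuous.
  rewrite -[X in _ --> X]addr0 -[X in X + _]addr0; apply: cvgD; first apply: cvgD.
  - by apply: c0; rewrite -[X in _ --> X](mul0r b); apply: cvgMl.
  - by apply: c0; rewrite -[X in _ --> X](mulr0 a); apply: cvgMr.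
  - by apply: c0; rewrite -[X in _ --> X](mulr0 0); apply: cvgM.
apply/subr_cvg0/norm_cvg0P => /=.
apply: (squeeze_cvgr _ (cvg_cst 0) lim0); apply: nearW => n.
by rewrite normr_ge0 distrC bnd.
Qed.

End L1.

(** * Nearest-point approximation *)

Section Nearest.
Context (R : realType) (V : normedModType R).
Implicit Types (e : nat -> V) (D : set V).

(** The first of e 0, ..., e j at minimal distance from x. It selects by
    comparing distances only, and so depends measurably on x. *)
Fixpoint nearest e (j : nat) (x : V) : V :=
  if j is j'.+1 then
    if `|x - e j'.+1| < `|x - nearest e j' x| then e j'.+1 else nearest e j' x
  else e 0%N.

Lemma nearest_le e j i x : (i <= j)%N -> `|x - nearest e j x| <= `|x - e i|.
Proof.
elim: j => [|j IH]; first by rewrite leqn0 => /eqP ->.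
rewrite leq_eqVlt => /orP[/eqP ->|ij] /=; case: ifPn => //.
- by rewrite -leNgt.
- by move=> /ltW /le_trans; apply; exact: IH.
- by move=> _; exact: IH.
Qed.

Definition dense_in D e :=
  (forall n, D (e n)) /\
  forall x, D x -> forall eps : R, 0 < eps -> exists n, `|x - e n| < eps.

Lemma nearest_in D e j x : (forall n, D (e n)) -> D (nearest e j x).
Proof. by move=> De; elim: j => //= j IH; case: ifP. Qed.

Lemma nearest_cvg D e x : dense_in D e -> D x ->
  (fun j => nearest e j x) @ \oo --> within D (nbhs x).
Proof.
move=> [De dD] Dx A /= /nbhs_ballP[eps /= eps0 xA].
have [n en] := dD x Dx eps eps0.
exists n => // j /= nj; apply: xA; last exact: nearest_in.
by rewrite -ball_normE /=; apply: le_lt_trans en; exact: nearest_le.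
Qed.

Lemma dense_subset D : (exists e, dense_in setT e) -> D !=set0 ->
  exists e, dense_in D e.
Proof.
move=> [e [_ de]] [x0 Dx0].
pose Q (c : nat * nat) x := D x /\ `|x - e c.1| < c.2.+1%:R^-1.
have /choice[g gP] : forall c, exists x, D x /\ (forall y, Q c y -> Q c x).
  move=> c; have [[y yQ]|nQ] := pselect (exists y, Q c y).
    by exists y; split=> //; case: yQ.
  by exists x0; split=> // y yQ; exfalso; apply: nQ; exists y.
exists (fun n => if @unpickle (nat * nat)%type n is Some c then g c else x0).
split=> [n|x Dx eps eps0]; first by case: unpickle => // c; have [] := gP c.
have [k kP] : exists k : nat, k.+1%:R^-1 < eps / 2.
  have := near_infty_natSinv_lt (PosNum (divr_gt0 eps0 (ltr0n R 2))) => -[k _ kP].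
  by exists k; exact: (kP k (leqnn k)).
have [n xn] := de x I k.+1%:R^-1 ltac:(by rewrite invr_gt0).
exists (pickle (n, k)); rewrite pickleK.
have [_ /(_ x (conj Dx xn))[_ /= gn]] := gP (n, k).
have -> : x - g (n, k) = (x - e n) - (g (n, k) - e n).
  by rewrite opprB addrA subrK.
rewrite (le_lt_trans (ler_normB _ _))// (splitr eps).
by rewrite ltrD// (lt_trans _ kP).
Qed.

End Nearest.

Section DenseSequences.
Context (R : realType).

Lemma dense_real : exists e : nat -> R, dense_in setT e /\ e 0%N = 0.
Proof.
exists (fun n => if n is n'.+1 then
  if @unpickle rat n' is Some q then ratr q else 0 else 0).
split=> //; split=> // x _ eps eps0.
have [q] := @rat_in_itvoo R (x - eps) (x + eps) ltac:(lra).
rewrite in_itv /= => /andP[q1 q2].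
exists (pickle q).+1; rewrite pickleK ltr_norml.
by apply/andP; split; lra.
Qed.

Lemma mx_norm_lt p q (A : 'M[R]_(p, q)) (eps : R) : 0 < eps ->
  `|A| < eps <-> forall i j, `|A i j| < eps.
Proof.
move=> eps0; have -> : `|A| = mx_norm A by [].
rewrite mx_normrE; split=> [/bigmax_ltP[_ H] i j|H].
  exact: (H (i, j) isT).
by apply/bigmax_ltP; split.
Qed.

Lemma dense_mx p q : exists e : nat -> 'M[R]_(p, q), dense_in setT e.
Proof.
exists (fun n => if @unpickle 'M[rat]_(p, q) n is Some A
  then map_mx ratr A else 0).
split=> // X _ eps eps0.
have /choice[f fP] : forall ij : 'I_p * 'I_q, exists r : rat,
    `|X ij.1 ij.2 - ratr r| < eps.
  move=> ij; have [r] :=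
    @rat_in_itvoo R (X ij.1 ij.2 - eps) (X ij.1 ij.2 + eps) ltac:(lra).
  rewrite in_itv /= => /andP[r1 r2]; exists r; rewrite ltr_norml.
  by apply/andP; split; lra.
exists (pickle (\matrix_(i, j) f (i, j) : 'M[rat]_(p, q))).
rewrite pickleK; apply/mx_norm_lt => // i j; rewrite !mxE.
exact: (fP (i, j)).
Qed.

Lemma dense_prod (V W : normedModType R) :
  (exists e : nat -> V, dense_in setT e) ->
  (exists e : nat -> W, dense_in setT e) ->
  exists e : nat -> (V * W)%type, dense_in setT e.
Proof.
move=> [e [_ de]] [g [_ dg]].
exists (fun n => if @unpickle (nat * nat)%type n is Some c
  then (e c.1, g c.2) else (e 0%N, g 0%N)).
split=> // -[x y] _ eps eps0.
have [n xn] := de x I eps eps0; have [k yk] := dg y I eps eps0.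
exists (pickle (n, k)); rewrite pickleK /=.
have -> : `|(x, y) - (e n, g k)| = Num.max `|x - e n| `|y - g k| by [].
by rewrite gt_max xn yk.
Qed.

End DenseSequences.

(** * Measurability of vector-valued maps *)

Section Caratheodory.
Context (R : realType) (V : normedModType R) (d : measure_display)
  (S : measurableType d).

(** Measurability through the distances to all points, for maps into a normed
    space that carries no sigma-algebra. *)
Definition dist_meas (X : S -> V) :=
  forall v : V, measurable_fun setT (fun s => `|X s - v|).

Lemma nearest_step_meas (X : S -> V) (e : nat -> V) j (f : S -> V -> R) :
  dist_meas X -> (forall n, measurable_fun setT (f^~ (e n))) ->
  measurable_fun setT (fun s => f s (nearest e j (X s))).
Proof.
move=> mX mf.
suff H : forall f : S -> V -> R, (forall n, measurable_fun setT (f^~ (e n))) ->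
    measurable_fun setT (fun s => f s (nearest e j (X s))) by exact: H.
elim: j => [|j IH] {mf}f mf /=; first exact: mf.
have -> : (fun s => f s (if `|X s - e j.+1| < `|X s - nearest e j (X s)|
      then e j.+1 else nearest e j (X s))) =
    (fun s => if `|X s - e j.+1| < `|X s - nearest e j (X s)|
      then f s (e j.+1) else f s (nearest e j (X s))).
  by apply/funext => s; case: ifP.
apply: measurable_fun_ifT; [|exact: mf|exact: IH].
apply: measurable_fun_ltr; first exact: mX.
exact: (IH (fun s v => `|X s - v|)).
Qed.

(** When the second argument is replaced by its nearest neighbours in a dense
    sequence, only countably many frozen arguments occur; continuity within D
    then gives the limit. *)
Lemma Caratheodory_meas (D : set V) (X : S -> V) (f : S -> V -> R) :
  (exists e : nat -> V, dense_in setT e) ->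
  dist_meas X -> (forall s, D (X s)) ->
  (forall v, D v -> measurable_fun setT (f^~ v)) ->
  (forall s v, D v -> f s @ within D (nbhs v) --> f s v) ->
  measurable_fun setT (fun s => f s (X s)).
Proof.
move=> de mX DX mf cf.
have [e eD] : exists e, dense_in D e.
  by apply: dense_subset => //; exists (X point).
apply: (@measurable_fun_cvg _ _ _ _ (fun j s => f s (nearest e j (X s)))).
  by move=> j; apply: nearest_step_meas => // n; apply: mf; case: eD.
move=> s _; apply: cvg_comp (cf s _ (DX s)).
exact: nearest_cvg.
Qed.

(** An open set of a separable space is a countable union of balls. *)
Lemma dist_meas_borel (X : S -> V) : (exists e : nat -> V, dense_in setT e) ->
  dist_meas X -> forall B, borel B -> measurable (X @^-1` B).
Proof.
move=> [e [_ de]] mX.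
suff H : @borel V `<=` [set B | measurable (X @^-1` B)] by [].
apply: smallest_sub.
  split => [|A mA|F mF] /=.
  - by rewrite preimage_set0.
  - rewrite setTD preimage_setC; exact: measurableC.
  - by rewrite preimage_bigcup; exact: bigcupT_measurable.
move=> U /= oU.
pose B (c : nat * nat) := ball (e c.1) (c.2.+1%:R^-1 : R).
have -> : X @^-1` U = \bigcup_(n in [set: nat])
    (if @unpickle (nat * nat)%type n is Some c then
     [set s | B c `<=` U /\ `|X s - e c.1| < c.2.+1%:R^-1] else set0).
  apply/seteqP; split=> [s /= Us|s [n _]]; last first.
    case: unpickle => // c [BU Xs]; apply: BU; rewrite /B -ball_normE /=.
    by rewrite distrC.
  have /nbhs_ballP[eps /= eps0 sU] : nbhs (X s) U by exact: open_nbhs_nbhs.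
  have [k kP] : exists k : nat, k.+1%:R^-1 < eps / 2.
    have := near_infty_natSinv_lt (PosNum (divr_gt0 eps0 (ltr0n R 2))) => -[k _ kP].
    by exists k; exact: (kP k (leqnn k)).
  have [n xn] := de (X s) I k.+1%:R^-1 ltac:(by rewrite invr_gt0).
  exists (pickle (n, k)) => //; rewrite pickleK; split=> //.
  move=> y; rewrite /B -ball_normE /= => yn; apply: sU; rewrite -ball_normE /=.
  have -> : X s - y = (X s - e n) + (e n - y) by rewrite addrA subrK.
  rewrite (le_lt_trans (ler_normD _ _))// (splitr eps) ltrD//; exact: lt_trans kP.
apply: bigcupT_measurable => n; case: unpickle => // c.
have [BU|nBU] := pselect (B c `<=` U); last first.
  by rewrite (_ : [set _ | _] = set0)//; apply/seteqP; split=> // s [].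
rewrite (_ : [set _ | _] = [set s | `|X s - e c.1| < c.2.+1%:R^-1]).
  have := measurable_fun_ltr (mX (e c.1)) (@measurable_cst _ _ S _ setT (c.2.+1%:R^-1 : R)).
  by move=> /(_ measurableT [set true] I); rewrite setTI.
by apply/seteqP; split=> s [].
Qed.

End Caratheodory.

Section DistMeas.
Context (R : realType) (d : measure_display) (S : measurableType d).

Lemma dist_meas_mx p q (X : S -> 'M[R]_(p, q)) :
  (forall i j, measurable_fun setT (fun s => X s i j)) -> dist_meas X.
Proof.
move=> mX v.
have -> : (fun s => `|X s - v|) =
    (fun s => \big[Num.max/0]_(ij : 'I_p * 'I_q) `|X s ij.1 ij.2 - v ij.1 ij.2|).
  apply/funext => s; have -> : `|X s - v| = mx_norm (X s - v) by [].
  by rewrite mx_normrE; apply: eq_bigr => ij _; rewrite !mxE.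
elim: (index_enum _) => [|ij s IH].
  rewrite [X in measurable_fun _ X](_ : _ = cst 0)//.
  by apply/funext => s; rewrite big_nil.
under eq_fun do rewrite big_cons.
apply: measurable_maxr; last exact: IH.
apply: (@measurableT_comp _ _ _ _ _ _ (@Num.norm R R)) => //.
by apply: measurable_funB => //; exact: mX.
Qed.

Lemma dist_meas_real (X : S -> R) : measurable_fun setT X -> dist_meas X.
Proof.
by move=> mX v; apply: measurableT_comp => //; exact: measurable_funB.
Qed.

Lemma dist_meas_prod (V W : normedModType R) (X : S -> V) (Y : S -> W) :
  dist_meas X -> dist_meas Y -> dist_meas (fun s => (X s, Y s)).
Proof.
move=> mX mY [v w].
have -> : (fun s => `|(X s, Y s) - (v, w)|) =
    (fun s => Num.max `|X s - v| `|Y s - w|) by [].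
by apply: measurable_maxr.
Qed.

End DistMeas.

(** * Measurability with respect to a sub-sigma-algebra *)

Lemma int_dom_cvg (R : realType) (d : measure_display) (X : measurableType d)
    (mu : {measure set X -> \bar R}) (fn : nat -> X -> R) (f g : X -> R) :
  (forall n, measurable_fun setT (fn n)) -> L1 mu g ->
  (forall n x, `|fn n x| <= g x) ->
  (forall x, (fn^~ x) @ \oo --> f x) ->
  L1 mu f /\ (fun n => \int[mu]_x fn n x) @ \oo --> \int[mu]_x f x.
Proof.
move=> mfn Ig fg fnf.
have mf : measurable_fun setT f.
  by apply: (measurable_fun_cvg mfn) => x _; exact: fnf.
have [|||||fi _ fl] := @dominated_convergence _ _ _ mu setT measurableT
  (fun n => EFin \o fn n) (EFin \o f) (EFin \o g).
- by move=> n; exact/measurable_EFinP.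
- exact/measurable_EFinP.
- by apply: aeW => x _; apply: cvg_EFin; [exact: nearW|exact: fnf].
- exact: Ig.
- by apply: aeW => x n _; rewrite /= lee_fin.
split=> //; have fin : (\int[mu]_x (EFin \o f) x)%E \is a fin_num.
  exact: integrable_fin_num.
move: fl; rewrite -(fineK fin) => /fine_cvgP[_ fl]; exact: fl.
Qed.

Lemma indic_split (R : realType) (T : Type) (B : set T) (b : T -> bool) (w : T)
   (x y : R) : B = [set w | b w] ->
  (if b w then x else y) = \1_B w * x + \1_(~` B) w * y.
Proof.
move=> ->; rewrite !indicE in_setC; case: ifPn => bw.
  by rewrite mem_set// mul1r mul0r addr0.
by rewrite memNset /= ?mul0r ?mul1r ?add0r//; exact/negP.
Qed.

Section SubSigma.
Context (R : realType) (d : measure_display) (Omega : measurableType d)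
  (P : probability Omega R) (G : set (set Omega)).

Definition gmeas (f : Omega -> R) := forall B, measurable B -> G (f @^-1` B).

Hypothesis sG : sigma_algebra setT G.
Let OG := g_sigma_algebraType G.

Lemma sub_measurableE : (measurable : set (set OG)) = G.
Proof. exact: sigma_algebra_id. Qed.

Lemma gmeasP (f : Omega -> R) :
  gmeas f <-> measurable_fun (setT : set OG) (f : OG -> R).
Proof.
split=> H; first by move=> _ B mB; rewrite setTI sub_measurableE; exact: H.
by move=> B mB; rewrite -sub_measurableE -[X in measurable X]setTI; exact: H.
Qed.

Lemma sub_setC A : G A -> G (~` A).
Proof. by case: sG => _ + _ => /[apply]; rewrite setTD. Qed.

Lemma sub_setI A B : G A -> G B -> G (A `&` B).
Proof. by rewrite -sub_measurableE; exact: measurableI. Qed.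

Lemma sub_setT : G setT.
Proof. by rewrite -sub_measurableE; exact: measurableT. Qed.

Hypothesis GF : G `<=` measurable.

Lemma gmeas_meas f : gmeas f -> measurable_fun setT f.
Proof. by move=> mf _ B mB; rewrite setTI; exact/GF/mf. Qed.

Lemma indic_meas A : G A -> measurable_fun setT (\1_A : Omega -> R).
Proof. by move=> GA; apply: measurable_indic; exact: GF. Qed.

Lemma indic_le1 (A : set Omega) w : `|\1_A w| <= (1 : R).
Proof. by rewrite ger0_norm// indicE; case: (_ \in _). Qed.

Lemma L1_indic A f : G A -> L1 P f -> L1 P (fun w => \1_A w * f w).
Proof.
move=> GA If; have := integrable_norm If => nf.
apply: L1_le nf; first by apply: measurable_funM; [exact: indic_meas|exact: L1_meas If].
by move=> x; rewrite normrM ler_piMl// indic_le1.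
Qed.

(** Integrals against a finite-valued approximation of a G-measurable map
    inherit a sign from the integrals against constants: at each stage of
    the recursion the map switches from one value to another on a set of G. *)
Lemma nearest_int (V : normedModType R) (X : Omega -> V) (e : nat -> V)
    (f : Omega -> V -> R) :
  (forall v, gmeas (fun w => `|X w - v|)) ->
  (forall n, L1 P (f^~ (e n))) ->
  (forall n A, G A -> 0 <= \int[P]_w (\1_A w * f w (e n))) ->
  forall j, L1 P (fun w => f w (nearest e j (X w))) /\
    forall A, G A -> 0 <= \int[P]_w (\1_A w * f w (nearest e j (X w))).
Proof.
move=> mX If f0; elim=> [|j [IHi IH]]; first by split; [exact: If|exact: f0].
pose b w := `|X w - e j.+1| < `|X w - nearest e j (X w)|.
pose B := [set w | b w].
have GB : G B.
  rewrite -sub_measurableE.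
  have mb : measurable_fun (setT : set OG) (b : OG -> bool).
    apply: measurable_fun_ltr; first exact/gmeasP.
    apply: (@nearest_step_meas R V _ OG X e j (fun w v => `|X w - v|)).
      by move=> v; exact/gmeasP.
    by move=> n; exact/gmeasP.
  by have := mb measurableT [set true] I; rewrite setTI.
have fE w : f w (nearest e j.+1 (X w)) =
    \1_B w * f w (e j.+1) + \1_(~` B) w * f w (nearest e j (X w)).
  by rewrite -(@indic_split _ _ B b)//= /b; case: ifP.
have I1 := L1_indic GB (If j.+1); have I2 := L1_indic (sub_setC GB) IHi.
split=> [|A GA].
  by apply: (L1_eq _ (L1D I1 I2)) => w; rewrite fE.
have := addr_ge0 (f0 j.+1 _ (sub_setI GA GB)) (IH _ (sub_setI GA (sub_setC GB))).
rewrite -intD; [|exact/L1_indic/If/sub_setI|].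
  congr (_ <= _); apply: eq_Rintegral => w _.
  by rewrite fE !indicI/=; ring.
by apply: L1_indic => //; apply: sub_setI => //; exact: sub_setC.
Qed.

(** Both inequalities follow from nearest_int, applied to multiples of h, for
    finite-valued approximations of xi; dominated convergence gives the limit. *)
Lemma int_meas_null (h xi : Omega -> R) : L1 P h ->
  (forall A, G A -> \int[P]_w (\1_A w * h w) = 0) ->
  gmeas xi -> L1 P (fun w => xi w * h w) -> \int[P]_w (xi w * h w) = 0.
Proof.
move=> Ih h0 mxi Ixh.
have [e [de e0]] := dense_real R.
have mX v : gmeas (fun w => `|xi w - v|).
  apply/gmeasP; apply: (@measurableT_comp _ _ _ _ _ _ (@Num.norm R R)) => //.
  by apply: measurable_funB => //; exact/gmeasP.
have If (c : R) n : L1 P (fun w => c * (e n * h w)) by apply: L1Z; exact: L1Z.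
have z (c : R) n A : G A -> \int[P]_w (\1_A w * (c * (e n * h w))) = 0.
  move=> GA; rewrite -[RHS](mulr0 (c * e n)) -(h0 _ GA) -intZ; last exact: L1_indic.
  by apply: eq_Rintegral => w _; ring.
have H (c : R) j : L1 P (fun w => c * (nearest e j (xi w) * h w)) /\
    0 <= c * \int[P]_w (nearest e j (xi w) * h w).
  have [|H1 /(_ _ sub_setT) H2] :=
    @nearest_int R xi e (fun w v => c * (v * h w)) mX (If c) _ j.
    by move=> n A GA; rewrite z.
  split=> //; move: H2; congr (_ <= _).
  have [c0|c0] := eqVneq c 0.
    rewrite c0 mul0r -[RHS](@int0 _ _ _ P); apply: eq_Rintegral => w _.
    by rewrite mul0r mulr0.
  rewrite -intZ; last first.
    by apply: L1_eq (L1Z c^-1 H1) => w; rewrite mulrA mulVf// mul1r.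
  by apply: eq_Rintegral => w _; rewrite indicE mem_set// mul1r.
have hj j : \int[P]_w (nearest e j (xi w) * h w) = 0.
  have [_ h1] := H 1 j; have [_ h2] := H (-1) j.
  by apply/eqP; rewrite eq_le; apply/andP; split; lra.
have [||||_ lim] := @int_dom_cvg _ _ _ P (fun j w => nearest e j (xi w) * h w)
   (fun w => xi w * h w) (fun w => 2 * `|xi w * h w|).
- move=> j; have [H1 _] := H 1 j; apply: L1_meas.
  by apply: L1_eq H1 => w; rewrite mul1r.
- by apply: L1Z; exact: integrable_norm Ixh.
- move=> j w; rewrite !normrM mulrA ler_wpM2r//.
  have := nearest_le e (xi w) (leq0n j); rewrite e0 subr0 => le.
  have -> : nearest e j (xi w) = xi w - (xi w - nearest e j (xi w)) by ring.
  rewrite (le_trans (ler_normB _ _))//; lra.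
- move=> w; apply: cvgMl.
  move=> A nA; apply: (nearest_cvg de (I : [set: R] (xi w))).
  by apply: filterS nA => y Ay _.
have lim0 : (fun n => \int[P]_w (nearest e n (xi w) * h w)) @ \oo --> (0 : R).
  by under eq_fun do rewrite hj; exact: cvg_cst.
exact: cvg_unique lim lim0.
Qed.

Lemma sub_int_EFin A f : G A -> L1 P f ->
  (\int[P]_(w in A) (f w)%:E)%E = (\int[P]_w (\1_A w * f w))%:E.
Proof.
move=> GA If; rewrite EFin_int; last exact: L1_indic.
rewrite [LHS]integral_mkcond; apply: eq_integral => w _.
rewrite patchE indicE; case: ifP => wA; first by rewrite mul1r.
by rewrite mul0r.
Qed.

End SubSigma.

(** * Conditional expectation and completion of a sub-sigma-algebra *)

Section CondExp.
Context (R : realType) (d : measure_display) (Omega : measurableType d)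
  (P : probability Omega R) (G : set (set Omega)).
Hypothesis sG : sigma_algebra setT G.
Hypothesis GF : G `<=` measurable.
Let OG := g_sigma_algebraType G.

Let id_meas : measurable_fun (setT : set Omega) (idfun : Omega -> OG).
Proof.
by move=> _ B mB; rewrite setTI; apply: GF; rewrite -(sub_measurableE sG).
Qed.

Let idG : {mfun Omega >-> OG} :=
  HB.pack (idfun : Omega -> OG) (isMeasurableFun.Build _ _ _ _ _ id_meas).

Let PG : probability OG R := distribution P idG.

(** The Radon-Nikodym derivative, with respect to the restriction of P to G,
    of the charge with density X. *)
Lemma condexp_exists (X : Omega -> R) : L1 P X ->
  exists Z, [/\ gmeas G Z, L1 P Z &
    forall A, G A -> \int[P]_w (\1_A w * Z w) = \int[P]_w (\1_A w * X w)].
Proof.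
move=> IX.
pose nu' : {charge set OG -> \bar R} :=
  pushforward (induced_charge IX : {charge set Omega -> \bar R}) idG.
pose nu := nu' id_meas.
have dom : nu `<< PG.
  apply/null_content_dominatesP => A mA A0.
  have GA : G A by rewrite -(sub_measurableE sG).
  rewrite /nu /nu' /= /pushforward /induced_charge preimage_id.
  apply: null_set_integral => //; first exact: GF.
  by apply: measurable_funTS; exact/measurable_EFinP/(L1_meas IX).
pose f := Radon_Nikodym nu PG.
have fint := Radon_Nikodym_integrable dom.
have mf : measurable_fun setT f by exact: measurable_int fint.
pose Z : Omega -> R := fine \o f.
have fE w : (Z w)%:E = f w by rewrite /Z /= fineK// Radon_Nikodym_fin_num.
have mZ : gmeas G Z.
  by apply/(gmeasP sG); apply: measurableT_comp => //.
have fpint : P.-integrable setT (f \o idG).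
  have /integrableP[_ fi] := fint; apply/integrableP; split.
    exact: measurableT_comp mf id_meas.
  by move: fi; rewrite (ge0_integral_pushforward id_meas)//;
    exact: measurableT_comp.
have IZ : L1 P Z.
  by apply: eq_integrable fpint => // w _; rewrite /= fE.
exists Z; split=> // A GA.
apply: EFin_inj; rewrite -!(sub_int_EFin GF)//.
have mA : measurable (A : set OG) by rewrite sub_measurableE.
transitivity (\int[PG]_(w in (A : set OG)) f w)%E.
  rewrite (integral_pushforward (mu := P) id_meas mf _ mA)//; last first.
    by apply: integrableS fpint => //; rewrite preimage_id; exact: GF.
  by rewrite preimage_id; apply: eq_integral => w _; rewrite /= fE.
rewrite -(Radon_Nikodym_integral dom mA).
by rewrite /nu /nu' /= /pushforward /induced_charge preimage_id.
Qed.

Lemma L2_cst (c : R) : L2 P (fun=> c).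
Proof.
apply: sq_L2 => //.
by apply: (finite_measure_integrable_cst P _ measurableT).
Qed.

Lemma int_cst (c : R) : \int[P]_w c = c.
Proof.
have -> : \int[P]_w c = c * fine (P setT) by exact: Rintegral_cst.
by rewrite probability_setT mulr1.
Qed.

Lemma L2_L1 f : L2 P f -> L1 P f.
Proof.
by move=> Lf; apply: L1_eq (L2M (L2_cst 1) Lf) => w; rewrite mul1r.
Qed.

Lemma int_sq_eq0 f : L2 P f -> \int[P]_w (f w ^+ 2) = 0 ->
  {ae P, forall w, f w = 0}.
Proof.
move=> Lf f0; have [mf _] := Lf; have If := L2_sq Lf.
have /(_ _)/iffLR := @ae_eq_integral_abs _ _ _ P setT measurableT
  (fun w => (f w ^+ 2)%:E).
have -> : (\int[P]_w `|(f w ^+ 2)%:E|)%E = 0%E.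
  rewrite -[RHS]/((0 : R)%:E) -f0 EFin_int//.
  by apply: eq_integral => w _; rewrite /= ger0_norm// sqr_ge0.
move=> /(_ _ erefl) H.
have {}H := H ltac:(by apply/measurable_EFinP; exact: measurable_funX).
apply: filterS H => w /(_ I) [] /eqP.
by rewrite sqrf_eq0 => /eqP.
Qed.

(** An element of L2 orthogonal to the orthogonal complement of the
    G-measurable elements is G-measurable up to a null set: the difference
    with its conditional expectation, truncated where the latter is large, is
    orthogonal to itself. *)
Lemma bipolar_gmeas (X : Omega -> R) : L2 P X ->
  (forall h, L2 P h -> (forall A, G A -> \int[P]_w (\1_A w * h w) = 0) ->
    \int[P]_w (h w * X w) = 0) ->
  exists2 Z, gmeas G Z & {ae P, forall w, X w = Z w}.
Proof.
move=> LX hX; have IX := L2_L1 LX.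
have [Z [mZ IZ ZX]] := condexp_exists IX; exists Z => //.
have mZ' := gmeas_meas GF mZ.
pose B n := [set w | `|Z w| <= n%:R].
have GB n : G (B n).
  have := mZ [set r | `|r| <= n%:R]; apply.
  have -> : [set r | `|r| <= n%:R] = `[- n%:R, n%:R]%classic :> set R.
    by apply/seteqP; split=> r /=; rewrite in_itv /= ler_norml.
  exact: measurable_itv.
pose h n w := \1_(B n) w * (X w - Z w).
have mB n : measurable_fun setT (\1_(B n) : Omega -> R) := indic_meas GF (GB n).
have LZ n : L2 P (fun w => \1_(B n) w * Z w).
  apply: L2_eq (@L2_bM _ _ _ _ (fun w => \1_(B n) w * Z w) _ n%:R _ _ (L2_cst 1)).
  - by move=> w; rewrite mulr1.
  - exact: measurable_funM.
  - move=> w; rewrite indicE; case: (boolP (w \in B n)) => wB.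
      by rewrite mul1r; move: wB; rewrite inE.
    by rewrite mul0r normr0.
have LX' n : L2 P (fun w => \1_(B n) w * X w).
  by apply: (L2_bM (mB n) _ LX) => w; exact: indic_le1.
have Lh n : L2 P (h n).
  by apply: L2_eq (L2B (LX' n) (LZ n)) => w; rewrite /h mulrBr.
have h0 n A : G A -> \int[P]_w (\1_A w * h n w) = 0.
  move=> GA; have GAB := sub_setI sG GA (GB n).
  transitivity (\int[P]_w (\1_(A `&` B n) w * X w - \1_(A `&` B n) w * Z w)).
    by apply: eq_Rintegral => w _; rewrite indicI /h /=; ring.
  rewrite intB; [|exact: (L1_indic GF)|exact: (L1_indic GF)].
  by rewrite ZX// subrr.
have z n : {ae P, forall w, h n w = 0}.
  apply: int_sq_eq0 => //.
  transitivity (\int[P]_w (h n w * X w - \1_(B n) w * Z w * h n w)).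
    apply: eq_Rintegral => w _; rewrite /h indicE.
    by case: (w \in _) => /=; ring.
  rewrite intB; [|exact: L2M|exact: L2M].
  rewrite hX//; last exact: h0.
  rewrite (int_meas_null sG GF (L2_L1 (Lh n)) (h0 n)) ?subr0//; last exact: L2M.
  apply/(gmeasP sG); apply: measurable_funM; last exact/(gmeasP sG).
  by apply: measurable_indic; rewrite (sub_measurableE sG).
have /ae_foralln := z; apply: filterS => w H.
have [n nZ] : exists n : nat, `|Z w| <= n%:R.
  exists (Num.trunc `|Z w|).+1; exact/ltW/truncnS_gt.
have := H n; rewrite /h indicE mem_set// mul1r => /eqP.
by rewrite subr_eq0 => /eqP.
Qed.

(** The completion of G inside the ambient sigma-algebra. *)
Definition completion : set (set Omega) :=
  [set A | measurable A /\ exists2 A', G A' & {ae P, forall w, A w <-> A' w}].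

Lemma completion_sub : completion `<=` measurable.
Proof. by move=> A []. Qed.

Lemma completion_incl : G `<=` completion.
Proof.
move=> A GA; split; first exact: GF.
by exists A => //; exact: aeW.
Qed.

Lemma completion_sigma : sigma_algebra setT completion.
Proof.
split=> [|A [mA [A' GA' AA']]|F cF].
- by apply: completion_incl; rewrite -(sub_measurableE sG); exact: measurable0.
- rewrite setTD; split; first exact: measurableC.
  exists (~` A'); first exact: sub_setC.
  by apply: filterS AA' => w [wA Aw]; split=> H /=; [move=> /Aw|move=> /wA].
have /choice[F' F'P] : forall n, exists A', G A' /\ {ae P, forall w, F n w <-> A' w}.
  by move=> n; have [_ [A' ? ?]] := cF n; exists A'.
split; first by apply: bigcupT_measurable => n; case: (cF n).
exists (\bigcup_n F' n).
  rewrite -(sub_measurableE sG); apply: bigcupT_measurable => n.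
  by rewrite (sub_measurableE sG); case: (F'P n).
have /ae_foralln := fun n => (F'P n).2.
by apply: filterS => w H; split=> -[n _ Fn]; exists n => //; apply/H.
Qed.

Lemma completion_int A h : completion A -> L1 P h ->
  exists2 A', G A' & \int[P]_w (\1_A w * h w) = \int[P]_w (\1_A' w * h w).
Proof.
move=> [mA [A' GA' AA']] Ih; exists A' => //; have mh := L1_meas Ih.
have mA' := GF GA'.
apply: int_ae_eq; [by apply: measurable_funM => //; exact: measurable_indic..|].
apply: filterS AA' => w AA'; congr (_ * _); rewrite !indicE.
have -> // : (w \in A) = (w \in A').
by apply/idP/idP; rewrite !inE => /AA'.
Qed.

Lemma ae_borel_completion n (X : Omega -> 'cV[R]_n) :
  (forall i, measurable_fun setT (fun w => X w i 0)) ->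
  (forall i, exists2 Z, gmeas G Z & {ae P, forall w, X w i 0 = Z w}) ->
  forall B, borel B -> completion (X @^-1` B).
Proof.
move=> mX H B bB.
have /choice[Z ZP] : forall i, exists Z, gmeas G Z /\ {ae P, forall w, X w i 0 = Z w}.
  by move=> i; have [Z ? ?] := H i; exists Z.
split.
  apply: dist_meas_borel bB; first exact: dense_mx.
  by apply: dist_meas_mx => i j; rewrite (ord1 j).
pose Y w : 'cV[R]_n := \col_i Z i w.
exists (Y @^-1` B).
  rewrite -(sub_measurableE sG).
  apply: (@dist_meas_borel R _ _ OG) bB; first exact: dense_mx.
  apply: dist_meas_mx => i j; apply/(gmeasP sG) => C mC.
  have -> : (fun w => Y w i j) = Z i by apply/funext => w; rewrite mxE.
  by have [+ _] := ZP i; apply.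
have : {ae P, forall w, forall i, X w i 0 = Z i w}.
  by apply: (@filter_forall _ _ _ _ _ _); move=> i; case: (ZP i).
apply: filterS => w XZ; suff XY : X w = Y w by rewrite /preimage /= XY.
by apply/colP => i; rewrite mxE.
Qed.

End CondExp.

(** * Moments of Gaussian variables *)

Lemma normal_prob_density (R : realType) (s : R) (g : R -> \bar R) :
  measurable_fun setT g -> (\int[normal_prob 0%R s]_x `|g x| < +oo)%E ->
  (\int[normal_prob 0%R s]_x g x =
   \int[lebesgue_measure]_x (g x * (normal_pdf 0 s x)%:E))%E.
Proof.
move=> mg gi.
rewrite -(Radon_Nikodym_change_of_variables (normal_prob_dominates 0 s))//=; last first.
  by apply/integrableP; split.
apply: ae_eq_integral => //.
- apply: emeasurable_funM => //; apply: (measurable_int lebesgue_measure).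
  by apply: Radon_Nikodym_integrable; exact: normal_prob_dominates.
- apply: emeasurable_funM => //=; apply/measurableT_comp => //=.
  exact: measurable_normal_pdf.
- apply: ae_eqe_mul2l => /=.
  rewrite Radon_NikodymE//=; first exact: normal_prob_dominates.
  move=> dom; case: cid => /= h [h1 h2 h3].
  apply: integral_ae_eq => //=.
  + by apply/measurableT_comp => //; exact: measurable_normal_pdf.
  + by move=> E _ mE; rewrite -h3.
Qed.

Section NormalLaw.
Context (R : realType) (d : measure_display) (Omega : measurableType d)
  (P : probability Omega R) (X : Omega -> R) (s : R).
Hypothesis mX : measurable_fun setT X.
Hypothesis s0 : 0 < s.
Hypothesis lawX : forall B : set (measurableTypeR R), measurable B ->
  P (X @^-1` B) = normal_prob 0 s B.

Let law_int (g : R -> R) : measurable_fun setT g -> (forall x, 0 <= g x) ->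
  (\int[P]_w (g (X w))%:E = \int[normal_prob 0%R s]_x (g x)%:E)%E.
Proof.
move=> mg g0.
have mX' : measurable_fun setT (X : Omega -> measurableTypeR R) by exact: mX.
pose X' : {mfun Omega >-> measurableTypeR R} :=
  HB.pack (X : Omega -> measurableTypeR R) (isMeasurableFun.Build _ _ _ _ _ mX').
transitivity (\int[distribution P X']_x (g x)%:E)%E.
  rewrite (ge0_integral_pushforward mX')//; first exact/measurable_EFinP.
  by move=> x _; rewrite lee_fin.
by apply: eq_measure_integral => A mA _; exact: lawX.
Qed.

(** The Gaussian density times exp (- eps x^2) is, up to a factor, the density
    of a Gaussian variable with smaller variance. *)
Let normal_exp (eps : R) : 0 < eps ->
  (\int[P]_w (expR (- (eps * X w ^+ 2)))%:E =
   ((Num.sqrt (1 + 2 * eps * s ^+ 2))^-1)%:E)%E.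
Proof.
move=> eps0; set c := Num.sqrt _.
have c20 : 0 < 1 + 2 * eps * s ^+ 2 by rewrite addr_gt0// !mulr_gt0// exprn_gt0.
have c0 : 0 < c by rewrite sqrtr_gt0.
have cE : c ^+ 2 = 1 + 2 * eps * s ^+ 2 by rewrite sqr_sqrtr// ltW.
pose g (x : R) := expR (- (eps * x ^+ 2)).
have mg : measurable_fun setT g.
  by apply: measurableT_comp => //; apply: measurableT_comp => //;
    apply: measurable_funM => //; exact: measurable_funX.
rewrite (law_int mg) => [|x]; last exact: expR_ge0.
rewrite normal_prob_density; last 2 first.
- exact/measurable_EFinP.
- apply: (@le_lt_trans _ _ (\int[normal_prob 0%R s]_x (cst 1%:E x))%E).
    apply: ge0_le_integral => //.
      by do 2 apply: measurableT_comp => //.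
    move=> x _; rewrite /= lee_fin ger0_norm ?expR_ge0//.
    by rewrite -[leRHS]expR0 ler_expR oppr_le0 mulr_ge0// ?sqr_ge0// ltW.
  rewrite integral_cst// [X in (_ * X)%E](_ : _ = 1%E) ?mule1 ?ltry//.
  exact: probability_setT.
pose s' := s / c.
have s'0 : 0 < s' by rewrite divr_gt0.
have E x : ((g x)%:E * (normal_pdf 0 s x)%:E =
    (c^-1)%:E * (normal_pdf 0 s' x)%:E)%E.
  rewrite !normal_pdfE ?gt_eqF//; rewrite -!EFinM; congr EFin.
  rewrite /normal_peak /normal_fun.
  have -> : Num.sqrt (s ^+ 2 * pi *+ 2) = s * Num.sqrt (pi *+ 2).
    by rewrite -mulrnAr sqrtrM ?sqr_ge0// sqrtr_sqr gtr0_norm.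
  have -> : Num.sqrt (s' ^+ 2 * pi *+ 2) = s' * Num.sqrt (pi *+ 2).
    by rewrite -mulrnAr sqrtrM ?sqr_ge0// sqrtr_sqr gtr0_norm.
  have p0 : Num.sqrt (pi *+ 2) != 0 :> R.
    by rewrite gt_eqF// sqrtr_gt0 mulrn_wgt0// pi_gt0.
  rewrite mulrCA -expRD /g !mulrA; congr (_ * expR _).
    by rewrite /s'; field; rewrite p0 !gt_eqF.
  have -> : s' ^+ 2 = s ^+ 2 / c ^+ 2 by rewrite /s' expr_div_n.
  rewrite cE; field.
  by rewrite !gt_eqF//=; nra.
under eq_integral do rewrite E.
rewrite integralZl//; last exact: integrable_normal_pdf.
by rewrite integral_normal_pdf mule1.
Qed.

(** The second moment is the limit of (1 - exp (- eps X^2)) / eps as eps tends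
    to 0, and normal_exp evaluates the expectation of this quotient. *)
Lemma normal_law_moment2 : L2 P X /\ \int[P]_w (X w ^+ 2) = s ^+ 2.
Proof.
pose eps n : R := n.+1%:R^-1.
have eps0 n : 0 < eps n by rewrite invr_gt0.
pose q n w := (1 - expR (- (eps n * X w ^+ 2))) / eps n.
pose c n := Num.sqrt (1 + 2 * eps n * s ^+ 2).
have c20 n : 0 < 1 + 2 * eps n * s ^+ 2 by rewrite addr_gt0// !mulr_gt0// exprn_gt0.
have c0 n : 0 < c n by rewrite sqrtr_gt0.
have cE n : c n ^+ 2 = 1 + 2 * eps n * s ^+ 2 by rewrite sqr_sqrtr// ltW.
have mexp n : measurable_fun setT (fun w => expR (- (eps n * X w ^+ 2))).
  by apply: measurableT_comp => //; apply: measurableT_comp => //;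
    apply: measurable_funM => //; exact: measurable_funX.
have exp1 n w : expR (- (eps n * X w ^+ 2)) <= 1.
  by rewrite -[leRHS]expR0 ler_expR oppr_le0 mulr_ge0// ?sqr_ge0// ltW.
have Iexp n : L1 P (fun w => expR (- (eps n * X w ^+ 2))).
  apply: (L1_le _ _ (L2_L1 (L2_cst P 1))) => // w.
  by rewrite ger0_norm ?expR_ge0.
have Iq n : L1 P (q n).
  apply: L1_eq (L1Z (eps n)^-1 (L1B (L2_L1 (L2_cst P 1)) (Iexp n))) => w.
  by rewrite mulrC.
have qE n : \int[P]_w q n w = 2 * s ^+ 2 / (c n * (c n + 1)).
  transitivity ((eps n)^-1 * \int[P]_w (1 - expR (- (eps n * X w ^+ 2)))).
    rewrite -intZ; last exact: L1B (L2_L1 (L2_cst P 1)) (Iexp n).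
    by apply: eq_Rintegral => w _; rewrite mulrC.
  rewrite intB//; last exact: L2_L1 (L2_cst P 1).
  rewrite {2}/Rintegral normal_exp// /= -/(c n).
  rewrite int_cst.
  have e0 := eps0 n; have k0 := c0 n; have k2 := cE n.
  have -> : s ^+ 2 = (c n ^+ 2 - 1) / (2 * eps n).
    by rewrite k2; field; rewrite gt_eqF.
  by field; rewrite !gt_eqF//=; lra.
have q0 n w : 0 <= q n w by rewrite divr_ge0 ?subr_ge0// ltW.
have qle n w : q n w <= X w ^+ 2.
  rewrite /q ler_pdivrMr// lerBlDr -lerBlDl.
  have := expR_ge1Dx (- (eps n * X w ^+ 2)); lra.
have qge n w : X w ^+ 2 / (1 + eps n * X w ^+ 2) <= q n w.
  set y := X w ^+ 2; have y0 : 0 <= y by exact: sqr_ge0.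
  have ey : 0 <= eps n * y by rewrite mulr_ge0// ltW.
  have k := expR_ge1Dx (eps n * y).
  have e1 : expR (- (eps n * y)) <= (1 + eps n * y)^-1.
    by rewrite expRN lef_pV2// posrE ?expR_gt0//; lra.
  rewrite /q ler_pdivlMr//.
  have -> : y / (1 + eps n * y) * eps n = 1 - (1 + eps n * y)^-1.
    by field; rewrite gt_eqF//; lra.
  by rewrite -/y; lra.
have epsl : eps @ \oo --> (0 : R) by exact: cvg_harmonic.
have cl : c @ \oo --> (1 : R).
  rewrite -[X in _ --> X]sqrtr1; apply: continuous_cvg; first exact: sqrt_continuous.
  rewrite -[X in _ --> X]addr0; apply: cvgD; first exact: cvg_cst.
  rewrite -[X in _ --> X](mul0r (s ^+ 2)); apply: cvgMl.
  by rewrite -[X in _ --> X](mulr0 (2 : R)); apply: cvgMr.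
have ql w : (q^~ w) @ \oo --> X w ^+ 2.
  apply: (@squeeze_cvgr _ _ _ _ (fun n => X w ^+ 2 / (1 + eps n * X w ^+ 2))
     (fun=> X w ^+ 2)); last exact: cvg_cst.
    by apply: nearW => n; rewrite qge qle.
  rewrite -[X in _ --> X]mulr1; apply: cvgMr; rewrite -[X in _ --> X]invr1.
  apply: cvgV; first by rewrite oner_neq0.
  rewrite -[X in _ --> X]addr0; apply: cvgD; first exact: cvg_cst.
  by rewrite -[X in _ --> X](mul0r (X w ^+ 2)); apply: cvgMl.
have intl : (fun n => \int[P]_w q n w) @ \oo --> s ^+ 2.
  rewrite (funext qE : (fun n => \int[P]_w q n w) = _).
  rewrite [X in _ --> X](_ : _ = 2 * s ^+ 2 / (1 * (1 + 1))); last by field.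
  apply: cvgMr; apply: cvgV; first by rewrite mul1r gt_eqF.
  by apply: cvgM => //; apply: cvgD => //; exact: cvg_cst.
have fat := @fatou _ _ _ P setT measurableT (fun n w => (q n w)%:E).
have {fat}le2 : (\int[P]_w (X w ^+ 2)%:E <= (s ^+ 2)%:E)%E.
  have e1 w : (limn_einf (fun n => (q n w)%:E) = (X w ^+ 2)%:E)%E.
    suff /cvg_limn_einf_sup[-> _] :
      (fun n => (q n w)%:E) @ \oo --> (X w ^+ 2)%:E by [].
    by apply: cvg_EFin; [exact: nearW|exact: ql].
  have e2 : (limn_einf (fun n => \int[P]_w (q n w)%:E) = (s ^+ 2)%:E)%E.
    suff /cvg_limn_einf_sup[-> _] :
      (fun n => \int[P]_w (q n w)%:E)%E @ \oo --> (s ^+ 2)%:E by [].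
    rewrite (funext (fun n => esym (EFin_int (Iq n))) :
      (fun n => \int[P]_w (q n w)%:E)%E = _).
    by apply: cvg_EFin; [exact: nearW|exact: intl].
  rewrite -e2; under eq_integral do rewrite -e1.
  apply: fat => n; last by move=> w _; rewrite lee_fin.
  by apply/measurable_EFinP/(L1_meas (Iq n)).
have LX : L2 P X by split=> //; apply: le_lt_trans le2 _; rewrite ltry.
split=> //; apply/eqP; rewrite eq_le; apply/andP; split.
  by rewrite -lee_fin EFin_int//; exact: L2_sq.
apply: (ler_cvg_to intl (cvg_cst _)); apply: nearW => n.
by apply: int_le => //; exact: L2_sq.
Qed.
End NormalLaw.

(** * Inner product *)

Section Inner.
Context (R : realType).

Lemma innerE p q (A B : 'M[R]_(p, q)) :
  inner A B = \sum_i \sum_j A i j * B i j.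
Proof.
rewrite /inner /mxtrace exchange_big /=; apply: eq_bigr => j _.
by rewrite mxE; apply: eq_bigr => i _; rewrite mxE.
Qed.

Lemma inner_col p (a b : 'cV[R]_p) : inner a b = \sum_i a i 0 * b i 0.
Proof. by rewrite innerE; apply: eq_bigr => i _; rewrite big_ord1. Qed.

Lemma innerC p q (A B : 'M[R]_(p, q)) : inner A B = inner B A.
Proof.
by rewrite !innerE; apply: eq_bigr => i _; apply: eq_bigr => j _; rewrite mulrC.
Qed.

Lemma innerDl p q (A B C : 'M[R]_(p, q)) : inner (A + B) C = inner A C + inner B C.
Proof. by rewrite /inner linearD mulmxDl linearD. Qed.

Lemma innerDr p q (A B C : 'M[R]_(p, q)) : inner C (A + B) = inner C A + inner C B.
Proof. by rewrite /inner mulmxDr linearD. Qed.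

Lemma innerNl p q (A C : 'M[R]_(p, q)) : inner (- A) C = - inner A C.
Proof. by rewrite /inner linearN mulNmx linearN. Qed.

Lemma innerNr p q (A C : 'M[R]_(p, q)) : inner C (- A) = - inner C A.
Proof. by rewrite /inner mulmxN linearN. Qed.

Lemma innerBl p q (A B C : 'M[R]_(p, q)) : inner (A - B) C = inner A C - inner B C.
Proof. by rewrite innerDl innerNl. Qed.

Lemma innerBr p q (A B C : 'M[R]_(p, q)) : inner C (A - B) = inner C A - inner C B.
Proof. by rewrite innerDr innerNr. Qed.

Lemma innerZl p q (c : R) (A C : 'M[R]_(p, q)) : inner (c *: A) C = c * inner A C.
Proof. by rewrite /inner linearZ /= -scalemxAl linearZ. Qed.

Lemma innerZr p q (c : R) (A C : 'M[R]_(p, q)) : inner C (c *: A) = c * inner C A.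
Proof. by rewrite /inner -scalemxAr linearZ. Qed.

Lemma inner0l p q (C : 'M[R]_(p, q)) : inner 0 C = 0.
Proof. by rewrite /inner trmx0 mul0mx linear0. Qed.

Lemma inner0r p q (C : 'M[R]_(p, q)) : inner C 0 = 0.
Proof. by rewrite /inner mulmx0 linear0. Qed.

Lemma inner_adj p q (A : 'M[R]_(p, q)) (x : 'cV[R]_q) (y : 'cV[R]_p) :
  inner (A *m x) y = inner x (A^T *m y).
Proof. by rewrite /inner trmx_mul mulmxA. Qed.

Lemma sqnE p q (A : 'M[R]_(p, q)) : sqn A = \sum_i \sum_j A i j ^+ 2.
Proof.
by rewrite /sqn innerE; apply: eq_bigr => i _; apply: eq_bigr => j _; rewrite expr2.
Qed.

Lemma sqn_ge0 p q (A : 'M[R]_(p, q)) : 0 <= sqn A.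
Proof. by rewrite sqnE; do 2 apply: sumr_ge0 => ? _; exact: sqr_ge0. Qed.

Lemma sqr_le_sqn p q (A : 'M[R]_(p, q)) i j : A i j ^+ 2 <= sqn A.
Proof.
rewrite sqnE (bigD1 i)//= (bigD1 j)//= -addrA lerDl addr_ge0//.
  by apply: sumr_ge0 => ? _; exact: sqr_ge0.
by do 2 apply: sumr_ge0 => ? _; exact: sqr_ge0.
Qed.

Lemma abs_le_enorm p q (A : 'M[R]_(p, q)) i j : `|A i j| <= enorm A.
Proof. by rewrite -sqrtr_sqr ler_wsqrtr// sqr_le_sqn. Qed.

Lemma inner_delta p (b : 'cV[R]_p) i : inner (delta_mx i 0) b = b i 0.
Proof.
rewrite inner_col (bigD1 i)//= mxE !eqxx mul1r big1 ?addr0// => j ji.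
by rewrite mxE (negbTE ji) mul0r.
Qed.

End Inner.

(** * Independence and Brownian increments *)

Section Indep.
Context (R : realType) (d : measure_display) (Omega : measurableType d)
  (P : probability Omega R).

Lemma sigma_rv_sigma (V : topologicalType) (X : Omega -> V) :
  sigma_algebra setT (sigma_rv X).
Proof.
have -> : sigma_rv X = preimage_set_system setT X (@borel V).
  apply/seteqP; split=> A [B bB].
    by move=> ->; exists B => //; rewrite setTI.
  by rewrite setTI => <-; exists B.
by apply: sigma_algebra_preimage; exact: smallest_sigma_algebra.
Qed.

Lemma borel_real (B : set R) : measurable B -> borel B.
Proof.
move=> mB.
have : (RGenOpens.G (R := R)).-sigma.-measurable B.
  by rewrite -RGenOpens.measurableE.
apply: smallest_sub; first exact: smallest_sigma_algebra.
move=> _ [x [y ->]]; apply: (@sub_sigma_algebra _ setT open).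
exact: interval_open.
Qed.

Lemma borel_preimage (V W : topologicalType) (f : V -> W) (B : set W) :
  continuous f -> borel B -> borel (f @^-1` B).
Proof.
move=> cf; suff H : @borel W `<=` [set B | borel (f @^-1` B)] by exact: H.
apply: smallest_sub.
  have [s0 sC sU] := smallest_sigma_algebra setT (@open V).
  split=> [|A mA|F mF] /=.
  - by rewrite preimage_set0; exact: s0.
  - by rewrite setTD preimage_setC -setTD; exact: sC.
  - by rewrite preimage_bigcup; exact: sU.
by move=> U oU /=; apply: (@sub_sigma_algebra _ setT open); move/continuousP : cf; exact.
Qed.

Lemma meas_wrt_real (V : topologicalType) (G : set (set Omega)) (X : Omega -> V)
  (f : V -> R) : continuous f -> meas_wrt G X -> gmeas G (f \o X).
Proof.
by move=> cf mX B /borel_real /(borel_preimage cf); exact: mX.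
Qed.

Lemma meas_wrt_coord p q (G : set (set Omega)) (X : Omega -> 'M[R]_(p, q)) i j :
  meas_wrt G X -> gmeas G (fun w => X w i j).
Proof. exact: (meas_wrt_real (@coord_continuous _ p q i j)). Qed.

Lemma L1_indic_meas A f : measurable A -> L1 P f ->
  L1 P (fun w => \1_A w * f w).
Proof.
exact: (@L1_indic _ _ _ _ measurable (fun _ => id)).
Qed.

(** int_meas_null is used twice, once for each sigma-algebra: the definition of
    independence is the case of two indicators. *)
Lemma indep_mul (G H : set (set Omega)) (eta xi : Omega -> R) :
  sigma_algebra setT G -> G `<=` measurable ->
  sigma_algebra setT H -> H `<=` measurable -> indep P G H ->
  gmeas G eta -> gmeas H xi -> L1 P xi ->
  L1 P (fun w => eta w * (xi w - \int[P]_w xi w)) ->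
  \int[P]_w (eta w * (xi w - \int[P]_w xi w)) = 0.
Proof.
move=> sG GF sH HF GH meta mxi Ixi Iex.
have IP A : measurable A -> \int[P]_w (\1_A w : R) = fine (P A).
  move=> mA; rewrite /Rintegral; congr fine.
  by rewrite integral_indic// setIT.
have I1 A : measurable A -> L1 P (\1_A : Omega -> R).
  move=> mA; apply: (L1_le _ _ (L2_L1 (L2_cst P 1))) => [|x].
    exact: measurable_indic.
  exact: indic_le1.
have c1 c := L2_L1 (L2_cst P c).
apply: (int_meas_null sG GF) => //; first exact: L1B.
move=> A GA; have mA := GF _ GA.
have z : \int[P]_w (xi w * (\1_A w - fine (P A))) = 0.
  apply: (int_meas_null sH HF) => //; first by apply: L1B => //; exact: I1.
    move=> B HB; have mB := HF _ HB.
    transitivity (\int[P]_w (\1_(A `&` B) w - fine (P A) * \1_B w)).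
      by apply: eq_Rintegral => w _; rewrite indicI /=; ring.
    rewrite intB; [|exact/I1/measurableI|exact/L1Z/I1].
    rewrite intZ; last exact: I1.
    rewrite !IP//; last exact: measurableI.
    rewrite GH// fineM ?subrr//; exact: fin_num_measure.
  apply: L1_eq (L1B (L1_indic_meas mA Ixi) (L1Z (fine (P A)) Ixi)) => w.
  by ring.
transitivity (\int[P]_w (xi w * (\1_A w - fine (P A)) +
    (fine (P A) * xi w - (\int[P]_w xi w) * \1_A w))).
  by apply: eq_Rintegral => w _; ring.
rewrite intD; [|apply: L1_eq (L1B (L1_indic_meas mA Ixi) (L1Z (fine (P A)) Ixi)) => w; ring|
  by apply: L1B; [exact: L1Z|exact/L1Z/I1]].
  rewrite z add0r intB; [|exact: L1Z|exact/L1Z/I1].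
  by rewrite !intZ//; [rewrite IP// mulrC subrr|exact: I1].
Qed.

End Indep.

Section Gaussian.
Context (R : realType) (d : measure_display) (Omega : measurableType d)
  (P : probability Omega R).

Lemma same_law_int (X Y : Omega -> R) : L1 P X -> L1 P Y ->
  (forall B : set (measurableTypeR R), measurable B ->
    P (X @^-1` B) = P (Y @^-1` B)) ->
  \int[P]_w X w = \int[P]_w Y w.
Proof.
move=> IX IY XY.
have mX : measurable_fun setT (X : Omega -> measurableTypeR R) by exact: L1_meas IX.
have mY : measurable_fun setT (Y : Omega -> measurableTypeR R) by exact: L1_meas IY.
pose X' : {mfun Omega >-> measurableTypeR R} :=
  HB.pack (X : Omega -> measurableTypeR R) (isMeasurableFun.Build _ _ _ _ _ mX).
pose Y' : {mfun Omega >-> measurableTypeR R} :=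
  HB.pack (Y : Omega -> measurableTypeR R) (isMeasurableFun.Build _ _ _ _ _ mY).
rewrite /Rintegral; congr fine.
transitivity (\int[distribution P X']_x x%:E)%E.
  rewrite (integral_pushforward mX)//.
transitivity (\int[distribution P Y']_x x%:E)%E.
  by apply: eq_measure_integral => A mA _; exact: XY.
by rewrite (integral_pushforward mY).
Qed.

Lemma gaussian_moments (X : Omega -> R) (v : R) : measurable_fun setT X ->
  gaussian_rv P X 0 v -> L2 P X /\ \int[P]_w (X w ^+ 2) = v.
Proof.
move=> mX [v0]; case: ifPn => [/eqP ->|vn0] H.
  have E : {ae P, forall w, (fun=> 0) w = X w} by apply: filterS H => w ->.
  split; first exact: L2_ae_eq mX E (L2_0 P).
  rewrite -[RHS](int0 P); apply: int_ae_eq => //; first exact: measurable_funX.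
  by apply: filterS E => w <-; rewrite expr0n.
have s0 : 0 < Num.sqrt v by rewrite sqrtr_gt0 lt_neqAle eq_sym vn0.
have [LX ->] := normal_law_moment2 mX s0 H; split=> //.
by rewrite sqr_sqrtr.
Qed.

(** X and its opposite have the same law, hence the same expectation. *)
Lemma gaussian_sym (X : Omega -> R) (v : R) : measurable_fun setT X ->
  gaussian_rv P X 0 v -> gaussian_rv P (fun w => - X w) 0 v ->
  \int[P]_w X w = 0.
Proof.
move=> mX gX gX'; have [LX _] := gaussian_moments mX gX.
have IX := L2_L1 LX.
have : \int[P]_w X w = \int[P]_w (- X w).
  move: gX gX' => -[v0]; case: ifPn => [/eqP ->|vn0] H [_]; rewrite ?eqxx ?(negbTE vn0).
    move=> _; apply: int_ae_eq => //; first by apply: measurableT_comp.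
    by apply: filterS H => w ->; rewrite oppr0.
  move=> H'; apply: same_law_int => //; first exact: L1N.
  by move=> B mB; rewrite H// H'.
rewrite intN// => /eqP; rewrite -subr_eq0 opprK.
by rewrite -mulr2n mulrn_eq0 /= => /eqP.
Qed.
End Gaussian.

Section BrownianIncrements.
Context (R : realType) (d : measure_display) (Omega : measurableType d)
  (P : probability Omega R) (T : R) (F : R -> set (set Omega)) (N : nat)
  (W : R -> Omega -> 'cV[R]_N).
Hypothesis cF : complete_filtration P T F.
Hypothesis bW : brownian P T F W.

Lemma filtr_sigma t : 0 <= t <= T -> sigma_algebra setT (F t).
Proof. by case: cF => _ H _ _ /H []. Qed.

Lemma filtr_meas t : 0 <= t <= T -> F t `<=` measurable.
Proof. by case: cF => _ H _ _ /H []. Qed.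

Lemma gmeas_mono s t (X : Omega -> R) : 0 <= s -> s <= t -> t <= T ->
  gmeas (F s) X -> gmeas (F t) X.
Proof. by case: cF => _ _ H _ s0 st tT mX B mB; apply: (H s t) => //; exact: mX. Qed.

Lemma BM_adapted c t : 0 <= t <= T -> gmeas (F t) (fun w => W t w c 0).
Proof. by case: bW => aW _ _ _ /aW; exact: meas_wrt_coord. Qed.

Let incr (a : 'cV[R]_N) s t w := inner a (W t w - W s w).

Let incrE a s t w : incr a s t w = \sum_i a i 0 * (W t w i 0 - W s w i 0).
Proof. by rewrite /incr inner_col; apply: eq_bigr => i _; rewrite !mxE. Qed.

Let incr_meas a s t : 0 <= s -> s < t -> t <= T -> measurable_fun setT (incr a s t).
Proof.
move=> s0 st tT; rewrite (funext (incrE a s t)).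
apply: measurable_sum => i; apply: measurable_funM => //.
have Wm r : 0 <= r <= T -> measurable_fun setT (fun w => W r w i 0).
  by move=> rT; apply: (gmeas_meas (filtr_meas rT)); exact: BM_adapted.
by apply: measurable_funB; apply: Wm; lra.
Qed.

Let incr_gauss a s t : 0 <= s -> s < t -> t <= T ->
  gaussian_rv P (incr a s t) 0 ((t - s) * inner a a).
Proof.
move=> s0 st tT; have [_ _ _ /(_ s t s0 st tT)[_ [_ _ /(_ a)]]] := bW.
by rewrite inner0r mul_scalar_mx innerZr.
Qed.

Let incr_moments a s t : 0 <= s -> s < t -> t <= T ->
  [/\ L2 P (incr a s t), \int[P]_w incr a s t w = 0 &
      \int[P]_w (incr a s t w ^+ 2) = (t - s) * inner a a].
Proof.
move=> s0 st tT; have ma := incr_meas a s0 st tT.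
have ga := incr_gauss a s0 st tT.
have [La Ea] := gaussian_moments ma ga; split=> //.
apply: (gaussian_sym ma ga).
have := incr_gauss (- a) s0 st tT.
rewrite innerNl innerNr opprK; congr (gaussian_rv _ _ _ _).
by apply/funext => w; rewrite /incr innerNl.
Qed.

Lemma incr_delta c s t w : W t w c 0 - W s w c 0 = incr (delta_mx c 0) s t w.
Proof. by rewrite /incr inner_delta !mxE. Qed.

Lemma BM_incr_L2 c s t : 0 <= s -> s <= t -> t <= T ->
  L2 P (fun w => W t w c 0 - W s w c 0).
Proof.
move=> s0; rewrite le_eqVlt => /orP[/eqP -> _|st tT].
  by apply: L2_eq (L2_0 P) => w; rewrite subrr.
have [La _ _] := incr_moments (delta_mx c 0) s0 st tT.
by apply: L2_eq La => w; rewrite incr_delta.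
Qed.

Lemma BM_indep s t (eta xi : Omega -> R) (f : 'cV[R]_N -> R) :
  0 <= s -> s < t -> t <= T -> continuous f ->
  (forall w, xi w = f (W t w - W s w)) ->
  gmeas (F s) eta -> L1 P xi -> \int[P]_w xi w = 0 ->
  L1 P (fun w => eta w * xi w) -> \int[P]_w (eta w * xi w) = 0.
Proof.
move=> s0 st tT cf xiE meta Ixi xi0 Iex.
have sT : 0 <= s <= T by lra.
have [_ _ _ /(_ s t s0 st tT)[ind [mW _ _]]] := bW.
pose X w := W t w - W s w.
have mxi : gmeas (sigma_rv X) xi.
  have -> : xi = f \o X by apply/funext.
  by apply: (meas_wrt_real cf) => B bB; exists B.
have := @indep_mul _ _ _ P _ _ eta xi (filtr_sigma sT) (filtr_meas sT)
  (sigma_rv_sigma X) _ ind meta mxi Ixi.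
rewrite xi0 => H.
have E : (fun w => eta w * (xi w - 0)) = (fun w => eta w * xi w).
  by apply/funext => w; rewrite subr0.
rewrite E in H; apply: H => // _ [B bB ->]; exact: mW.
Qed.

Lemma BM_incr_mean0 c s t (eta : Omega -> R) : 0 <= s -> s <= t -> t <= T ->
  gmeas (F s) eta -> L2 P eta ->
  \int[P]_w (eta w * (W t w c 0 - W s w c 0)) = 0.
Proof.
move=> s0; rewrite le_eqVlt => /orP[/eqP -> _ _ _|st tT meta Leta].
  by rewrite -[RHS](int0 P); apply: eq_Rintegral => w _; rewrite subrr mulr0.
have LX := BM_incr_L2 c s0 (ltW st) tT.
apply: (BM_indep (f := fun x => x c 0) s0 st tT) => //.
- exact: coord_continuous.
- by move=> w; rewrite !mxE.
- exact: L2_L1.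
- have [_ + _] := incr_moments (delta_mx c 0) s0 st tT.
  by move=> <-; apply: eq_Rintegral => w _; rewrite incr_delta.
- exact: L2M.
Qed.

Lemma BM_incr_cov c c' s t (eta : Omega -> R) (C : R) :
  0 <= s -> s <= t -> t <= T ->
  gmeas (F s) eta -> (forall w, `|eta w| <= C) ->
  \int[P]_w (eta w * ((W t w c 0 - W s w c 0) * (W t w c' 0 - W s w c' 0))) =
  (c == c')%:R * (t - s) * \int[P]_w eta w.
Proof.
move=> s0; rewrite le_eqVlt => /orP[/eqP -> _ _ _|st tT meta etaC].
  rewrite subrr mulr0 mul0r -[RHS](int0 P); apply: eq_Rintegral => w _.
  by rewrite !subrr !mulr0.
have sT : 0 <= s <= T by lra.
pose x w := W t w c 0 - W s w c 0; pose y w := W t w c' 0 - W s w c' 0.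
have Lx := BM_incr_L2 c s0 (ltW st) tT; have Ly := BM_incr_L2 c' s0 (ltW st) tT.
have Ieta : L1 P eta.
  apply: (L1_le _ _ (L2_L1 (L2_cst P C))) => //.
  exact: (gmeas_meas (filtr_meas sT)).
set k := (c == c')%:R * (t - s).
pose a1 : 'cV[R]_N := delta_mx c 0 + delta_mx c' 0.
have [L1_ _ E1] := incr_moments a1 s0 st tT.
have [L2_ _ E2] := incr_moments (delta_mx c 0) s0 st tT.
have [L3_ _ E3] := incr_moments (delta_mx c' 0) s0 st tT.
have Exy : \int[P]_w (x w * y w) = k.
  transitivity (\int[P]_w (2^-1 * (incr a1 s t w ^+ 2 -
    (incr (delta_mx c 0) s t w ^+ 2 + incr (delta_mx c' 0) s t w ^+ 2)))).
    apply: eq_Rintegral => w _; rewrite /x /y !incr_delta /incr innerDl.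
    by field.
  have I23 := L1D (L2_sq L2_) (L2_sq L3_).
  rewrite intZ; last by apply: L1B => //; exact: L2_sq.
  rewrite intB//; last exact: L2_sq.
  rewrite intD; [|exact: L2_sq|exact: L2_sq].
  rewrite E1 E2 E3 /a1 !innerDl !innerDr !inner_delta !mxE !eqxx /=.
  rewrite /k (eq_sym c'); by case: (c == c') => /=; field.
have Ixy : L1 P (fun w => x w * y w) by exact: L2M.
have Ie : L1 P (fun w => eta w * (x w * y w)).
  apply: L1_eq (L2M (L2_bM (gmeas_meas (filtr_meas sT) meta) etaC Lx) Ly) => w.
  by rewrite mulrA.
have Ik : L1 P (fun w => k * eta w) by exact: L1Z.
have c1 := L2_L1 (L2_cst P k).
have : \int[P]_w (eta w * (x w * y w - k)) = 0.
  apply: (BM_indep (f := fun z => z c 0 * z c' 0 - k) s0 st tT) => //.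
  - move=> z; exact: (cvgB (cvgM (@coord_continuous R N 1 c 0 z)
      (@coord_continuous R N 1 c' 0 z)) (cvg_cst k)).
  - by move=> w; rewrite /x /y !mxE.
  - exact: L1B.
  - by rewrite intB// Exy int_cst subrr.
  - by apply: L1_eq (L1B Ie Ik) => w; ring.
move=> H; rewrite -intZ//; apply/eqP; rewrite -subr_eq0 -intB//.
by rewrite -[X in _ == X]H; apply/eqP; apply: eq_Rintegral => w _; rewrite -/(x w) -/(y w); ring.
Qed.
End BrownianIncrements.

(** * Fubini for real-valued functions *)

Section FubiniReal.
Context (R : realType) (d1 d2 : measure_display) (X : measurableType d1)
  (Y : measurableType d2) (mu : {sigma_finite_measure set X -> \bar R})
  (nu : {sigma_finite_measure set Y -> \bar R}).
Implicit Types f : X * Y -> R.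

Lemma fub_ae1 f : L1 (mu \x nu)%E f -> {ae mu, forall x, L1 nu (fun y => f (x, y))}.
Proof. exact: ae_integrable1. Qed.

Lemma fub_ae2 f : L1 (mu \x nu)%E f -> {ae nu, forall y, L1 mu (fun x => f (x, y))}.
Proof. exact: ae_integrable2. Qed.

Lemma fub_meas1 f : measurable_fun setT f ->
  measurable_fun setT (fun x => \int[nu]_y f (x, y)).
Proof.
move=> mf; rewrite /Rintegral.
apply: (@measurableT_comp _ _ _ _ _ _ (@fine R)) => //.
have -> : (fun x => \int[nu]_y (f (x, y))%:E)%E =
  (fun x => (\int[nu]_y ((EFin \o f)^\+ (x, y)) - \int[nu]_y ((EFin \o f)^\- (x, y)))%E).
  apply/funext => x; rewrite [LHS]integralE.
  by congr (_ - _)%E; apply: eq_integral => y _; rewrite ?funeposE ?funenegE.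
have mf' : measurable_fun setT (EFin \o f) by exact/measurable_EFinP.
apply: emeasurable_funB.
  apply: (@measurable_fun_fubini_tonelli_F _ _ _ _ _ nu ((EFin \o f)^\+)%E _
    (funepos_ge0 _)).
  exact: measurable_funepos.
apply: (@measurable_fun_fubini_tonelli_F _ _ _ _ _ nu ((EFin \o f)^\-)%E _
    (funeneg_ge0 _)).
exact: measurable_funeneg.
Qed.

Lemma fub_meas2 f : measurable_fun setT f ->
  measurable_fun setT (fun y => \int[mu]_x f (x, y)).
Proof.
move=> mf; rewrite /Rintegral.
apply: (@measurableT_comp _ _ _ _ _ _ (@fine R)) => //.
have -> : (fun y => \int[mu]_x (f (x, y))%:E)%E =
  (fun y => (\int[mu]_x ((EFin \o f)^\+ (x, y)) - \int[mu]_x ((EFin \o f)^\- (x, y)))%E).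
  apply/funext => x; rewrite [LHS]integralE.
  by congr (_ - _)%E; apply: eq_integral => y _; rewrite ?funeposE ?funenegE.
have mf' : measurable_fun setT (EFin \o f) by exact/measurable_EFinP.
apply: emeasurable_funB.
  apply: (@measurable_fun_fubini_tonelli_G _ _ _ _ _ mu ((EFin \o f)^\+)%E _
    (funepos_ge0 _)).
  exact: measurable_funepos.
apply: (@measurable_fun_fubini_tonelli_G _ _ _ _ _ mu ((EFin \o f)^\-)%E _
    (funeneg_ge0 _)).
exact: measurable_funeneg.
Qed.

Lemma fub1 f : L1 (mu \x nu)%E f ->
  L1 mu (fun x => \int[nu]_y f (x, y)) /\
  \int[(mu \x nu)%E]_q f q = \int[mu]_x \int[nu]_y f (x, y).
Proof.
move=> If; have IF := integrable_fubini_F If.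
have aeF : {ae mu, forall x, fubini_F nu (EFin \o f) x =
    (\int[nu]_y f (x, y))%:E}.
  by apply: filterS (fub_ae1 If) => x Ix; rewrite EFin_int.
have mF : measurable_fun setT (EFin \o (fun x => \int[nu]_y f (x, y))).
  by apply/measurable_EFinP; apply: fub_meas1; exact: L1_meas If.
split.
  apply/integrableP; split=> //.
  have /integrableP[mF' +] := IF; congr (_ < _)%E.
  apply: ae_eq_integral => //; do ?exact: measurableT_comp.
  by apply: filterS aeF => x /= ->.
rewrite [LHS]/Rintegral -integral12_prod_meas1//; congr fine.
apply: ae_eq_integral => //; first exact: measurable_int IF.
by apply: filterS aeF => x /= ->.
Qed.

Lemma fub2 f : L1 (mu \x nu)%E f ->
  L1 nu (fun y => \int[mu]_x f (x, y)) /\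
  \int[(mu \x nu)%E]_q f q = \int[nu]_y \int[mu]_x f (x, y).
Proof.
move=> If.
have mG : measurable_fun setT (fubini_G mu (EFin \o f)) := measurable_fubini_G If.
have aeG : {ae nu, forall y, fubini_G mu (EFin \o f) y =
    (\int[mu]_x f (x, y))%:E}.
  by apply: filterS (fub_ae2 If) => y Iy; rewrite EFin_int.
have mg : measurable_fun setT (fun y => \int[mu]_x f (x, y)).
  by apply: fub_meas2; exact: L1_meas If.
split; last first.
  rewrite [LHS]/Rintegral -integral21_prod_meas1//; congr fine.
  apply: ae_eq_integral => //; first exact/measurable_EFinP.
  by apply: filterS aeG => y /= ->.
apply/integrableP; split; first exact/measurable_EFinP.
have /integrableP[_] := If; rewrite fubini_tonelli2//; last first.
  by apply: measurableT_comp => //; exact: measurable_int If.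
apply: le_lt_trans; apply: ge0_le_integral => //.
- by apply: measurableT_comp => //; exact/measurable_EFinP.
- apply: (@measurable_fun_fubini_tonelli_G _ _ _ _ _ mu) => //.
  by apply: measurableT_comp => //; exact: measurable_int If.
move=> y _; rewrite /fubini_G /Rintegral.
have mf : measurable_fun setT (fun x => (f (x, y))%:E).
  apply/measurable_EFinP; apply: measurableT_comp; first exact: L1_meas If.
  exact: measurable_pair2.
apply: le_trans (le_abse_integral mu measurableT mf).
pose v := (\int[mu]_x (f (x, y))%:E)%E.
change ((`|EFin (fine v)| <= `|v|)%E).
by case: v => [r| |] /=; rewrite ?normr0 ?leey ?lexx.
Qed.

Lemma fub_prod (f : X -> R) (g : Y -> R) : L1 mu f -> L1 nu g ->
  L1 (mu \x nu)%E (fun q => f q.1 * g q.2) /\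
  \int[(mu \x nu)%E]_q (f q.1 * g q.2) = \int[mu]_x f x * \int[nu]_y g y.
Proof.
move=> If Ig; have mf := L1_meas If; have mg := L1_meas Ig.
have I : L1 (mu \x nu)%E (fun q => f q.1 * g q.2).
  apply/integrable12ltyP.
    apply/measurable_EFinP; apply: measurable_funM.
      by apply: (@measurableT_comp _ _ _ _ _ _ f).
    by apply: (@measurableT_comp _ _ _ _ _ _ g).
  have H x : (\int[nu]_y `|((f x * g y)%R)%:E| =
      (`|f x|)%:E * \int[nu]_y (`|g y|)%:E)%E.
    rewrite -integralZl//; last exact: integrable_norm Ig.
    by apply: eq_integral => y _; rewrite /= normrM EFinM.
  under eq_integral do rewrite H.
  have Jg := integrable_norm Ig; rewrite -EFin_int//.
  under eq_integral do rewrite -EFinM mulrC EFinM.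
  rewrite integralZl//; last exact: integrable_norm If.
  rewrite -EFin_int; last exact: integrable_norm If.
  by rewrite -EFinM ltry.
split=> //; have [_ ->] := fub1 I.
transitivity (\int[mu]_x ((\int[nu]_y g y) * f x)); last by rewrite intZ// mulrC.
by apply: eq_Rintegral => x _; rewrite /= intZ// mulrC.
Qed.

End FubiniReal.

(** * Simple stochastic integrals *)

Section IndicatorItv.
Context (R : realType).
Let lam := @lebesgue_measure R.

Definition ind (a b t : R) : R := ((a < t <= b)%R)%:R.

Lemma indE a b : ind a b = \1_(`]a, b]%classic) :> (R -> R).
Proof.
apply/funext => t; rewrite /ind indicE.
have -> // : (t \in `]a, b]%classic) = (a < t <= b).
by apply/idP/idP; rewrite inE /= in_itv.
Qed.

Lemma ind_meas a b : measurable_fun setT (ind a b : measurableTypeR R -> R).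
Proof. by rewrite indE; exact: measurable_indic. Qed.

Lemma ind_int a b : L1 lam (ind a b) /\ \int[lam]_t ind a b t = Num.max 0 (b - a).
Proof.
have E : (\int[lam]_t (ind a b t)%:E = (Num.max 0 (b - a))%:E)%E.
  rewrite indE integral_indic// setIT.
  transitivity (lebesgue_measure (`]a, b]%classic : set R)) => //.
  rewrite lebesgue_measure_itv /= lte_fin.
  by case: ltP => ab; [rewrite max_r ?EFinB//|rewrite max_l//]; lra.
split; last by rewrite /Rintegral E.
apply/integrableP; split; first by apply/measurable_EFinP; exact: ind_meas.
rewrite (_ : (\int[lam]_x _)%E = (Num.max 0 (b - a))%:E) ?ltry// -E.
by apply: eq_integral => t _; rewrite /= ger0_norm// /ind.
Qed.

Lemma indM a b a' b' t : ind a b t * ind a' b' t = ind (Num.max a a') (Num.min b b') t.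
Proof. by rewrite /ind -natrM mulnb gt_max le_min andbACA. Qed.

End IndicatorItv.

Section SimpleIntegral.
Context (R : realType) (d : measure_display) (Omega : measurableType d)
  (P : probability Omega R) (T : R) (F : R -> set (set Omega)) (N : nat)
  (W : R -> Omega -> 'cV[R]_N).
Hypothesis T0 : 0 <= T.
Hypothesis cF : complete_filtration P T F.
Hypothesis bW : brownian P T F W.
Notation lam := (@lebesgue_measure R).
Notation LP := (lam \x P)%E.

Let dB c s t w := W t w c 0 - W s w c 0.

Definition bdd (phi : Omega -> R) := exists C, forall w, `|phi w| <= C.

Lemma bdd_L2 phi t : 0 <= t <= T -> gmeas (F t) phi -> bdd phi -> L2 P phi.
Proof.
move=> tT mp [C pC]; apply: (L2_le _ _ (L2_cst P C)).
  exact: (gmeas_meas (filtr_meas cF tT)).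
by move=> w; rewrite (le_trans (pC w)) ?ler_norm.
Qed.

Lemma bddM phi psi : bdd phi -> bdd psi -> bdd (fun w => phi w * psi w).
Proof.
move=> [C pC] [D qD]; exists (C * D) => w; rewrite normrM ler_pM//.
Qed.

Lemma gmeasM (G : set (set Omega)) (phi psi : Omega -> R) : sigma_algebra setT G ->
  gmeas G phi -> gmeas G psi -> gmeas G (fun w => phi w * psi w).
Proof.
by move=> sG mp mq; apply/(gmeasP sG); apply: measurable_funM; exact/gmeasP.
Qed.

Lemma dB_gmeas c s t : 0 <= s -> s <= t -> t <= T -> gmeas (F t) (dB c s t).
Proof.
move=> s0 st tT; have tT' : 0 <= t <= T by lra.
have sT' : 0 <= s <= T by lra.
apply/(gmeasP (filtr_sigma cF tT')); apply: measurable_funB;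
  apply/(gmeasP (filtr_sigma cF tT')).
  exact: (BM_adapted bW).
by apply: (gmeas_mono cF s0 st tT); exact: (BM_adapted bW).
Qed.

(** The later increment is independent of everything that happened before m. *)
Lemma dB_cross c c' s m t phi s' : 0 <= s -> s <= m -> 0 <= s' -> s' <= m -> m <= t ->
  t <= T -> gmeas (F m) phi -> bdd phi ->
  \int[P]_w (phi w * dB c s m w * dB c' m t w) = 0.
Proof.
move=> s0 sm s'0 s'm mt tT mphi bphi.
have mT : 0 <= m <= T by lra.
apply: (BM_incr_mean0 cF bW) => //; first lra.
  apply: gmeasM => //; first exact: (filtr_sigma cF mT).
  by apply: dB_gmeas => //; lra.
have [C pC] := bphi; apply: (L2_bM _ pC).
  exact: (gmeas_meas (filtr_meas cF mT)).
by apply: (BM_incr_L2 cF bW) => //; lra.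
Qed.

Let dB_split c s m t w : dB c s t w = dB c s m w + dB c m t w.
Proof. by rewrite /dB; ring. Qed.

Lemma L1_elem c c' s t s' t' phi : 0 <= s -> s <= t -> t <= T ->
  0 <= s' -> s' <= t' -> t' <= T -> measurable_fun setT phi -> bdd phi ->
  L1 P (fun w => phi w * dB c s t w * dB c' s' t' w).
Proof.
move=> s0 st tT s'0 st' tT' mphi [C bphi]; apply: L2M.
  by apply: (L2_bM mphi bphi); exact: (BM_incr_L2 cF bW).
exact: (BM_incr_L2 cF bW).
Qed.

Lemma elem_cov_le c c' s s' r r' phi :
  0 <= s -> s <= s' -> s' <= T -> s <= r -> r <= r' -> r' <= T ->
  gmeas (F r) phi -> bdd phi ->
  \int[P]_w (phi w * dB c s s' w * dB c' r r' w) =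
  (c == c')%:R * \int[P]_w phi w * Num.max 0 (Num.min s' r' - r).
Proof.
move=> s0 ss' s'T sr rr' r'T mphi bphi; have rT : 0 <= r <= T by lra.
have mp := gmeas_meas (filtr_meas cF rT) mphi.
have [s'r|rs'] := leP s' r.
  rewrite max_l ?mulr0; last by rewrite subr_le0 ge_min s'r.
  transitivity (\int[P]_w (phi w * dB c s r w * dB c' r r' w
     - phi w * dB c s' r w * dB c' r r' w)).
    by apply: eq_Rintegral => w _; rewrite (dB_split c s s' r); ring.
  rewrite intB; [|by apply: L1_elem => //; lra|by apply: L1_elem => //; lra].
  by rewrite !(@dB_cross _ _ _ _ _ _ r) ?subrr//; lra.
set m := Num.min s' r'.
have rm : r <= m by rewrite le_min rr' ltW.
have mT : m <= T by rewrite ge_min s'T.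
have mT' : 0 <= m <= T by lra.
have ms' : m <= s' by rewrite ge_min lexx.
have mr' : m <= r' by rewrite ge_min lexx orbT.
have mphi' : gmeas (F m) phi by apply: (gmeas_mono cF _ rm) => //; lra.
have I1 : L1 P (fun w => phi w * dB c s r w * dB c' r r' w) by apply: L1_elem => //; lra.
have I2 : L1 P (fun w => phi w * dB c r m w * dB c' r m w) by apply: L1_elem => //; lra.
have I3 : L1 P (fun w => phi w * dB c r m w * dB c' m r' w) by apply: L1_elem => //; lra.
have I4 : L1 P (fun w => phi w * dB c' r m w * dB c m s' w) by apply: L1_elem => //; lra.
transitivity (\int[P]_w (phi w * dB c s r w * dB c' r r' w +
    phi w * dB c r m w * dB c' r m w + phi w * dB c r m w * dB c' m r' w +
    phi w * dB c' r m w * dB c m s' w)).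
  apply: eq_Rintegral => w _; rewrite (dB_split c s r s') (dB_split c r m s').
  rewrite (dB_split c' r m r').
  have : dB c m s' w * dB c' m r' w = 0.
    rewrite /m; have [_|_] := leP s' r'; first by rewrite /dB subrr mul0r.
    by rewrite /dB subrr mulr0.
  move=> z; ring: z.
rewrite intD//; last by apply: L1D => //; exact: L1D.
rewrite intD//; last exact: L1D.
rewrite intD//.
rewrite !(@dB_cross _ _ _ _ _ _ r) //; do ?lra.
have [C pC] := bphi.
rewrite add0r !addr0 max_r ?subr_ge0//.
rewrite -mulrA [_ * (m - r)]mulrC mulrA -(BM_incr_cov cF bW c c' _ rm mT mphi pC)//; last lra.
by apply: eq_Rintegral => w _; rewrite mulrA.
Qed.

Lemma elem_cov_trunc c c' s s' r r' t phi psi :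
  0 <= s -> s <= s' -> s' <= T -> s <= r -> r <= r' -> r' <= T -> 0 <= t <= T ->
  gmeas (F s) phi -> bdd phi -> gmeas (F r) psi -> bdd psi ->
  \int[P]_w ((phi w * dB c (Num.min t s) (Num.min t s') w) *
             (psi w * dB c' (Num.min t r) (Num.min t r') w)) =
  (c == c')%:R * \int[P]_w (phi w * psi w) *
    Num.max 0 (Num.min (Num.min t s') (Num.min t r') - r).
Proof.
move=> s0 ss' s'T sr rr' r'T tT mphi bphi mpsi bpsi.
have [tr|rt] := leP t r.
  have -> : Num.min t r' = t by rewrite min_l//; lra.
  rewrite [Num.max _ _]max_l ?mulr0; last first.
    by rewrite subr_le0 (le_trans _ tr)// ge_min lexx orbT.
  rewrite -[RHS](int0 P); apply: eq_Rintegral => w _.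
  by rewrite /dB subrr !mulr0.
have -> : Num.min t s = s by rewrite min_r//; lra.
have mst : s <= Num.min t s' by rewrite le_min ss' andbT; lra.
have mrt : r <= Num.min t r' by rewrite le_min rr' andbT ltW.
have msT : Num.min t s' <= T by rewrite ge_min s'T orbT.
have mrT : Num.min t r' <= T by rewrite ge_min r'T orbT.
have rT : 0 <= r <= T by lra.
rewrite -(elem_cov_le c c' s0 mst msT sr mrt mrT (phi := fun w => phi w * psi w)).
- by apply: eq_Rintegral => w _; ring.
- apply: gmeasM => //; first exact: (filtr_sigma cF rT).
  by apply: (gmeas_mono cF s0 sr) => //; lra.
- exact: bddM.
Qed.

(** Only the overlap of the two intervals contributes, by dB_cross. *)
Lemma elem_cov c c' s s' r r' t phi psi :
  0 <= s -> s <= s' -> s' <= T -> 0 <= r -> r <= r' -> r' <= T -> 0 <= t <= T ->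
  gmeas (F s) phi -> bdd phi -> gmeas (F r) psi -> bdd psi ->
  \int[P]_w ((phi w * dB c (Num.min t s) (Num.min t s') w) *
             (psi w * dB c' (Num.min t r) (Num.min t r') w)) =
  (c == c')%:R * \int[P]_w (phi w * psi w) *
    \int[lam]_tau (ind 0 t tau * (ind s s' tau * ind r r' tau)).
Proof.
move=> s0 ss' s'T r0 rr' r'T tT mphi bphi mpsi bpsi.
have -> : \int[lam]_tau (ind 0 t tau * (ind s s' tau * ind r r' tau)) =
    Num.max 0 (Num.min (Num.min t s') (Num.min t r') - Num.max s r).
  under eq_Rintegral do rewrite !indM.
  have [_ ->] := ind_int (Num.max 0 (Num.max s r)) (Num.min t (Num.min s' r')).
  rewrite [Num.max 0 (Num.max s r)]max_r; last by rewrite le_max s0.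
  by rewrite minACA minxx.
have [sr|rs] := leP s r; first exact: elem_cov_trunc.
transitivity (\int[P]_w ((psi w * dB c' (Num.min t r) (Num.min t r') w) *
    (phi w * dB c (Num.min t s) (Num.min t s') w))).
  by apply: eq_Rintegral => w _; rewrite mulrC.
rewrite elem_cov_trunc//; last exact: ltW.
rewrite eq_sym minC; congr (_ * _ * _).
by apply: eq_Rintegral => w _; rewrite mulrC.
Qed.
End SimpleIntegral.

Lemma int_sum_mul (R : realType) (d : measure_display) (X : measurableType d)
    (mu : {measure set X -> \bar R}) n m (x : 'I_n -> X -> R) (y : 'I_m -> X -> R) :
  (forall a, L2 mu (x a)) -> (forall b, L2 mu (y b)) ->
  \int[mu]_w ((\sum_a x a w) * (\sum_b y b w)) =
  \sum_a \sum_b \int[mu]_w (x a w * y b w).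
Proof.
move=> Lx Ly.
transitivity (\int[mu]_w (\sum_a \sum_b (x a w * y b w))).
  by apply: eq_Rintegral => w _; rewrite mulr_suml; apply: eq_bigr => a _; rewrite mulr_sumr.
rewrite int_sum => [|a _]; last by apply: L1_sum => b _; exact: L2M.
by apply: eq_bigr => a _; rewrite int_sum// => b _; exact: L2M.
Qed.

Lemma cvg_bigsum (R : realType) (I : Type) (s : seq I) (u : I -> nat -> R)
    (l : I -> R) : (forall i, u i @ \oo --> l i) ->
  (fun k => \sum_(i <- s) u i k) @ \oo --> \sum_(i <- s) l i.
Proof.
move=> ul; elim: s => [|i s IH].
  rewrite big_nil (_ : (fun k => _) = cst 0); first exact: cvg_cst.
  by apply/funext => k; rewrite big_nil.
rewrite big_cons (_ : (fun k => _) = fun k => u i k + \sum_(j <- s) u j k).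
  by apply: cvgD.
by apply/funext => k; rewrite big_cons.
Qed.

Section Cut.
Context (R : realType) (d : measure_display) (Omega : measurableType d).

(** Integrals over the time interval are taken over the whole product space, of
    processes set to 0 outside the interval. *)
Definition trim (T : R) (X : R -> Omega -> R) (q : measurableTypeR R * Omega) : R :=
  if 0 <= q.1 <= T then X q.1 q.2 else 0.

End Cut.

Section ItoSimple.
Context (R : realType) (d : measure_display) (Omega : measurableType d)
  (P : probability Omega R) (T : R) (F : R -> set (set Omega)) (N : nat)
  (W : R -> Omega -> 'cV[R]_N).
Hypothesis T0 : 0 <= T.
Hypothesis cF : complete_filtration P T F.
Hypothesis bW : brownian P T F W.
Notation lam := (@lebesgue_measure R).
Notation LP := (lam \x P)%E.

Section OneSimple.
Context (p r : nat) (S : simple_process R Omega p r).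
Hypothesis okS : simple_ok T F S.

Lemma sp_time_bounds a : (a <= sp_size S)%N -> 0 <= sp_time S a <= T.
Proof.
case: okS => t0 mono tT _ asz.
have up : forall b, (b <= sp_size S)%N -> 0 <= sp_time S b.
  elim=> // b IH bs; apply: le_trans (mono b bs); apply: IH; exact: ltnW.
have down : forall b, (b <= sp_size S)%N -> sp_time S (sp_size S - b) <= T.
  elim=> [|b IH] bs; first by rewrite subn0.
  apply: le_trans (IH (ltnW bs)).
  have -> : (sp_size S - b = (sp_size S - b.+1).+1)%N by rewrite subnSK.
  by apply: mono; rewrite ltn_subrL /=; exact: leq_ltn_trans bs.
by rewrite up//= -(subKn asz) down// leq_subr.
Qed.

Lemma sp_coef_ok (a : 'I_(sp_size S)) i j :
  gmeas (F (sp_time S a)) (fun w => sp_coef S a w i j) /\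
  bdd (fun w => sp_coef S a w i j).
Proof.
have [_ _ _ /(_ a (ltn_ord a))[mc [C cC]]] := okS; split.
  exact: meas_wrt_coord mc.
by exists C => w; rewrite (le_trans _ (cC w))// abs_le_enorm.
Qed.

Lemma sp_coef_L2 (a : 'I_(sp_size S)) i j : L2 P (fun w => sp_coef S a w i j).
Proof.
have [m b] := sp_coef_ok a i j.
exact: (bdd_L2 cF (sp_time_bounds (ltnW (ltn_ord a)))).
Qed.

Lemma simple_val_coord t w i j : simple_val S t w i j =
  \sum_(a < sp_size S) ind (sp_time S a) (sp_time S a.+1) t * sp_coef S a w i j.
Proof.
rewrite /simple_val summxE; apply: eq_bigr => a _.
by rewrite /ind; case: ifP => _; rewrite ?mul1r ?mxE ?mul0r.
Qed.

Lemma sp_elem_L2 (a : 'I_(sp_size S)) i j t :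
  L2 LP (fun q => ind 0 t q.1 *
    (ind (sp_time S a) (sp_time S a.+1) q.1 * sp_coef S a q.2 i j)).
Proof.
have [m [C cC]] := sp_coef_ok a i j.
have ta := sp_time_bounds (ltnW (ltn_ord a)).
have mc := gmeas_meas (filtr_meas cF ta) m.
have mm : measurable_fun setT (fun q : measurableTypeR R * Omega =>
  ind 0 t q.1 * (ind (sp_time S a) (sp_time S a.+1) q.1 * sp_coef S a q.2 i j)).
  apply: measurable_funM; first exact: measurableT_comp (ind_meas 0 t) measurable_fst.
  apply: measurable_funM; first exact: measurableT_comp (ind_meas _ _) measurable_fst.
  exact: measurableT_comp mc measurable_snd.
apply: sq_L2 => //.
have [I _] := fub_prod (ind_int 0 t).1 (L2_L1 (L2_cst P (C ^+ 2))).
apply: (L1_le _ _ I); first exact: measurable_funX.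
move=> q; rewrite ger0_norm ?sqr_ge0// !exprMn.
have i1 (x : bool) : (x%:R : R) ^+ 2 = x%:R by case: x; rewrite ?expr1n ?expr0n.
rewrite /ind !i1; case: (0 < _ <= _); rewrite ?mul0r ?mul1r//.
case: (_ < _ <= _); rewrite ?mul0r ?mul1r ?sqr_ge0//.
rewrite -(real_normK (num_real (sp_coef S a q.2 i j))) lerXn2r ?nnegrE//.
by rewrite (le_trans _ (cC q.2)).
Qed.

Lemma trim_simple t i j q : trim t (fun s w => simple_val S s w i j) q =
  \sum_(a < sp_size S) ind 0 t q.1 *
    (ind (sp_time S a) (sp_time S a.+1) q.1 * sp_coef S a q.2 i j).
Proof.
rewrite /trim simple_val_coord; case: ifPn => [/andP[q0 qt]|qn].
  apply: eq_bigr => a _.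
  have [q0'|q0'] := ltP 0 q.1; first by rewrite [ind 0 t _]/ind q0' qt mul1r.
  have /andP[s0 _] := sp_time_bounds (ltnW (ltn_ord a)).
  have -> : ind (sp_time S a) (sp_time S a.+1) q.1 = 0.
    by rewrite /ind ltNge (le_trans q0' s0).
  by rewrite !mul0r mulr0.
rewrite big1// => a _; rewrite /ind; case: (boolP (0 < q.1 <= t)); rewrite ?mul0r//.
by move=> /andP[/ltW q0 qt]; rewrite q0 qt in qn.
Qed.

Lemma trim_simple_L2 t i j : L2 LP (trim t (fun s w => simple_val S s w i j)).
Proof.
apply: (L2_eq (fun q => esym (trim_simple t i j q))).
by apply: L2_sum => a _; exact: sp_elem_L2.
Qed.

Context (w : R -> Omega -> 'cV[R]_r) (iota : 'I_r -> 'I_N).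
Hypothesis wW : forall t o j, w t o j 0 = W t o (iota j) 0.

Lemma simple_integral_coord t o i : simple_integral w S t o i 0 =
  \sum_j \sum_(a < sp_size S) sp_coef S a o i j *
    (W (Num.min t (sp_time S a.+1)) o (iota j) 0 -
     W (Num.min t (sp_time S a)) o (iota j) 0).
Proof.
rewrite /simple_integral summxE exchange_big; apply: eq_bigr => a _.
by rewrite mxE; apply: eq_bigr => j _; rewrite !mxE !wW.
Qed.

Lemma sp_incr_L2 (a : 'I_(sp_size S)) i j t : 0 <= t <= T ->
  L2 P (fun o => sp_coef S a o i j *
    (W (Num.min t (sp_time S a.+1)) o (iota j) 0 -
     W (Num.min t (sp_time S a)) o (iota j) 0)).
Proof.
move=> tT; have [m [C cC]] := sp_coef_ok a i j.
have ta := sp_time_bounds (ltnW (ltn_ord a)).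
have tb := sp_time_bounds (ltn_ord a).
have mc := gmeas_meas (filtr_meas cF ta) m.
have [_ /(_ a (ltn_ord a)) mono _ _] := okS.
apply: (L2_bM mc cC); apply: (BM_incr_L2 cF bW).
- by rewrite le_min; case/andP: tT => ->; case/andP: ta.
- by rewrite le_min !ge_min lexx mono orbT.
- by rewrite ge_min; case/andP: tT => _ ->.
Qed.

Lemma simple_integral_L2 t i : 0 <= t <= T ->
  L2 P (fun o => simple_integral w S t o i 0).
Proof.
move=> tT; apply: (L2_eq (fun o => esym (simple_integral_coord t o i))).
by apply: L2_sum => j _; apply: L2_sum => a _; exact: sp_incr_L2.
Qed.

(** The increments after t have mean zero given the past. *)
Lemma simple_mart t t' i (xi : Omega -> R) : 0 <= t -> t <= t' -> t' <= T ->
  gmeas (F t) xi -> L2 P xi ->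
  \int[P]_o (xi o * (simple_integral w S t' o i 0 - simple_integral w S t o i 0)) = 0.
Proof.
move=> t0 tt' t'T mxi Lxi.
have tT : 0 <= t <= T by lra.
have tT' : 0 <= t' <= T by lra.
pose x j (a : 'I_(sp_size S)) o := xi o * sp_coef S a o i j *
  (W (Num.max t (Num.min t' (sp_time S a.+1))) o (iota j) 0 -
   W (Num.max t (Num.min t' (sp_time S a))) o (iota j) 0).
have split_ c o z : W (Num.min t' z) o c 0 - W (Num.min t z) o c 0 =
    W (Num.max t (Num.min t' z)) o c 0 - W t o c 0.
  have -> : Num.min t z = Num.min t (Num.min t' z) by rewrite minA [Num.min t t']min_l.
  by case: (leP t (Num.min t' z)) => _; rewrite ?subrr.
have mul_L2 (a : 'I_(sp_size S)) j : L2 P (fun o => xi o * sp_coef S a o i j).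
  have [m [C cC]] := sp_coef_ok a i j.
  have ta := sp_time_bounds (ltnW (ltn_ord a)).
  apply: L2_eq (L2_bM (gmeas_meas (filtr_meas cF ta) m) cC Lxi) => o.
  by rewrite mulrC.
have mx (a : nat) : (a <= sp_size S)%N ->
    0 <= Num.max t (Num.min t' (sp_time S a)) /\
    Num.max t (Num.min t' (sp_time S a)) <= T.
  move=> /sp_time_bounds ta; rewrite le_max t0 ge_max ge_min t'T; lra.
have mono (a : 'I_(sp_size S)) : Num.max t (Num.min t' (sp_time S a)) <=
    Num.max t (Num.min t' (sp_time S a.+1)).
  have [_ /(_ a (ltn_ord a)) mono _ _] := okS.
  rewrite ge_max le_max lexx /= le_max; apply/orP; right.
  by rewrite le_min !ge_min lexx mono orbT.
have Ix j a : L1 P (x j a).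
  apply: L2M (mul_L2 a j) _; apply: (BM_incr_L2 cF bW) => //.
    by have [] := mx _ (ltnW (ltn_ord a)).
  by have [] := mx _ (ltn_ord a).
transitivity (\int[P]_o (\sum_j \sum_a x j a o)).
  apply: eq_Rintegral => o _; rewrite !simple_integral_coord -sumrB mulr_sumr.
  apply: eq_bigr => j _; rewrite -sumrB mulr_sumr; apply: eq_bigr => a _.
  rewrite -mulrBr mulrA /x; congr (_ * _).
  have := split_ (iota j) o (sp_time S a.+1); have := split_ (iota j) o (sp_time S a).
  lra.
rewrite int_sum => [|j _]; last by apply: L1_sum => a _; exact: Ix.
apply: big1 => j _; rewrite int_sum => [|a _]; last exact: Ix.
apply: big1 => a _; have [m _] := sp_coef_ok a i j.
have ta := sp_time_bounds (ltnW (ltn_ord a)).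
have [t'a|at'] := leP t' (sp_time S a).
  rewrite -[RHS](int0 P); apply: eq_Rintegral => o _; rewrite /x.
  have [_ /(_ a (ltn_ord a)) mono' _ _] := okS.
  by rewrite !min_l// ?(le_trans t'a)// subrr mulr0.
have [b0 bT] := mx _ (ltnW (ltn_ord a)); have [c0 cT] := mx _ (ltn_ord a).
apply: (BM_incr_mean0 cF bW) => //.
have bT' : 0 <= Num.max t (Num.min t' (sp_time S a)) <= T by rewrite b0 bT.
apply: gmeasM; first exact: (filtr_sigma cF bT').
  by apply: (gmeas_mono cF t0 _ bT) => //; rewrite le_max lexx.
apply: (gmeas_mono cF _ _ bT) m; first by case/andP: ta.
by rewrite le_max le_min lexx (ltW at') orbT.
Qed.

End OneSimple.

(** The isometry for two integrands and two blocks of components of the same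
    Brownian motion; iota and iota' say where the blocks sit. *)
Lemma simple_cov p r p' r' (S : simple_process R Omega p r)
    (S' : simple_process R Omega p' r') (w : R -> Omega -> 'cV[R]_r)
    (w' : R -> Omega -> 'cV[R]_r') (iota : 'I_r -> 'I_N) (iota' : 'I_r' -> 'I_N) t i i' :
  simple_ok T F S -> simple_ok T F S' ->
  (forall t o j, w t o j 0 = W t o (iota j) 0) ->
  (forall t o j, w' t o j 0 = W t o (iota' j) 0) ->
  0 <= t <= T ->
  \int[P]_o (simple_integral w S t o i 0 * simple_integral w' S' t o i' 0) =
  \sum_j \sum_j' (iota j == iota' j')%:R * \int[LP]_q
    (trim t (fun s o => simple_val S s o i j) q *
     trim t (fun s o => simple_val S' s o i' j') q).
Proof.
move=> okS okS' wW wW' tT.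
under eq_Rintegral do
  rewrite (simple_integral_coord S wW) (simple_integral_coord S' wW').
rewrite int_sum_mul; last 2 first.
- by move=> j; apply: L2_sum => a _; exact: sp_incr_L2.
- by move=> j; apply: L2_sum => a _; exact: sp_incr_L2.
apply: eq_bigr => j _; apply: eq_bigr => j' _.
rewrite int_sum_mul; last 2 first.
- by move=> a; exact: sp_incr_L2.
- by move=> a; exact: sp_incr_L2.
under [in RHS]eq_Rintegral do rewrite (trim_simple okS) (trim_simple okS').
rewrite int_sum_mul; last 2 first.
- by move=> a; exact: sp_elem_L2.
- by move=> a; exact: sp_elem_L2.
rewrite mulr_sumr; apply: eq_bigr => a _; rewrite mulr_sumr; apply: eq_bigr => a' _.
have [ma ba] := sp_coef_ok okS a i j; have [ma' ba'] := sp_coef_ok okS' a' i' j'.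
have /andP[a0 _] := sp_time_bounds okS (ltnW (ltn_ord a)).
have /andP[_ aT] := sp_time_bounds okS (ltn_ord a).
have /andP[a0' _] := sp_time_bounds okS' (ltnW (ltn_ord a')).
have /andP[_ aT'] := sp_time_bounds okS' (ltn_ord a').
have [_ /(_ a (ltn_ord a)) mono _ _] := okS.
have [_ /(_ a' (ltn_ord a')) mono' _ _] := okS'.
rewrite (elem_cov cF bW)// -mulrA; congr (_ * _).
pose f tau := ind 0 t tau * (ind (sp_time S a) (sp_time S a.+1) tau *
  ind (sp_time S' a') (sp_time S' a'.+1) tau).
have If : L1 lam f.
  by apply: L1_eq (ind_int _ _).1 => tau; rewrite /f !indM.
have Ig : L1 P (fun o => sp_coef S a o i j * sp_coef S' a' o i' j').
  by apply: L2M; [exact: sp_coef_L2 okS a i j|exact: sp_coef_L2 okS' a' i' j'].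
rewrite mulrC; have [_ <-] := fub_prod If Ig.
apply: eq_Rintegral => q _; rewrite /f.
have i1 : ind 0 t q.1 * ind 0 t q.1 = ind 0 t q.1.
  by rewrite /ind; case: (0 < _ <= _); rewrite ?mul1r ?mul0r.
ring: i1.
Qed.

End ItoSimple.

(** * Square-integrable processes *)

Section Process.
Context (R : realType) (d : measure_display) (Omega : measurableType d)
  (P : probability Omega R).
Notation lam := (@lebesgue_measure R).
Notation LP := (lam \x P)%E.

Definition PL2 (T : R) (X : R -> Omega -> R) := L2 LP (trim T X).

Lemma trim0 T q : trim T (fun _ (_ : Omega) => 0 : R) q = 0.
Proof. by rewrite /trim; case: ifP. Qed.

Lemma trimD T (X Y : R -> Omega -> R) q :
  trim T (fun t o => X t o + Y t o) q = trim T X q + trim T Y q.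
Proof. by rewrite /trim; case: ifP; rewrite ?addr0. Qed.

Lemma trimN T (X : R -> Omega -> R) q : trim T (fun t o => - X t o) q = - trim T X q.
Proof. by rewrite /trim; case: ifP; rewrite ?oppr0. Qed.

Lemma trimB T (X Y : R -> Omega -> R) q :
  trim T (fun t o => X t o - Y t o) q = trim T X q - trim T Y q.
Proof. by rewrite trimD trimN. Qed.

Lemma trim_sum T n (X : 'I_n -> R -> Omega -> R) q :
  trim T (fun t o => \sum_i X i t o) q = \sum_i trim T (X i) q.
Proof. by rewrite /trim; case: ifP => // _; rewrite big1. Qed.

Lemma trim_itv_meas T :
  measurable_fun setT (fun q : measurableTypeR R * Omega => 0 <= q.1 <= T).
Proof.
by apply: measurable_and; apply: measurable_fun_ler.
Qed.

Lemma trim_meas_le t T (X : R -> Omega -> R) : t <= T ->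
  measurable_fun setT (trim T X) -> measurable_fun setT (trim t X).
Proof.
move=> tT mX.
have -> : trim t X = fun q => if 0 <= q.1 <= t then trim T X q else 0.
  apply/funext => q; rewrite /trim; case: ifP => // /andP[-> qt] /=.
  by rewrite (le_trans qt tT).
by apply: measurable_fun_ifT => //; exact: trim_itv_meas.
Qed.

Lemma PL2_le t T (X : R -> Omega -> R) : t <= T -> PL2 T X -> PL2 t X.
Proof.
move=> tT LX; apply: (L2_le _ _ LX); first exact: trim_meas_le (LX.1).
move=> q; rewrite /trim; case: ifP => [/andP[-> qt]|_] /=.
  by rewrite (le_trans qt tT).
by rewrite normr0.
Qed.

Lemma joint_cut (V : topologicalType) T (X : R -> Omega -> V) (f : V -> R) :
  continuous f -> joint_meas T X -> measurable_fun setT (trim T (fun t o => f (X t o))).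
Proof.
move=> cf jX _ B mB; rewrite setTI.
pose b (q : measurableTypeR R * Omega) := 0 <= q.1 <= T.
have mb := trim_itv_meas T measurableT (_ : measurable [set false]).
have {}mb : measurable [set q | ~~ b q].
  have := mb I; rewrite setTI; congr measurable.
  by apply/seteqP; split=> q /=; rewrite /b; case: (_ <= _ <= _).
have mXB := jX _ (borel_preimage cf (borel_real mB)).
have [B0|nB0] := pselect (B 0).
  have -> : trim T (fun t o => f (X t o)) @^-1` B =
    [set q | 0 <= q.1 <= T /\ (f @^-1` B) (X q.1 q.2)] `|` [set q | ~~ b q].
    apply/seteqP; split=> q /=; rewrite /trim /b; case: ifP => qT.
    - by left.
    - by right.
    - by case=> [[]|].
    - by [].
  exact: measurableU.
have -> // : trim T (fun t o => f (X t o)) @^-1` B =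
    [set q | 0 <= q.1 <= T /\ (f @^-1` B) (X q.1 q.2)].
by apply/seteqP; split=> q /=; rewrite /trim; case: ifP => qT // [].
Qed.

Lemma sqintE T p q (D : R -> Omega -> 'M[R]_(p, q)) :
  (forall i j, measurable_fun setT (trim T (fun t o => D t o i j))) ->
  (sqint P T D = \int[LP]_x (trim T (fun t o => sqn (D t o)) x)%:E)%E /\
  measurable_fun setT (trim T (fun t o => sqn (D t o))).
Proof.
move=> mD.
have mS : measurable_fun setT (trim T (fun t o => sqn (D t o))).
  have -> : trim T (fun t o => sqn (D t o)) =
     fun x => \sum_i \sum_j trim T (fun t o => D t o i j) x ^+ 2.
    apply/funext => x; rewrite /trim; case: ifP => _; first by rewrite sqnE.
    by rewrite big1// => i _; rewrite big1// => j _; rewrite expr0n.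
  apply: measurable_sum => i; apply: measurable_sum => j.
  exact: measurable_funX.
split; last exact: mS.
rewrite fubini_tonelli2; last 2 first.
- exact/measurable_EFinP.
- by move=> x; rewrite lee_fin /trim; case: ifP => // _; exact: sqn_ge0.
rewrite /sqint; apply: eq_integral => o _; rewrite /fubini_G.
rewrite [LHS]integral_mkcond; apply: eq_integral => t _.
rewrite patchE /trim /=.
have -> : (t \in `[0, T]%classic) = (0 <= t <= T).
  by apply/idP/idP; rewrite inE /= in_itv.
by case: ifP.
Qed.

Lemma sqint_ge t T p q (D : R -> Omega -> 'M[R]_(p, q)) i j : t <= T ->
  (forall i j, measurable_fun setT (trim T (fun t o => D t o i j))) ->
  (\int[LP]_x ((trim t (fun t o => D t o i j) x) ^+ 2)%:E <= sqint P T D)%E.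
Proof.
move=> tT mD; have [-> mS] := sqintE mD.
apply: ge0_le_integral => //.
- by move=> x _; rewrite lee_fin sqr_ge0.
- apply/measurable_EFinP. apply: measurable_funX. exact: (trim_meas_le tT (mD i j)).
- exact/measurable_EFinP.
move=> x _; rewrite lee_fin /trim; case: ifP => [/andP[-> xt]|_].
  by rewrite (le_trans xt tT) /= sqr_le_sqn.
by rewrite expr0n /=; case: ifP => // _; exact: sqn_ge0.
Qed.

Lemma sqint_PL2 T p q (X : R -> Omega -> 'M[R]_(p, q)) i j :
  joint_meas T X -> (sqint P T X < +oo)%E -> PL2 T (fun t o => X t o i j).
Proof.
move=> jX sX.
have mX i' j' := joint_cut (@coord_continuous R p q i' j') jX.
by split; [exact: mX|exact: le_lt_trans (sqint_ge i j (lexx T) mX) sX].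
Qed.

Lemma L2F_PL2 T F p q (X : R -> Omega -> 'M[R]_(p, q)) i j :
  L2F P T F X -> PL2 T (fun t o => X t o i j).
Proof. by case=> _; exact: sqint_PL2. Qed.

End Process.

(** * The Ito integral *)

Section Ito.
Context (R : realType) (d : measure_display) (Omega : measurableType d)
  (P : probability Omega R) (T : R) (F : R -> set (set Omega)) (N : nat)
  (W : R -> Omega -> 'cV[R]_N).
Hypothesis T0 : 0 <= T.
Hypothesis cF : complete_filtration P T F.
Hypothesis bW : brownian P T F W.
Notation lam := (@lebesgue_measure R).
Notation LP := (lam \x P)%E.

Section One.
Context (p r : nat) (Z : R -> Omega -> 'M[R]_(p, r)) (I : R -> Omega -> 'cV[R]_p)
  (w : R -> Omega -> 'cV[R]_r) (iota : 'I_r -> 'I_N).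
Hypothesis wW : forall t o j, w t o j 0 = W t o (iota j) 0.
Hypothesis Z2 : forall i j, PL2 P T (fun t o => Z t o i j).
Hypothesis IZ : ito_integral P T F w Z I.

(** The squared Frobenius norms dominate the squares of the coordinates, so that
    the approximation may be read coordinate by coordinate. *)
Lemma ito_approx : exists S : nat -> simple_process R Omega p r,
  [/\ forall k, simple_ok T F (S k),
      forall t i j, t <= T ->
        cvg2 LP (fun k => trim t (fun s o => simple_val (S k) s o i j))
          (trim t (fun s o => Z s o i j)) &
      forall t i, 0 <= t <= T -> L2 P (fun o => I t o i 0) /\
        cvg2 P (fun k o => simple_integral w (S k) t o i 0) (fun o => I t o i 0)].
Proof.
have [aI _ [S [okS SZ SI]]] := IZ; exists S; split=> //.
  move=> t i j tT; apply: squeeze_cvge SZ => //; last exact: cvg_cst.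
  apply: nearW => k; rewrite integral_ge0 => [|x _]; last by rewrite lee_fin sqr_ge0.
  rewrite (_ : (\int[LP]_x _)%E = (\int[LP]_x ((trim t (fun s o =>
    (Z s o - simple_val (S k) s o) i j) x) ^+ 2)%:E)%E).
    apply: sqint_ge => // i' j'.
    rewrite (_ : trim T _ = fun q => trim T (fun s o => Z s o i' j') q -
      trim T (fun s o => simple_val (S k) s o i' j') q).
      apply: measurable_funB; first exact: L2_meas (Z2 i' j').
      exact: L2_meas (trim_simple_L2 cF (okS k) T i' j').
    by apply/funext => q; rewrite -trimB /trim !mxE.
  by apply: eq_integral => x _; rewrite -trimB /trim !mxE.
move=> t i tT.
have mI : measurable_fun setT (fun o => I t o i 0).
  apply: (gmeas_meas (filtr_meas cF tT)); apply: meas_wrt_coord; exact: aI.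
have mI' i' : measurable_fun setT (fun o => I t o i' 0).
  apply: (gmeas_meas (filtr_meas cF tT)); apply: meas_wrt_coord; exact: aI.
have LS k i' := simple_integral_L2 cF bW (okS k) wW i' tT.
have le k : (\int[P]_o ((I t o i 0 - simple_integral w (S k) t o i 0) ^+ 2)%:E <=
    'E_P[fun o => sqn (I t o - simple_integral w (S k) t o)])%E.
  rewrite unlock; apply: ge0_le_integral => //.
  - by move=> o _; rewrite lee_fin sqr_ge0.
  - apply/measurable_EFinP/measurable_funX; apply: measurable_funB => //.
    exact: L2_meas (LS k i).
  - apply/measurable_EFinP.
    have -> : (fun o => sqn (I t o - simple_integral w (S k) t o)) =
       fun o => \sum_i (I t o i 0 - simple_integral w (S k) t o i 0) ^+ 2.
      apply/funext => o; rewrite sqnE; apply: eq_bigr => i' _.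
      by rewrite big_ord1 !mxE.
    apply: measurable_sum => i'; apply: measurable_funX; apply: measurable_funB => //.
    exact: L2_meas (LS k i').
  - move=> o _; rewrite lee_fin.
    by have := sqr_le_sqn (I t o - simple_integral w (S k) t o) i 0; rewrite !mxE.
have c2 : cvg2 P (fun k o => simple_integral w (S k) t o i 0) (fun o => I t o i 0).
  apply: squeeze_cvge (SI t tT) => //; last exact: cvg_cst.
  by apply: nearW => k; rewrite le andbT integral_ge0// => o _; rewrite lee_fin sqr_ge0.
split=> //; have /fine_cvgP[[k _ /(_ k (leqnn k)) fk] _] := c2.
have LD : L2 P (fun o => I t o i 0 - simple_integral w (S k) t o i 0).
  split; first by apply: measurable_funB => //; exact: L2_meas (LS k i).
  by rewrite ltey_eq fk.
by apply: L2_eq (L2D LD (LS k i)) => o; rewrite subrK.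
Qed.

Lemma ito_L2 t i : 0 <= t <= T -> L2 P (fun o => I t o i 0).
Proof. by have [S [_ _ H]] := ito_approx; move=> /(H t i)[]. Qed.

(** Orthogonality to the past is preserved by mean-square limits. *)
Lemma ito_mart t t' i (xi : Omega -> R) : 0 <= t -> t <= t' -> t' <= T ->
  gmeas (F t) xi -> L2 P xi ->
  \int[P]_o (xi o * (I t' o i 0 - I t o i 0)) = 0.
Proof.
move=> t0 tt' t'T mxi Lxi.
have tT : 0 <= t <= T by lra.
have tT' : 0 <= t' <= T by lra.
have [S [okS _ H]] := ito_approx.
have [L1_ c1] := H t i tT; have [L2_ c2] := H t' i tT'.
have LS k s sT := simple_integral_L2 cF bW (okS k) wW i (t := s) sT.
have cx : cvg2 P (fun _ => xi) xi.
  rewrite /cvg2 (_ : (fun _ => _) = fun=> 0%E); first exact: cvg_cst.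
  apply/funext => k; rewrite -[RHS](@integral0 _ _ _ P setT).
  by apply: eq_integral => o _; rewrite subrr expr0n.
have l1 := cvg2_mul (fun _ => Lxi) (fun k => LS k t tT) Lxi L1_ cx c1.
have l2 := cvg2_mul (fun _ => Lxi) (fun k => LS k t' tT') Lxi L2_ cx c2.
have l3 := @cvgB _ _ _ _ _ _ _ _ _ l2 l1.
move: l3 => /(_ _) l3.
have -> : \int[P]_o (xi o * (I t' o i 0 - I t o i 0)) =
   \int[P]_o (xi o * I t' o i 0) - \int[P]_o (xi o * I t o i 0).
  rewrite -intB; [|exact: L2M|exact: L2M].
  by apply: eq_Rintegral => o _; rewrite mulrBr.
rewrite -(cvg_lim _ l3)//; apply: cvg_lim => //.
rewrite (_ : _ - _ = fun=> 0); first exact: cvg_cst.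
apply/funext => k; rewrite -[RHS](simple_mart cF bW (okS k) wW i t0 tt' t'T mxi Lxi).
rewrite /= -[LHS]/(_ - _) -intB; [|exact: L2M Lxi (LS k t' tT')|exact: L2M Lxi (LS k t tT)].
by apply: eq_Rintegral => o _; rewrite mulrBr.
Qed.

End One.

Lemma ito_isometry p r p' r' (Z : R -> Omega -> 'M[R]_(p, r))
    (Z' : R -> Omega -> 'M[R]_(p', r'))
    (I : R -> Omega -> 'cV[R]_p) (I' : R -> Omega -> 'cV[R]_p')
    (w : R -> Omega -> 'cV[R]_r) (w' : R -> Omega -> 'cV[R]_r')
    (iota : 'I_r -> 'I_N) (iota' : 'I_r' -> 'I_N) t i i' :
  (forall t o j, w t o j 0 = W t o (iota j) 0) ->
  (forall t o j, w' t o j 0 = W t o (iota' j) 0) ->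
  (forall i j, PL2 P T (fun t o => Z t o i j)) ->
  (forall i j, PL2 P T (fun t o => Z' t o i j)) ->
  ito_integral P T F w Z I -> ito_integral P T F w' Z' I' -> 0 <= t <= T ->
  \int[P]_o (I t o i 0 * I' t o i' 0) =
  \sum_j \sum_j' (iota j == iota' j')%:R * \int[LP]_q
    (trim t (fun s o => Z s o i j) q * trim t (fun s o => Z' s o i' j') q).
Proof.
move=> wW wW' Z2 Z2' IZ IZ' tT; have /andP[_ t1] := tT.
have [S [okS SZ SI]] := ito_approx wW Z2 IZ.
have [S' [okS' SZ' SI']] := ito_approx wW' Z2' IZ'.
have [L1_ c1] := SI t i tT; have [L2_ c2] := SI' t i' tT.
have l1 := cvg2_mul (fun k => simple_integral_L2 cF bW (okS k) wW i tT)
  (fun k => simple_integral_L2 cF bW (okS' k) wW' i' tT) L1_ L2_ c1 c2.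
rewrite -(cvg_lim _ l1)//; apply: cvg_lim => //.
rewrite (funext (fun k => simple_cov cF bW i i' (okS k) (okS' k) wW wW' tT)).
apply: cvg_bigsum => j; apply: cvg_bigsum => j'; apply: cvgMr.
apply: cvg2_mul.
- by move=> k; exact: (trim_simple_L2 cF (okS k)).
- by move=> k; exact: (trim_simple_L2 cF (okS' k)).
- exact: PL2_le t1 (Z2 i j).
- exact: PL2_le t1 (Z2' i' j').
- exact: SZ.
- exact: SZ'.
Qed.

End Ito.

(** * Time integrals *)

Section PathCalculus.
Context (R : realType).
Notation lam := (@lebesgue_measure R).
Implicit Types (f g : measurableTypeR R -> R).

Definition ind0 (t s : R) : R := ((0 <= s <= t)%R)%:R.

Lemma ind0E t : ind0 t = \1_(`[0, t]%classic) :> (R -> R).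
Proof.
apply/funext => s; rewrite /ind0 indicE.
have -> // : (s \in `[0, t]%classic) = (0 <= s <= t).
by apply/idP/idP; rewrite inE /= in_itv.
Qed.

Lemma ind0_meas t : measurable_fun setT (ind0 t : measurableTypeR R -> R).
Proof. by rewrite ind0E; exact: measurable_indic. Qed.

Lemma ind0_sq t s : ind0 t s ^+ 2 = ind0 t s.
Proof. by rewrite /ind0; case: (_ <= _ <= _); rewrite ?expr1n ?expr0n. Qed.

Lemma ind0_bound t s : `|ind0 t s| <= 1.
Proof. by rewrite /ind0; case: (_ <= _ <= _); rewrite ?normr1 ?normr0. Qed.

Lemma ind0_int t : 0 <= t -> L1 lam (ind0 t) /\ \int[lam]_s ind0 t s = t.
Proof.
move=> t0.
have E : (\int[lam]_s (ind0 t s)%:E = t%:E)%E.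
  rewrite ind0E integral_indic// setIT.
  transitivity (lebesgue_measure (`[0, t]%classic : set R)) => //.
  rewrite lebesgue_measure_itv /= lte_fin; case: ltP => [_|t0']; first by rewrite sube0.
  by have -> : t = 0 by lra.
split; last by rewrite /Rintegral E.
apply/integrableP; split; first by apply/measurable_EFinP; exact: ind0_meas.
rewrite (_ : (\int[lam]_x _)%E = t%:E) ?ltry// -E.
by apply: eq_integral => s _; rewrite /= ger0_norm// /ind0.
Qed.

Lemma ind0_L2 t : 0 <= t -> L2 lam (ind0 t).
Proof.
move=> t0; apply: sq_L2; first exact: ind0_meas.
by apply: L1_eq (ind0_int t0).1 => s; rewrite ind0_sq.
Qed.

(** Cauchy-Schwarz on the time interval. *)
Lemma path_sq_bound T t f : 0 < T -> 0 <= t <= T -> measurable_fun setT f ->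
  (((\int[lam]_s (ind0 t s * f s)) ^+ 2)%:E <=
   T%:E * \int[lam]_s ((f s) ^+ 2)%:E)%E.
Proof.
move=> T0 /andP[t0 tT] mf.
have [fi|] := ltP (\int[lam]_s ((f s) ^+ 2)%:E)%E +oo%E; last first.
  by rewrite leye_eq => /eqP ->; rewrite gt0_muley ?lte_fin// leey.
have Lf : L2 lam f by split.
rewrite -EFin_int; last exact: L2_sq.
rewrite -EFinM lee_fin (le_trans (CauchySchwarz (ind0_L2 t0) Lf))//.
rewrite ler_wpM2r//; first by apply: Rintegral_ge0 => s _; exact: sqr_ge0.
have [_ <-] := ind0_int (le_trans t0 tT).
apply: int_le; [exact: L2_sq (ind0_L2 t0)|exact: (ind0_int (le_trans t0 tT)).1|].
move=> s; rewrite ind0_sq /ind0; case: (boolP (0 <= s <= t)) => [/andP[-> st]|_].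
  by rewrite (le_trans st tT).
by rewrite ler0n.
Qed.

(** Integration by parts for absolutely continuous paths, from Fubini on the
    two triangles of the square. *)
Lemma path_by_parts t f g : L1 lam f -> L1 lam g ->
  (forall s, ~~ (0 <= s <= t) -> f s = 0) ->
  (forall s, ~~ (0 <= s <= t) -> g s = 0) ->
  (\int[lam]_s f s) * (\int[lam]_s g s) =
  \int[lam]_s ((\int[lam]_r (ind0 s r * f r)) * g s + f s * (\int[lam]_r (ind0 s r * g r))).
Proof.
move=> If Ig f0 g0.
have mf := L1_meas If; have mg := L1_meas Ig.
have [Ifg <-] := fub_prod If Ig.
pose b (q : measurableTypeR R * measurableTypeR R) : R := ((q.1 <= q.2)%R)%:R.
have mb : measurable_fun setT b.
  have -> : b = \1_[set q | q.1 <= q.2].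
    apply/funext => q; rewrite /b indicE.
    have -> // : (q \in [set q | q.1 <= q.2]) = (q.1 <= q.2).
    by apply/idP/idP; rewrite inE.
  apply: measurable_indic.
  have := measurable_fun_ler (@measurable_fst _ _ (measurableTypeR R) (measurableTypeR R))
    (@measurable_snd _ _ (measurableTypeR R) (measurableTypeR R)).
  by move=> /(_ measurableT [set true] I); rewrite setTI.
have b1 q : `|b q| <= 1 by rewrite /b normr_nat lern1 leq_b1.
have nfg := integrable_norm Ifg.
have I1 : L1 (lam \x lam)%E (fun q => b q * (f q.1 * g q.2)).
  apply: L1_le nfg; first by apply: measurable_funM => //; exact: L1_meas Ifg.
  by move=> q; rewrite normrM ler_piMl.
have I2 : L1 (lam \x lam)%E (fun q => (1 - b q) * (f q.1 * g q.2)).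
  by apply: L1_eq (L1B Ifg I1) => q; ring.
transitivity (\int[(lam \x lam)%E]_q (b q * (f q.1 * g q.2) + (1 - b q) * (f q.1 * g q.2))).
  by apply: eq_Rintegral => q _; ring.
rewrite intD//; have [J1 ->] := fub2 I1; have [J2 ->] := fub1 I2.
have E1 s : \int[lam]_r (b (r, s) * (f (r, s).1 * g (r, s).2)) =
    (\int[lam]_r (ind0 s r * f r)) * g s.
  rewrite [RHS]mulrC -intZ; last first.
    apply: L1_le (integrable_norm If).
      by apply: measurable_funM => //; exact: ind0_meas.
    by move=> r; rewrite normrM ler_piMl// ind0_bound.
  apply: eq_Rintegral => r _; rewrite /b /ind0 /=.
  by have [r0|r0] := boolP (0 <= r); [|rewrite f0 ?negb_and ?r0//]; ring.
have E2 r : \int[lam]_s ((1 - b (r, s)) * (f (r, s).1 * g (r, s).2)) =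
    f r * (\int[lam]_s (ind0 r s * g s)).
  rewrite -intZ; last first.
    apply: L1_le (integrable_norm Ig).
      by apply: measurable_funM => //; exact: ind0_meas.
    by move=> s; rewrite normrM ler_piMl// ind0_bound.
  have mi := ind0_meas r.
  apply: int_ae_eq.
  - apply: measurable_funM.
      apply: measurable_funB => //; apply: measurableT_comp mb _.
      exact: measurable_pair1.
    by apply: measurable_funM => /=; [exact: measurable_cst|exact: mg].
  - by apply: measurable_funM => //; apply: measurable_funM.
  exists [set r]; split=> //; first exact: lebesgue_measure_set1.
  move=> s /=; apply: contra_notP => sr; rewrite /b /ind0 /=.
  have [s0|s0] := boolP (0 <= s); last by rewrite g0 ?negb_and ?s0//; ring.
  by case: (ltgtP s r) sr => // _ _ /=; ring.
rewrite (eq_Rintegral _ (fun s _ => E1 s)) (eq_Rintegral _ (fun r _ => E2 r)).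
rewrite -intD//; first by apply: L1_eq J1 => s; rewrite E1.
by apply: L1_eq J2 => s; rewrite E2.
Qed.

End PathCalculus.

Section ProcessCalculus.
Context (R : realType) (d : measure_display) (Omega : measurableType d)
  (P : probability Omega R) (T : R).
Hypothesis T0 : 0 < T.
Notation lam := (@lebesgue_measure R).
Notation LP := (lam \x P)%E.
Implicit Types X Y D : R -> Omega -> R.

Lemma trim_slice_meas X t : measurable_fun setT (trim T X) -> 0 <= t <= T ->
  measurable_fun setT (X t).
Proof.
move=> mX tT.
have : measurable_fun setT (fun o => trim T X (t, o)).
  apply: measurableT_comp mX _; exact: measurable_pair1.
by congr measurable_fun; apply/funext => o; rewrite /trim tT.
Qed.

Lemma PL2_slice X : PL2 P T X -> {ae lam, forall t, 0 <= t <= T -> L2 P (X t)}.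
Proof.
move=> LX; have := fub_ae1 (L2_sq LX); apply: filterS => t It tT.
apply: sq_L2; first exact: trim_slice_meas (L2_meas LX) tT.
by apply: L1_eq It => o; rewrite /trim tT.
Qed.

Lemma ae_time_ex (Q : R -> Prop) : {ae lam, forall t, 0 <= t <= T -> Q t} ->
  exists2 t, 0 <= t <= T & Q t.
Proof.
move=> [N [mN N0 sub]]; apply: contrapT => nQ.
have : (lam `[0%R, T]%classic <= lam N)%E.
  apply: le_measure; rewrite ?inE//.
  move=> t /=; rewrite in_itv /= => tT; apply: sub => /= H.
  by apply: nQ; exists t => //; exact: H.
have -> : lam `[0%R, T]%classic = T%:E.
  transitivity (lebesgue_measure (`[0, T]%classic : set R)) => //.
  by rewrite lebesgue_measure_itv /= lte_fin T0 sube0.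
by rewrite N0 lee_fin leNgt T0.
Qed.

Lemma PL2_cst (xi : Omega -> R) : L2 P xi -> PL2 P T (fun=> xi).
Proof.
move=> Lx; have mx := L2_meas Lx.
have E q : trim T (fun=> xi) q = ind0 T q.1 * xi q.2.
  by rewrite /trim /ind0; case: ifP; rewrite ?mul1r ?mul0r.
apply: sq_L2.
  rewrite (funext E); apply: measurable_funM.
    exact: measurableT_comp (ind0_meas T) measurable_fst.
  exact: measurableT_comp mx measurable_snd.
have [I _] := fub_prod (ind0_int (ltW T0)).1 (L2_sq Lx).
by apply: L1_eq I => q; rewrite E exprMn ind0_sq.
Qed.

(** The time integral of D up to t, written over the whole line so that it is
    measurable jointly in t and the outcome. *)
Definition tint D (t : R) (o : Omega) : R :=
  \int[lam]_r (ind0 t r * trim T D (r, o)).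

Lemma tintE D t o : t <= T -> tint D t o = \int[lebesgue_measure]_(s in `[0, t]) D s o.
Proof.
move=> tT; rewrite [RHS]Rintegral_mkcond; apply: eq_Rintegral => s _.
rewrite patchE /ind0 /trim /=.
have -> : (s \in `[0, t]%classic) = (0 <= s <= t).
  by apply/idP/idP; rewrite inE /= in_itv.
have [/andP[s0 st]|_] := boolP (0 <= s <= t); last by rewrite mul0r.
by rewrite s0 (le_trans st tT) mul1r.
Qed.

Lemma tint0 D o : tint D 0 o = 0.
Proof.
rewrite tintE ?ltW// [LHS]/Rintegral.
have -> : `[0%R, 0%R]%classic = [set 0%R] :> set R.
  by apply/seteqP; split=> s /=; rewrite in_itv /= => H; [lra|rewrite H lexx].
by rewrite integral_set1.
Qed.

Lemma tint_joint D : measurable_fun setT (trim T D) ->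
  measurable_fun setT (fun q : measurableTypeR R * Omega => tint D q.1 q.2).
Proof.
move=> mD.
apply: (fub_meas1 lam (f := fun z : (measurableTypeR R * Omega) * measurableTypeR R =>
  ind0 z.1.1 z.2 * trim T D (z.2, z.1.2))).
have m11 : measurable_fun setT (fun z : (measurableTypeR R * Omega) * measurableTypeR R => z.1.1).
  exact: measurableT_comp measurable_fst measurable_fst.
have m12 : measurable_fun setT (fun z : (measurableTypeR R * Omega) * measurableTypeR R => z.1.2).
  exact: measurableT_comp measurable_snd measurable_fst.
have m2 : measurable_fun setT (fun z : (measurableTypeR R * Omega) * measurableTypeR R => z.2).
  exact: measurable_snd.
apply: measurable_funM; last first.
  by apply: measurableT_comp mD _; apply: measurable_fun_pair.
pose A := [set z : (measurableTypeR R * Omega) * measurableTypeR R |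
  (0 <= z.2 <= z.1.1)%R].
have -> : (fun z : (measurableTypeR R * Omega) * measurableTypeR R =>
    ind0 z.1.1 z.2) = \1_A.
  apply/funext => z; rewrite /ind0 indicE.
  have -> // : (z \in A) = (0 <= z.2 <= z.1.1).
  by apply/idP/idP; rewrite inE.
apply: measurable_indic.
have := @measurable_and _ _ setT _ _ (measurable_fun_ler (@measurable_cst _ _ _ _ setT (0:R)) m2)
   (measurable_fun_ler m2 m11).
by move=> /(_ measurableT [set true] I); rewrite setTI.
Qed.

Lemma slice_meas2 D o : measurable_fun setT (trim T D) ->
  measurable_fun setT (fun s : measurableTypeR R => trim T D (s, o)).
Proof. by move=> mD; apply: measurableT_comp mD _; exact: measurable_pair2. Qed.

Lemma int_trim_sq D : PL2 P T D ->
  (\int[P]_o (T%:E * \int[lam]_s ((trim T D (s, o)) ^+ 2)%:E) < +oo)%E.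
Proof.
move=> LD; have mD := L2_meas LD.
have mD2 : measurable_fun setT (fun q => ((trim T D q) ^+ 2)%:E).
  by apply/measurable_EFinP; exact: measurable_funX.
have pos q : (0 <= ((trim T D q) ^+ 2)%:E)%E by rewrite lee_fin sqr_ge0.
rewrite ge0_integralZl//.
- have [_ +] := LD; rewrite fubini_tonelli2//; rewrite /fubini_G => H.
  by rewrite lte_mul_pinfty// ?lee_fin ltW.
- exact: (@measurable_fun_fubini_tonelli_G _ _ _ _ _ lam _ mD2 pos).
- by move=> o _; apply: integral_ge0 => s _.
- by rewrite lee_fin ltW.
Qed.

Lemma tint_L2 D t : PL2 P T D -> 0 <= t <= T -> L2 P (tint D t).
Proof.
move=> LD tT; have mD := L2_meas LD.
have mD2 : measurable_fun setT (fun q => ((trim T D q) ^+ 2)%:E).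
  by apply/measurable_EFinP; exact: measurable_funX.
have pos q : (0 <= ((trim T D q) ^+ 2)%:E)%E by rewrite lee_fin sqr_ge0.
have mt : measurable_fun setT (tint D t).
  have mp : measurable_fun setT (fun o : Omega => ((t : measurableTypeR R), o)).
    exact: measurable_pair1.
  exact: (measurableT_comp (tint_joint mD) mp).
split=> //; apply: le_lt_trans (int_trim_sq LD).
apply: ge0_le_integral => //.
- by move=> o _; rewrite lee_fin sqr_ge0.
- by apply/measurable_EFinP; exact: measurable_funX.
- apply: emeasurable_funM => //.
  exact: (@measurable_fun_fubini_tonelli_G _ _ _ _ _ lam _ mD2 pos).
- by move=> o _; apply: path_sq_bound => //; exact: slice_meas2.
Qed.

Lemma tint_PL2 D : PL2 P T D -> PL2 P T (tint D).
Proof.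
move=> LD; have mD := L2_meas LD.
have mD2 : measurable_fun setT (fun q => ((trim T D q) ^+ 2)%:E).
  by apply/measurable_EFinP; exact: measurable_funX.
have pos q : (0 <= ((trim T D q) ^+ 2)%:E)%E by rewrite lee_fin sqr_ge0.
have mt : measurable_fun setT (trim T (tint D)).
  apply: measurable_fun_ifT => //; first exact: trim_itv_meas.
  exact: tint_joint.
split=> //.
pose g o := (\int[lam]_s ((trim T D (s, o)) ^+ 2)%:E)%E.
have mg : measurable_fun setT g.
  exact: (@measurable_fun_fubini_tonelli_G _ _ _ _ _ lam _ mD2 pos).
have g0 o : (0 <= g o)%E by apply: integral_ge0.
have gpos o : (0 <= T%:E * g o)%E by apply: mule_ge0 => //; rewrite lee_fin ltW.
apply: (@le_lt_trans _ _ (\int[LP]_q ((ind0 T q.1)%:E * (T%:E * g q.2)))%E).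
  apply: ge0_le_integral => //.
  - by move=> q _; rewrite lee_fin sqr_ge0.
  - by apply/measurable_EFinP; exact: measurable_funX.
  - apply: emeasurable_funM.
      by apply/measurable_EFinP; exact: measurableT_comp (ind0_meas T) measurable_fst.
    by apply: emeasurable_funM => //; exact: measurableT_comp mg measurable_snd.
  - move=> q _; rewrite /trim /ind0; case: ifP => [qT|_]; last first.
      by rewrite mul0e expr0n.
    by rewrite mul1e; apply: path_sq_bound => //; exact: slice_meas2.
rewrite fubini_tonelli1//; last 2 first.
- apply: emeasurable_funM.
    by apply/measurable_EFinP; exact: measurableT_comp (ind0_meas T) measurable_fst.
  by apply: emeasurable_funM => //; exact: measurableT_comp mg measurable_snd.
- by move=> q; apply: mule_ge0 => //; rewrite lee_fin ler0n.
have := int_trim_sq LD; rewrite -/g => fin.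
have pos2 : (0 <= \int[P]_o (T%:E * g o))%E.
  by apply: integral_ge0.
have FE (s : measurableTypeR R) : (fubini_F P
    (fun q : measurableTypeR R * Omega => (ind0 T q.1)%:E * (T%:E * g q.2)) s =
    (ind0 T s)%:E * \int[P]_o (T%:E * g o))%E.
  rewrite /fubini_F /= ge0_integralZl//; last by rewrite lee_fin ler0n.
  exact: measurable_funeM mg.
rewrite (eq_integral _ _ (fun s _ => FE s)).
move: fin pos2; case: (\int[P]_o (T%:E * g o))%E => [c| |] // _ _.
rewrite integralZr//; last exact: (ind0_int (ltW T0)).1.
by rewrite -EFin_int; [rewrite -EFinM ltry|exact: (ind0_int (ltW T0)).1].
Qed.

(** Fubini's theorem, between the time integral and the expectation. *)
Lemma tint_dual D t xi : PL2 P T D -> 0 <= t <= T -> L2 P xi ->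
  L1 LP (fun q => xi q.2 * trim t D q) /\
  \int[P]_o (xi o * tint D t o) = \int[LP]_q (xi q.2 * trim t D q).
Proof.
move=> LD tT Lxi; have /andP[t0 tT'] := tT.
have LX := PL2_cst Lxi.
have E q : trim T (fun=> xi) q * trim t D q = xi q.2 * trim t D q.
  rewrite /trim; case: (boolP (0 <= q.1 <= t)) => [/andP[-> qt]|_]; last by rewrite !mulr0.
  by rewrite (le_trans qt tT').
have I : L1 LP (fun q => xi q.2 * trim t D q).
  by apply: L1_eq (L2M LX (PL2_le tT' LD)) => q; rewrite E.
split=> //; have [_ ->] := fub2 I.
have It : L1 LP (trim t D).
  apply: L1_eq (L2M (PL2_cst (L2_cst P 1)) (PL2_le tT' LD)) => q.
  rewrite /trim; case: (boolP (0 <= q.1 <= t)) => [/andP[-> qt]|_]; last by rewrite !mulr0.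
  by rewrite (le_trans qt tT') mul1r.
have [I2 _] := fub2 I.
apply: int_ae_eq; [|exact: L1_meas I2|].
  by apply: measurable_funM; [exact: L2_meas Lxi|exact: L2_meas (tint_L2 LD tT)].
apply: filterS (fub_ae2 It) => o Io; rewrite /= intZ//; congr (_ * _).
apply: eq_Rintegral => s _; rewrite /ind0 /trim /=.
case: (boolP (0 <= s <= t)) => [/andP[-> st]|_]; last by rewrite mul0r.
by rewrite (le_trans st tT') mul1r.
Qed.

Lemma tint_by_parts D D' : PL2 P T D -> PL2 P T D' ->
  \int[P]_o (tint D T o * tint D' T o) =
  \int[LP]_q (trim T (tint D) q * trim T D' q + trim T D q * trim T (tint D') q).
Proof.
move=> LD LD'; have LA := tint_PL2 LD; have LA' := tint_PL2 LD'.
have TT : 0 <= T <= T by rewrite ltW/=.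
have I : L1 LP (fun q => trim T (tint D) q * trim T D' q + trim T D q * trim T (tint D') q).
  exact: L1D (L2M LA LD') (L2M LD LA').
have toL1 X : PL2 P T X -> L1 LP (trim T X).
  move=> LX; apply: L1_eq (L2M (PL2_cst (L2_cst P 1)) LX) => q.
  by rewrite /trim; case: ifP; rewrite ?mul1r ?mul0r.
have [I2 ->] := fub2 I.
apply: int_ae_eq; [|exact: L1_meas I2|].
  by apply: measurable_funM; [exact: L2_meas (tint_L2 LD TT)|exact: L2_meas (tint_L2 LD' TT)].
have a1 := fub_ae2 (toL1 _ LD); have a2 := fub_ae2 (toL1 _ LD').
have full X o : tint X T o = \int[lam]_s trim T X (s, o).
  apply: eq_Rintegral => s _; rewrite /ind0 /trim /=.
  by case: ifP; rewrite ?mul1r ?mul0r.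
apply: filterS2 a1 a2 => o I1 I1'; rewrite !full.
rewrite (@path_by_parts R T)//.
- apply: eq_Rintegral => s _; rewrite /trim /=.
  by case: ifP => // _; rewrite !mulr0 mul0r.
- by move=> s /negbTE; rewrite /trim /= => ->.
- by move=> s /negbTE; rewrite /trim /= => ->.
Qed.

End ProcessCalculus.

(** * The product formula *)

Lemma ae_and (R : realType) (d : measure_display) (X : measurableType d)
  (mu : {measure set X -> \bar R}) (A B : X -> Prop) :
  {ae mu, forall x, A x} -> {ae mu, forall x, B x} -> {ae mu, forall x, A x /\ B x}.
Proof. by move=> aA aB; apply: filterS2 aA aB => x. Qed.

Section Bilinear.
Context (R : realType) (d : measure_display) (X : measurableType d)
  (mu : {measure set X -> \bar R}).
Implicit Types x y z : X -> R.

Lemma ipDl x y z : L2 mu x -> L2 mu y -> L2 mu z ->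
  \int[mu]_w ((x w + y w) * z w) = \int[mu]_w (x w * z w) + \int[mu]_w (y w * z w).
Proof.
move=> Lx Ly Lz; rewrite -intD; [|exact: L2M|exact: L2M].
by apply: eq_Rintegral => w _; rewrite mulrDl.
Qed.

Lemma ipDr x y z : L2 mu x -> L2 mu y -> L2 mu z ->
  \int[mu]_w (z w * (x w + y w)) = \int[mu]_w (z w * x w) + \int[mu]_w (z w * y w).
Proof.
move=> Lx Ly Lz; rewrite -intD; [|exact: L2M|exact: L2M].
by apply: eq_Rintegral => w _; rewrite mulrDr.
Qed.

Lemma ipC x y : \int[mu]_w (x w * y w) = \int[mu]_w (y w * x w).
Proof. by apply: eq_Rintegral => w _; rewrite mulrC. Qed.

End Bilinear.

Section Product.
Context (R : realType) (d : measure_display) (Omega : measurableType d)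
  (P : probability Omega R) (T : R) (F : R -> set (set Omega)).
Hypothesis T0 : 0 < T.
Hypothesis cF : complete_filtration P T F.
Notation lam := (@lebesgue_measure R).
Notation LP := (lam \x P)%E.
Implicit Types X Y D M : R -> Omega -> R.

(** Of the martingale M only the orthogonality of its final increments to the past
    is recorded. *)
Definition semimart X D M : Prop :=
  [/\ forall t, 0 <= t <= T -> gmeas (F t) (X t),
      PL2 P T X /\ PL2 P T D,
      forall t, 0 <= t <= T -> gmeas (F t) (D t),
      (forall t, 0 <= t <= T -> L2 P (M t)) /\
      (forall t xi, 0 <= t <= T -> gmeas (F t) xi -> L2 P xi ->
         \int[P]_o (xi o * (M T o - M t o)) = 0) &
      forall t, 0 <= t <= T ->
        {ae P, forall o, X t o = X 0 o + tint T D t o + M t o}].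

Let T00 : 0 <= (0 : R) <= T. Proof. by rewrite lexx ltW. Qed.
Let TT : 0 <= T <= T. Proof. by rewrite lexx ltW. Qed.

Lemma semimart_L2 X D M t : semimart X D M -> 0 <= t <= T -> L2 P (X t).
Proof.
move=> [aX [LX LD] _ [LM _] XE].
have mX s : 0 <= s <= T -> measurable_fun setT (X s).
  by move=> sT; apply: (gmeas_meas (filtr_meas cF sT)); exact: aX.
have L0 : L2 P (X 0).
  have [s sT Ls] := ae_time_ex T0 (PL2_slice LX).
  apply: L2_ae_eq (L2B (L2B Ls (tint_L2 T0 LD sT)) (LM s sT)); first exact: mX.
  by apply: filterS (XE s sT) => o ->; ring.
move=> tT; apply: L2_ae_eq (L2D (L2D L0 (tint_L2 T0 LD tT)) (LM t tT)).
  exact: mX.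
by apply: filterS (XE t tT) => o ->.
Qed.

Lemma semimart_M0 X D M : semimart X D M -> {ae P, forall o, M 0 o = 0}.
Proof.
move=> [_ _ _ _ XE]; apply: filterS (XE 0 T00) => o.
by rewrite tint0// addr0 -{1}[X 0 o]addr0 => /addrI.
Qed.

(** By the martingale property the terminal value of N may be replaced, against
    the drift at each time, by its value at that time, which is known from Y. *)
Lemma semimart_drift X D M Y D' N : semimart X D M -> semimart Y D' N ->
  \int[P]_o (tint T D T o * N T o) =
  \int[LP]_q (trim T D q * (trim T Y q - trim T (fun=> Y 0) q - trim T (tint T D') q)).
Proof.
move=> sX sY; have [_ [_ LD] aD _ _] := sX; have [aY [LY LD'] _ [LN mN] YE] := sY.
have LY0 := semimart_L2 sY T00.
have [I1 E1] := tint_dual T0 LD TT (LN T TT).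
have LK := L2B (L2B LY (PL2_cst T0 LY0)) (tint_PL2 T0 LD').
have I2 : L1 LP (fun q => trim T D q * (trim T Y q - trim T (fun=> Y 0) q - trim T (tint T D') q)).
  exact: L2M LD LK.
transitivity (\int[P]_o (N T o * tint T D T o)).
  by apply: eq_Rintegral => o _; rewrite mulrC.
rewrite E1; have [J1 ->] := fub1 I1; have [J2 ->] := fub1 I2.
apply: int_ae_eq; [exact: L1_meas J1|exact: L1_meas J2|].
apply: filterS (ae_and (PL2_slice LD) (PL2_slice LY)) => s [Ds Ys].
have [sT|/negbTE sT] := boolP (0 <= s <= T); last first.
  rewrite /trim /= sT; transitivity (0 : R).
    by rewrite -[RHS](int0 P); apply: eq_Rintegral => o _; rewrite mulr0.
  by rewrite -[LHS](int0 P); apply: eq_Rintegral => o _; rewrite mul0r.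
have {}Ds := Ds sT; have {}Ys := Ys sT.
transitivity (\int[P]_o (D s o * N s o)).
  have z := mN s (D s) sT (aD s sT) Ds.
  apply/eqP; rewrite -subr_eq0; apply/eqP; rewrite -[RHS]z.
  transitivity (\int[P]_o (D s o * N T o - D s o * N s o)); last first.
    by apply: eq_Rintegral => o _; ring.
  rewrite intB; [|exact: L2M Ds (LN T TT)|exact: L2M Ds (LN s sT)].
  congr (_ - _); apply: eq_Rintegral => o _.
  by rewrite /trim /= sT mulrC.
have Bs := tint_L2 T0 LD' sT.
apply: int_ae_eq.
- exact: L1_meas (L2M Ds (LN s sT)).
- have := L1_meas (L2M Ds (L2B (L2B Ys LY0) Bs)); congr measurable_fun.
  by apply/funext => o; rewrite /trim /= sT.
by apply: filterS (YE s sT) => o YEo; rewrite /trim /= sT YEo; ring.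
Qed.

(** The product rule in expectation. Expanding both final values, the products
    of two drifts are integrated by parts, the products of a drift and a
    martingale are given by semimart_drift, and the initial values are
    orthogonal to the martingales. *)
Lemma product_formula X D M Y D' N : semimart X D M -> semimart Y D' N ->
  \int[P]_o (X T o * Y T o) - \int[P]_o (X 0 o * Y 0 o) =
  \int[LP]_q (trim T X q * trim T D' q + trim T D q * trim T Y q) +
  \int[P]_o (M T o * N T o).
Proof.
move=> sX sY.
have [aX [LX LD] aD [LM mM] XE] := sX; have [aY [LY LD'] aD' [LN mN] YE] := sY.
have LX0 := semimart_L2 sX T00; have LY0 := semimart_L2 sY T00.
have LXT := semimart_L2 sX TT; have LYT := semimart_L2 sY TT.
have LA := tint_L2 T0 LD TT; have LB := tint_L2 T0 LD' TT.
have LMT := LM T TT; have LNT := LN T TT.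
pose A := tint T D; pose B := tint T D'.
have X0N : \int[P]_o (X 0 o * N T o) = 0.
  rewrite -[RHS](mN 0 (X 0) T00 (aX 0 T00) LX0); apply: int_ae_eq.
  - exact: L1_meas (L2M LX0 LNT).
  - exact: L1_meas (L2M LX0 (L2B LNT (LN 0 T00))).
  - by apply: filterS (semimart_M0 sY) => o ->; rewrite subr0.
have Y0M : \int[P]_o (Y 0 o * M T o) = 0.
  rewrite -[RHS](mM 0 (Y 0) T00 (aY 0 T00) LY0); apply: int_ae_eq.
  - exact: L1_meas (L2M LY0 LMT).
  - exact: L1_meas (L2M LY0 (L2B LMT (LM 0 T00))).
  - by apply: filterS (semimart_M0 sX) => o ->; rewrite subr0.
have LU := L2D LX0 LA; have LV := L2D LY0 LB.
have E : \int[P]_o (X T o * Y T o) =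
    \int[P]_o ((X 0 o + A T o + M T o) * (Y 0 o + B T o + N T o)).
  apply: int_ae_eq; [exact: L1_meas (L2M LXT LYT)| |].
    exact: L1_meas (L2M (L2D LU LMT) (L2D LV LNT)).
  by apply: filterS2 (XE T TT) (YE T TT) => o -> ->.
rewrite E (ipDr LV LNT (L2D LU LMT)) (ipDl LU LMT LV) (ipDl LU LMT LNT).
rewrite (ipDl LX0 LA LV) (ipDl LX0 LA LNT) X0N add0r (ipDr LY0 LB LX0).
rewrite (ipDr LY0 LB LA) (ipDr LY0 LB LMT) (ipC P (M T) (Y 0)) Y0M add0r.
rewrite tint_by_parts// (semimart_drift sX sY) (ipC P (M T)) (semimart_drift sY sX).
have [J1 ->] := tint_dual T0 LD' TT LX0.
have [J2 E2] := tint_dual T0 LD TT LY0; rewrite (ipC P (A T)) E2.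
have PA := tint_PL2 T0 LD; have PB := tint_PL2 T0 LD'.
have PX0 := PL2_cst T0 LX0; have PY0 := PL2_cst T0 LY0.
have I1 := L1D (L2M PA LD') (L2M LD PB).
have I2 := L2M LD (L2B (L2B LY PY0) PB).
have I3 := L2M LD' (L2B (L2B LX PX0) PA).
have -> : \int[LP]_q (trim T X q * trim T D' q + trim T D q * trim T Y q) =
   \int[LP]_q (X 0 q.2 * trim T D' q) + \int[LP]_q (Y 0 q.2 * trim T D q) +
   \int[LP]_q (trim T (tint T D) q * trim T D' q + trim T D q * trim T (tint T D') q) +
   \int[LP]_q (trim T D q * (trim T Y q - trim T (fun=> Y 0) q - trim T (tint T D') q)) +
   \int[LP]_q (trim T D' q * (trim T X q - trim T (fun=> X 0) q - trim T (tint T D) q)).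
  have J12 := L1D J1 J2; have J3 := L1D J12 I1; have J4 := L1D J3 I2.
  rewrite -intD// -intD// -intD// -intD//.
  apply: eq_Rintegral => q _; rewrite /trim; case: ifP => _; ring.
have alg (a1 b1 b2 b3 b4 b5 a2 : R) : a1 + b1 + (b2 + b3) + b5 + (b4 + a2) - a1 =
  b1 + b2 + b3 + b4 + b5 + a2 by ring.
exact: alg.
Qed.

End Product.

(** * Stochastic differentials *)

Section MatrixProcess.
Context (R : realType) (d : measure_display) (Omega : measurableType d)
  (P : probability Omega R) (T : R).
Notation lam := (@lebesgue_measure R).
Notation LP := (lam \x P)%E.

Definition mPL2 p q (X : R -> Omega -> 'M[R]_(p, q)) :=
  forall i j, PL2 P T (fun t o => X t o i j).

Lemma trim_inner p q (X Y : R -> Omega -> 'M[R]_(p, q)) x :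
  trim T (fun t o => inner (X t o) (Y t o)) x =
  \sum_i \sum_j trim T (fun t o => X t o i j) x * trim T (fun t o => Y t o i j) x.
Proof.
rewrite /trim; case: ifP => _; first by rewrite innerE.
by rewrite big1// => i _; rewrite big1// => j _; rewrite mulr0.
Qed.

Lemma inner_L1 p q (X Y : R -> Omega -> 'M[R]_(p, q)) : mPL2 X -> mPL2 Y ->
  L1 LP (trim T (fun t o => inner (X t o) (Y t o))).
Proof.
move=> LX LY; apply: (L1_eq (fun x => esym (trim_inner X Y x))).
apply: L1_sum => i _; apply: L1_sum => j _; exact: L2M (LX i j) (LY i j).
Qed.

Lemma int_inner p q (X Y : R -> Omega -> 'M[R]_(p, q)) : mPL2 X -> mPL2 Y ->
  \int[LP]_x trim T (fun t o => inner (X t o) (Y t o)) x =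
  \sum_i \sum_j \int[LP]_x
    (trim T (fun t o => X t o i j) x * trim T (fun t o => Y t o i j) x).
Proof.
move=> LX LY; rewrite (eq_Rintegral _ (fun x _ => trim_inner X Y x)).
rewrite int_sum => [|i _]; last first.
  by apply: L1_sum => j _; exact: L2M (LX i j) (LY i j).
by apply: eq_bigr => i _; rewrite int_sum// => j _; exact: L2M (LX i j) (LY i j).
Qed.

End MatrixProcess.

Section ItoProduct.
Context (R : realType) (d : measure_display) (Omega : measurableType d)
  (P : probability Omega R) (T : R) (F : R -> set (set Omega)) (r rt : nat)
  (w : R -> Omega -> 'cV[R]_r) (wt : R -> Omega -> 'cV[R]_rt).
Hypothesis T0 : 0 < T.
Hypothesis cF : complete_filtration P T F.
Hypothesis bW : brownian P T F (fun t o => col_mx (w t o) (wt t o)).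
Notation lam := (@lebesgue_measure R).
Notation LP := (lam \x P)%E.

Let T00 : 0 <= T. Proof. exact: ltW. Qed.

Let wW t o j : w t o j 0 = (col_mx (w t o) (wt t o)) (lshift rt j) 0.
Proof. by rewrite col_mxEu. Qed.

Let wtW t o j : wt t o j 0 = (col_mx (w t o) (wt t o)) (rshift r j) 0.
Proof. by rewrite col_mxEd. Qed.

Section Semimartingale.
Context (p : nat) (X D : R -> Omega -> 'cV[R]_p) (Z : R -> Omega -> 'M[R]_(p, r))
  (Zt : R -> Omega -> 'M[R]_(p, rt)).

Definition L2_differential :=
  [/\ has_differential P T F w wt X D Z Zt, mPL2 P T X, mPL2 P T D,
      mPL2 P T Z /\ mPL2 P T Zt &
      forall t i, 0 <= t <= T -> gmeas (F t) (fun o => D t o i 0)].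

Hypothesis dX : L2_differential.

Lemma differential_semimart : exists I It,
  [/\ ito_integral P T F w Z I, ito_integral P T F wt Zt It,
    {ae P, forall o, forall t, 0 <= t <= T ->
       X t o = X 0 o + time_integral (D^~ o) t + I t o + It t o} &
    forall i, semimart P T F (fun t o => X t o i 0) (fun t o => D t o i 0)
      (fun t o => I t o i 0 + It t o i 0)].
Proof.
have [[aX [I [It [II IIt XE]]]] LX LD [LZ LZt] aD] := dX.
exists I, It; split=> // i; split.
- by move=> t tT; apply: meas_wrt_coord; exact: aX.
- by split; [exact: LX|exact: LD].
- by move=> t tT; exact: aD.
- split=> [t tT|t xi tT mxi Lxi].
    apply: L2D; first exact: (ito_L2 cF bW wW LZ II).
    exact: (ito_L2 cF bW wtW LZt IIt).
  have /andP[t0 tT'] := tT.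
  have E1 := ito_mart cF bW wW LZ II i t0 tT' (lexx T) mxi Lxi.
  have E2 := ito_mart cF bW wtW LZt IIt i t0 tT' (lexx T) mxi Lxi.
  have TT : 0 <= T <= T by rewrite T00 lexx.
  have LI s sT := ito_L2 cF bW wW LZ II i (t := s) sT.
  have LIt s sT := ito_L2 cF bW wtW LZt IIt i (t := s) sT.
  rewrite -[RHS]addr0 -{1}E1 -E2 -intD.
  + by apply: eq_Rintegral => o _; ring.
  + exact: L2M Lxi (L2B (LI T TT) (LI t tT)).
  + exact: L2M Lxi (L2B (LIt T TT) (LIt t tT)).
- move=> t tT; apply: filterS XE => o /(_ t tT) ->.
  rewrite !mxE tintE ?addrA//; by case/andP: tT.
Qed.

Lemma differential_L2 t i : 0 <= t <= T -> L2 P (fun o => X t o i 0).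
Proof.
have [I [It [_ _ _ s]]] := differential_semimart.
exact: (semimart_L2 T0 cF (s i)).
Qed.

End Semimartingale.

(** The components of w and wt are distinct components of one Brownian motion,
    so that only the diagonal terms of ito_isometry survive. *)
Lemma ito_pair_isometry p (Z Z' : R -> Omega -> 'M[R]_(p, r))
    (Zt Zt' : R -> Omega -> 'M[R]_(p, rt)) (I I' It It' : R -> Omega -> 'cV[R]_p) t i :
  mPL2 P T Z -> mPL2 P T Z' -> mPL2 P T Zt -> mPL2 P T Zt' ->
  ito_integral P T F w Z I -> ito_integral P T F wt Zt It ->
  ito_integral P T F w Z' I' -> ito_integral P T F wt Zt' It' -> 0 <= t <= T ->
  \int[P]_o ((I t o i 0 + It t o i 0) * (I' t o i 0 + It' t o i 0)) =
  \sum_j \int[LP]_q (trim t (fun s o => Z s o i j) q * trim t (fun s o => Z' s o i j) q) +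
  \sum_j \int[LP]_q (trim t (fun s o => Zt s o i j) q * trim t (fun s o => Zt' s o i j) q).
Proof.
move=> LZ LZ' LZt LZt' II IIt II' IIt' tT.
have L1_ := ito_L2 cF bW wW LZ II i tT; have L2_ := ito_L2 cF bW wtW LZt IIt i tT.
have L3_ := ito_L2 cF bW wW LZ' II' i tT; have L4_ := ito_L2 cF bW wtW LZt' IIt' i tT.
rewrite (ipDl L1_ L2_ (L2D L3_ L4_)) (ipDr L3_ L4_ L1_) (ipDr L3_ L4_ L2_).
rewrite (ito_isometry cF bW i i wW wW LZ LZ' II II' tT).
rewrite (ito_isometry cF bW i i wW wtW LZ LZt' II IIt' tT).
rewrite (ito_isometry cF bW i i wtW wW LZt LZ' IIt II' tT).
rewrite (ito_isometry cF bW i i wtW wtW LZt LZt' IIt IIt' tT).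
have diag n (g : 'I_n -> 'I_n -> R) (h : 'I_n -> 'I_(r + rt)) : injective h ->
    \sum_j \sum_j' (h j == h j')%:R * g j j' = \sum_j g j j.
  move=> inj; apply: eq_bigr => j _; rewrite (bigD1 j)//= eqxx mul1r big1 ?addr0//.
  by move=> j' j'j; rewrite (inj_eq inj) eq_sym (negbTE j'j) mul0r.
rewrite (diag _ _ (lshift rt))//; last exact: lshift_inj.
rewrite (diag _ _ (@rshift r rt))//; last exact: rshift_inj.
have z1 : forall g : 'I_r -> 'I_rt -> R,
    \sum_j \sum_j' (lshift rt j == rshift r j')%:R * g j j' = 0.
  by move=> g; rewrite big1// => j _; rewrite big1// => j' _; rewrite eq_lrshift mul0r.
have z2 : forall g : 'I_rt -> 'I_r -> R,
    \sum_j \sum_j' (rshift r j == lshift rt j')%:R * g j j' = 0.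
  by move=> g; rewrite big1// => j _; rewrite big1// => j' _; rewrite eq_rlshift mul0r.
by rewrite z1 z2 addr0 add0r.
Qed.

(** The product formula, summed over the coordinates; the isometry evaluates the
    product of the martingale parts. *)
Lemma ito_product p (X D X' D' : R -> Omega -> 'cV[R]_p)
    (Z Z' : R -> Omega -> 'M[R]_(p, r)) (Zt Zt' : R -> Omega -> 'M[R]_(p, rt)) :
  L2_differential X D Z Zt -> L2_differential X' D' Z' Zt' ->
  L1 LP (trim T (fun t o => inner (X t o) (D' t o) + inner (D t o) (X' t o) +
      inner (Z t o) (Z' t o) + inner (Zt t o) (Zt' t o))) /\
  \int[P]_o inner (X T o) (X' T o) - \int[P]_o inner (X 0 o) (X' 0 o) =
  \int[LP]_q trim T (fun t o => inner (X t o) (D' t o) + inner (D t o) (X' t o) +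
      inner (Z t o) (Z' t o) + inner (Zt t o) (Zt' t o)) q.
Proof.
move=> dX dX'.
have [_ LX LD [LZ LZt] _] := dX; have [_ LX' LD' [LZ' LZt'] _] := dX'.
have [I [It [II IIt _ sX]]] := differential_semimart dX.
have [I' [It' [II' IIt' _ sX']]] := differential_semimart dX'.
have TT : 0 <= T <= T by rewrite T00 lexx.
have Z0 : 0 <= (0 : R) <= T by rewrite T00 lexx.
have J1 := inner_L1 LX LD'; have J2 := inner_L1 LD LX'.
have J3 := inner_L1 LZ LZ'; have J4 := inner_L1 LZt LZt'.
have J12 := L1D J1 J2; have J123 := L1D J12 J3; have J := L1D J123 J4.
have E q : trim T (fun t o => inner (X t o) (D' t o) + inner (D t o) (X' t o) +
      inner (Z t o) (Z' t o) + inner (Zt t o) (Zt' t o)) q =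
   trim T (fun t o => inner (X t o) (D' t o)) q + trim T (fun t o => inner (D t o) (X' t o)) q +
   trim T (fun t o => inner (Z t o) (Z' t o)) q + trim T (fun t o => inner (Zt t o) (Zt' t o)) q.
  by rewrite !trimD.
split; first by apply: (L1_eq (fun q => esym (E q))).
rewrite (eq_Rintegral _ (fun q _ => E q)) intD// intD// intD//.
rewrite !int_inner//.
have split_ t : 0 <= t <= T -> \int[P]_o inner (X t o) (X' t o) =
    \sum_i \int[P]_o (X t o i 0 * X' t o i 0).
  move=> tT; rewrite -int_sum => [|i _]; last first.
    exact: L2M (differential_L2 dX i tT) (differential_L2 dX' i tT).
  by apply: eq_Rintegral => o _; rewrite inner_col.
rewrite !split_// -sumrB -!big_split /=; apply: eq_bigr => i _.
rewrite (product_formula T0 cF (sX i) (sX' i)).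
rewrite (ito_pair_isometry i LZ LZ' LZt LZt' II IIt II' IIt' TT).
rewrite !big_ord1 intD; last 2 first.
- exact: L2M (LX i 0) (LD' i 0).
- exact: L2M (LD i 0) (LX' i 0).
by rewrite addrA.
Qed.

End ItoProduct.

(** * Closure properties of adapted square-integrable processes *)

Lemma ae_timeS (R : realType) (A B : measurableTypeR R -> Prop) :
  (forall t, A t -> B t) ->
  {ae (@lebesgue_measure R), forall t, A t} ->
  {ae (@lebesgue_measure R), forall t, B t}.
Proof. by move=> AB; apply: filterS. Qed.

Lemma L1_le_ae (R : realType) (d : measure_display) (X : measurableType d)
    (mu : {measure set X -> \bar R}) (f g : X -> R) :
  measurable_fun setT f -> L1 mu g -> {ae mu, forall x, `|f x| <= g x} -> L1 mu f.
Proof.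
move=> mf Ig fg; have mg := L1_meas Ig.
pose h x := if `|f x| <= g x then f x else 0.
have mh : measurable_fun setT h.
  apply: measurable_fun_ifT => //; apply: measurable_fun_ler => //.
  exact: measurableT_comp.
apply: (L1_ae_eq mf (f := h)).
  by apply: filterS fg => x; rewrite /h => ->.
apply: (L1_le mh _ (integrable_norm Ig)) => x; rewrite /h.
case: ifP => [fx|_]; last by rewrite normr0 normr_ge0.
by rewrite /= (le_trans fx) ?ler_norm.
Qed.

Section Nice.
Context (R : realType) (d : measure_display) (Omega : measurableType d)
  (P : probability Omega R) (T : R) (F : R -> set (set Omega)).
Hypothesis T0 : 0 < T.
Hypothesis sF : forall t, 0 <= t <= T -> sigma_algebra setT (F t).
Notation lam := (@lebesgue_measure R).
Notation LP := (lam \x P)%E.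

Definition adaptedL2s (x : R -> Omega -> R) :=
  PL2 P T x /\ forall t, 0 <= t <= T -> gmeas (F t) (x t).

Definition bounded_coef (a : R -> R) :=
  measurable_fun setT (fun t : measurableTypeR R => if 0 <= t <= T then a t else 0) /\
  exists C, forall t, 0 <= t <= T -> `|a t| <= C.

Lemma Linf_bounded p q (A : R -> 'M[R]_(p, q)) i j : Linf T A -> bounded_coef (fun t => A t i j).
Proof.
move=> [mA [C AC]]; split; last first.
  by exists C => t tT; rewrite (le_trans _ (AC t tT))// abs_le_enorm.
move=> _ B mB; rewrite setTI.
have mBA := mA _ (borel_preimage (@coord_continuous R p q i j) (borel_real mB)).
have mI : measurable (`[0, T]%classic : set (measurableTypeR R)) by exact: measurable_itv.
pose S := `[0, T]%classic `&` A @^-1` ((fun M : 'M[R]_(p, q) => M i j) @^-1` B).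
have [B0|nB0] := pselect (B 0).
  rewrite (_ : _ @^-1` B = S `|` (~` `[0, T]%classic)).
    by apply: measurableU => //; exact: measurableC.
  apply/seteqP; split=> t; rewrite /S /= in_itv /=; case: ifP => tT.
  - by left.
  - by right.
  - by case=> [[]|].
  - by [].
rewrite (_ : _ @^-1` B = S)//.
by apply/seteqP; split=> t; rewrite /S /= in_itv /=; case: ifP => tT // [].
Qed.

Lemma gmeas_cst (G : set (set Omega)) (c : R) : sigma_algebra setT G ->
  gmeas G (fun=> c).
Proof. by move=> sG; apply/(gmeasP sG). Qed.

Lemma adaptedL2sD x y : adaptedL2s x -> adaptedL2s y -> adaptedL2s (fun t o => x t o + y t o).
Proof.
move=> [Lx ax] [Ly ay]; split.
  by apply: (L2_eq (fun q => esym (trimD T x y q))); exact: L2D.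
move=> t tT; apply/(gmeasP (sF tT)); apply: measurable_funD.
  by apply/(gmeasP (sF tT)); exact: ax.
by apply/(gmeasP (sF tT)); exact: ay.
Qed.

Lemma adaptedL2sN x : adaptedL2s x -> adaptedL2s (fun t o => - x t o).
Proof.
move=> [Lx ax]; split.
  by apply: (L2_eq (fun q => esym (trimN T x q))); exact: L2N.
move=> t tT; apply/(gmeasP (sF tT)); apply: measurableT_comp => //.
by apply/(gmeasP (sF tT)); exact: ax.
Qed.

Lemma adaptedL2s_0 : adaptedL2s (fun _ _ => 0).
Proof.
split; first by apply: L2_eq (L2_0 LP) => q; rewrite trim0.
by move=> t tT; apply: gmeas_cst; exact: sF.
Qed.

Lemma adaptedL2s_sum n (x : 'I_n -> R -> Omega -> R) : (forall i, adaptedL2s (x i)) ->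
  adaptedL2s (fun t o => \sum_i x i t o).
Proof.
move=> nx; split.
  apply: (L2_eq (fun q => esym (trim_sum T x q))); apply: L2_sum => i _.
  by case: (nx i).
move=> t tT; apply/(gmeasP (sF tT)); apply: measurable_sum => i.
by apply/(gmeasP (sF tT)); case: (nx i) => _; exact.
Qed.

Lemma PL2_bounded a x : bounded_coef a -> PL2 P T x -> PL2 P T (fun t o => a t * x t o).
Proof.
move=> [ma [C aC]] Lx.
pose a' (q : measurableTypeR R * Omega) := if 0 <= q.1 <= T then a q.1 else 0.
have : L2 LP (fun q => a' q * trim T x q).
  apply: (@L2_bM _ _ _ _ a' _ (Num.max C 0) _ _ Lx).
    exact: (measurableT_comp ma measurable_fst).
  move=> q; rewrite /a'; case: ifP => qT; rewrite le_max ?normr0 ?lexx ?orbT//.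
  by rewrite aC.
by apply: L2_eq => q; rewrite /a' /trim; case: ifP => _; rewrite ?mulr0.
Qed.

Lemma adaptedL2s_bounded a x : bounded_coef a -> adaptedL2s x -> adaptedL2s (fun t o => a t * x t o).
Proof.
move=> ba [Lx ax]; split; first exact: PL2_bounded.
move=> t tT; apply/(gmeasP (sF tT)); apply: measurable_funM => //.
by apply/(gmeasP (sF tT)); exact: ax.
Qed.

Lemma adaptedL2s_cst (c : R) : adaptedL2s (fun _ _ => c).
Proof.
split; first exact (PL2_cst T0 (L2_cst P c)).
by move=> t tT; apply: gmeas_cst; exact: sF.
Qed.

Lemma adaptedL2s_det a : bounded_coef a -> adaptedL2s (fun t _ => a t).
Proof.
move=> ba; have := adaptedL2s_bounded ba (adaptedL2s_cst 1).
by congr adaptedL2s; apply/funext => t; apply/funext => o; rewrite mulr1.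
Qed.

Lemma int_sq_le f : L2 P f -> (\int[P]_o f o) ^+ 2 <= \int[P]_o (f o ^+ 2).
Proof.
move=> Lf; have := CauchySchwarz (L2_cst P 1) Lf.
have -> : \int[P]_o (1 * f o) = \int[P]_o f o.
  by apply: eq_Rintegral => o _; rewrite mul1r.
have -> : \int[P]_o ((1 : R) ^+ 2) = 1 by rewrite int_cst expr1n.
by rewrite mul1r.
Qed.

Lemma PL2_mean x : PL2 P T x -> PL2 P T (fun t _ => \int[P]_o x t o).
Proof.
move=> Lx; pose e (t : measurableTypeR R) := \int[P]_o trim T x (t, o).
have me : measurable_fun setT e by apply: fub_meas1; exact: L2_meas Lx.
have Le : L2 lam e.
  apply: sq_L2 => //; have [Ig _] := fub1 (L2_sq Lx).
  suff H : {ae lam, forall t, `|e t ^+ 2| <= \int[P]_o (trim T x (t, o) ^+ 2)}.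
    by apply: (L1_le_ae _ Ig H); exact: measurable_funX.
  apply: ae_timeS (PL2_slice Lx) => t Lt; rewrite ger0_norm ?sqr_ge0//.
  have [tT|/negbTE tT] := boolP (0 <= t <= T).
    by rewrite /e /trim /= tT; exact: int_sq_le (Lt tT).
  rewrite /e /trim /= tT; have -> : \int[P]_o (0 : R) = 0 by exact: int0.
  by rewrite expr0n; apply: Rintegral_ge0.
apply: (@L2_eq _ _ _ _ (fun q => e q.1)).
  move=> q; rewrite /e /trim /=; case: ifP => //.
  by move=> _; exact: int0.
apply: sq_L2; first exact: (measurableT_comp me measurable_fst).
have [I _] := fub_prod (L2_sq Le) (L2_L1 (L2_cst P 1)).
by apply: L1_eq I => q; rewrite mulr1.
Qed.

Lemma adaptedL2s_mean x : adaptedL2s x -> adaptedL2s (fun t _ => \int[P]_o x t o).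
Proof.
move=> [Lx _]; split; first exact: PL2_mean.
by move=> t tT; apply: gmeas_cst; exact: sF.
Qed.

Definition adaptedL2 p q (X : R -> Omega -> 'M[R]_(p, q)) :=
  forall i j, adaptedL2s (fun t o => X t o i j).

Lemma adaptedL2_mPL2 p q (X : R -> Omega -> 'M[R]_(p, q)) : adaptedL2 X -> mPL2 P T X.
Proof. by move=> nX i j; case: (nX i j). Qed.

Lemma eq_adaptedL2s x y : (forall t o, x t o = y t o) -> adaptedL2s x -> adaptedL2s y.
Proof. by move=> xy; congr adaptedL2s; apply/funext => t; apply/funext. Qed.

Lemma L2F_adaptedL2 p q (X : R -> Omega -> 'M[R]_(p, q)) : L2F P T F X -> adaptedL2 X.
Proof.
move=> LX i j; split; first exact: L2F_PL2 LX.
by move=> t tT; apply: meas_wrt_coord; case: LX => aX _ _; exact: aX.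
Qed.

Lemma adaptedL2D p q (X Y : R -> Omega -> 'M[R]_(p, q)) : adaptedL2 X -> adaptedL2 Y ->
  adaptedL2 (fun t o => X t o + Y t o).
Proof.
move=> nX nY i j; apply: eq_adaptedL2s (adaptedL2sD (nX i j) (nY i j)) => t o.
by rewrite mxE.
Qed.

Lemma adaptedL2N p q (X : R -> Omega -> 'M[R]_(p, q)) : adaptedL2 X ->
  adaptedL2 (fun t o => - X t o).
Proof.
by move=> nX i j; apply: eq_adaptedL2s (adaptedL2sN (nX i j)) => t o; rewrite mxE.
Qed.

Lemma adaptedL2B p q (X Y : R -> Omega -> 'M[R]_(p, q)) : adaptedL2 X -> adaptedL2 Y ->
  adaptedL2 (fun t o => X t o - Y t o).
Proof. by move=> nX nY; apply: adaptedL2D => //; exact: adaptedL2N. Qed.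

Lemma adaptedL20 p q : adaptedL2 (fun _ _ => 0 : 'M[R]_(p, q)).
Proof. by move=> i j; apply: eq_adaptedL2s adaptedL2s_0 => t o; rewrite mxE. Qed.

Lemma adaptedL2_det p q (A : R -> 'M[R]_(p, q)) : Linf T A -> adaptedL2 (fun t _ => A t).
Proof. by move=> LA i j; apply: adaptedL2s_det; exact: Linf_bounded. Qed.

Lemma adaptedL2_mul p q s (A : R -> 'M[R]_(p, q)) (X : R -> Omega -> 'M[R]_(q, s)) :
  Linf T A -> adaptedL2 X -> adaptedL2 (fun t o => A t *m X t o).
Proof.
move=> LA nX i j.
have := adaptedL2s_sum (fun k => adaptedL2s_bounded (Linf_bounded i k LA) (nX k j)).
by apply: eq_adaptedL2s => t o; rewrite mxE.
Qed.

Lemma adaptedL2_mulT p q s (A : R -> 'M[R]_(q, p)) (X : R -> Omega -> 'M[R]_(q, s)) :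
  Linf T A -> adaptedL2 X -> adaptedL2 (fun t o => (A t)^T *m X t o).
Proof.
move=> LA nX i j.
have := adaptedL2s_sum (fun k => adaptedL2s_bounded (Linf_bounded k i LA) (nX k j)).
by apply: eq_adaptedL2s => t o; rewrite mxE; apply: eq_bigr => k _; rewrite mxE.
Qed.

Lemma meanE p q (X : Omega -> 'M[R]_(p, q)) i j :
  mean P X i j = \int[P]_o X o i j.
Proof. by rewrite mxE unlock. Qed.

Lemma adaptedL2_mean p q (X : R -> Omega -> 'M[R]_(p, q)) : adaptedL2 X ->
  adaptedL2 (fun t _ => mean P (X t)).
Proof.
move=> nX i j; apply: eq_adaptedL2s (adaptedL2s_mean (nX i j)) => t o.
by rewrite meanE.
Qed.

Lemma adaptedL2_gapp m r (ga : 'I_r -> R -> 'M[R]_m) (Z : R -> Omega -> 'M[R]_(m, r)) :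
  (forall j, Linf T (ga j)) -> adaptedL2 Z -> adaptedL2 (fun t o => gapp ga t (Z t o)).
Proof.
move=> Lga nZ i k.
have := adaptedL2s_sum (fun j => adaptedL2s_sum (fun l =>
  adaptedL2s_bounded (Linf_bounded i l (Lga j)) (nZ l j))).
apply: eq_adaptedL2s => t o; rewrite /gapp summxE; apply: eq_bigr => j _.
by rewrite mxE; apply: eq_bigr => l _; rewrite mxE.
Qed.

Lemma adaptedL2_gappT m r (ga : 'I_r -> R -> 'M[R]_m) (X : R -> Omega -> 'cV[R]_m) :
  (forall j, Linf T (ga j)) -> adaptedL2 X -> adaptedL2 (fun t o => gappT ga t (X t o)).
Proof.
move=> Lga nX i j; have := adaptedL2_mulT (Lga j) nX i 0.
by apply: eq_adaptedL2s => t o; rewrite [RHS]mxE.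
Qed.

End Nice.

(** * Gronwall's lemma and the regularity of controls *)

Lemma ae_time_and (R : realType) (A B : measurableTypeR R -> Prop) :
  {ae (@lebesgue_measure R), forall t, A t} ->
  {ae (@lebesgue_measure R), forall t, B t} ->
  {ae (@lebesgue_measure R), forall t, A t /\ B t}.
Proof. by move=> aA aB; apply: filterS2 aA aB => t. Qed.

Lemma half_cvg (R : realType) (K : R) : (fun j => K / 2 ^+ j) @ \oo --> (0 : R).
Proof.
rewrite -[X in _ --> X](mulr0 K); apply: cvgMr.
have -> : (fun j => (2 ^+ j)^-1) = (fun j => 2^-1 ^+ j) :> (nat -> R).
  by apply/funext => j; rewrite exprVn.
by apply: cvg_expr; rewrite ger0_norm ?invr_ge0//; lra.
Qed.

(** Gronwall: on each time step of length 1 / (2 C), a bound on the solution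
    improves by a factor 2 once the solution vanishes on the earlier steps. *)
Lemma gronwall0 (R : realType) (t C : R) (Theta Phi : R -> R) : 0 < C ->
  L1 (@lebesgue_measure R) (Phi : measurableTypeR R -> R) -> (forall r, 0 <= Phi r) ->
  (forall s, 0 <= s <= t ->
     0 <= Theta s <= \int[@lebesgue_measure R]_r (ind0 s r * Phi r)) ->
  {ae (@lebesgue_measure R), forall r, 0 <= r <= t -> Phi r <= C * Theta r} ->
  forall s, 0 <= s <= t -> Theta s = 0.
Proof.
move=> C0 IP P0 TP PT; pose lam := @lebesgue_measure R.
have mP := L1_meas IP; pose K := \int[lam]_r Phi r; pose del := (2 * C)^-1.
have K00 : 0 <= K by apply: Rintegral_ge0.
have IiP s : L1 lam (fun r => ind0 s r * Phi r).
  apply: (L1_le _ _ IP) => [|r]; first by apply: measurable_funM => //; exact: ind0_meas.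
  by rewrite normrM (ger0_norm (P0 r)) ler_piMl// ind0_bound.
(* Up to time N * del the a priori bound K may be halved any number of times. *)
have step N j s : 0 <= s <= t -> s <= N%:R * del -> Theta s <= K / 2 ^+ j.
  elim: N j s => [|N IHN] j s st sN.
    have s0 : s = 0 by move: sN; rewrite mul0r; lra.
    have /andP[_] := TP s st; move/le_trans; apply.
    rewrite (_ : \int[_]_r _ = 0).
      by rewrite divr_ge0 ?exprn_ge0.
    rewrite -[RHS](@int0 _ _ _ lam); apply: int_ae_eq => //; first exact: L1_meas (IiP s).
    exists [set 0 : R]; split=> //; first exact: lebesgue_measure_set1.
    move=> r /=; apply: contra_notP => r0; rewrite s0 /ind0.
    case: (boolP (0 <= r <= 0)) => [|_]; last by rewrite mul0r.
    by rewrite -eq_le eq_sym => /eqP /r0.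
  have vanish r : 0 <= r <= t -> r <= N%:R * del -> Theta r <= 0.
    move=> rt rN; have H j' := IHN j' r rt rN.
    have lim := half_cvg K.
    by apply: (ler_cvg_to (cvg_cst (Theta r)) lim); exact: nearW.
  elim: j s st sN => [|j IHj] s st sN.
    have /andP[_] := TP s st; move/le_trans; apply; rewrite divr1.
    apply: int_le => // r; rewrite -[leRHS]mul1r ler_wpM2r//.
    by rewrite (le_trans (ler_norm _)) ?ind0_bound.
  have /andP[_] := TP s st; move/le_trans; apply.
  have [Ii Ei] := ind_int (N%:R * del) (N.+1%:R * del).
  apply: (@le_trans _ _ (\int[lam]_r (C * (K / 2 ^+ j) * ind (N%:R * del) (N.+1%:R * del) r))).
    apply: int_ae_le; [exact: IiP|exact: L1Z|].
    apply: ae_timeS PT => r Pr; rewrite /ind0.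
    have K0 : 0 <= C * (K / 2 ^+ j).
      by rewrite mulr_ge0 ?divr_ge0 ?exprn_ge0// ltW.
    case: (boolP (0 <= r <= s)) => [/andP[r0 rs]|_]; last first.
      by rewrite mul0r mulr_ge0// ler0n.
    rewrite mul1r; have rt : 0 <= r <= t by lra.
    have {}Pr := Pr rt; rewrite (le_trans Pr)//.
    rewrite -mulrA ler_wpM2l ?(ltW C0)//.
    rewrite /ind; have [rN|Nr] := leP r (N%:R * del); first by rewrite /= mulr0 vanish.
    by rewrite (le_trans rs sN) /= mulr1 IHj// (le_trans rs).
  rewrite intZ// Ei max_r; last by rewrite subr_ge0 ler_wpM2r ?ler_nat ?invr_ge0 ?mulr_ge0 ?ltW.
  rewrite -mulrBl -natrB// subSnn mul1r /del exprS le_eqVlt; apply/orP; left; apply/eqP.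
  by field; rewrite gt_eqF ?exprn_gt0//= gt_eqF.
move=> s st; have /andP[T0 _] := TP s st.
have del0 : 0 < del by rewrite invr_gt0 mulr_gt0.
have [N sN] : exists N : nat, s <= N%:R * del.
  exists (Num.trunc (s / del)).+1; rewrite -ler_pdivrMr//; exact/ltW/truncnS_gt.
apply/eqP; rewrite eq_le T0 andbT.
have lim := half_cvg K.
by apply: (ler_cvg_to (cvg_cst (Theta s)) lim); apply: nearW => j; exact: step st sN.
Qed.

Section Observation.
Context (R : realType) (d : measure_display) (Omega : measurableType d)
  (P : probability Omega R) (T : R).
Hypothesis T0 : 0 < T.
Notation lam := (@lebesgue_measure R).
Notation LP := (lam \x P)%E.

(** A supremum over the time interval dominates the time average. *)
Lemma sup_PL2 p q (X : R -> Omega -> 'M[R]_(p, q)) : joint_meas T X ->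
  (\int[P]_o ereal_sup [set (sqn (X t o))%:E | t in `[0%R, T]] < +oo)%E ->
  mPL2 P T X.
Proof.
move=> jX sX; suff : (sqint P T X < +oo)%E by move=> H i j; exact: sqint_PL2.
have mX i' j' := joint_cut (@coord_continuous R p q i' j') jX.
have [sE mS] := sqintE P mX.
pose G o := (\int[lam]_(t in `[0%R, T]) (sqn (X t o))%:E)%E.
pose Sup o := ereal_sup [set (sqn (X t o))%:E | t in `[0%R, T]].
have mT : measurable (`[0, T]%classic : set (measurableTypeR R)) by exact: measurable_itv.
have GE o : G o = (\int[lam]_t (trim T (fun t o => sqn (X t o)) (t, o))%:E)%E.
  rewrite /G integral_mkcond; apply: eq_integral => t _; rewrite patchE /trim /=.
  have -> : (t \in `[0, T]%classic) = (0 <= t <= T).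
    by apply/idP/idP; rewrite inE /= in_itv.
  by case: ifP.
have pos q' : (0 <= (trim T (fun t o => sqn (X t o)) q')%:E)%E.
  by rewrite lee_fin /trim; case: ifP => // _; exact: sqn_ge0.
have mG : measurable_fun setT G.
  rewrite (funext GE); apply: (@measurable_fun_fubini_tonelli_G _ _ _ _ _ lam
     (fun q' => (trim T (fun t o => sqn (X t o)) q')%:E)) => //.
  exact/measurable_EFinP.
have G0 o : (0 <= G o)%E.
  by apply: integral_ge0 => t _; rewrite lee_fin sqn_ge0.
have S0 o : (0 <= Sup o)%E.
  apply: (@le_trans _ _ (sqn (X 0 o))%:E); first by rewrite lee_fin sqn_ge0.
  by apply: ereal_sup_ubound; exists 0 => //=; rewrite in_itv /= lexx ltW.
have GS o : (T^-1%:E * G o <= Sup o)%E.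
  have le : (G o <= T%:E * Sup o)%E.
    apply: (@le_trans _ _ (\int[lam]_(t in `[0%R, T]) (cst (Sup o) t))%E).
      apply: ge0_le_integral => //.
      - by move=> t _; rewrite lee_fin sqn_ge0.
      - apply/measurable_EFinP.
        have := slice_meas2 o mS; move=> /(measurable_funS measurableT (@subsetT _ `[0, T]%classic)).
        apply: eq_measurable_fun => t; rewrite inE /= in_itv /= => tT.
        by rewrite /trim /= tT.
      - by move=> t tT; apply: ereal_sup_ubound; exists t.
    rewrite integral_cst//.
    by rewrite [X in (_ * X <= _)%E](@lebesgue_measure_itv R `[0, T]) /= lte_fin T0 sube0 muleC.
  apply: (@le_trans _ _ (T^-1%:E * (T%:E * Sup o))%E).
    by apply: lee_wpmul2l => //; rewrite lee_fin invr_ge0 ltW.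
  by rewrite muleA -EFinM mulVf ?gt_eqF// mul1e.
have H : (\int[P]_o (T^-1%:E * G o) < +oo)%E.
  apply: le_lt_trans sX.
  have TG0 o : (0 <= T^-1%:E * G o)%E by apply: mule_ge0 => //; rewrite lee_fin invr_ge0 ltW.
  rewrite !ge0_integralTE//; apply: ereal_sup_le => _ [h hG <-].
  by exists h => // o; exact: le_trans (hG o) (GS o).
move: H; rewrite ge0_integralZl//; last by rewrite lee_fin invr_ge0 ltW.
rewrite -[X in (_ * X)%E]/(sqint P T X).
case: (sqint P T X) => [c _| |_]; [exact: ltry| |by []].
by rewrite gt0_muley ?lte_fin ?invr_gt0.
Qed.

Lemma borel_graph_meas n p (S : measurableType d) (s : S -> R)
  (u : S -> 'cV[R]_n) (g : R -> 'cV[R]_n -> 'cV[R]_p) (B : set 'cV[R]_p) :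
  (forall B, borel B ->
     borel [set q : (R * 'cV[R]_n)%type | 0 <= q.1 <= T /\ B (g q.1 q.2)]) ->
  measurable_fun setT s -> (forall i, measurable_fun setT (fun x => u x i 0)) ->
  borel B -> measurable [set x | 0 <= s x <= T /\ B (g (s x) (u x))].
Proof.
move=> hg ms mu bB.
apply: (@dist_meas_borel R _ _ S (fun x => (s x, u x)) _ _ _ (hg B bB)).
  apply: dense_prod; last exact: dense_mx.
  by have [e [? _]] := dense_real R; exists e.
apply: dist_meas_prod; first exact: dist_meas_real.
by apply: dist_meas_mx => i j; rewrite (ord1 j).
Qed.

End Observation.

(** * Processes driven by the same noise *)

Section SameNoise.
Context (R : realType) (d : measure_display) (Omega : measurableType d)
  (P : probability Omega R) (T : R) (F : R -> set (set Omega)) (r rt : nat)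
  (w : R -> Omega -> 'cV[R]_r) (wt : R -> Omega -> 'cV[R]_rt).
Hypothesis T0 : 0 < T.
Hypothesis cF : complete_filtration P T F.
Hypothesis bW : brownian P T F (fun t o => col_mx (w t o) (wt t o)).
Notation lam := (@lebesgue_measure R).
Notation LP := (lam \x P)%E.

Let wW t o j : w t o j 0 = (col_mx (w t o) (wt t o)) (lshift rt j) 0.
Proof. by rewrite col_mxEu. Qed.

Let wtW t o j : wt t o j 0 = (col_mx (w t o) (wt t o)) (rshift r j) 0.
Proof. by rewrite col_mxEd. Qed.

Section Pair.
Context (p : nat) (Z : R -> Omega -> 'M[R]_(p, r)) (Zt : R -> Omega -> 'M[R]_(p, rt)).
Hypotheses (LZ : mPL2 P T Z) (LZt : mPL2 P T Zt).

Lemma differential_at (X D : R -> Omega -> 'cV[R]_p) :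
  has_differential P T F w wt X D Z Zt -> exists I It,
  [/\ ito_integral P T F w Z I, ito_integral P T F wt Zt It &
    forall t i, 0 <= t <= T -> L2 P (fun o => I t o i 0 + It t o i 0) /\
      {ae P, forall o, X t o i 0 = X 0 o i 0 + tint T (fun t o => D t o i 0) t o +
        (I t o i 0 + It t o i 0)}].
Proof.
move=> [aX [I [It [II IIt XE]]]]; exists I, It; split=> // t i tT; split.
  exact: L2D (ito_L2 cF bW wW LZ II i tT) (ito_L2 cF bW wtW LZt IIt i tT).
apply: filterS XE => o /(_ t tT) ->.
by rewrite !mxE tintE ?addrA//; case/andP: tT.
Qed.

Lemma differential_slice_L2 (X D : R -> Omega -> 'cV[R]_p) t i : 0 <= t <= T ->
  has_differential P T F w wt X D Z Zt -> mPL2 P T D ->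
  L2 P (fun o => X 0 o i 0) -> L2 P (fun o => X t o i 0).
Proof.
move=> tT dX LD X0; have [I [It [_ _ H]]] := differential_at dX.
have [LI XE] := H t i tT; have [aX _] := dX.
have L := L2D (L2D X0 (tint_L2 T0 (LD i 0) tT)) LI.
apply: L2_ae_eq L.
  by apply: (gmeas_meas (filtr_meas cF tT)); apply: meas_wrt_coord; exact: aX.
by apply: filterS XE => o ->.
Qed.

(** By the isometry the two stochastic integrals have the same covariance
    whichever versions are taken, so that they agree almost surely at each
    time and only the drifts and the initial values can differ. *)
Lemma same_noise (X D X' D' : R -> Omega -> 'cV[R]_p) t i : 0 <= t <= T ->
  has_differential P T F w wt X D Z Zt -> has_differential P T F w wt X' D' Z Zt ->
  {ae P, forall o, X t o i 0 - X' t o i 0 = X 0 o i 0 - X' 0 o i 0 +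
    (tint T (fun t o => D t o i 0) t o - tint T (fun t o => D' t o i 0) t o)}.
Proof.
move=> tT dX dX'.
have [I [It [II IIt H]]] := differential_at dX.
have [I' [It' [II' IIt' H']]] := differential_at dX'.
have [LI XE] := H t i tT; have [LI' XE'] := H' t i tT.
have [c iso] : exists c, forall J J' Jt Jt', ito_integral P T F w Z J ->
    ito_integral P T F wt Zt Jt -> ito_integral P T F w Z J' ->
    ito_integral P T F wt Zt Jt' ->
    \int[P]_o ((J t o i 0 + Jt t o i 0) * (J' t o i 0 + Jt' t o i 0)) = c.
  by eexists=> J J' Jt Jt' ? ? ? ?; apply: (ito_pair_isometry cF bW).
have z : {ae P, forall o, (I t o i 0 + It t o i 0) - (I' t o i 0 + It' t o i 0) = 0}.
  apply: int_sq_eq0; first exact: L2B.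
  have E o : ((I t o i 0 + It t o i 0) - (I' t o i 0 + It' t o i 0)) ^+ 2 =
     ((I t o i 0 + It t o i 0) * (I t o i 0 + It t o i 0) -
     2 * ((I t o i 0 + It t o i 0) * (I' t o i 0 + It' t o i 0))) +
     (I' t o i 0 + It' t o i 0) * (I' t o i 0 + It' t o i 0) by ring.
  have J1 := L2M LI LI; have J2 := L1Z 2 (L2M LI LI'); have J3 := L2M LI' LI'.
  rewrite (eq_Rintegral _ (fun o _ => E o)) intD//; last exact: L1B.
  rewrite intB// intZ; last exact: L2M.
  rewrite (iso _ _ _ _ II IIt II IIt) (iso _ _ _ _ II IIt II' IIt').
  by rewrite (iso _ _ _ _ II' IIt' II' IIt'); ring.
apply: filterS (ae_and z (ae_and XE XE')) => o [zo [-> ->]].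
by rewrite -[RHS]addr0 -zo; ring.
Qed.

End Pair.
End SameNoise.

Section Filtration.
Context (R : realType) (d : measure_display) (Omega : measurableType d)
  (P : probability Omega R) (T : R) (F : R -> set (set Omega)) (r rt : nat)
  (w : R -> Omega -> 'cV[R]_r) (wt : R -> Omega -> 'cV[R]_rt).
Hypothesis T0 : 0 < T.
Hypothesis cF : complete_filtration P T F.
Hypothesis bW : brownian P T F (fun t o => col_mx (w t o) (wt t o)).
Notation lam := (@lebesgue_measure R).
Notation LP := (lam \x P)%E.

Lemma tint_dual_time D s xi : PL2 P T D -> 0 <= s <= T -> L2 P xi ->
  L1 lam (fun t : measurableTypeR R => \int[P]_o (xi o * trim T D (t, o))) /\
  \int[P]_o (xi o * tint T D s o) =
  \int[lam]_t (ind0 s t * \int[P]_o (xi o * trim T D (t, o))).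
Proof.
move=> LD sT Lxi; have [_ E] := tint_dual T0 LD sT Lxi.
have TT : 0 <= T <= T by rewrite lexx ltW.
have [JT _] := tint_dual T0 LD TT Lxi; have [Js _] := tint_dual T0 LD sT Lxi.
split; first by have [] := fub1 JT.
rewrite E; have [_ ->] := fub1 Js; apply: eq_Rintegral => t _.
rewrite /ind0 /trim /=; case: (boolP (0 <= t <= s)) => [/andP[-> ts]|_].
  by rewrite (le_trans ts) ?mul1r//; case/andP: sT.
by rewrite mul0r -[RHS](@int0 _ _ _ P); apply: eq_Rintegral => o _; rewrite mulr0.
Qed.

Lemma eqT_mPL2 p q (X Y : R -> Omega -> 'M[R]_(p, q)) :
  (forall t o, 0 <= t <= T -> X t o = Y t o) -> mPL2 P T X -> mPL2 P T Y.
Proof.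
move=> E LX i j; apply: L2_eq (LX i j) => x; rewrite /trim.
by case: (boolP (0 <= x.1 <= T)) => // xT; rewrite E.
Qed.

Lemma sigma_path_sigma (V : topologicalType) (Y : R -> Omega -> V) t :
  sigma_algebra setT (sigma_path Y t).
Proof. exact: smallest_sigma_algebra. Qed.

Lemma sigma_path_meas (V : topologicalType) (Y : R -> Omega -> V) t :
  0 <= t <= T -> adapted T F Y -> sigma_path Y t `<=` measurable.
Proof.
move=> /andP[t0 tT] aY; apply: smallest_sub; first exact: sigma_algebra_measurable.
move=> A [s [/andP[s0 st] [B bB ->]]].
have sT : 0 <= s <= T by rewrite s0 (le_trans st).
by apply: (filtr_meas cF sT); exact: aY.
Qed.

Lemma sigma_path_mono (V : topologicalType) (Y : R -> Omega -> V) s t : s <= t ->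
  sigma_path Y s `<=` sigma_path Y t.
Proof.
move=> st; apply: smallest_sub; first exact: sigma_path_sigma.
move=> A [r' [/andP[r0 rs] H]]; apply: sub_gen_smallest; exists r'.
by rewrite r0 (le_trans rs).
Qed.

End Filtration.

(** * The filtration of the observation *)

Lemma L1_norm (R : realType) (d : measure_display) (X : measurableType d)
  (mu : {measure set X -> \bar R}) (f : X -> R) : L1 mu f -> L1 mu (fun x => `|f x|).
Proof. exact: integrable_norm. Qed.

Section WeakSlice.
Context (R : realType) (d : measure_display) (Omega : measurableType d)
  (P : probability Omega R) (h : Omega -> R).
Hypothesis Lh : L2 P h.
Hypothesis h0 : \int[P]_o h o = 0.

(** Testing against h removes everything but the state: the deterministic terms,
    because h has mean zero, and V by assumption. *)
Lemma weak_affine n p (A : 'M[R]_(p, n)) (X X0 : Omega -> 'cV[R]_n)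
    (c c0 : 'cV[R]_p) (V : Omega -> 'cV[R]_p) i :
  (forall j, L2 P (fun o => X o j 0)) -> (forall j, L2 P (fun o => X0 o j 0)) ->
  L2 P (fun o => V o i 0) -> \int[P]_o (h o * V o i 0) = 0 ->
  \int[P]_o (h o * (A *m X o + c + V o) i 0) -
    \int[P]_o (h o * (A *m X0 o + c0) i 0) =
  \sum_j A i j * \int[P]_o (h o * (X o j 0 - X0 o j 0)).
Proof.
move=> LX LX0 LV V0.
have lin (Y : Omega -> 'cV[R]_n) (e : R) (U : Omega -> R) : (forall j, L2 P (fun o => Y o j 0)) ->
    L2 P U -> \int[P]_o (h o * U o) = 0 ->
    \int[P]_o (h o * (\sum_j A i j * Y o j 0 + e + U o)) =
    \sum_j A i j * \int[P]_o (h o * Y o j 0).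
  move=> LY LU U0.
  have J j := L1Z (A i j) (L2M Lh (LY j)).
  have E o : h o * (\sum_j A i j * Y o j 0 + e + U o) =
      (\sum_j A i j * (h o * Y o j 0) + e * h o) + h o * U o.
    rewrite !mulrDr mulr_sumr [h o * e]mulrC; congr (_ + _ + _).
    by apply: eq_bigr => j _; ring.
  have JS : L1 P (fun o => \sum_j A i j * (h o * Y o j 0)).
    by apply: L1_sum => j _; exact: J.
  have Jh := L1Z e (L2_L1 Lh).
  rewrite (eq_Rintegral _ (fun o _ => E o)) intD; [|exact: L1D JS Jh|exact: L2M].
  rewrite U0 addr0 intD// intZ; last exact: L2_L1.
  rewrite h0 mulr0 addr0 int_sum => [|j _]; last exact: J.
  by apply: eq_bigr => j _; rewrite intZ//; exact: L2M.
have -> : \int[P]_o (h o * (A *m X o + c + V o) i 0) =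
    \sum_j A i j * \int[P]_o (h o * X o j 0).
  rewrite -(lin X (c i 0) (fun o => V o i 0))//.
  by apply: eq_Rintegral => o _; rewrite !mxE.
have -> : \int[P]_o (h o * (A *m X0 o + c0) i 0) =
    \sum_j A i j * \int[P]_o (h o * X0 o j 0).
  rewrite -(lin X0 (c0 i 0) (fun=> 0))//; last 2 first.
  - exact: L2_0.
  - by rewrite -[RHS](@int0 _ _ _ P); apply: eq_Rintegral => o _; rewrite mulr0.
  by apply: eq_Rintegral => o _; rewrite !mxE addr0.
rewrite -sumrB; apply: eq_bigr => j _; rewrite -mulrBr -intB; last 2 first.
- exact: L2M.
- exact: L2M.
by congr (_ * _); apply: eq_Rintegral => o _; rewrite mulrBr.
Qed.

End WeakSlice.

Section Observed.
Context (R : realType) (d : measure_display) (Omega : measurableType d)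
  (P : probability Omega R) (T : R) (F : R -> set (set Omega)) (r rt : nat)
  (w : R -> Omega -> 'cV[R]_r) (wt : R -> Omega -> 'cV[R]_rt).
Hypothesis T0 : 0 < T.
Hypothesis cF : complete_filtration P T F.
Hypothesis bW : brownian P T F (fun t o => col_mx (w t o) (wt t o)).
Notation lam := (@lebesgue_measure R).
Notation LP := (lam \x P)%E.

Lemma L1_ind0 s f : L1 lam f -> L1 lam (fun r : measurableTypeR R => ind0 s r * f r).
Proof.
move=> If; have mf := L1_meas If.
apply: (L1_le (g := fun r => `|f r|)).
- by apply: measurable_funM => //; exact: ind0_meas.
- by move=> x; rewrite normrM ler_piMl// ind0_bound.
- exact: (L1_norm If).
Qed.

(** The two noises cancel by same_noise, and tint_dual_time takes the test by h
    under the time integral of the drifts. *)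
Lemma weak_evolution p (Z : R -> Omega -> 'M[R]_(p, r)) (Zt : R -> Omega -> 'M[R]_(p, rt))
    (X D X' D' : R -> Omega -> 'cV[R]_p) (h : Omega -> R) i :
  mPL2 P T Z -> mPL2 P T Zt -> mPL2 P T D -> mPL2 P T D' ->
  has_differential P T F w wt X D Z Zt -> has_differential P T F w wt X' D' Z Zt ->
  {ae P, forall o, X 0 o = X' 0 o} -> L2 P h ->
  exists2 g : R -> R, L1 lam (g : measurableTypeR R -> R) &
  (forall t, 0 <= t <= T -> g t = \int[P]_o (h o * D t o i 0) - \int[P]_o (h o * D' t o i 0)) /\
  forall t, 0 <= t <= T ->
    \int[P]_o (h o * (X t o i 0 - X' t o i 0)) = \int[lam]_s (ind0 t s * g s).
Proof.
move=> LZ LZt LD LD' dX dX' X0 Lh.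
pose psi (B : R -> Omega -> 'cV[R]_p) (t : R) :=
  \int[P]_o (h o * trim T (fun t o => B t o i 0) (t, o)).
exists (fun t => psi D t - psi D' t).
  have T1 : 0 <= T <= T by rewrite lexx ltW.
  have [J _] := tint_dual_time T0 (LD i 0) T1 Lh.
  have [J' _] := tint_dual_time T0 (LD' i 0) T1 Lh.
  exact: L1B J J'.
split=> t tT; first by rewrite /psi /trim /= tT.
have [J E] := tint_dual_time T0 (LD i 0) tT Lh.
have [J' E'] := tint_dual_time T0 (LD' i 0) tT Lh.
have SN := same_noise cF bW LZ LZt i tT dX dX'.
have L := tint_L2 T0 (LD i 0) tT; have L' := tint_L2 T0 (LD' i 0) tT.
transitivity (\int[P]_o (h o * tint T (fun t o => D t o i 0) t o) -
    \int[P]_o (h o * tint T (fun t o => D' t o i 0) t o)).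
  rewrite -intB; [|exact: L2M|exact: L2M]; apply: int_ae_eq.
  - apply: measurable_funM; first exact: L2_meas Lh.
    have [aX _] := dX; have [aX' _] := dX'.
    apply: measurable_funB; apply: (gmeas_meas (filtr_meas cF tT)); apply: meas_wrt_coord.
    + exact: aX.
    + exact: aX'.
  - exact: L1_meas (L1B (L2M Lh L) (L2M Lh L')).
  - by apply: filterS (ae_and SN X0) => o [-> ->]; rewrite subrr add0r mulrBr.
rewrite E E' -intB; [|exact: L1_ind0 J|exact: L1_ind0 J'].
by apply: eq_Rintegral => s _; rewrite mulrBr.
Qed.

Context (n s : nat) (a : R -> 'M[R]_n) (f : R -> 'M[R]_(s, n))
  (ex ex0 : R -> 'cV[R]_n) (ey ey0 : R -> 'cV[R]_s)
  (x Dx Vx x0 Dx0 : R -> Omega -> 'cV[R]_n) (Y DY VY Y0 DY0 : R -> Omega -> 'cV[R]_s)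
  (Zx : R -> Omega -> 'M[R]_(n, r)) (Ztx : R -> Omega -> 'M[R]_(n, rt))
  (ZY : R -> Omega -> 'M[R]_(s, r)) (ZtY : R -> Omega -> 'M[R]_(s, rt)).
Hypotheses (LZx : mPL2 P T Zx) (LZtx : mPL2 P T Ztx)
  (LZY : mPL2 P T ZY) (LZtY : mPL2 P T ZtY).
Hypotheses (LDx : mPL2 P T Dx) (LDx0 : mPL2 P T Dx0)
  (LDY : mPL2 P T DY) (LDY0 : mPL2 P T DY0).
Hypotheses (dx : has_differential P T F w wt x Dx Zx Ztx)
  (dx0 : has_differential P T F w wt x0 Dx0 Zx Ztx)
  (dY : has_differential P T F w wt Y DY ZY ZtY)
  (dY0 : has_differential P T F w wt Y0 DY0 ZY ZtY).
Hypotheses (x00 : {ae P, forall o, x 0 o = x0 0 o})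
  (YY : {ae P, forall o, Y 0 o = 0}) (Y00 : {ae P, forall o, Y0 0 o = 0}).
Hypotheses (Lx : forall t j, 0 <= t <= T -> L2 P (fun o => x t o j 0))
  (Lx0 : forall t j, 0 <= t <= T -> L2 P (fun o => x0 t o j 0)).
Hypotheses
  (EDx : forall t o, 0 <= t <= T -> Dx t o = a t *m x t o + ex t + Vx t o)
  (EDx0 : forall t o, 0 <= t <= T -> Dx0 t o = a t *m x0 t o + ex0 t)
  (EDY : forall t o, 0 <= t <= T -> DY t o = f t *m x t o + ey t + VY t o)
  (EDY0 : forall t o, 0 <= t <= T -> DY0 t o = f t *m x0 t o + ey0 t).
Hypotheses (nVx : adaptedL2 P T (sigma_path Y) Vx) (nVY : adaptedL2 P T (sigma_path Y) VY).
Hypothesis La : Linf T a.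

Section Annihilator.
Context (t : R) (h : Omega -> R).
Hypothesis tT : 0 <= t <= T.
Hypothesis Lh : L2 P h.
Hypothesis hG : forall A, sigma_path Y t A -> \int[P]_o (\1_A o * h o) = 0.

Let aY : adapted T F Y. Proof. by case: dY. Qed.

Let GF : sigma_path Y t `<=` measurable.
Proof. by move=> A; exact: (sigma_path_meas cF tT aY). Qed.

Let hnull X s0 : 0 <= s0 <= t -> gmeas (sigma_path Y s0) X -> L2 P X ->
  \int[P]_o (h o * X o) = 0.
Proof.
move=> /andP[s00 st] mX LX; rewrite ipC.
have mX' : gmeas (sigma_path Y t) X by move=> B /mX; apply: sigma_path_mono.
exact: (int_meas_null (sigma_path_sigma Y t) GF (L2_L1 Lh) hG mX' (L2M LX Lh)).
Qed.

Let h1 : \int[P]_o h o = 0.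
Proof.
rewrite -(hG (sub_setT (sigma_path_sigma Y t))).
by apply: eq_Rintegral => o _; rewrite indicT mul1r.
Qed.

Let slices p (V : R -> Omega -> 'cV[R]_p) : adaptedL2 P T (sigma_path Y) V ->
  {ae lam, forall q : measurableTypeR R, forall i, 0 <= q <= t ->
    L2 P (fun o => V q o i 0) /\ \int[P]_o (h o * V q o i 0) = 0}.
Proof.
move=> nV; apply: filter_forall => i; have [LV mV] := nV i 0.
apply: ae_timeS (PL2_slice LV) => q H qt.
have qT : 0 <= q <= T by case/andP: qt tT => -> /= qt /andP[_]; exact: le_trans.
split; first exact: H.
by apply: (hnull qt); [exact: mV|exact: H].
Qed.

(** The tested differences solve a linear equation with zero initial value: the
    control has disappeared from it by weak_affine. *)
Lemma weak_state_eq0 q i : 0 <= q <= t ->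
  \int[P]_o (h o * (x q o i 0 - x0 q o i 0)) = 0.
Proof.
have sub z : 0 <= z <= t -> 0 <= z <= T.
  by case/andP: tT => _ tT' /andP[-> /le_trans]; exact.
pose th z j := \int[P]_o (h o * (x z o j 0 - x0 z o j 0)).
have ev j := weak_evolution j LZx LZtx LDx LDx0 dx dx0 x00 Lh.
have [g Hg] : exists g : 'I_n -> R -> R, forall j, [/\
    L1 lam (g j : measurableTypeR R -> R),
    forall t, 0 <= t <= T -> g j t = \int[P]_o (h o * Dx t o j 0) - \int[P]_o (h o * Dx0 t o j 0) &
    forall t, 0 <= t <= T -> th t j = \int[lam]_s (ind0 t s * g j s)].
  have [g Hg] := choice (fun j => ex_intro _ (sval (cid2 (ev j))) (svalP (cid2 (ev j)))).
  by exists g => j; have [? []] := Hg j.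
have [C C0 Ca] : exists2 C, 0 < C & forall z i j, 0 <= z <= T -> `|a z i j| <= C.
  have [_ [C AC]] := La; exists (`|C| + 1); first by rewrite ltr_wpDl.
  move=> z i' j' zT; apply: (le_trans (abs_le_enorm _ _ _)); apply: (le_trans (AC z zT)).
  by rewrite (le_trans (ler_norm _))// lerDl.
pose Theta z := \sum_j `|th z j|; pose Phi z := \sum_j `|g j z|.
have IP : L1 lam (Phi : measurableTypeR R -> R).
  apply: L1_sum => j _; have [Ig _ _] := Hg j.
  exact: (L1_norm Ig).
have TP z : 0 <= z <= t -> 0 <= Theta z <= \int[lam]_r' (ind0 z r' * Phi r').
  move=> zt; rewrite sumr_ge0//=.
  have J j : L1 lam (fun r' : measurableTypeR R => ind0 z r' * `|g j r'|).
    have [Ig _ _] := Hg j; apply: L1_ind0.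
    exact: (L1_norm Ig).
  have -> : \int[lam]_r' (ind0 z r' * Phi r') = \sum_j \int[lam]_r' (ind0 z r' * `|g j r'|).
    by rewrite -int_sum//; apply: eq_Rintegral => r' _; rewrite mulr_sumr.
  apply: ler_sum => j _; have [Ig _ ->] := Hg j; last exact: sub.
  have Ii := L1_ind0 z Ig.
  have p0 r' : 0 <= ind0 z r' by rewrite /ind0 ler0n.
  rewrite ler_norml -intN//; apply/andP; split; apply: int_le => //; first exact: L1N.
    by move=> r'; rewrite -mulrN ler_wpM2l// lerNl ler_normr lexx orbT.
  by move=> r'; rewrite ler_wpM2l// ler_norm.
(* One is added to the constant to keep it positive in dimension 0. *)
have PT : {ae lam, forall z : measurableTypeR R, 0 <= z <= t -> Phi z <= (n%:R * C + 1) * Theta z}.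
  apply: ae_timeS (slices nVx) => z Hz zt; have zT := sub z zt.
  rewrite mulrDl mul1r; apply: (@le_trans _ _ (n%:R * C * Theta z)); last by rewrite lerDl sumr_ge0.
  have gE j : g j z = \sum_l a z j l * th z l.
    have [_ -> // _] := Hg j; have [LV V0] := Hz j zt.
    rewrite -(weak_affine Lh h1 (a z) (ex z) (ex0 z) (fun l => Lx l zT) (fun l => Lx0 l zT) LV V0).
    by congr (_ - _); apply: eq_Rintegral => o _; rewrite ?EDx ?EDx0.
  have -> : n%:R * C * Theta z = \sum_(j < n) C * Theta z.
    by rewrite sumr_const card_ord -mulrA mulr_natl.
  apply: ler_sum => j _; rewrite gE (le_trans (ler_norm_sum _ _ _))// mulr_sumr.
  by apply: ler_sum => l _; rewrite normrM ler_wpM2r// Ca.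
move=> qt.
have C1 : 0 < n%:R * C + 1 by rewrite ltr_wpDl// mulr_ge0// ltW.
have := gronwall0 C1 IP (fun _ => sumr_ge0 _ (fun _ _ => normr_ge0 _)) TP PT qt.
move=> /eqP; rewrite psumr_eq0// => /allP /(_ i (mem_index_enum _)).
by rewrite normr_eq0 => /eqP.
Qed.

Lemma weak_observation_eq0 q i : 0 <= q <= t -> \int[P]_o (h o * Y0 q o i 0) = 0.
Proof.
move=> qt; have sub z : 0 <= z <= t -> 0 <= z <= T.
  by case/andP: tT => _ tT' /andP[-> /le_trans]; exact.
have qT := sub q qt.
have Y0Y : {ae P, forall o, Y 0 o = Y0 0 o}.
  by apply: filterS (ae_and YY Y00) => o [-> ->].
have [g Ig [gE ev]] := weak_evolution i LZY LZtY LDY LDY0 dY dY0 Y0Y Lh.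
have init (X : R -> Omega -> 'cV[R]_s) D : has_differential P T F w wt X D ZY ZtY ->
    {ae P, forall o, X 0 o = 0} -> L2 P (fun o => X 0 o i 0).
  move=> [aX _] X0; apply: L2_ae_eq (L2_0 P) => //.
    have Z0 : 0 <= (0 : R) <= T by rewrite lexx ltW.
    by apply: (gmeas_meas (filtr_meas cF Z0)); apply: meas_wrt_coord; exact: aX.
  by apply: filterS X0 => o ->; rewrite mxE.
have LY := differential_slice_L2 T0 cF bW LZY LZtY qT dY LDY (init _ _ dY YY).
have LY0 := differential_slice_L2 T0 cF bW LZY LZtY qT dY0 LDY0 (init _ _ dY0 Y00).
have hY : \int[P]_o (h o * Y q o i 0) = 0.
  apply: (hnull qt) => //; apply: (meas_wrt_coord (X := Y q)) => B bB.
  by apply: sub_gen_smallest; exists q; rewrite lexx; case/andP: qt => -> _; split=> //; exists B.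
have E : \int[P]_o (h o * (Y q o i 0 - Y0 q o i 0)) = 0.
  rewrite ev// -[RHS](@int0 _ _ _ lam); apply: int_ae_eq => //; first exact: L1_meas (L1_ind0 q Ig).
  apply: ae_timeS (slices nVY) => z Hz; rewrite /ind0.
  case: (boolP (0 <= z <= q)) => [/andP[z0 zq]|_]; last by rewrite mul0r.
  have zt : 0 <= z <= t by rewrite z0 (le_trans zq)//; case/andP: qt.
  have zT := sub z zt; have [LV V0] := Hz i zt.
  rewrite mul1r gE//.
  have := weak_affine Lh h1 (f z) (ey z) (ey0 z) (fun l => Lx l zT) (fun l => Lx0 l zT) LV V0.
  rewrite (eq_Rintegral _ (fun o _ => congr1 (fun v : 'cV[R]_s => h o * v i 0) (esym (EDY o zT)))).
  rewrite (eq_Rintegral _ (fun o _ => congr1 (fun v : 'cV[R]_s => h o * v i 0) (esym (EDY0 o zT)))).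
  by move=> ->; rewrite big1// => l _; rewrite weak_state_eq0// mulr0.
move: E; rewrite (eq_Rintegral _ (fun o _ => mulrBr (h o) _ _)) intB; [|exact: L2M|exact: L2M].
by rewrite hY sub0r => /eqP; rewrite oppr_eq0 => /eqP.
Qed.

End Annihilator.

(** Testing against the random variables orthogonal to the observation of Y up
    to t removes the control, whose drift is measurable for it: what is left of
    x - x0 solves a homogeneous linear equation, hence vanishes, so that Y0 is
    almost surely a function of the path of Y. *)
Lemma observation_filtration t : 0 <= t <= T ->
  sigma_path Y0 t `<=` completion P (sigma_path Y t).
Proof.
move=> tT; have sG := sigma_path_sigma Y t.
have aY : adapted T F Y by case: dY.
have aY0 : adapted T F Y0 by case: dY0.
have GF : sigma_path Y t `<=` measurable by move=> A; exact: (sigma_path_meas cF tT aY).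
apply: smallest_sub; first exact: completion_sigma.
move=> A [q [qt [B bB ->]]].
have qT : 0 <= q <= T by case/andP: qt tT => -> /= qt /andP[_]; exact: le_trans.
have mY0 i : measurable_fun setT (fun o => Y0 q o i 0).
  by apply: (gmeas_meas (filtr_meas cF qT)); apply: meas_wrt_coord; exact: aY0.
have C := ae_borel_completion sG mY0; apply: C bB => i.
apply: (bipolar_gmeas sG GF).
  apply: (differential_slice_L2 T0 cF bW LZY LZtY qT dY0 LDY0).
  have Z0 : 0 <= (0 : R) <= T by rewrite lexx ltW.
  apply: L2_ae_eq (L2_0 P) => //.
    by apply: (gmeas_meas (filtr_meas cF Z0)); apply: meas_wrt_coord; exact: aY0.
  by apply: filterS Y00 => o ->; rewrite mxE.
by move=> h Lh hG; apply: (weak_observation_eq0 tT Lh hG).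
Qed.

End Observed.

(** * Difference quotients of convex functions *)

Section ConvexDifferential.
Context (R : realType) (V : normedModType R) (D : set V) (f : V -> R) (df : V -> V -> R).
Hypothesis dfD : diff_within D f df.

Definition step n : R := n.+1%:R^-1.

Lemma step_gt0 n : 0 < step n. Proof. by rewrite invr_gt0 ltr0n. Qed.

Lemma step_le1 n : step n <= 1. Proof. by rewrite invf_le1 ?ltr0n// ler1n. Qed.

Lemma step_cvg : step @ \oo --> 0. Proof. exact: cvg_harmonic. Qed.

Definition segment (x y : V) n : V := x + step n *: (y - x).

Lemma segmentB x y n : segment x y n - x = step n *: (y - x).
Proof. by rewrite /segment [LHS]addrC addKr. Qed.

Lemma segment_cvg (x y : V) : segment x y @ \oo --> x.
Proof.
rewrite -[X in _ --> X]addr0 -(scale0r (y - x)); apply: cvgD; first exact: cvg_cst.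
by apply: cvgZ; [exact: step_cvg|exact: cvg_cst].
Qed.

(** A relative differential gives relative continuity. *)
Lemma diff_within_cvg x K : D x -> (forall h, `|df x h| <= K * `|h|) ->
  f @ within D (nbhs x) --> f x.
Proof.
move=> Dx dfK; apply/cvgrPdist_le => e e0.
have K1 : 0 < `|K| + 1 by rewrite ltr_wpDl.
have A := dfD Dx ltr01.
have B : \forall y \near within D (nbhs x), `|y - x| <= e / (`|K| + 1).
  apply: cvg_within; have := @cvgr_dist_le _ _ _ _ _ id _ (@cvg_id _ (nbhs x)) (e / (`|K| + 1)).
  by move=> /(_ _ (divr_gt0 e0 K1)); apply: filterS => y; rewrite distrC.
apply: filterS2 A B => y Ay By.
have -> : f x - f y = - (f y - f x - df x (y - x) + df x (y - x)) by ring.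
rewrite normrN (le_trans (ler_normD _ _))//.
apply: (@le_trans _ _ (1 * `|y - x| + `|K| * `|y - x|)).
  by rewrite lerD// (le_trans (dfK _))// ler_wpM2r// ler_norm.
by rewrite -mulrDl addrC mulrC -ler_pdivlMr.
Qed.

Lemma diff_within_quot x y : D x -> (forall n, D (segment x y n)) ->
  (forall c h, df x (c *: h) = c * df x h) ->
  (fun n => (step n)^-1 * (f (segment x y n) - f x)) @ \oo --> df x (y - x).
Proof.
move=> Dx Dxy dfZ; apply/cvgrPdist_le => e e0.
pose e' := e / (`|y - x| + 1).
have y1 : 0 < `|y - x| + 1 by rewrite ltr_wpDl.
have e'0 : 0 < e' by rewrite divr_gt0.
have A := dfD Dx e'0.
have C : segment x y @ \oo --> within D (nbhs x).
  move=> B nB; have DD : \forall n \near \oo, D (segment x y n) by exact: nearW.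
  by apply: filterS2 DD (@segment_cvg x y _ nB) => z Dz; apply.
have CA : \forall n \near \oo, `|f (segment x y n) - f x - df x (segment x y n - x)| <=
    e' * `|segment x y n - x| by exact: C _ A.
apply: filterS CA => n /=.
rewrite segmentB dfZ normrZ (gtr0_norm (step_gt0 n)) => H.
have s0 := step_gt0 n.
have -> : df x (y - x) - (step n)^-1 * (f (segment x y n) - f x) =
    - ((step n)^-1 * (f (segment x y n) - f x - step n * df x (y - x))).
  by field; rewrite gt_eqF.
rewrite normrN normrM gtr0_norm ?invr_gt0//.
rewrite -(ler_pM2l s0) mulrA mulfV ?gt_eqF// mul1r (le_trans H)//.
rewrite mulrCA ler_wpM2l ?(ltW s0)// /e' -mulrA ler_piMr ?(ltW e0)//.
by rewrite mulrC ler_pdivrMr// mul1r lerDl.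
Qed.

Hypothesis cf : @convex_function R V D f.

Lemma convex_segment x y n : D x -> D y ->
  f (segment x y n) - f x <= step n * (f y - f x).
Proof.
move=> Dx Dy; have s0 := ltW (step_gt0 n).
have H : f (step n *: y + (1 - step n) *: x) <= step n * f y + (1 - step n) * f x :=
  cf (Itv01 s0 (step_le1 n)) (mem_set Dy) (mem_set Dx).
have E : step n *: y + (1 - step n) *: x = segment x y n.
  by rewrite /segment scalerBr scalerBl scale1r addrCA.
by move: H; rewrite E; lra.
Qed.

Hypothesis hD : forall x y, D x -> D y -> forall n, D (segment x y n).
Hypothesis dfZ : forall x c h, df x (c *: h) = c * df x h.

(** By convexity the difference quotients along the segment lie below the
    increment, and they converge to the differential. *)
Lemma convex_gradient x y : D x -> D y -> df x (y - x) <= f y - f x.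
Proof.
move=> Dx Dy; have C := diff_within_quot Dx (hD Dx Dy) (dfZ x).
have := ler_cvg_to C (cvg_cst (f y - f x)); apply; apply: nearW => n.
by rewrite ler_pdivrMl ?step_gt0// convex_segment.
Qed.

(** The lower bound is the gradient inequality at the point of the segment. *)
Lemma convex_quot_bounds x y n : D x -> D y ->
  df x (y - x) <= (step n)^-1 * (f (segment x y n) - f x) <= f y - f x.
Proof.
move=> Dx Dy; rewrite ler_pdivrMl ?step_gt0// convex_segment// andbT.
rewrite ler_pdivlMl ?step_gt0// -dfZ -segmentB.
by apply: convex_gradient => //; exact: hD.
Qed.

End ConvexDifferential.

Lemma convex_set_segment (R : realType) (V : normedModType R) (U : set V) x y n :
  @convex_set R V U -> U x -> U y -> U (segment x y n).
Proof.
move=> cU Ux Uy; have s0 := ltW (step_gt0 R n).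
have H : step R n *: y + (1 - step R n) *: x \in U :=
  cU y x (Itv01 s0 (step_le1 R n)) (mem_set Uy) (mem_set Ux).
have E : step R n *: y + (1 - step R n) *: x = segment x y n.
  by rewrite /segment scalerBr scalerBl scale1r addrCA.
by move: H; rewrite E inE.
Qed.

Section Gradients.
Context (R : realType).

Lemma abs_inner_le p (a : 'cV[R]_p) : exists2 K, 0 <= K & forall h : 'cV[R]_p, `|inner a h| <= K * `|h|.
Proof.
exists (\sum_i `|a i 0|); first by rewrite sumr_ge0.
move=> h; rewrite inner_col (le_trans (ler_norm_sum _ _ _))// mulr_suml.
apply: ler_sum => i _; rewrite normrM ler_wpM2l//.
by have := @mx_normrE; rewrite /Num.norm /= mx_normrE => _; apply: (le_bigmax _ _ (i, 0)).
Qed.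

Lemma differentiable_diff_within (V : normedModType R) (f : V -> R) :
  (forall x, differentiable f x) -> diff_within setT f (fun x h => 'd f x h).
Proof.
move=> df x _ e e0; rewrite withinET.
have := diff_locally (df x) => /eqaddoP /(_ e e0).
rewrite [X in X -> _](near_shift x) sub0r; apply: filterS => y /=.
by rewrite -[X in `|X| <= _ -> _]/(f (y - x + x) - (f x + 'd f x (y - x))) subrK opprD addrA.
Qed.

Lemma diff_inner_grad p (f : 'cV[R]_p -> R) x h : differentiable f x ->
  'd f x h = inner (grad f x) h.
Proof.
move=> df; rewrite {1}[h]matrix_sum_delta linear_sum inner_col; apply: eq_bigr => i _.
by rewrite big_ord1 linearZ /= mxE deriveE// mulrC.
Qed.

Lemma diff_pair_grad p q (f : 'cV[R]_p * 'cV[R]_q -> R) x (h : 'cV[R]_p * 'cV[R]_q) :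
  differentiable f x ->
  'd f x h = inner (grad (fun y => f (y, x.2)) x.1) h.1 +
             inner (grad (fun y => f (x.1, y)) x.2) h.2.
Proof.
case: x h => x1 x2 [h1 h2] df /=.
have -> : (h1, h2) = (\sum_i h1 i 0 *: (delta_mx i 0, 0)) +
    \sum_i h2 i 0 *: (0, delta_mx i 0) :> 'cV[R]_p * 'cV[R]_q.
  have col_sum n (v : 'cV[R]_n) : \sum_i v i 0 *: delta_mx i 0 = v.
    by rewrite [RHS]matrix_sum_delta; apply: eq_bigr => i _; rewrite big_ord1.
  apply: injective_projections => /=.
    rewrite !(big_morph (@fst 'cV[R]_p 'cV[R]_q) (fun _ _ => erefl) erefl) /= col_sum.
    by rewrite big1 ?addr0// => i _; rewrite scaler0.
  rewrite !(big_morph (@snd 'cV[R]_p 'cV[R]_q) (fun _ _ => erefl) erefl) /= col_sum.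
  by rewrite big1 ?add0r// => i _; rewrite scaler0.
rewrite linearD !linear_sum !inner_col; congr (_ + _); apply: eq_bigr => i _.
  rewrite linearZ /= mxE -deriveE// mulrC; congr (_ * _).
  rewrite /derive; apply: (congr1 (fun g : R -> R => lim (g @ 0^'))); apply/funext => h /=.
  have -> // : h *: (delta_mx i 0, 0) + (x1, x2) = (h *: delta_mx i 0 + x1, x2) :> 'cV[R]_p * 'cV[R]_q.
  by apply: injective_projections => //=; rewrite scaler0 add0r.
rewrite linearZ /= mxE -deriveE// mulrC; congr (_ * _).
rewrite /derive; apply: (congr1 (fun g : R -> R => lim (g @ 0^'))); apply/funext => h /=.
have -> // : h *: (0, delta_mx i 0) + (x1, x2) = (x1, h *: delta_mx i 0 + x2) :> 'cV[R]_p * 'cV[R]_q.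
by apply: injective_projections => //=; rewrite scaler0 add0r.
Qed.

End Gradients.

(** * Random convex costs *)

Section Bounds.
Context (R : realType).

Definition abs1 p (x : 'cV[R]_p) : R := \sum_i `|x i 0|.

Lemma abs1_ge0 p (x : 'cV[R]_p) : 0 <= abs1 x. Proof. exact: sumr_ge0. Qed.

Lemma sum_sq_le p (a : 'I_p -> R) : (forall i, 0 <= a i) ->
  \sum_i a i ^+ 2 <= (\sum_i a i) ^+ 2.
Proof.
move=> a0; rewrite expr2 mulr_suml; apply: ler_sum => i _.
by rewrite expr2 ler_wpM2l// (bigD1 i)//= lerDl sumr_ge0.
Qed.

Lemma sqn_le_abs1 p (x : 'cV[R]_p) : sqn x <= abs1 x ^+ 2.
Proof.
rewrite sqnE; apply: le_trans (sum_sq_le (a := fun i => `|x i 0|) _) => //.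
by apply: ler_sum => i _; rewrite big_ord1 real_normK ?num_real.
Qed.

Lemma enorm_le_abs1 p (x : 'cV[R]_p) : enorm x <= abs1 x.
Proof.
rewrite /enorm -(ger0_norm (abs1_ge0 x)) -sqrtr_sqr.
by apply: ler_wsqrtr; exact: sqn_le_abs1.
Qed.

Lemma abs1_le_norm p (x : 'cV[R]_p) : abs1 x <= p%:R * `|x|.
Proof.
apply: (@le_trans _ _ (\sum_(i < p) `|x|)); last by rewrite sumr_const card_ord mulr_natl.
apply: ler_sum => i _.
rewrite {2}/Num.norm /= mx_normrE; exact: (le_bigmax _ (fun ij => `|x ij.1 ij.2|) (i, 0)).
Qed.

Lemma norm_le_abs1 p (x : 'cV[R]_p) : `|x| <= abs1 x.
Proof.
rewrite {1}/Num.norm /= mx_normrE; apply/bigmax_leP; split; first exact: abs1_ge0.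
by move=> [i j] _ /=; rewrite (ord1 j) /abs1 (bigD1 i)//= lerDl sumr_ge0.
Qed.

Lemma abs_inner_abs1 p (a b : 'cV[R]_p) : `|inner a b| <= enorm a * abs1 b.
Proof.
rewrite inner_col (le_trans (ler_norm_sum _ _ _))// mulr_sumr.
by apply: ler_sum => i _; rewrite normrM ler_wpM2r// abs_le_enorm.
Qed.

End Bounds.

(** The cost as a random field: S is either the probability space, at a frozen
    time, or the product of the time line with it. In the second case
    everything is cut to the time interval, whence the indicator e in the
    growth bounds. *)
Section CostField.
Context (R : realType) (n k : nat) (ds : measure_display) (S : measurableType ds).
Let V := ('cV[R]_n * 'cV[R]_n * 'cV[R]_k)%type.
Context (U : set 'cV[R]_k) (L : S -> V -> R) (gx gxb : S -> V -> 'cV[R]_n)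
  (gv : S -> V -> 'cV[R]_k).
Let D : set V := [set q | U q.2].

Definition dL s (q h : V) : R :=
  inner (gx s q) h.1.1 + inner (gxb s q) h.1.2 + inner (gv s q) h.2.

Hypothesis cU : @convex_set R 'cV[R]_k U.
Hypothesis mL : forall q, D q -> measurable_fun setT (L^~ q).
Hypothesis dD : forall s, diff_within D (L s) (dL s).
Hypothesis cgx : forall s i q, D q -> (fun q => gx s q i 0) @ within D (nbhs q) --> gx s q i 0.
Hypothesis cgxb : forall s i q, D q -> (fun q => gxb s q i 0) @ within D (nbhs q) --> gxb s q i 0.

Record point_meas (q : S -> V) : Prop := PointMeas {
  pt_in : forall s, U (q s).2;
  pt_m1 : forall i, measurable_fun setT (fun s => (q s).1.1 i 0);
  pt_m2 : forall i, measurable_fun setT (fun s => (q s).1.2 i 0);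
  pt_m3 : forall i, measurable_fun setT (fun s => (q s).2 i 0) }.

Lemma dense_V : exists e : nat -> V, dense_in setT e.
Proof. by apply: dense_prod; [apply: dense_prod|]; exact: dense_mx. Qed.

Lemma point_dist_meas q : point_meas q -> dist_meas q.
Proof.
move=> [_ m1 m2 m3].
have E : q = (fun s => ((q s).1.1, (q s).1.2, (q s).2)).
  by apply/funext => s; case: (q s) => -[].
rewrite E; apply: dist_meas_prod; first apply: dist_meas_prod.
- by apply: dist_meas_mx => i j; rewrite (ord1 j).
- by apply: dist_meas_mx => i j; rewrite (ord1 j).
- by apply: dist_meas_mx => i j; rewrite (ord1 j).
Qed.

Lemma dLZ s q c h : dL s q (c *: h) = c * dL s q h.
Proof. by rewrite /dL /= !innerZr; ring. Qed.

Lemma dL_bound s q : exists K, forall h, `|dL s q h| <= K * `|h|.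
Proof.
have [K1 K10 H1] := abs_inner_le (gx s q).
have [K2 K20 H2] := abs_inner_le (gxb s q).
have [K3 K30 H3] := abs_inner_le (gv s q).
exists (K1 + K2 + K3) => -[[h1 h2] h3]; rewrite /dL /= !mulrDl.
apply: le_trans (ler_normD _ _) _; apply: lerD; first apply: le_trans (ler_normD _ _) _; first apply: lerD.
- by apply: (le_trans (H1 _)); rewrite ler_wpM2l// !prod_normE !le_max /= ?le_max lexx.
- by apply: (le_trans (H2 _)); rewrite ler_wpM2l// !prod_normE !le_max /= ?le_max lexx ?orbT.
- by apply: (le_trans (H3 _)); rewrite ler_wpM2l// !prod_normE !le_max /= lexx orbT.
Qed.

Lemma L_cvg s q : D q -> L s @ within D (nbhs q) --> L s q.
Proof. by move=> Dq; have [K HK] := dL_bound s q; exact: (diff_within_cvg (@dD s) Dq HK). Qed.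

Lemma L_meas q : point_meas q -> measurable_fun setT (fun s => L s (q s)).
Proof.
move=> pq; apply: (Caratheodory_meas (D := D) dense_V (point_dist_meas pq)) => //.
- by move=> s; exact: (pt_in pq s).
- exact: L_cvg.
Qed.

Lemma segment_in q q' m : D q -> D q' -> D (segment q q' m).
Proof. by move=> Dq Dq'; exact: (convex_set_segment m cU Dq Dq'). Qed.

Lemma segment_point q q' m : point_meas q -> point_meas q' ->
  point_meas (fun s => segment (q s) (q' s) m).
Proof.
move=> [i0 m1 m2 m3] [i0' m1' m2' m3']; split=> [s|i|i|i].
- exact: (@segment_in (q s) (q' s)).
- rewrite [X in measurable_fun _ X](_ : _ = fun s => (q s).1.1 i 0 +
    step R m * ((q' s).1.1 i 0 - (q s).1.1 i 0)); last by apply/funext => s; rewrite /= !mxE.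
  by apply: measurable_funD => //; apply: measurable_funM => //; exact: measurable_funB.
- rewrite [X in measurable_fun _ X](_ : _ = fun s => (q s).1.2 i 0 +
    step R m * ((q' s).1.2 i 0 - (q s).1.2 i 0)); last by apply/funext => s; rewrite /= !mxE.
  by apply: measurable_funD => //; apply: measurable_funM => //; exact: measurable_funB.
- rewrite [X in measurable_fun _ X](_ : _ = fun s => (q s).2 i 0 +
    step R m * ((q' s).2 i 0 - (q s).2 i 0)); last by apply/funext => s; rewrite /= !mxE.
  by apply: measurable_funD => //; apply: measurable_funM => //; exact: measurable_funB.
Qed.

Definition quot (q q' : S -> V) m s : R :=
  (step R m)^-1 * (L s (segment (q s) (q' s) m) - L s (q s)).

Lemma quot_meas q q' m : point_meas q -> point_meas q' -> measurable_fun setT (quot q q' m).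
Proof.
move=> pq pq'; apply: measurable_funM => //; apply: measurable_funB; last exact: L_meas.
exact: (L_meas (segment_point m pq pq')).
Qed.

Lemma quot_cvg q q' s : D (q s) -> D (q' s) ->
  (fun m => quot q q' m s) @ \oo --> dL s (q s) (q' s - q s).
Proof.
move=> Dq Dq'; apply: (diff_within_quot (@dD s) Dq) => [m|].
  exact: segment_in.
exact: dLZ.
Qed.

(** The gradients inherit their measurability from the difference quotients. *)
Lemma dL_meas q q' : point_meas q -> point_meas q' ->
  measurable_fun setT (fun s => dL s (q s) (q' s - q s)).
Proof.
move=> pq pq'; apply: (measurable_fun_cvg (fun m => quot_meas m pq pq')) => s _.
by apply: quot_cvg; [exact: pt_in pq s|exact: pt_in pq' s].
Qed.

Lemma const_point q : D q -> point_meas (fun=> q).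
Proof. by move=> Dq; split=> // i; exact: measurable_cst. Qed.

Lemma gx_meas q i : point_meas q -> measurable_fun setT (fun s => gx s (q s) i 0).
Proof.
move=> pq; apply: (Caratheodory_meas (D := D) (f := fun s q => gx s q i 0) dense_V (point_dist_meas pq)).
- by move=> s; exact: (pt_in pq s).
- move=> v Dv; have Dv' : D (v + (delta_mx i 0, 0, 0)) by rewrite /D /= addr0.
  have := dL_meas (const_point Dv) (const_point Dv'); apply: eq_measurable_fun => s _.
  by rewrite /dL (addrC v) addrK /= !inner0r !addr0 innerC inner_delta.
- by move=> s v; exact: cgx.
Qed.

Lemma gxb_meas q i : point_meas q -> measurable_fun setT (fun s => gxb s (q s) i 0).
Proof.
move=> pq; apply: (Caratheodory_meas (D := D) (f := fun s q => gxb s q i 0) dense_V (point_dist_meas pq)).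
- by move=> s; exact: (pt_in pq s).
- move=> v Dv; have Dv' : D (v + (0, delta_mx i 0, 0)) by rewrite /D /= addr0.
  have := dL_meas (const_point Dv) (const_point Dv'); apply: eq_measurable_fun => s _.
  by rewrite /dL (addrC v) addrK /= !inner0r addr0 add0r innerC inner_delta.
- by move=> s v; exact: cgxb.
Qed.

Section Integrability.
Context (mu : {measure set S -> \bar R}) (e : S -> R) (C : R).
Hypothesis C0 : 0 <= C.
Hypothesis e01 : forall s, e s = 0 \/ e s = 1.
Hypothesis Le : L2 mu e.
Hypothesis gL : forall s q, D q -> `|L s q| <= C * e s * (1 + sqn q.1.1 + sqn q.1.2 + sqn q.2).
Let gr (q : V) := 1 + enorm q.1.1 + enorm q.1.2 + enorm q.2.
Hypothesis ggx : forall s q, D q -> enorm (gx s q) <= C * e s * gr q.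
Hypothesis ggxb : forall s q, D q -> enorm (gxb s q) <= C * e s * gr q.
Hypothesis ggv : forall s q, D q -> enorm (gv s q) <= C * e s * gr q.

(** A common bound for the sizes that enter the growth conditions, chosen linear
    so that it is square integrable along a square-integrable point. *)
Definition size1 (q : V) : R := 1 + abs1 q.1.1 + abs1 q.1.2 + abs1 q.2.

Record point_L2 (q : S -> V) : Prop := PointL2 {
  pt_meas : point_meas q;
  pt_L1 : forall i, L2 mu (fun s => e s * (q s).1.1 i 0);
  pt_L2 : forall i, L2 mu (fun s => e s * (q s).1.2 i 0);
  pt_L3 : forall i, L2 mu (fun s => e s * (q s).2 i 0) }.

Lemma L2_norm f : L2 mu f -> L2 mu (fun s => `|f s|).
Proof.
move=> Lf; apply: (L2_le _ _ Lf) => [|s]; last by rewrite normr_id.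
by apply: measurableT_comp => //; exact: L2_meas Lf.
Qed.

Lemma abs1_L2 p (x : S -> 'cV[R]_p) : (forall i, L2 mu (fun s => e s * x s i 0)) ->
  L2 mu (fun s => e s * abs1 (x s)).
Proof.
move=> Lx; have := L2_sum (index_enum 'I_p) (Q := xpredT) (fun i _ => L2_norm (Lx i)).
apply: L2_eq => s; rewrite /abs1 mulr_sumr; apply: eq_bigr => i _.
by rewrite normrM; case: (e01 s) => ->; rewrite ?normr0 ?normr1.
Qed.

Lemma size_L2 q : point_L2 q -> L2 mu (fun s => e s * size1 (q s)).
Proof.
move=> [_ L1_ L2_ L3_].
have := L2D (L2D (L2D Le (abs1_L2 L1_)) (abs1_L2 L2_)) (abs1_L2 L3_).
by apply: L2_eq => s; rewrite /size1; ring.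
Qed.

Lemma size1_ge1 q : 1 <= size1 q.
Proof.
rewrite /size1; have := abs1_ge0 q.1.1; have := abs1_ge0 q.1.2; have := abs1_ge0 q.2.
lra.
Qed.

Lemma gr_le_size q : gr q <= size1 q.
Proof. by rewrite /gr /size1 !lerD ?enorm_le_abs1. Qed.

Lemma e_ge0 s : 0 <= e s. Proof. by case: (e01 s) => ->. Qed.

Lemma L_le_size s q : D q -> `|L s q| <= C * (e s * size1 q) ^+ 2.
Proof.
move=> Dq; apply: (le_trans (gL s Dq)); rewrite -mulrA ler_wpM2l//.
have -> : (e s * size1 q) ^+ 2 = e s * size1 q ^+ 2.
  by case: (e01 s) => ->; rewrite ?mul0r ?mul1r// expr0n.
rewrite ler_wpM2l ?e_ge0//.
have := sqn_le_abs1 q.1.1; have := sqn_le_abs1 q.1.2; have := sqn_le_abs1 q.2.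
have := abs1_ge0 q.1.1; have := abs1_ge0 q.1.2; have := abs1_ge0 q.2.
rewrite /size1; move: (abs1 _) (abs1 _) (abs1 _) => a b c a0 b0 c0.
move: (sqn _) (sqn _) (sqn _) => a' b' c' H1 H2 H3; nra.
Qed.

Lemma L_L1 q : point_L2 q -> L1 mu (fun s => L s (q s)).
Proof.
move=> pq; apply: (L1_le _ (fun s => L_le_size s (pt_in (pt_meas pq) s))).
  exact: L_meas (pt_meas pq).
by apply: L1Z; apply: L2_sq; exact: size_L2.
Qed.

Lemma grad_L2 p (g : S -> V -> 'cV[R]_p) q i : point_L2 q ->
  (forall s q, D q -> enorm (g s q) <= C * e s * gr q) ->
  measurable_fun setT (fun s => g s (q s) i 0) -> L2 mu (fun s => g s (q s) i 0).
Proof.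
move=> pq gg mg; apply: (L2_le mg _ (L2Z C (size_L2 pq))) => s.
apply: (le_trans (abs_le_enorm _ _ _)); apply: (le_trans (gg s _ (pt_in (pt_meas pq) s))).
rewrite ger0_norm ?mulr_ge0 ?e_ge0// ?(le_trans ler01 (size1_ge1 _))//.
by rewrite mulrA ler_wpM2l ?mulr_ge0 ?e_ge0// gr_le_size.
Qed.

Lemma gx_L2 q i : point_L2 q -> L2 mu (fun s => gx s (q s) i 0).
Proof. by move=> pq; apply: grad_L2 => //; exact: gx_meas (pt_meas pq). Qed.

Lemma gxb_L2 q i : point_L2 q -> L2 mu (fun s => gxb s (q s) i 0).
Proof. by move=> pq; apply: grad_L2 => //; exact: gxb_meas (pt_meas pq). Qed.

(** Each gradient is bounded by the size of the point, each increment by the sizes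
    of both points. *)
Lemma dL_L1 q q' : point_L2 q -> point_L2 q' ->
  L1 mu (fun s => dL s (q s) (q' s - q s)).
Proof.
move=> pq pq'.
have B := L1Z (3 * C) (L2M (size_L2 pq) (L2D (size_L2 pq) (size_L2 pq'))).
apply: (L1_le _ _ B); first exact: dL_meas (pt_meas pq) (pt_meas pq').
move=> s; have Dq := pt_in (pt_meas pq) s.
have part p (g : 'cV[R]_p) (h h' : 'cV[R]_p) : enorm g <= C * e s * gr (q s) ->
    abs1 h <= size1 (q s) -> abs1 h' <= size1 (q' s) ->
    `|inner g (h' - h)| <= C * ((e s * size1 (q s)) * (e s * size1 (q s) + e s * size1 (q' s))).
  move=> Hg Hh Hh'; apply: (le_trans (abs_inner_abs1 _ _)).
  have E : C * ((e s * size1 (q s)) * (e s * size1 (q s) + e s * size1 (q' s))) =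
     (C * e s * size1 (q s)) * (size1 (q s) + size1 (q' s)).
    by case: (e01 s) => ->; ring.
  rewrite E; apply: ler_pM; rewrite ?abs1_ge0 ?sqrtr_ge0//.
    by apply: (le_trans Hg); rewrite ler_wpM2l ?mulr_ge0 ?e_ge0// gr_le_size.
  apply: (@le_trans _ _ (abs1 h + abs1 h')); last exact: lerD.
  rewrite /abs1 -big_split /=; apply: ler_sum => i _.
  by rewrite !mxE addrC (le_trans (ler_normD _ _))// normrN.
have a1 q0 : abs1 q0.1.1 <= size1 q0 /\ abs1 q0.1.2 <= size1 q0 /\ abs1 q0.2 <= size1 q0.
  rewrite /size1; have := abs1_ge0 q0.1.1; have := abs1_ge0 q0.1.2; have := abs1_ge0 q0.2.
  by lra.
have [A1 [A2 A3]] := a1 (q s); have [A1' [A2' A3']] := a1 (q' s).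
have P1 := part _ _ _ _ (ggx s Dq) A1 A1'.
have P2 := part _ _ _ _ (ggxb s Dq) A2 A2'.
have P3 := part _ _ _ _ (ggv s Dq) A3 A3'.
rewrite /dL (le_trans (ler_normD _ _))// (le_trans (lerD (ler_normD _ _) (lexx _)))//.
apply: (le_trans (lerD (lerD P1 P2) P3)); rewrite le_eqVlt; apply/orP; left; apply/eqP; ring.
Qed.

Hypothesis cL : forall s, @convex_function R V D (L s).

Lemma L_gradient q q' s : D q -> D q' -> dL s q (q' - q) <= L s q' - L s q.
Proof.
move=> Dq Dq'; apply: (convex_gradient (@dD s) (@cL s)) => //.
- by move=> x y Dx Dy m; exact: segment_in.
- exact: dLZ.
Qed.

(** Dominated convergence: the quotients lie between the differential and the
    increment, both integrable. *)
Lemma quot_int_cvg q q' : point_L2 q -> point_L2 q' ->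
  (forall m, L1 mu (quot q q' m)) /\
  (fun m => \int[mu]_s quot q q' m s) @ \oo --> \int[mu]_s dL s (q s) (q' s - q s).
Proof.
move=> pq pq'; have J := dL_L1 pq pq'; have Jq := L_L1 pq; have Jq' := L_L1 pq'.
have B := L1D (L1_norm J) (L1_norm (L1B Jq' Jq)).
have bnd m s : `|quot q q' m s| <= `|dL s (q s) (q' s - q s)| + `|L s (q' s) - L s (q s)|.
  have /andP[l u] : dL s (q s) (q' s - q s) <= quot q q' m s <= L s (q' s) - L s (q s).
    apply: (convex_quot_bounds (@dD s) (@cL s)).
    - by move=> x y Dx Dy m'; exact: segment_in.
    - exact: dLZ.
    - exact: pt_in (pt_meas pq) s.
    - exact: pt_in (pt_meas pq') s.
  have := ler_norm (L s (q' s) - L s (q s)); have := ler_norm (- dL s (q s) (q' s - q s)).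
  rewrite normrN => H1 H2; rewrite ler_norml.
  have := normr_ge0 (dL s (q s) (q' s - q s)); have := normr_ge0 (L s (q' s) - L s (q s)).
  by move: H1 H2 l u; move: `|_| `|_| => *; lra.
have mq m := quot_meas m (pt_meas pq) (pt_meas pq').
split=> [m|]; first exact: (L1_le (mq m) (bnd m) B).
apply: (int_dom_cvg mq B bnd _).2 => s.
by apply: quot_cvg; [exact: pt_in (pt_meas pq) s|exact: pt_in (pt_meas pq') s].
Qed.

End Integrability.
End CostField.

(** * The minimum condition at a frozen time *)

Section LinearBound.
Context (R : realType).

Lemma inner_mul_bound p k (B : 'M[R]_(p, k)) : exists2 K, 0 <= K &
  forall (h : 'cV[R]_k) (y : 'cV[R]_p), `|inner (B *m h) y| <= K * (abs1 h * abs1 y).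
Proof.
exists (\sum_i \sum_j `|B i j|); first by rewrite sumr_ge0// => i _; rewrite sumr_ge0.
move=> h y; rewrite inner_col (le_trans (ler_norm_sum _ _ _))// [abs1 y]/abs1 !mulr_sumr.
apply: ler_sum => i _; rewrite normrM mulrA ler_wpM2r// mxE.
rewrite (le_trans (ler_norm_sum _ _ _))//.
apply: (@le_trans _ _ (\sum_j `|B i j| * abs1 h)).
  apply: ler_sum => j _; rewrite normrM ler_wpM2l//.
  by rewrite /abs1 (bigD1 j)//= lerDl sumr_ge0.
rewrite -mulr_suml ler_wpM2r ?abs1_ge0// (bigD1 i)//= lerDl sumr_ge0// => i' _.
by rewrite sumr_ge0.
Qed.

End LinearBound.

Lemma cvg_in_within (R : realType) (V : normedModType R) (D : set V) (s : nat -> V) (x : V) :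
  (forall j, D (s j)) -> s @ \oo --> x -> s @ \oo --> within D (nbhs x).
Proof.
move=> Ds sx B nB; have DD : \forall j \near \oo, D (s j) by exact: nearW.
by apply: filterS2 DD (sx _ nB) => z Dz; apply.
Qed.

Section FixedTime.
Context (R : realType) (d : measure_display) (Omega : measurableType d)
  (P : probability Omega R) (n m k : nat).
Let V := ('cV[R]_n * 'cV[R]_n * 'cV[R]_k)%type.
Context (U : set 'cV[R]_k) (l : V -> R) (gx gxb : V -> 'cV[R]_n) (gv : V -> 'cV[R]_k) (C : R).
Let D : set V := [set q | U q.2].
Let gr (q : V) := 1 + enorm q.1.1 + enorm q.1.2 + enorm q.2.
Hypotheses (cU : @convex_set R 'cV[R]_k U) (C0 : 0 <= C).
Hypothesis dl : diff_within D l (fun q h => inner (gx q) h.1.1 + inner (gxb q) h.1.2 + inner (gv q) h.2).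
Hypothesis gl : forall q, D q -> `|l q| <= C * (1 + sqn q.1.1 + sqn q.1.2 + sqn q.2).
Hypothesis ggx : forall q, D q -> enorm (gx q) <= C * gr q.
Hypothesis ggxb : forall q, D q -> enorm (gxb q) <= C * gr q.
Hypothesis ggv : forall q, D q -> enorm (gv q) <= C * gr q.
Hypothesis cl : @convex_function R V D l.

Context (G : set (set Omega)).
Hypotheses (sG : sigma_algebra setT G) (GF : G `<=` measurable).
Context (x : Omega -> 'cV[R]_n) (xb : 'cV[R]_n) (u : Omega -> 'cV[R]_k)
  (p : Omega -> 'cV[R]_n) (kk : Omega -> 'cV[R]_m) (B : 'M[R]_(n, k)) (Psi : 'M[R]_(m, k)).
Hypotheses (Lx : forall i, L2 P (fun o => x o i 0)) (Lu : forall i, L2 P (fun o => u o i 0))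
  (Lp : forall i, L2 P (fun o => p o i 0)) (Lk : forall i, L2 P (fun o => kk o i 0)).
Hypothesis Uu : forall o, U (u o).

Let L (_ : Omega) := l.
Let e1 (o : Omega) : R := 1.
Let pt (v : Omega -> 'cV[R]_k) o : V := (x o, xb, v o).
Let lin (h : 'cV[R]_k) o := inner (B *m h) (p o) - inner (Psi *m h) (kk o).
Let incr o (v : 'cV[R]_k) := lin (v - u o) o + (l (x o, xb, v) - l (x o, xb, u o)).

Let dD (o : Omega) : diff_within D (L o) (dL (fun _ => gx) (fun _ => gxb) (fun _ => gv) o).
Proof. exact: dl. Qed.

Let mL q : D q -> measurable_fun setT (fun o => L o q).
Proof. by move=> _; exact: measurable_cst. Qed.

Let e01 o : e1 o = 0 \/ e1 o = 1. Proof. by right. Qed.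

Let Le : L2 P e1. Proof. exact: L2_cst. Qed.

Let gL o q : D q -> `|L o q| <= C * e1 o * (1 + sqn q.1.1 + sqn q.1.2 + sqn q.2).
Proof. by move=> Dq; rewrite mulr1; exact: gl. Qed.

Let pt_point v : (forall o, U (v o)) -> (forall i, L2 P (fun o => v o i 0)) ->
  point_L2 U P e1 (pt v).
Proof.
move=> Uv Lv; split; first split=> //= i.
- exact: L2_meas (Lx i).
- exact: L2_meas (Lv i).
- by move=> i; apply: L2_eq (Lx i) => o; rewrite mul1r.
- by move=> i; apply: L2_eq (L2_cst P (xb i 0)) => o; rewrite mul1r.
- by move=> i; apply: L2_eq (Lv i) => o; rewrite mul1r.
Qed.

Let lL1 v : (forall o, U (v o)) -> (forall i, L2 P (fun o => v o i 0)) ->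
  L1 P (fun o => l (pt v o)).
Proof. by move=> Uv Lv; apply: (L_L1 mL dD C0 e01 Le gL); exact: pt_point. Qed.

Let innerL1 q' (Y Z : Omega -> 'cV[R]_q') : (forall i, L2 P (fun o => Y o i 0)) ->
  (forall i, L2 P (fun o => Z o i 0)) -> L1 P (fun o => inner (Y o) (Z o)).
Proof.
move=> LY LZ; apply: (L1_eq (f := fun o => \sum_i Y o i 0 * Z o i 0)).
  by move=> o; rewrite inner_col.
by apply: L1_sum => i _; exact: L2M.
Qed.

Let mulL2 q' (A : 'M[R]_(q', k)) (v : Omega -> 'cV[R]_k) :
  (forall i, L2 P (fun o => v o i 0)) -> forall i, L2 P (fun o => (A *m v o) i 0).
Proof.
move=> Lv i; apply: (L2_eq (f := fun o => \sum_j A i j * v o j 0)).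
  by move=> o; rewrite mxE.
by apply: L2_sum => j _; exact: L2Z.
Qed.

Let linL1 (v : Omega -> 'cV[R]_k) : (forall i, L2 P (fun o => v o i 0)) -> L1 P (fun o => lin (v o) o).
Proof.
by move=> Lv; apply: L1B; apply: innerL1 => //; exact: mulL2.
Qed.

Let subL2 (v v' : Omega -> 'cV[R]_k) : (forall i, L2 P (fun o => v o i 0)) ->
  (forall i, L2 P (fun o => v' o i 0)) -> forall i, L2 P (fun o => (v o - v' o) i 0).
Proof.
by move=> Lv Lv' i; apply: L2_eq (L2B (Lv i) (Lv' i)) => o; rewrite !mxE.
Qed.

Let incrL1 (v : Omega -> 'cV[R]_k) : (forall o, U (v o)) -> (forall i, L2 P (fun o => v o i 0)) ->
  L1 P (fun o => incr o (v o)).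
Proof.
move=> Uv Lv; apply: L1D; first exact: linL1 (subL2 Lv Lu).
exact: L1B (lL1 Uv Lv) (lL1 Uu Lu).
Qed.

Hypothesis incr_ge0 : forall v, U v -> forall A, G A -> 0 <= \int[P]_o (\1_A o * incr o v).

(** The minimum condition bears on constant controls; a G-measurable control is
    a limit of G-measurable controls with finitely many values, on which the
    condition may be applied value by value. *)
Lemma incr_control_ge0 v : (forall o, U (v o)) -> (forall i, L2 P (fun o => v o i 0)) ->
  (forall i, gmeas G (fun o => v o i 0)) -> 0 <= \int[P]_o incr o (v o).
Proof.
move=> Uv Lv mv.
have Une : U !=set0.
  have [w0 _] : [set: Omega] !=set0.
    apply/set0P/eqP => E0; have := probability_setT P; rewrite E0 measure0 => /eqP.
    by rewrite eq_sym onee_eq0.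
  by exists (v w0).
have [e eU] := dense_subset (dense_mx R k 1) Une.
have Ue i : U (e i) by case: eU.
have Le' i : forall j, L2 P (fun o : Omega => e i j 0) by move=> j; exact: L2_cst.
have mX z : gmeas G (fun o => `|v o - z|).
  apply/(gmeasP sG); apply: (@dist_meas_mx R _ (g_sigma_algebraType G) k 1 v) => i j.
  by rewrite (ord1 j); apply/(gmeasP sG); exact: mv.
have NI := nearest_int sG GF mX (fun i => incrL1 (fun=> Ue i) (Le' i))
  (fun i A GA => incr_ge0 (Ue i) GA).
have NL j : L1 P (fun o => incr o (nearest e j (v o))) by have [] := NI j.
have N0 j : 0 <= \int[P]_o incr o (nearest e j (v o)).
  have [_ /(_ _ (sub_setT sG))] := NI j; congr (0 <= _).
  by apply: eq_Rintegral => o _; rewrite indicT mul1r.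
have [K1 K10 HK1] := inner_mul_bound B; have [K2 K20 HK2] := inner_mul_bound Psi.
(* A nearest point is no further from v than e 0 is: this bounds the size of
   all the approximations at once. *)
pose a o := k%:R * (`|e 0%N| + 2 * abs1 (v o)).
have nrle j o : abs1 (nearest e j (v o)) <= a o.
  apply: (le_trans (abs1_le_norm _)); rewrite ler_wpM2l//.
  have H : `|v o - nearest e j (v o)| <= `|v o - e 0%N| by exact: nearest_le.
  have E : nearest e j (v o) = v o - (v o - nearest e j (v o)) by rewrite opprB addrC subrK.
  rewrite E (le_trans (ler_normB _ _))//.
  have H1 := ler_normB (v o) (e 0%N); have H2 := norm_le_abs1 (v o); lra.
have L2abs q' (Y : Omega -> 'cV[R]_q') : (forall i, L2 P (fun o => Y o i 0)) ->
    L2 P (fun o => abs1 (Y o)).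
  by move=> LY; apply: L2_sum => i _; exact: L2_norm.
have La : L2 P a by exact: L2Z (L2D (L2_cst P _) (L2Z 2 (L2abs _ _ Lv))).
pose b o := 1 + abs1 (x o) + abs1 xb + a o.
have Lb : L2 P b.
  exact: L2D (L2D (L2D (L2_cst P 1) (L2abs _ _ Lx)) (L2_cst P _)) La.
pose dom o := (K1 * ((a o + abs1 (u o)) * abs1 (p o)) +
   K2 * ((a o + abs1 (u o)) * abs1 (kk o))) + (C * b o ^+ 2 + `|l (pt u o)|).
have Lau := L2D La (L2abs _ _ Lu).
have Ldom : L1 P dom.
  apply: L1D; apply: L1D.
  - by apply: L1Z; exact: L2M Lau (L2abs _ _ Lp).
  - by apply: L1Z; exact: L2M Lau (L2abs _ _ Lk).
  - by apply: L1Z; exact: L2_sq Lb.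
  - exact: L1_norm (lL1 Uu Lu).
have bnd j o : `|incr o (nearest e j (v o))| <= dom o.
  set z := nearest e j (v o).
  have Uz : U z by exact: nearest_in.
  have az : abs1 z <= a o by exact: nrle.
  have zu : abs1 (z - u o) <= a o + abs1 (u o).
    apply: (@le_trans _ _ (abs1 z + abs1 (u o))); last by rewrite lerD2r.
    rewrite /abs1 -big_split /=; apply: ler_sum => i _.
    by rewrite !mxE ler_normB.
  have lz : `|l (x o, xb, z)| <= C * b o ^+ 2.
    have := L_le_size C0 e01 gL o (q := (x o, xb, z)) Uz; rewrite /e1 mul1r => H; apply: (le_trans H).
    have H0 : 0 <= size1 (x o, xb, z) := le_trans ler01 (size1_ge1 _).
    have H1 : size1 (x o, xb, z) <= b o by rewrite /size1 /b /= lerD2l.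
    by rewrite ler_wpM2l// lerXn2r ?nnegrE// (le_trans H0 H1).
  have B1 : `|inner (B *m (z - u o)) (p o)| <= K1 * ((a o + abs1 (u o)) * abs1 (p o)).
    by apply: (le_trans (HK1 _ _)); rewrite ler_wpM2l// ler_wpM2r ?abs1_ge0.
  have B2 : `|inner (Psi *m (z - u o)) (kk o)| <= K2 * ((a o + abs1 (u o)) * abs1 (kk o)).
    by apply: (le_trans (HK2 _ _)); rewrite ler_wpM2l// ler_wpM2r ?abs1_ge0.
  rewrite /incr /lin (le_trans (ler_normD _ _))// lerD// (le_trans (ler_normB _ _))// lerD//.
have lim o : (fun j => incr o (nearest e j (v o))) @ \oo --> incr o (v o).
  have cz : (fun j => nearest e j (v o)) @ \oo --> v o.
    by apply: cvg_trans (nearest_cvg eU (Uv o)) _; exact: cvg_within.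
  have cl' : (fun j => l (x o, xb, nearest e j (v o))) @ \oo --> l (x o, xb, v o).
    have Dj j : D (x o, xb, nearest e j (v o)) := nearest_in j (v o) Ue.
    have cj : (fun j => (x o, xb, nearest e j (v o))) @ \oo --> pt v o.
      exact: (cvg_pair (cvg_cst (x o, xb)) cz).
    have H := cvg_in_within Dj cj.
    have H3 : L o @ within D (nbhs (pt v o)) --> L o (pt v o) by apply: (L_cvg dD); exact: Uv.
    exact: (cvg_comp _ _ H H3).
  pose c := B^T *m p o - Psi^T *m kk o.
  have linE h : lin h o = \sum_i h i 0 * c i 0.
    by rewrite -inner_col /c innerBr -!inner_adj.
  apply: cvgD; last by apply: cvgB => //; exact: cvg_cst.
  rewrite linE (eq_cvg _ _ (fun j => linE _)).
  apply: cvg_bigsum => i.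
  have cc : (fun j => nearest e j (v o) i 0) @ \oo --> v o i 0.
    exact: (cvg_comp _ _ cz (@coord_continuous R k 1 i 0 (v o))).
  have E (z : 'cV[R]_k) : (z - u o) i 0 * c i 0 = (z i 0 - u o i 0) * c i 0 by rewrite !mxE.
  rewrite E (eq_cvg _ _ (fun j => E _)).
  by apply: cvgM; [apply: cvgB => //; exact: cvg_cst|exact: cvg_cst].
have mi j : measurable_fun setT (fun o => incr o (nearest e j (v o))) by exact: L1_meas (NL j).
have [_ cvg] := int_dom_cvg mi Ldom bnd lim.
by apply: (ler_cvg_to (cvg_cst 0) cvg); exact: nearW.
Qed.

(** The minimum condition for u + eps (v - u), divided by eps, as eps tends to 0:
    the linear part does not change, and quot_int_cvg gives the limit of the
    quotients of the convex part. *)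
Lemma first_order_ge0 v : (forall o, U (v o)) -> (forall i, L2 P (fun o => v o i 0)) ->
  (forall i, gmeas G (fun o => u o i 0)) -> (forall i, gmeas G (fun o => v o i 0)) ->
  [/\ L1 P (fun o => lin (v o - u o) o),
      L1 P (fun o => dL (fun _ => gx) (fun _ => gxb) (fun _ => gv) o (pt u o) (pt v o - pt u o)) &
  0 <= \int[P]_o lin (v o - u o) o +
    \int[P]_o dL (fun _ => gx) (fun _ => gxb) (fun _ => gv) o (pt u o) (pt v o - pt u o)].
Proof.
move=> Uv Lv mu mv.
have Jl := linL1 (subL2 Lv Lu).
have pu := pt_point Uu Lu; have pv := pt_point Uv Lv.
have Jd : L1 P (fun o => dL (fun _ => gx) (fun _ => gxb) (fun _ => gv) o (pt u o) (pt v o - pt u o)).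
  apply: (dL_L1 cU mL dD C0 e01 Le _ _ _ pu pv) => o q Dq; rewrite mulr1; by [exact: ggx|exact: ggxb|exact: ggv].
split=> //.
have [Jqq cq] : (forall j, L1 P (quot L (pt u) (pt v) j)) /\
  (fun j => \int[P]_o quot L (pt u) (pt v) j o) @ \oo -->
    \int[P]_o dL (fun _ => gx) (fun _ => gxb) (fun _ => gv) o (pt u o) (pt v o - pt u o).
  apply: (quot_int_cvg cU mL dD C0 e01 Le gL _ _ _ (fun _ => cl) pu pv) => o q Dq; rewrite mulr1; by [exact: ggx|exact: ggxb|exact: ggv].
have cs : (fun j => \int[P]_o lin (v o - u o) o + \int[P]_o quot L (pt u) (pt v) j o) @ \oo -->
  \int[P]_o lin (v o - u o) o +
    \int[P]_o dL (fun _ => gx) (fun _ => gxb) (fun _ => gv) o (pt u o) (pt v o - pt u o).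
  by apply: cvgD => //; exact: cvg_cst.
apply: (ler_cvg_to (cvg_cst 0) cs); apply: nearW => j.
pose v' o := segment (u o) (v o) j.
have Uv' o : U (v' o) by exact: (convex_set_segment j cU).
have E' o i : v' o i 0 = u o i 0 + step R j * (v o i 0 - u o i 0) by rewrite /v' /segment !mxE.
have Lv' i : L2 P (fun o => v' o i 0).
  by apply: L2_eq (L2D (Lu i) (L2Z (step R j) (L2B (Lv i) (Lu i)))) => o; rewrite E'.
have mv' i : gmeas G (fun o => v' o i 0).
  apply/(gmeasP sG).
  rewrite (_ : (fun o => v' o i 0) = fun o => u o i 0 + step R j * (v o i 0 - u o i 0)); last first.
    by apply/funext => o; rewrite E'.
  have mu' := (gmeasP sG _).1 (mu i); have mv'' := (gmeasP sG _).1 (mv i).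
  by apply: measurable_funD => //; apply: measurable_funM => //; exact: measurable_funB.
have := incr_control_ge0 Uv' Lv' mv'.
have s0 := step_gt0 R j.
have E o : incr o (v' o) = step R j * (lin (v o - u o) o + quot L (pt u) (pt v) j o).
  rewrite mulrDr /quot mulrA mulfV ?gt_eqF// mul1r /incr; congr (_ + (_ - _)).
    by rewrite /v' segmentB /lin -!scalemxAr !innerZl mulrBr.
  congr l; rewrite /segment /pt; apply: injective_projections => //=.
  by apply: injective_projections => //=; rewrite subrr scaler0 addr0.
rewrite (eq_Rintegral _ (fun o _ => E o)) intZ; last exact: L1D.
by rewrite intD// pmulr_rge0.
Qed.

End FixedTime.

(** * The running cost *)

Section RunningCost.
Context (R : realType) (n m r rt k : nat) (M : model R n m r rt k)
  (d : measure_display) (Omega : measurableType d) (P : probability Omega R)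
  (F : R -> set (set Omega)).
Notation T := (mT M).
Notation lam := (@lebesgue_measure R).
Notation LP := (lam \x P)%E.
Let V := ('cV[R]_n * 'cV[R]_n * 'cV[R]_k)%type.
Let S : measurableType _ := (measurableTypeR R * Omega)%type.
Let D : set V := [set q | mU M q.2].

(** What running_cost_ok asserts of the gradient lv in v and of the growth
    constant C. *)
Definition grad_ok (lv : R -> 'cV[R]_n -> 'cV[R]_n -> 'cV[R]_k -> 'cV[R]_k) (C : R) : Prop :=
  0 < C /\ forall t, 0 <= t <= mT M ->
    [/\ diff_within D (fun q => ml M t q.1.1 q.1.2 q.2)
          (fun q dq => inner (lx M t q.1.1 q.1.2 q.2) dq.1.1 +
                       inner (lxb M t q.1.1 q.1.2 q.2) dq.1.2 +
                       inner (lv t q.1.1 q.1.2 q.2) dq.2),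
        [/\ {within D, continuous (fun q => lx M t q.1.1 q.1.2 q.2)},
            {within D, continuous (fun q => lxb M t q.1.1 q.1.2 q.2)} &
            {within D, continuous (fun q => lv t q.1.1 q.1.2 q.2)}],
        forall x xb v, mU M v ->
          `|ml M t x xb v| <= C * (1 + sqn x + sqn xb + sqn v) &
        forall x xb v, mU M v ->
          [/\ enorm (lx M t x xb v) <= C * (1 + enorm x + enorm xb + enorm v),
              enorm (lxb M t x xb v) <= C * (1 + enorm x + enorm xb + enorm v) &
              enorm (lv t x xb v) <= C * (1 + enorm x + enorm xb + enorm v)]].

Context (lv : R -> 'cV[R]_n -> 'cV[R]_n -> 'cV[R]_k -> 'cV[R]_k) (C : R).
Hypothesis T0 : 0 < T.
Hypothesis ok : grad_ok lv C.
Hypothesis ml_meas : forall x xb v, mU M v ->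
  measurable_fun (`[0, T] : set (measurableTypeR R)) (fun t => ml M t x xb v : measurableTypeR R).
Hypothesis cU : @convex_set R 'cV[R]_k (mU M).
Hypothesis cl : forall t, 0 <= t <= T -> @convex_function R V D (fun q => ml M t q.1.1 q.1.2 q.2).
Context (v0 : 'cV[R]_k).
Hypothesis Uv0 : mU M v0.

Let on (A : Type) (z : A) (g : R -> A) (s : S) : A := if 0 <= s.1 <= T then g s.1 else z.

Definition lP (s : S) (q : V) : R := on 0 (fun t => ml M t q.1.1 q.1.2 q.2) s.
Definition gxP (s : S) (q : V) : 'cV[R]_n := on 0 (fun t => lx M t q.1.1 q.1.2 q.2) s.
Definition gxbP (s : S) (q : V) : 'cV[R]_n := on 0 (fun t => lxb M t q.1.1 q.1.2 q.2) s.
Definition gvP (s : S) (q : V) : 'cV[R]_k := on 0 (fun t => lv t q.1.1 q.1.2 q.2) s.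
Definition eP (s : S) : R := on 0 (fun=> 1) s.

Lemma lP_meas q : D q -> measurable_fun setT (lP^~ q).
Proof.
move=> Dq; have mt : measurable (`[0, T]%classic : set (measurableTypeR R)) by exact: measurable_itv.
have H := ml_meas q.1.1 q.1.2 Dq.
have H2 : measurable_fun setT (fun t : measurableTypeR R =>
    if 0 <= t <= T then ml M t q.1.1 q.1.2 q.2 else 0).
  have := (measurable_restrictT _ mt).1 H; apply: eq_measurable_fun => t _.
  rewrite patchE (_ : (t \in `[0, T]%classic) = (0 <= t <= T)); last first.
    by apply/idP/idP; rewrite inE /= in_itv.
  by case: ifP.
exact: (measurableT_comp H2 measurable_fst).
Qed.

Lemma dlP s : diff_within D (lP s) (dL gxP gxbP gvP s).
Proof.
rewrite /lP /on /dL /gxP /gxbP /gvP /on; case: (boolP (0 <= s.1 <= T)) => sT.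
  by have [_ /(_ _ sT) []] := ok.
move=> q Dq e e0; apply: filterE => q'.
by rewrite !inner0l !addr0 !subr0 normr0 mulr_ge0// ltW.
Qed.

Let within_coord p (g : V -> 'cV[R]_p) i q : D q -> {within D, continuous g} ->
  (fun q => g q i 0) @ within D (nbhs q) --> g q i 0.
Proof.
move=> Dq /subspace_continuousP /(_ q Dq) cg.
exact: (cvg_comp _ _ cg (@coord_continuous R p 1 i 0 (g q))).
Qed.

Lemma gxP_cvg s i q : D q -> (fun q => gxP s q i 0) @ within D (nbhs q) --> gxP s q i 0.
Proof.
move=> Dq; rewrite /gxP /on; case: (boolP (0 <= s.1 <= T)) => sT; last exact: cvg_cst.
have [_ /(_ _ sT) [_ [c1 c2 c3] _ _]] := ok.
exact: (within_coord Dq c1).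
Qed.

Lemma gxbP_cvg s i q : D q -> (fun q => gxbP s q i 0) @ within D (nbhs q) --> gxbP s q i 0.
Proof.
move=> Dq; rewrite /gxbP /on; case: (boolP (0 <= s.1 <= T)) => sT; last exact: cvg_cst.
have [_ /(_ _ sT) [_ [c1 c2 c3] _ _]] := ok.
exact: (within_coord Dq c2).
Qed.

Lemma eP01 s : eP s = 0 \/ eP s = 1.
Proof. by rewrite /eP /on; case: ifP; [right|left]. Qed.

Lemma eP_L2 : L2 LP eP.
Proof. by apply: L2_eq (PL2_cst T0 (L2_cst P 1)) => s. Qed.

Lemma C_ge0 : 0 <= C. Proof. by have [/ltW] := ok. Qed.

Lemma lP_le s q : D q -> `|lP s q| <= C * eP s * (1 + sqn q.1.1 + sqn q.1.2 + sqn q.2).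
Proof.
move=> Dq; rewrite /lP /eP /on; case: (boolP (0 <= s.1 <= T)) => sT.
  have [_ H] := ok.
  have [_ _ {}H _] := H _ sT.
  have {}H := H q.1.1 q.1.2 q.2 Dq.
  by move: H; move: (1 + _ + _ + _) => z; rewrite mulr1.
by rewrite normr0 mulr0 mul0r.
Qed.

Let gr (q : V) := 1 + enorm q.1.1 + enorm q.1.2 + enorm q.2.

Let enorm0 p : enorm (0 : 'cV[R]_p) = 0.
Proof. by rewrite /enorm /sqn inner0l sqrtr0. Qed.

Lemma gxP_le s q : D q -> enorm (gxP s q) <= C * eP s * gr q.
Proof.
move=> Dq; rewrite /gxP /eP /on; case: (boolP (0 <= s.1 <= T)) => sT.
  by have [_ /(_ _ sT) [_ _ _ H]] := ok; have [H1 _ _] := H q.1.1 q.1.2 q.2 Dq;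
    rewrite mulr1; exact: H1.
by rewrite enorm0 mulr0 mul0r.
Qed.

Lemma gxbP_le s q : D q -> enorm (gxbP s q) <= C * eP s * gr q.
Proof.
move=> Dq; rewrite /gxbP /eP /on; case: (boolP (0 <= s.1 <= T)) => sT.
  by have [_ /(_ _ sT) [_ _ _ H]] := ok; have [_ H1 _] := H q.1.1 q.1.2 q.2 Dq;
    rewrite mulr1; exact: H1.
by rewrite enorm0 mulr0 mul0r.
Qed.

Lemma gvP_le s q : D q -> enorm (gvP s q) <= C * eP s * gr q.
Proof.
move=> Dq; rewrite /gvP /eP /on; case: (boolP (0 <= s.1 <= T)) => sT.
  by have [_ /(_ _ sT) [_ _ _ H]] := ok; have [_ _ H1] := H q.1.1 q.1.2 q.2 Dq;
    rewrite mulr1; exact: H1.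
by rewrite enorm0 mulr0 mul0r.
Qed.

Lemma lP_convex s : @convex_function R V D (lP s).
Proof.
rewrite /lP /on; case: (boolP (0 <= s.1 <= T)) => sT; first exact: cl.
by move=> t x y _ _; rewrite convmm.
Qed.

(** The running point, completed outside the time interval by an arbitrary
    point of the domain of the cost. *)
Definition run_point (x : R -> Omega -> 'cV[R]_n) (v : R -> Omega -> 'cV[R]_k) (s : S) : V :=
  if 0 <= s.1 <= T then (x s.1 s.2, mean P (x s.1), v s.1 s.2) else (0, 0, v0).

Section Point.
Context (x : R -> Omega -> 'cV[R]_n) (v : R -> Omega -> 'cV[R]_k).
Hypotheses (Lx : mPL2 P T x) (Lv : mPL2 P T v).
Hypothesis Uv : forall t o, 0 <= t <= T -> mU M (v t o).

Lemma fill_meas (f : R -> Omega -> R) (c : R) : measurable_fun setT (trim T f) ->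
  measurable_fun setT (fun s : S => if 0 <= s.1 <= T then f s.1 s.2 else c).
Proof.
move=> mf; rewrite (_ : (fun s : S => _) = fun s => trim T f s + c * (1 - eP s)).
  apply: measurable_funD => //; apply: measurable_funM => //.
  by apply: measurable_funB => //; exact: L2_meas eP_L2.
apply/funext => s; rewrite /trim /eP /on; case: (0 <= s.1 <= T).
  by rewrite subrr mulr0 addr0.
by rewrite subr0 mulr1 add0r.
Qed.

Lemma run_point_L2 : point_L2 (mU M) LP eP (run_point x v).
Proof.
have Lm i : PL2 P T (fun t _ => mean P (x t) i 0).
  have E (s : S) : trim T (fun t _ => \int[P]_o x t o i 0) s =
      trim T (fun t _ => mean P (x t) i 0) s.
    by rewrite /trim meanE.
  exact: L2_eq E (PL2_mean (Lx i 0)).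
have c (Z : R -> Omega -> V) (c0 : V) (f : V -> R) : L2 LP (trim T (fun t o => f (Z t o))) ->
    measurable_fun setT (fun s : S => f (if 0 <= s.1 <= T then Z s.1 s.2 else c0)) /\
    L2 LP (fun s : S => eP s * f (if 0 <= s.1 <= T then Z s.1 s.2 else c0)).
  move=> LZ; split.
    rewrite (_ : (fun s : S => _) = fun s : S => if 0 <= s.1 <= T then f (Z s.1 s.2) else f c0).
      exact: fill_meas (L2_meas LZ).
    by apply/funext => s; case: ifP.
  have E s : trim T (fun t o => f (Z t o)) s = eP s * f (if 0 <= s.1 <= T then Z s.1 s.2 else c0).
    by rewrite /trim /eP /on; case: ifP => _; rewrite ?mul1r ?mul0r.
  exact: L2_eq E LZ.
pose Z t o : V := (x t o, mean P (x t), v t o).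
have c1 i := c Z (0, 0, v0) (fun q => q.1.1 i 0) (Lx i 0).
have c2 i := c Z (0, 0, v0) (fun q => q.1.2 i 0) (Lm i).
have c3 i := c Z (0, 0, v0) (fun q => q.2 i 0) (Lv i 0).
split; first split.
- by move=> s; rewrite /run_point; case: (boolP (0 <= s.1 <= T)) => // sT; exact: Uv.
- by move=> i; exact: (c1 i).1.
- by move=> i; exact: (c2 i).1.
- by move=> i; exact: (c3 i).1.
- by move=> i; exact: (c1 i).2.
- by move=> i; exact: (c2 i).2.
- by move=> i; exact: (c3 i).2.
Qed.

Lemma running_L1 : L1 LP (trim T (fun t o => ml M t (x t o) (mean P (x t)) (v t o))).
Proof.
have L := L_L1 lP_meas dlP C_ge0 eP01 eP_L2 lP_le run_point_L2.
have E s : lP s (run_point x v s) =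
    trim T (fun t o => ml M t (x t o) (mean P (x t)) (v t o)) s.
  by rewrite /lP /on /run_point /trim; case: (0 <= s.1 <= T).
exact: L1_eq E L.
Qed.

Lemma lx_mPL2 : mPL2 P T (fun t o => lx M t (x t o) (mean P (x t)) (v t o)).
Proof.
move=> i j; rewrite (ord1 j).
have L := gx_L2 cU lP_meas dlP gxP_cvg C_ge0 eP01 eP_L2 gxP_le i run_point_L2.
have E s : gxP s (run_point x v s) i 0 =
    trim T (fun t o => lx M t (x t o) (mean P (x t)) (v t o) i 0) s.
  by rewrite /gxP /on /run_point /trim; case: (0 <= s.1 <= T); rewrite ?mxE.
exact: L2_eq E L.
Qed.

Lemma lxb_mPL2 : mPL2 P T (fun t o => lxb M t (x t o) (mean P (x t)) (v t o)).
Proof.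
move=> i j; rewrite (ord1 j).
have L := gxb_L2 cU lP_meas dlP gxbP_cvg C_ge0 eP01 eP_L2 gxbP_le i run_point_L2.
have E s : gxbP s (run_point x v s) i 0 =
    trim T (fun t o => lxb M t (x t o) (mean P (x t)) (v t o) i 0) s.
  by rewrite /gxbP /on /run_point /trim; case: (0 <= s.1 <= T); rewrite ?mxE.
exact: L2_eq E L.
Qed.

(** At a frozen time the same argument runs over the sub-sigma-algebra. *)
Lemma frozen_grad_gmeas G t : sigma_algebra setT G -> 0 <= t <= T ->
  (forall i, gmeas G (fun o => x t o i 0)) -> (forall i, gmeas G (fun o => v t o i 0)) ->
  forall i, gmeas G (fun o => lx M t (x t o) (mean P (x t)) (v t o) i 0) /\
    gmeas G (fun o => lxb M t (x t o) (mean P (x t)) (v t o) i 0).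
Proof.
move=> sG tT mx mv i; pose OG := g_sigma_algebraType G.
have pt : point_meas (mU M) (fun o : OG => (x t o, mean P (x t), v t o) : V).
  split=> //= [z|j|j]; first exact: Uv.
    by apply/(gmeasP sG); exact: mx.
  by apply/(gmeasP sG); exact: mv.
have [_ /(_ _ tT) [dl [c1 c2 c3] _ _]] := ok.
pose L (_ : OG) (q : V) := ml M t q.1.1 q.1.2 q.2.
have mL q : D q -> measurable_fun setT (fun o => L o q) by move=> _; exact: measurable_cst.
split; apply/(gmeasP sG).
  exact: (@gx_meas R n k _ OG (mU M) L (fun _ q => lx M t q.1.1 q.1.2 q.2)
    (fun _ q => lxb M t q.1.1 q.1.2 q.2) (fun _ q => lv t q.1.1 q.1.2 q.2) cU mL (fun=> dl)
    (fun _ i q Dq => within_coord Dq c1) _ i pt).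
exact: (@gxb_meas R n k _ OG (mU M) L (fun _ q => lx M t q.1.1 q.1.2 q.2)
    (fun _ q => lxb M t q.1.1 q.1.2 q.2) (fun _ q => lv t q.1.1 q.1.2 q.2) cU mL (fun=> dl)
    (fun _ i q Dq => within_coord Dq c2) _ i pt).
Qed.

End Point.

(** The differential of the running cost at (xu, u) in the direction of (xv, v). *)
Definition run_slope (xu : R -> Omega -> 'cV[R]_n) (u : R -> Omega -> 'cV[R]_k)
    (xv : R -> Omega -> 'cV[R]_n) (v : R -> Omega -> 'cV[R]_k) (t : R) (o : Omega) : R :=
  inner (lx M t (xu t o) (mean P (xu t)) (u t o)) (xv t o - xu t o) +
  inner (lxb M t (xu t o) (mean P (xu t)) (u t o)) (mean P (xv t) - mean P (xu t)) +
  inner (lv t (xu t o) (mean P (xu t)) (u t o)) (v t o - u t o).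

(** The gradient inequality of the convex running cost, integrated. *)
Lemma running_slope xu u xv v : mPL2 P T xu -> mPL2 P T u -> mPL2 P T xv -> mPL2 P T v ->
  (forall t o, 0 <= t <= T -> mU M (u t o)) -> (forall t o, 0 <= t <= T -> mU M (v t o)) ->
  L1 LP (trim T (run_slope xu u xv v)) /\
  \int[LP]_s trim T (run_slope xu u xv v) s <=
  \int[LP]_s trim T (fun t o => ml M t (xv t o) (mean P (xv t)) (v t o)) s -
  \int[LP]_s trim T (fun t o => ml M t (xu t o) (mean P (xu t)) (u t o)) s.
Proof.
move=> Lxu Lu Lxv Lv Uu Uv.
have pu := run_point_L2 Lxu Lu Uu; have pv := run_point_L2 Lxv Lv Uv.
have J := dL_L1 cU lP_meas dlP C_ge0 eP01 eP_L2 gxP_le gxbP_le gvP_le pu pv.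
have E s : dL gxP gxbP gvP s (run_point xu u s) (run_point xv v s - run_point xu u s) =
    trim T (run_slope xu u xv v) s.
  rewrite /dL /gxP /gxbP /gvP /on /run_point /run_slope /trim.
  by case: (boolP (0 <= s.1 <= T)) => //= sT; rewrite !inner0l !addr0.
have Js := L1_eq E J; split=> //.
rewrite -intB; [|exact: running_L1|exact: running_L1].
apply: int_le => //; first by apply: L1B; exact: running_L1.
move=> s; rewrite -E.
have El x w : lP s (run_point x w s) = trim T (fun t o => ml M t (x t o) (mean P (x t)) (w t o)) s.
  by rewrite /lP /on /run_point /trim; case: (0 <= s.1 <= T).
rewrite -!El; apply: (L_gradient cU dlP lP_convex).
  exact: (pt_in (pt_meas pu) s).
exact: (pt_in (pt_meas pv) s).
Qed.

End RunningCost.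

(** * Adjoints and expectations *)

Section Adjoints.
Context (R : realType).

Lemma inner_adjT p q (A : 'M[R]_(p, q)) (y : 'cV[R]_p) (x : 'cV[R]_q) :
  inner (A^T *m y) x = inner y (A *m x).
Proof. by rewrite inner_adj trmxK. Qed.

Lemma gappB m r (ga : 'I_r -> R -> 'M[R]_m) t (z z' : 'M[R]_(m, r)) :
  gapp ga t (z - z') = gapp ga t z - gapp ga t z'.
Proof.
rewrite /gapp -sumrB; apply: eq_bigr => j _.
by rewrite -mulmxBr; congr (_ *m _); apply/matrixP => i i'; rewrite !mxE.
Qed.

Lemma gappT_adj m r (ga : 'I_r -> R -> 'M[R]_m) t (y : 'cV[R]_m) (z : 'M[R]_(m, r)) :
  inner (gappT ga t y) z = inner y (gapp ga t z).
Proof.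
rewrite innerE exchange_big /=.
transitivity (\sum_j inner y (ga j t *m col j z)).
  apply: eq_bigr => j _; rewrite -inner_adjT inner_col.
  by apply: eq_bigr => i _; rewrite !mxE.
rewrite /gapp; elim/big_ind2: _ => [|x1 x2 y1 y2 -> ->|//]; first by rewrite inner0r.
by rewrite innerDr.
Qed.

End Adjoints.

Section Means.
Context (R : realType) (d : measure_display) (Omega : measurableType d)
  (P : probability Omega R).

Definition L2m p q (X : Omega -> 'M[R]_(p, q)) := forall i j, L2 P (fun o => X o i j).

Lemma L2mD p q (X Y : Omega -> 'M[R]_(p, q)) : L2m X -> L2m Y -> L2m (fun o => X o + Y o).
Proof. by move=> LX LY i j; apply: L2_eq (L2D (LX i j) (LY i j)) => o; rewrite mxE. Qed.

Lemma L2mB p q (X Y : Omega -> 'M[R]_(p, q)) : L2m X -> L2m Y -> L2m (fun o => X o - Y o).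
Proof. by move=> LX LY i j; apply: L2_eq (L2B (LX i j) (LY i j)) => o; rewrite !mxE. Qed.

Lemma L2m_cst p q (A : 'M[R]_(p, q)) : L2m (fun=> A).
Proof. by move=> i j; exact: L2_cst. Qed.

Lemma L2m_mul p q s (A : 'M[R]_(p, q)) (X : Omega -> 'M[R]_(q, s)) : L2m X ->
  L2m (fun o => A *m X o).
Proof.
move=> LX i j; apply: (L2_eq (f := fun o => \sum_l A i l * X o l j)).
  by move=> o; rewrite mxE.
by apply: L2_sum => l _; exact: L2Z.
Qed.

Lemma L2m_gappT m r (ga : 'I_r -> R -> 'M[R]_m) t (X : Omega -> 'cV[R]_m) : L2m X ->
  L2m (fun o => gappT ga t (X o)).
Proof.
by move=> LX i j; apply: L2_eq (L2m_mul (ga j t)^T LX i 0) => o; rewrite [RHS]mxE.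
Qed.

Lemma inner_L2m p q (X Y : Omega -> 'M[R]_(p, q)) : L2m X -> L2m Y ->
  L1 P (fun o => inner (X o) (Y o)).
Proof.
move=> LX LY; apply: (L1_eq (f := fun o => \sum_i \sum_j X o i j * Y o i j)).
  by move=> o; rewrite innerE.
by apply: L1_sum => i _; apply: L1_sum => j _; exact: L2M.
Qed.

Lemma mean_mul p q s (A : 'M[R]_(p, q)) (X : Omega -> 'M[R]_(q, s)) : L2m X ->
  mean P (fun o => A *m X o) = A *m mean P X.
Proof.
move=> LX; apply/matrixP => i j; rewrite meanE mxE.
under eq_Rintegral => o _ do rewrite mxE.
rewrite int_sum => [|l _]; last by apply: L1Z; exact: L2_L1.
by apply: eq_bigr => l _; rewrite intZ ?meanE//; exact: L2_L1.
Qed.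

Lemma meanB p q (X Y : Omega -> 'M[R]_(p, q)) : L2m X -> L2m Y ->
  mean P (fun o => X o - Y o) = mean P X - mean P Y.
Proof.
move=> LX LY; apply/matrixP => i j; rewrite [RHS]mxE [X in _ = _ + X]mxE !meanE.
under eq_Rintegral => o _ do rewrite !mxE.
by rewrite intB//; exact: L2_L1.
Qed.

Lemma mean_gappT m r (ga : 'I_r -> R -> 'M[R]_m) t (X : Omega -> 'cV[R]_m) : L2m X ->
  mean P (fun o => gappT ga t (X o)) = gappT ga t (mean P X).
Proof.
move=> LX; apply/matrixP => i j; rewrite [RHS]mxE -mean_mul// !meanE.
by apply: eq_Rintegral => o _; rewrite mxE.
Qed.

(** Exchanging the expectation between the two sides of an inner product
    leaves its expectation unchanged. *)
Definition swap p q (Q Y : Omega -> 'M[R]_(p, q)) (o : Omega) : R :=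
  inner (Q o) (mean P Y) - inner (mean P Q) (Y o).

Lemma swap_int p q (Q Y : Omega -> 'M[R]_(p, q)) : L2m Q -> L2m Y ->
  L1 P (swap Q Y) /\ \int[P]_o swap Q Y o = 0.
Proof.
move=> LQ LY; have J1 := inner_L2m LQ (L2m_cst (mean P Y)).
have J2 := inner_L2m (L2m_cst (mean P Q)) LY.
split; first exact: L1B.
rewrite intB//; apply/eqP; rewrite subr_eq0; apply/eqP.
under eq_Rintegral => o _ do rewrite innerE.
under [RHS]eq_Rintegral => o _ do rewrite innerE.
rewrite !int_sum; last 2 first.
- by move=> i _; apply: L1_sum => j _; exact: L2M (L2_cst P _) (LY i j).
- by move=> i _; apply: L1_sum => j _; exact: L2M (LQ i j) (L2_cst P _).
apply: eq_bigr => i _; rewrite !int_sum; last 2 first.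
- by move=> j _; exact: L2M (L2_cst P _) (LY i j).
- by move=> j _; exact: L2M (LQ i j) (L2_cst P _).
apply: eq_bigr => j _.
rewrite intZ; last exact: L2_L1.
under eq_Rintegral => o _ do rewrite mulrC.
rewrite intZ; last exact: L2_L1.
by rewrite !meanE mulrC.
Qed.

End Means.

Section Transfer.
Context (R : realType) (d : measure_display) (Omega : measurableType d)
  (P : probability Omega R) (T : R) (F : R -> set (set Omega)).
Hypothesis T0 : 0 < T.

Lemma eqT_adaptedL2 p q (X Y : R -> Omega -> 'M[R]_(p, q)) :
  (forall t o, 0 <= t <= T -> X t o = Y t o) -> adaptedL2 P T F X -> adaptedL2 P T F Y.
Proof.
move=> E nX i j; have [LX mX] := nX i j; split.
  exact: (eqT_mPL2 E (adaptedL2_mPL2 nX) i j).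
move=> t tT; rewrite (_ : (fun o => Y t o i j) = (fun o => X t o i j)); first exact: mX.
by apply/funext => o; rewrite E.
Qed.

Lemma adaptedL2_subfilt (G : R -> set (set Omega)) p q (X : R -> Omega -> 'M[R]_(p, q)) :
  (forall t, 0 <= t <= T -> G t `<=` F t) -> adaptedL2 P T G X -> adaptedL2 P T F X.
Proof.
move=> GF nX i j; have [LX mX] := nX i j; split=> // t tT B mB.
by apply: (GF t tT); exact: mX.
Qed.

Lemma adaptedL2_slices p q (X : R -> Omega -> 'M[R]_(p, q)) : mPL2 P T X ->
  {ae (@lebesgue_measure R), forall t : measurableTypeR R, 0 <= t <= T -> L2m P (X t)}.
Proof.
move=> LX.
have H i j := PL2_slice (LX i j).
have {}H : {ae (@lebesgue_measure R), forall t : measurableTypeR R, forall i j,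
    0 <= t <= T -> L2 P (fun o => X t o i j)}.
  by apply: filter_forall => i; apply: filter_forall => j; exact: H.
by apply: ae_timeS H => t Ht tT i j; exact: Ht.
Qed.

Lemma sigma_path_sub (V : topologicalType) (Y : R -> Omega -> V) t :
  complete_filtration P T F -> 0 <= t <= T -> adapted T F Y -> sigma_path Y t `<=` F t.
Proof.
move=> cF /andP[t0 tT] aY.
have tT' : 0 <= t <= T by rewrite t0.
apply: smallest_sub; first exact: (filtr_sigma cF tT').
move=> A [s [/andP[s0 st] [B bB ->]]].
have sT : 0 <= s <= T by rewrite s0 (le_trans st).
have [_ _ H _] := cF; apply: (H s t) => //.
exact: aY.
Qed.

Lemma control_adaptedL2 k (v : R -> Omega -> 'cV[R]_k) : joint_meas T v -> adapted T F v ->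
  (\int[P]_o ereal_sup [set (sqn (v t o))%:E | t in `[0%R, T]] < +oo)%E ->
  adaptedL2 P T F v.
Proof.
move=> jv av sv i j; split; first exact: (sup_PL2 T0 jv sv i j).
by move=> t tT; apply: meas_wrt_coord; exact: av.
Qed.

End Transfer.

(** * The terminal and initial costs *)

Section ConvexDifferentiable.
Context (R : realType).

Lemma differentiable_gradient (V : normedModType R) (f : V -> R) x y :
  (forall x, differentiable f x) -> @convex_function R V setT f ->
  'd f x (y - x) <= f y - f x.
Proof.
move=> df cf; apply: (convex_gradient (differentiable_diff_within df) cf) => //.
by move=> z c h; rewrite linearZ.
Qed.

Context (d : measure_display) (Omega : measurableType d) (P : probability Omega R).

Lemma continuous_meas p (f : 'cV[R]_p -> R) (X : Omega -> 'cV[R]_p) : continuous f ->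
  (forall i, measurable_fun setT (fun o => X o i 0)) ->
  measurable_fun setT (fun o => f (X o)).
Proof.
move=> cf mX; apply: (@Caratheodory_meas R _ _ Omega setT X (fun _ => f)) => //.
- exact: dense_mx.
- by apply: dist_meas_mx => i j; rewrite (ord1 j).
- by move=> o v _; rewrite withinET; exact: cf.
Qed.

Lemma L2m_abs1 p (X : Omega -> 'cV[R]_p) : L2m P X -> L2 P (fun o => abs1 (X o)).
Proof. by move=> LX; apply: L2_sum => i _; apply: L2_norm; exact: LX. Qed.

End ConvexDifferentiable.

Section EndCosts.
Context (R : realType) (n m r rt k : nat) (M : model R n m r rt k)
  (d : measure_display) (Omega : measurableType d) (P : probability Omega R).
Let V := ('cV[R]_n * 'cV[R]_n)%type.

Section Terminal.
Hypothesis ok : terminal_cost_ok M.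
Hypothesis cphi : @convex_function R V setT (fun q => mphi M q.1 q.2).

Let dphi (q : V) : differentiable (fun q : V => mphi M q.1 q.2) q.
Proof. by have [H _ _ _] := ok. Qed.

Let pairc (c : 'cV[R]_n) : continuous (fun x : 'cV[R]_n => (x, c)).
Proof. by move=> x; exact: (cvg_pair (@cvg_id _ (nbhs x)) (cvg_cst c)). Qed.

Lemma terminal_L1 (x : Omega -> 'cV[R]_n) c : L2m P x -> L1 P (fun o => mphi M (x o) c).
Proof.
move=> Lx; have [_ _ _ [C C0 bnd]] := ok.
have mf : measurable_fun setT (fun o => mphi M (x o) c).
  apply: (@continuous_meas _ _ _ _ (fun z => mphi M z c)) => [z|i]; last exact: L2_meas (Lx i 0).
  have H := differentiable_continuous (dphi (z, c)).
  exact: (cvg_comp _ _ (pairc (x := z)) H).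
have LB := L2D (L2D (L2_cst P 1) (L2m_abs1 Lx)) (L2_cst P (abs1 c)).
apply: (L1_le mf _ (L1Z C (L2_sq LB))) => o.
have [H _] := bnd (x o) c; apply: (le_trans H); rewrite ler_wpM2l ?(ltW C0)//.
have := sqn_le_abs1 (x o); have := sqn_le_abs1 c.
have := abs1_ge0 (x o); have := abs1_ge0 c; move: (abs1 _) (abs1 _) (sqn _) (sqn _).
by move=> a b a' b'; nra.
Qed.

Let grad_L2m (g : 'cV[R]_n -> 'cV[R]_n -> 'cV[R]_n) (C : R) (x : Omega -> 'cV[R]_n) c :
  0 < C -> continuous (fun q : V => g q.1 q.2) -> L2m P x ->
  (forall z c, enorm (g z c) <= C * (1 + enorm z + enorm c)) ->
  L2m P (fun o => g (x o) c).
Proof.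
move=> C0 cg Lx bnd i j; rewrite (ord1 j).
have mf : measurable_fun setT (fun o => g (x o) c i 0).
  apply: (@continuous_meas _ _ _ _ (fun z => g z c i 0)) => [z|i']; last exact: L2_meas (Lx i' 0).
  have H := cvg_comp _ _ (pairc (x := z)) (cg (z, c)).
  exact: (cvg_comp _ _ H (@coord_continuous R n 1 i 0 (g z c))).
have LB := L2D (L2D (L2_cst P 1) (L2m_abs1 Lx)) (L2_cst P (abs1 c)).
apply: (L2_le mf _ (L2Z C LB)) => o.
apply: (le_trans (abs_le_enorm _ _ _)); apply: (le_trans (bnd _ _)).
rewrite normrM (gtr0_norm C0) ler_wpM2l ?(ltW C0)//.
by rewrite ger0_norm ?addr_ge0 ?abs1_ge0// !lerD ?enorm_le_abs1.
Qed.

Let bounds : exists2 C : R, 0 < C & forall z c,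
  enorm (phix M z c) <= C * (1 + enorm z + enorm c) /\
  enorm (phixb M z c) <= C * (1 + enorm z + enorm c).
Proof.
have [_ _ _ [C C0 bnd]] := ok; exists C => // z c; have [_ H] := bnd z c.
have e0 p (a : 'cV[R]_p) : 0 <= enorm a by exact: sqrtr_ge0.
move: H (e0 _ (phix M z c)) (e0 _ (phixb M z c)).
by move: (enorm (phix M z c)) (enorm (phixb M z c)) (C * _) => a b K H a0 b0; split; lra.
Qed.

Lemma phix_L2m (x : Omega -> 'cV[R]_n) c : L2m P x -> L2m P (fun o => phix M (x o) c).
Proof.
have [C C0 bnd] := bounds; have [_ c1 _ _] := ok.
by move=> Lx; exact: (grad_L2m (g := phix M) c C0 c1 Lx (fun z c' => (bnd z c').1)).
Qed.

Lemma phixb_L2m (x : Omega -> 'cV[R]_n) c : L2m P x -> L2m P (fun o => phixb M (x o) c).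
Proof.
have [C C0 bnd] := bounds; have [_ _ c1 _] := ok.
by move=> Lx; exact: (grad_L2m (g := phixb M) c C0 c1 Lx (fun z c' => (bnd z c').2)).
Qed.

Lemma terminal_slope (xu xv : Omega -> 'cV[R]_n) cu cv : L2m P xu -> L2m P xv ->
  \int[P]_o (inner (phix M (xu o) cu) (xv o - xu o) +
             inner (phixb M (xu o) cu) (cv - cu)) <=
  \int[P]_o mphi M (xv o) cv - \int[P]_o mphi M (xu o) cu.
Proof.
move=> Lu Lv; rewrite -intB; [|exact: terminal_L1|exact: terminal_L1].
apply: int_le.
- apply: L1D; first exact: inner_L2m (phix_L2m cu Lu) (L2mB Lv Lu).
  exact: inner_L2m (phixb_L2m cu Lu) (L2m_cst P _).
- by apply: L1B; exact: terminal_L1.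
- move=> o; have := differentiable_gradient (xu o, cu) (xv o, cv) dphi cphi.
  by rewrite diff_pair_grad.
Qed.

End Terminal.

Section Initial.
Hypothesis ok : initial_cost_ok M.
Hypothesis cvphi : @convex_function R 'cV[R]_m setT (mvphi M).

Lemma initial_L1 (y : Omega -> 'cV[R]_m) : L2m P y -> L1 P (fun o => mvphi M (y o)).
Proof.
move=> Ly; have [df _ [C C0 bnd]] := ok.
have mf : measurable_fun setT (fun o => mvphi M (y o)).
  apply: continuous_meas => [z|i]; last exact: L2_meas (Ly i 0).
  exact: (differentiable_continuous (df z)).
have LB := L2D (L2_cst P 1) (L2m_abs1 Ly).
apply: (L1_le mf _ (L1Z C (L2_sq LB))) => o.
have [H _] := bnd (y o); apply: (le_trans H); rewrite ler_wpM2l ?(ltW C0)//.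
have := sqn_le_abs1 (y o); have := abs1_ge0 (y o); move: (abs1 _) (sqn _).
by move=> a a'; nra.
Qed.

Lemma vphiy_meas (y : Omega -> 'cV[R]_m) : L2m P y ->
  forall i, measurable_fun setT (fun o => vphiy M (y o) i 0).
Proof.
move=> Ly i; have [_ c1 _] := ok.
apply: (@continuous_meas _ _ _ _ (fun z => vphiy M z i 0)) => [z|i']; last exact: L2_meas (Ly i' 0).
exact: (cvg_comp _ _ (c1 z) (@coord_continuous R m 1 i 0 (vphiy M z))).
Qed.

Lemma initial_slope (yu yv : Omega -> 'cV[R]_m) : L2m P yu -> L2m P yv ->
  L2m P (fun o => vphiy M (yu o)) ->
  \int[P]_o inner (vphiy M (yu o)) (yv o - yu o) <=
  \int[P]_o mvphi M (yv o) - \int[P]_o mvphi M (yu o).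
Proof.
move=> Lu Lv Lg; have [df _ _] := ok.
rewrite -intB; [|exact: initial_L1|exact: initial_L1].
apply: int_le.
- exact: inner_L2m Lg (L2mB Lv Lu).
- by apply: L1B; exact: initial_L1.
- move=> o; have := differentiable_gradient (yu o) (yv o) df cvphi.
  by rewrite diff_inner_grad.
Qed.

End Initial.
End EndCosts.

(** * State and observation of an admissible control *)

Section Verification.
Context (R : realType) (n m r rt k : nat) (M : model R n m r rt k)
  (d : measure_display) (Omega : measurableType d)
  (P : probability Omega R) (F : R -> set (set Omega))
  (w : R -> Omega -> 'cV[R]_r) (wt : R -> Omega -> 'cV[R]_rt)
  (xi : Omega -> 'cV[R]_n)
  (x0 : R -> Omega -> 'cV[R]_n) (Y0 : R -> Omega -> 'cV[R]_rt)
  (bt : R -> 'M[R]_(n, k)) (bb : R -> 'cV[R]_n)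
  (psit : R -> 'M[R]_(m, k)) (psib : R -> 'cV[R]_m).
Notation T := (mT M).
Notation lam := (@lebesgue_measure R).
Notation LP := (lam \x P)%E.
Notation E := (mean P).
Hypotheses (mok : model_ok M) (bok : basis_ok M P F w wt xi)
  (unc : uncontrolled_eq M P F w wt xi x0 Y0)
  (gfin : forall v, Uad0 M P Y0 v -> (sqint P T (fun t o => mg M t (v t o)) < +oo)%E)
  (Lbt : Linf T bt) (Lbb : Linf T bb) (Lpsit : Linf T psit) (Lpsib : Linf T psib)
  (mbE : forall t v, 0 <= t <= T -> mb M t v = bt t *m v + bb t)
  (mpsiE : forall t v, 0 <= t <= T -> mpsi M t v = psit t *m v + psib t).

Lemma model_T0 : 0 < T. Proof. by have [[[? _] _ _ _] _] := mok. Qed.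
Let T0 := model_T0.
Let cF : complete_filtration P T F. Proof. by case: bok. Qed.
Let bW : brownian P T F (fun t o => col_mx (w t o) (wt t o)). Proof. by case: bok. Qed.
Let sF t : 0 <= t <= T -> sigma_algebra setT (F t). Proof. by move=> tT; exact: (filtr_sigma cF tT). Qed.

Section Admissible.
Context (v : R -> Omega -> 'cV[R]_k) (x : R -> Omega -> 'cV[R]_n)
  (y : R -> Omega -> 'cV[R]_m) (z : R -> Omega -> 'M[R]_(m, r))
  (zt : R -> Omega -> 'M[R]_(m, rt)) (Y : R -> Omega -> 'cV[R]_rt).
Hypothesis adm : admissible M P F w wt xi Y0 v x y z zt Y.

Lemma admissible_in t o : 0 <= t <= T -> mU M (v t o).
Proof. by have [[_ _ H _] _ _ _] := adm; exact: H. Qed.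

Lemma observation_adapted : adapted T F Y.
Proof. by have [_ _ [[aY _] _] _] := adm. Qed.

Lemma admissible_obs_adaptedL2 : adaptedL2 P T (sigma_path Y) v.
Proof. by have [[jv _ _ sv] _ _ av] := adm; exact: (control_adaptedL2 T0 jv av sv). Qed.

Lemma admissible_adaptedL2 : adaptedL2 P T F v.
Proof.
apply: (adaptedL2_subfilt _ admissible_obs_adaptedL2) => t tT.
exact: (sigma_path_sub cF tT observation_adapted).
Qed.

Lemma state_adaptedL2 : [/\ adaptedL2 P T F x, adaptedL2 P T F y, adaptedL2 P T F z & adaptedL2 P T F zt].
Proof. by have [_ [[? ? ? ?] _] _ _] := adm; split; exact: L2F_adaptedL2. Qed.

Let nX : adaptedL2 P T F x. Proof. by case: state_adaptedL2. Qed.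
Let nY : adaptedL2 P T F y. Proof. by case: state_adaptedL2. Qed.
Let nZ : adaptedL2 P T F z. Proof. by case: state_adaptedL2. Qed.
Let nZt : adaptedL2 P T F zt. Proof. by case: state_adaptedL2. Qed.

Let diff_of p (X D D' : R -> Omega -> 'cV[R]_p) (Z : R -> Omega -> 'M[R]_(p, r))
    (Zt : R -> Omega -> 'M[R]_(p, rt)) :
  has_differential P T F w wt X D Z Zt -> adaptedL2 P T F X -> adaptedL2 P T F D' ->
  adaptedL2 P T F Z -> adaptedL2 P T F Zt -> (forall t o, 0 <= t <= T -> D' t o = D t o) ->
  L2_differential P T F w wt X D Z Zt.
Proof.
move=> dX nX' nD' nZ' nZt' eD; have nD := eqT_adaptedL2 eD nD'; split=> //.
- exact: adaptedL2_mPL2.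
- exact: adaptedL2_mPL2.
- by split; exact: adaptedL2_mPL2.
- by move=> t i tT; have [_] := nD i 0; exact.
Qed.

Lemma state_differential : L2_differential P T F w wt x
  (fun t o => ma M t *m x t o + ma_b M t *m E (x t) + mb M t (v t o))
  (fun t o => mc M t) (fun t o => 0).
Proof.
have [_ [_ [dx _ _ _]] _ _] := adm.
have [[[_ [[La Lab Lc] _]] _ _ _] _] := mok.
apply: (@diff_of _ _ _ (fun t o => ma M t *m x t o + ma_b M t *m E (x t) + (bt t *m v t o + bb t)) _ _ dx) => //.
- exact (adaptedL2D sF (adaptedL2D sF (adaptedL2_mul sF La nX) (adaptedL2_mul sF Lab (adaptedL2_mean sF nX)))
    (adaptedL2D sF (adaptedL2_mul sF Lbt admissible_adaptedL2) (adaptedL2_det P T0 sF Lbb))).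
- exact: (adaptedL2_det P T0 sF).
- exact: (adaptedL20 P sF).
- by move=> t o tT; rewrite mbE.
Qed.

Lemma backward_differential : L2_differential P T F w wt y
  (fun t o => - (mal M t *m x t o + mal_b M t *m E (x t)
                 + mbe M t *m y t o + mbe_b M t *m E (y t)
                 + gapp (mga M) t (z t o) + gapp (mga_b M) t (E (z t))
                 + gapp (mgat M) t (zt t o) + gapp (mgat_b M) t (E (zt t))
                 + mpsi M t (v t o))) z zt.
Proof.
have [_ [_ [_ dy _ _]] _ _] := adm.
have [[[_ [_ [[Lal Lalb Lbe Lbeb] [[Lga Lgab Lgat Lgatb] _]]]] _ _ _] _] := mok.
apply: (@diff_of _ _ _ (fun t o => - (mal M t *m x t o + mal_b M t *m E (x t)
                 + mbe M t *m y t o + mbe_b M t *m E (y t)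
                 + gapp (mga M) t (z t o) + gapp (mga_b M) t (E (z t))
                 + gapp (mgat M) t (zt t o) + gapp (mgat_b M) t (E (zt t))
                 + (psit t *m v t o + psib t))) _ _ dy) => //.
- exact (adaptedL2N sF (adaptedL2D sF (adaptedL2D sF (adaptedL2D sF (adaptedL2D sF (adaptedL2D sF (adaptedL2D sF (adaptedL2D sF (adaptedL2D sF
    (adaptedL2_mul sF Lal nX) (adaptedL2_mul sF Lalb (adaptedL2_mean sF nX)))
    (adaptedL2_mul sF Lbe nY)) (adaptedL2_mul sF Lbeb (adaptedL2_mean sF nY)))
    (adaptedL2_gapp sF Lga nZ)) (adaptedL2_gapp sF Lgab (adaptedL2_mean sF nZ)))
    (adaptedL2_gapp sF Lgat nZt)) (adaptedL2_gapp sF Lgatb (adaptedL2_mean sF nZt)))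
    (adaptedL2D sF (adaptedL2_mul sF Lpsit admissible_adaptedL2) (adaptedL2_det P T0 sF Lpsib)))).
- by move=> t o tT; rewrite mpsiE.
Qed.

Let mgok : forall B, borel B ->
  borel [set q : (R * 'cV[R]_k)%type | 0 <= q.1 <= T /\ B (mg M q.1 q.2)].
Proof. by have [[[_ [_ [_ [_ [_ H]]]]] _ _ _] _] := mok. Qed.

(** The control at each time is a function of the path of its own observation,
    hence so is its drift in the observation. *)
Lemma obs_drift_adaptedL2 : adaptedL2 P T (sigma_path Y) (fun t o => mg M t (v t o)).
Proof.
have nv := admissible_obs_adaptedL2.
have jg : joint_meas T (fun t o => mg M t (v t o)).
  move=> B bB.
  (* Outside the time interval the control need not be measurable. *)
  pose v' (s : measurableTypeR R * Omega) := if 0 <= s.1 <= T then v s.1 s.2 else 0.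
  have mv' i : measurable_fun setT (fun s => v' s i 0).
    have [[Lv _] _] := nv i 0.
    rewrite (_ : (fun s => v' s i 0) = trim T (fun t o => v t o i 0))//.
    by apply/funext => s; rewrite /v' /trim; case: ifP => // _; rewrite mxE.
  have := borel_graph_meas mgok measurable_fst mv' bB; congr measurable.
  apply/seteqP; split=> s /= [sT]; by rewrite /v' sT.
have [adm0 _ _ _] := adm.
move=> i j; split; first exact: (sqint_PL2 i j jg (gfin adm0)).
move=> t tT; apply: meas_wrt_coord => B bB.
pose OG := g_sigma_algebraType (sigma_path Y t).
have mvt i' : measurable_fun (setT : set OG) (fun o : OG => v t o i' 0).
  by apply/(gmeasP (sigma_path_sigma Y t)); have [_] := nv i' 0; exact.
have := @borel_graph_meas R _ T k rt OG (fun=> t) (v t) (mg M) B mgok (measurable_cst t) mvt bB.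
rewrite (sub_measurableE (sigma_path_sigma Y t)); congr (sigma_path Y t _).
by apply/seteqP; split=> o /=; [case|].
Qed.

(** This is observation_filtration for the model: the drift of the forward state
    is affine in the state and in the control. *)
Lemma free_filtration t : 0 <= t <= T ->
  sigma_path Y0 t `<=` completion P (sigma_path Y t).
Proof.
move=> tT.
have [Lx0 dx0 x00 dY0 Y00] := unc.
have [_ [_ [_ _ xx _]] [dY YY] _] := adm.
have [dx Lx LDx [Lc L0] _] := state_differential.
have [[[_ [[La Lab Lc'] [_ [_ [[Lf Lfb Lh _ _] _]]]]] _ _ _] _] := mok.
have nx0 := L2F_adaptedL2 Lx0.
have nD0 : adaptedL2 P T F (fun t o => ma M t *m x0 t o + ma_b M t *m E (x0 t)).
  exact (adaptedL2D sF (adaptedL2_mul sF La nx0) (adaptedL2_mul sF Lab (adaptedL2_mean sF nx0))).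
have d0 : L2_differential P T F w wt x0 (fun t o => ma M t *m x0 t o + ma_b M t *m E (x0 t))
    (fun t o => mc M t) (fun t o => 0).
  exact (diff_of dx0 nx0 nD0 (adaptedL2_det P T0 sF Lc') (adaptedL20 P sF (p := n) (q := rt)) (fun _ _ _ => erefl)).
have nDY0 : adaptedL2 P T F (fun t o => mf M t *m x0 t o + mf_b M t *m E (x0 t)).
  exact (adaptedL2D sF (adaptedL2_mul sF Lf nx0) (adaptedL2_mul sF Lfb (adaptedL2_mean sF nx0))).
have ng : adaptedL2 P T F (fun t o => mg M t (v t o)).
  apply: (adaptedL2_subfilt _ obs_drift_adaptedL2) => s sT.
  exact: (sigma_path_sub cF sT observation_adapted).
have nDY : adaptedL2 P T F (fun t o => mf M t *m x t o + mf_b M t *m E (x t) + mg M t (v t o)).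
  exact (adaptedL2D sF (adaptedL2D sF (adaptedL2_mul sF Lf nX) (adaptedL2_mul sF Lfb (adaptedL2_mean sF nX))) ng).
have sY s : 0 <= s <= T -> sigma_algebra setT (sigma_path Y s).
  by move=> _; exact: sigma_path_sigma.
have nV : adaptedL2 P T (sigma_path Y) (fun t o => bt t *m v t o + bb t).
  exact (adaptedL2D sY (adaptedL2_mul sY Lbt admissible_obs_adaptedL2) (adaptedL2_det P T0 sY Lbb)).
apply: (observation_filtration T0 cF bW Lc L0 (adaptedL2_mPL2 (adaptedL20 P sF (p := rt) (q := r)))
  (adaptedL2_mPL2 (adaptedL2_det P T0 sF Lh)) LDx (adaptedL2_mPL2 nD0) (adaptedL2_mPL2 nDY) (adaptedL2_mPL2 nDY0)
  dx dx0 dY dY0 _ YY Y00 _ _ _ _ _ _ nV obs_drift_adaptedL2 La tT).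
- by apply: filterS (ae_and xx x00) => o [-> ->].
- by move=> s j sT; exact: (differential_L2 T0 cF bW state_differential j sT).
- by move=> s j sT; exact: (differential_L2 T0 cF bW d0 j sT).
- by move=> s o sT; rewrite mbE.
- by [].
- by [].
- by [].
Qed.

End Admissible.
End Verification.

(** * The algebra of the duality *)

Section DualityAlgebra.
Context (R : realType) (n m r rt k : nat).
Context (a ab : 'M[R]_n) (al alb : 'M[R]_(m, n)) (be beb : 'M[R]_m)
  (ga gab : 'I_r -> R -> 'M[R]_m) (gat gatb : 'I_rt -> R -> 'M[R]_m) (t : R)
  (B : 'M[R]_(n, k)) (Psi : 'M[R]_(m, k)) (bb : 'cV[R]_n) (sb : 'cV[R]_m)
  (p lx lxb eQ : 'cV[R]_n) (q c : 'M[R]_(n, r)) (qt : 'M[R]_(n, rt)) (kk ek : 'cV[R]_m)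
  (lv : 'cV[R]_k).

Let Dp := - (a^T *m p + lx + eQ - al^T *m kk - alb^T *m ek).
Let Dk := be^T *m kk + beb^T *m ek.
Let Vk := gappT ga t kk + gappT gab t ek.
Let Vkt := gappT gat t kk + gappT gatb t ek.

(** The integrands of the products of the costate with the forward state and of
    the multiplier with the backward state. *)
Definition pair_int (x ex : 'cV[R]_n) (y ey : 'cV[R]_m) (z ez : 'M[R]_(m, r))
    (zt ezt : 'M[R]_(m, rt)) (v : 'cV[R]_k) : R :=
  (inner p (a *m x + ab *m ex + (B *m v + bb)) + inner Dp x + inner q c + inner qt 0) +
  (inner kk (- (al *m x + alb *m ex + be *m y + beb *m ey + gapp ga t z + gapp gab t ez +
                gapp gat t zt + gapp gatb t ezt + (Psi *m v + sb))) +
   inner Dk y + inner Vk z + inner Vkt zt).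

(** The adjoint equation is designed so that, in the difference of two such
    integrands, all products with the states cancel, up to terms in which an
    expectation has changed sides. *)
Lemma pair_int_diff x ex y ey z ez zt ezt v x' ex' y' ey' z' ez' zt' ezt' v' :
  pair_int x' ex' y' ey' z' ez' zt' ezt' v' - pair_int x ex y ey z ez zt ezt v +
    (inner lx (x' - x) + inner lxb (ex' - ex) + inner lv (v' - v)) =
  (inner (B *m (v' - v)) p - inner (Psi *m (v' - v)) kk + inner lv (v' - v)) +
  (inner (ab^T *m p + lxb) (ex' - ex) - inner eQ (x' - x)) -
  (inner (alb^T *m kk) (ex' - ex) - inner (alb^T *m ek) (x' - x)) -
  (inner (beb^T *m kk) (ey' - ey) - inner (beb^T *m ek) (y' - y)) -
  (inner (gappT gab t kk) (ez' - ez) - inner (gappT gab t ek) (z' - z)) -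
  (inner (gappT gatb t kk) (ezt' - ezt) - inner (gappT gatb t ek) (zt' - zt)).
Proof.
rewrite /pair_int /Dp /Dk /Vk /Vkt (innerC (B *m _)) (innerC (Psi *m _)).
rewrite !(innerBl, innerDl, innerNl, inner_adjT, gappT_adj).
rewrite !(innerBr, innerDr, innerNr, mulmxBr, gappB, inner_adjT).
by ring.
Qed.

End DualityAlgebra.

(** * Optimality *)

Section Duality.
Context (R : realType) (n m r rt k : nat) (M : model R n m r rt k)
  (d : measure_display) (Omega : measurableType d)
  (P : probability Omega R) (F : R -> set (set Omega))
  (w : R -> Omega -> 'cV[R]_r) (wt : R -> Omega -> 'cV[R]_rt)
  (xi : Omega -> 'cV[R]_n)
  (x0 : R -> Omega -> 'cV[R]_n) (Y0 : R -> Omega -> 'cV[R]_rt)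
  (bt : R -> 'M[R]_(n, k)) (bb : R -> 'cV[R]_n)
  (psit : R -> 'M[R]_(m, k)) (psib : R -> 'cV[R]_m)
  (u : R -> Omega -> 'cV[R]_k)
  (xu : R -> Omega -> 'cV[R]_n) (yu : R -> Omega -> 'cV[R]_m)
  (zu : R -> Omega -> 'M[R]_(m, r)) (ztu : R -> Omega -> 'M[R]_(m, rt))
  (Yu : R -> Omega -> 'cV[R]_rt)
  (kk : R -> Omega -> 'cV[R]_m) (p : R -> Omega -> 'cV[R]_n)
  (q : R -> Omega -> 'M[R]_(n, r)) (qt : R -> Omega -> 'M[R]_(n, rt)).
Notation T := (mT M).
Notation lam := (@lebesgue_measure R).
Notation LP := (lam \x P)%E.
Notation E := (mean P).
Hypotheses (mok : model_ok M) (bok : basis_ok M P F w wt xi)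
  (unc : uncontrolled_eq M P F w wt xi x0 Y0)
  (gfin : forall v, Uad0 M P Y0 v -> (sqint P T (fun t o => mg M t (v t o)) < +oo)%E)
  (ccx : costs_convex M)
  (Lbt : Linf T bt) (Lbb : Linf T bb) (Lpsit : Linf T psit) (Lpsib : Linf T psib)
  (mbE : forall t v, 0 <= t <= T -> mb M t v = bt t *m v + bb t)
  (mpsiE : forall t v, 0 <= t <= T -> mpsi M t v = psit t *m v + psib t)
  (admu : admissible M P F w wt xi Y0 u xu yu zu ztu Yu)
  (adj : adjoint_eq M P F w wt u xu yu kk p q qt)
  (minc : minimum_condition M P u xu yu zu ztu Yu kk p q).
Context (lv : R -> 'cV[R]_n -> 'cV[R]_n -> 'cV[R]_k -> 'cV[R]_k) (C : R).
Hypothesis ok : grad_ok M lv C.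
Hypothesis ml_meas : forall x xb v, mU M v ->
  measurable_fun (`[0, T] : set (measurableTypeR R)) (fun t => ml M t x xb v : measurableTypeR R).

Let T0 : 0 < T := model_T0 mok.
Let cF : complete_filtration P T F. Proof. by case: bok. Qed.
Let bW : brownian P T F (fun t o => col_mx (w t o) (wt t o)). Proof. by case: bok. Qed.
Let sF t : 0 <= t <= T -> sigma_algebra setT (F t).
Proof. by move=> tT; exact: (filtr_sigma cF tT). Qed.
Let cU : @convex_set R 'cV[R]_k (mU M). Proof. by have [[_ _ _ [_ ?]] _] := mok. Qed.
Let Uex : exists v, mU M v. Proof. by have [[_ _ _ [[v Uv] _]] _] := mok; exists v. Qed.

Let nu := admissible_adaptedL2 mok bok admu.
Let Uu := admissible_in admu.
Let nxu : adaptedL2 P T F xu. Proof. by case: (state_adaptedL2 admu). Qed.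
Let nkk : adaptedL2 P T F kk. Proof. by have [[? ? ? ?] _] := adj; exact: L2F_adaptedL2. Qed.
Let np : adaptedL2 P T F p. Proof. by have [[? ? ? ?] _] := adj; exact: L2F_adaptedL2. Qed.
Let nq : adaptedL2 P T F q. Proof. by have [[? ? ? ?] _] := adj; exact: L2F_adaptedL2. Qed.
Let nqt : adaptedL2 P T F qt. Proof. by have [[? ? ? ?] _] := adj; exact: L2F_adaptedL2. Qed.

Let lxu t o := lx M t (xu t o) (E (xu t)) (u t o).
Let lxbu t o := lxb M t (xu t o) (E (xu t)) (u t o).

Let nlx : adaptedL2 P T F lxu.
Proof.
have [v0 Uv0] := Uex.
move=> i j; split.
  exact: (lx_mPL2 T0 ok ml_meas cU Uv0 (adaptedL2_mPL2 nxu) (adaptedL2_mPL2 nu) Uu i j).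
move=> t tT; rewrite (ord1 j).
have mx i' : gmeas (F t) (fun o => xu t o i' 0) by have [_] := nxu i' 0; exact.
have mu i' : gmeas (F t) (fun o => u t o i' 0) by have [_] := nu i' 0; exact.
by have [] := frozen_grad_gmeas P ok cU Uu (sF tT) tT mx mu i.
Qed.

Let nlxb : adaptedL2 P T F lxbu.
Proof.
have [v0 Uv0] := Uex.
move=> i j; split.
  exact: (lxb_mPL2 T0 ok ml_meas cU Uv0 (adaptedL2_mPL2 nxu) (adaptedL2_mPL2 nu) Uu i j).
move=> t tT; rewrite (ord1 j).
have mx i' : gmeas (F t) (fun o => xu t o i' 0) by have [_] := nxu i' 0; exact.
have mu i' : gmeas (F t) (fun o => u t o i' 0) by have [_] := nu i' 0; exact.
by have [] := frozen_grad_gmeas P ok cU Uu (sF tT) tT mx mu i.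
Qed.

Definition p_drift t o := - ((ma M t)^T *m p t o + lxu t o
  + E (fun o' => (ma_b M t)^T *m p t o' + lxbu t o')
  - (mal M t)^T *m kk t o - (mal_b M t)^T *m E (kk t)).

Lemma costate_differential : L2_differential P T F w wt p p_drift q qt.
Proof.
have [_ [_ dp _ _]] := adj.
have [[[_ [[La Lab Lc] [[Lal Lalb Lbe Lbeb] _]]] _ _ _] _] := mok.
have nD : adaptedL2 P T F p_drift.
  exact (adaptedL2N sF (adaptedL2B sF (adaptedL2B sF (adaptedL2D sF (adaptedL2D sF (adaptedL2_mulT sF La np) nlx)
    (adaptedL2_mean sF (adaptedL2D sF (adaptedL2_mulT sF Lab np) nlxb)))
    (adaptedL2_mulT sF Lal nkk)) (adaptedL2_mulT sF Lalb (adaptedL2_mean sF nkk)))).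
split=> //.
- exact: adaptedL2_mPL2.
- exact: adaptedL2_mPL2.
- by split; exact: adaptedL2_mPL2.
- by move=> t i tT; have [_] := nD i 0; exact.
Qed.

Definition k_drift t o := (mbe M t)^T *m kk t o + (mbe_b M t)^T *m E (kk t).
Definition k_vol t o := gappT (mga M) t (kk t o) + gappT (mga_b M) t (E (kk t)).
Definition k_volt t o := gappT (mgat M) t (kk t o) + gappT (mgat_b M) t (E (kk t)).

Lemma multiplier_differential : L2_differential P T F w wt kk k_drift k_vol k_volt.
Proof.
have [_ [dk _ _ _]] := adj.
have [[[_ [_ [[Lal Lalb Lbe Lbeb] [[Lga Lgab Lgat Lgatb] _]]]] _ _ _] _] := mok.
have nD : adaptedL2 P T F k_drift.
  exact (adaptedL2D sF (adaptedL2_mulT sF Lbe nkk) (adaptedL2_mulT sF Lbeb (adaptedL2_mean sF nkk))).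
have nV : adaptedL2 P T F k_vol.
  exact (adaptedL2D sF (adaptedL2_gappT sF Lga nkk) (adaptedL2_gappT sF Lgab (adaptedL2_mean sF nkk))).
have nVt : adaptedL2 P T F k_volt.
  exact (adaptedL2D sF (adaptedL2_gappT sF Lgat nkk) (adaptedL2_gappT sF Lgatb (adaptedL2_mean sF nkk))).
split=> //.
- exact: adaptedL2_mPL2.
- exact: adaptedL2_mPL2.
- by split; exact: adaptedL2_mPL2.
- by move=> t i tT; have [_] := nD i 0; exact.
Qed.

(** The integrand in which the product rule applied to the costate and the
    multiplier results. *)
Definition pairing (x : R -> Omega -> 'cV[R]_n) (y : R -> Omega -> 'cV[R]_m)
    (z : R -> Omega -> 'M[R]_(m, r)) (zt : R -> Omega -> 'M[R]_(m, rt))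
    (v : R -> Omega -> 'cV[R]_k) t o : R :=
  pair_int (ma M t) (ma_b M t) (mal M t) (mal_b M t) (mbe M t) (mbe_b M t)
    (mga M) (mga_b M) (mgat M) (mgat_b M) t (bt t) (psit t) (bb t) (psib t)
    (p t o) (lxu t o) (E (fun o' => (ma_b M t)^T *m p t o' + lxbu t o'))
    (q t o) (mc M t) (qt t o) (kk t o) (E (kk t))
    (x t o) (E (x t)) (y t o) (E (y t)) (z t o) (E (z t)) (zt t o) (E (zt t)) (v t o).

Lemma pairing_product v x y z zt Y : admissible M P F w wt xi Y0 v x y z zt Y ->
  L1 LP (trim T (pairing x y z zt v)) /\
  (\int[P]_o inner (p T o) (x T o) - \int[P]_o inner (p 0 o) (x 0 o)) +
  (\int[P]_o inner (kk T o) (y T o) - \int[P]_o inner (kk 0 o) (y 0 o)) =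
  \int[LP]_s trim T (pairing x y z zt v) s.
Proof.
move=> adm.
have [J1 E1] := ito_product T0 cF bW costate_differential
  (state_differential mok bok Lbt Lbb mbE adm).
have [J2 E2] := ito_product T0 cF bW multiplier_differential
  (backward_differential mok bok Lpsit Lpsib mpsiE adm).
pose f1 t o := inner (p t o) (ma M t *m x t o + ma_b M t *m E (x t) + mb M t (v t o)) +
  inner (p_drift t o) (x t o) + inner (q t o) (mc M t) + inner (qt t o) 0.
pose f2 t o := inner (kk t o) (- (mal M t *m x t o + mal_b M t *m E (x t)
                 + mbe M t *m y t o + mbe_b M t *m E (y t)
                 + gapp (mga M) t (z t o) + gapp (mga_b M) t (E (z t))
                 + gapp (mgat M) t (zt t o) + gapp (mgat_b M) t (E (zt t))
                 + mpsi M t (v t o))) +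
  inner (k_drift t o) (y t o) + inner (k_vol t o) (z t o) + inner (k_volt t o) (zt t o).
have Es s : trim T f1 s + trim T f2 s = trim T (pairing x y z zt v) s.
  rewrite /trim; case: (boolP (0 <= s.1 <= T)) => [sT|_]; last by rewrite addr0.
  by rewrite /f1 /f2 mbE// mpsiE.
split; first exact: L1_eq Es (L1D J1 J2).
by rewrite E1 E2 -(eq_Rintegral _ (fun s _ => Es s)) intD.
Qed.

Section Competitor.
Context (v : R -> Omega -> 'cV[R]_k) (xv : R -> Omega -> 'cV[R]_n)
  (yv : R -> Omega -> 'cV[R]_m) (zv : R -> Omega -> 'M[R]_(m, r))
  (ztv : R -> Omega -> 'M[R]_(m, rt)) (Yv : R -> Omega -> 'cV[R]_rt).
Hypothesis admv : admissible M P F w wt xi Y0 v xv yv zv ztv Yv.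

Let nv := admissible_adaptedL2 mok bok admv.
Let Uv := admissible_in admv.

Definition lin_slope t o :=
  inner (bt t *m (v t o - u t o)) (p t o) - inner (psit t *m (v t o - u t o)) (kk t o).
Definition lv_slope t o := inner (lv t (xu t o) (E (xu t)) (u t o)) (v t o - u t o).

Let hamB t vv vv' o : 0 <= t <= T ->
  let H v o := hamiltonian M t (xu t o) (yu t o) (zu t o) (ztu t o)
    (E (xu t)) (E (yu t)) (E (zu t)) (E (ztu t)) v (kk t o) (p t o) (q t o) in
  H vv o - H vv' o = inner (bt t *m (vv - vv')) (p t o) - inner (psit t *m (vv - vv')) (kk t o) +
    (ml M t (xu t o) (E (xu t)) vv - ml M t (xu t o) (E (xu t)) vv').
Proof.
move=> tT /=; rewrite /hamiltonian !mbE// !mpsiE// !mulmxBr !innerDl !innerNl.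
by ring.
Qed.

(** A competing control v is adapted to the observation without control, hence
    almost surely a function of the observation of u at the same time by
    free_filtration; so v may be compared with u in the minimum condition. *)
Lemma stationarity : {ae lam, forall t : measurableTypeR R, 0 <= t <= T ->
  [/\ L1 P (lin_slope t), L1 P (lv_slope t) &
    0 <= \int[P]_o lin_slope t o + \int[P]_o lv_slope t o]}.
Proof.
have Su := adaptedL2_slices (adaptedL2_mPL2 nu); have Sv := adaptedL2_slices (adaptedL2_mPL2 nv).
apply: ae_timeS (ae_time_and minc (ae_time_and Su Sv)) => t [mint [Sut Svt]] tT.
have [Hu [Hv [cHu cHv [infH _]]]] := mint tT.
have Lu := Sut tT; have Lv := Svt tT.
have [okC /(_ t tT) [dl _ gl gg]] := ok.
have [cl _ _] := ccx.
pose G := completion P (sigma_path Yu t).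
have sY := sigma_path_sigma Yu t.
have GY : sigma_path Yu t `<=` measurable.
  by move=> A; exact: (sigma_path_meas cF tT (observation_adapted admu)).
have sG : sigma_algebra setT G by exact: completion_sigma.
have GF : G `<=` measurable by exact: completion_sub.
have Lx i : L2 P (fun o => xu t o i 0).
  exact: (differential_L2 T0 cF bW (state_differential mok bok Lbt Lbb mbE admu) i tT).
have Lp i : L2 P (fun o => p t o i 0).
  exact: (differential_L2 T0 cF bW costate_differential i tT).
have Lk i : L2 P (fun o => kk t o i 0).
  exact: (differential_L2 T0 cF bW multiplier_differential i tT).
have mu i : gmeas G (fun o => u t o i 0).
  move=> B mB; apply: (completion_incl P GY).
  have [_ mui] := admissible_obs_adaptedL2 mok admu i 0.
  exact: (mui t tT B mB).
have mv i : gmeas G (fun o => v t o i 0).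
  move=> B mB; apply: (free_filtration mok bok unc gfin Lbt Lbb mbE admu tT).
  have [[_ av _ _] _ _ _] := admv.
  exact: (meas_wrt_coord i 0 (av t tT) mB).
have inc vv : mU M vv -> forall A, G A -> 0 <= \int[P]_o (\1_A o *
    (inner (bt t *m (vv - u t o)) (p t o) - inner (psit t *m (vv - u t o)) (kk t o) +
    (ml M t (xu t o) (E (xu t)) vv - ml M t (xu t o) (E (xu t)) (u t o)))).
  move=> Uvv A GA.
  have [IH IHv _ EH] := cHv vv Uvv; have [IHu IHuu _ EHu] := cHu.
  under eq_Rintegral => o _ do rewrite -(hamB vv (u t o) o tT).
  have [A' GA' ->] := completion_int GY GA (L1B IH IHu).
  have toZ X Z : L1 P X -> L1 P Z ->
      (\int[P]_(o in A') (Z o)%:E = \int[P]_(o in A') (X o)%:E)%E ->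
      \int[P]_o (\1_A' o * X o) = \int[P]_o (\1_A' o * Z o).
    move=> IX IZ; rewrite !(sub_int_EFin GY GA')//.
    by move=> /eqP; rewrite eqe => /eqP ->.
  have E1 := toZ _ _ IH IHv (EH A' GA'); have E2 := toZ _ _ IHu IHuu (EHu A' GA').
  have I1 := L1_indic GY GA' IH; have I2 := L1_indic GY GA' IHu.
  have I3 := L1_indic GY GA' IHv; have I4 := L1_indic GY GA' IHuu.
  rewrite (eq_Rintegral _ (fun o _ => mulrBr (\1_A' o) _ _)) intB// E1 E2 -intB//.
  rewrite -[leLHS](@int0 _ _ _ P); apply: int_ae_le; [exact: L1_0|exact: L1B|].
  apply: filterS (infH vv Uvv) => o Ho.
  by rewrite -mulrBr mulr_ge0 ?subr_ge0// indicE ler0n.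
have [J1 J2 J3] := first_order_ge0 (l := fun q => ml M t q.1.1 q.1.2 q.2)
  (gx := fun q => lx M t q.1.1 q.1.2 q.2) (gxb := fun q => lxb M t q.1.1 q.1.2 q.2)
  (gv := fun q => lv t q.1.1 q.1.2 q.2) cU (ltW okC) dl
  (fun q Dq => gl q.1.1 q.1.2 q.2 Dq)
  (fun q Dq => let: And3 H _ _ := gg q.1.1 q.1.2 q.2 Dq in H)
  (fun q Dq => let: And3 _ H _ := gg q.1.1 q.1.2 q.2 Dq in H)
  (fun q Dq => let: And3 _ _ H := gg q.1.1 q.1.2 q.2 Dq in H)
  (cl t tT) sG GF Lx (fun i => Lu i 0) Lp Lk (fun o => Uu o tT) inc
  (fun o => Uv o tT) (fun i => Lv i 0) mu mv.
have E o : dL (fun _ q => lx M t q.1.1 q.1.2 q.2) (fun _ q => lxb M t q.1.1 q.1.2 q.2)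
    (fun _ q => lv t q.1.1 q.1.2 q.2) o (xu t o, E (xu t), u t o)
    ((xu t o, E (xu t), v t o) - (xu t o, E (xu t), u t o)) = lv_slope t o.
  by rewrite /dL /= !subrr !inner0r !add0r.
split=> //; first exact: L1_eq E J2.
by rewrite (eq_Rintegral _ (fun o _ => E o)) in J3.
Qed.

Let nxv : adaptedL2 P T F xv. Proof. by case: (state_adaptedL2 admv). Qed.

(** At almost every time pair_int_diff leaves, in expectation, the first-order
    term of the minimum condition: the swapped expectations cancel. *)
Lemma slope_ge0 :
  0 <= \int[LP]_s trim T (run_slope M P lv xu u xv v) s +
    (\int[LP]_s trim T (pairing xv yv zv ztv v) s -
     \int[LP]_s trim T (pairing xu yu zu ztu u) s).
Proof.
have [v0 Uv0] := Uex; have [cl _ _] := ccx.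
have [Jr _] := running_slope T0 ok ml_meas cU cl Uv0 (adaptedL2_mPL2 nxu) (adaptedL2_mPL2 nu)
  (adaptedL2_mPL2 nxv) (adaptedL2_mPL2 nv) Uu Uv.
have [Jv _] := pairing_product admv; have [Ju _] := pairing_product admu.
have [nxu' nyu nzu nztu] := state_adaptedL2 admu; have [nxv' nyv nzv nztv] := state_adaptedL2 admv.
have Jvu := L1B Jv Ju; have J := L1D Jvu Jr.
rewrite addrC -intB// -intD//.
have [Jt ->] := fub1 J.
rewrite -[leLHS](@int0 _ _ _ lam); apply: int_ae_le => //; first exact: L1_0.
have S := ae_time_and stationarity (ae_time_and (adaptedL2_slices (adaptedL2_mPL2 nxu))
  (ae_time_and (adaptedL2_slices (adaptedL2_mPL2 nxv)) (ae_time_and (adaptedL2_slices (adaptedL2_mPL2 nyu))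
  (ae_time_and (adaptedL2_slices (adaptedL2_mPL2 nyv)) (ae_time_and (adaptedL2_slices (adaptedL2_mPL2 nzu))
  (ae_time_and (adaptedL2_slices (adaptedL2_mPL2 nzv)) (ae_time_and (adaptedL2_slices (adaptedL2_mPL2 nztu))
  (ae_time_and (adaptedL2_slices (adaptedL2_mPL2 nztv)) (ae_time_and (adaptedL2_slices (adaptedL2_mPL2 np))
  (ae_time_and (adaptedL2_slices (adaptedL2_mPL2 nkk)) (adaptedL2_slices (adaptedL2_mPL2 nlxb)))))))))))).
apply: ae_timeS S => t [H [Hxu [Hxv [Hyu [Hyv [Hzu [Hzv [Hztu [Hztv [Hp [Hk Hlxb]]]]]]]]]]].
case: (boolP (0 <= t <= T)) => [tT|tT]; last first.
  rewrite -[leLHS](@int0 _ _ _ P) le_eqVlt; apply/orP; left; apply/eqP.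
  by apply: eq_Rintegral => o _; rewrite /trim /= (negbTE tT) subr0 addr0.
have [Jl Jlv pos] := H tT.
have {}Hxu := Hxu tT; have {}Hxv := Hxv tT; have {}Hyu := Hyu tT; have {}Hyv := Hyv tT.
have {}Hzu := Hzu tT; have {}Hzv := Hzv tT; have {}Hztu := Hztu tT; have {}Hztv := Hztv tT.
have {}Hp := Hp tT; have {}Hk := Hk tT; have {}Hlxb := Hlxb tT.
have LQ1 := L2mD (L2m_mul (ma_b M t)^T Hp) Hlxb.
have LQ2 := L2m_mul (mal_b M t)^T Hk; have LQ3 := L2m_mul (mbe_b M t)^T Hk.
have LQ4 := L2m_gappT (mga_b M) t Hk; have LQ5 := L2m_gappT (mgat_b M) t Hk.
have LX := L2mB Hxv Hxu; have LY := L2mB Hyv Hyu; have LZ := L2mB Hzv Hzu.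
have LZt := L2mB Hztv Hztu.
have [W1 w1] := swap_int LQ1 LX; have [W2 w2] := swap_int LQ2 LX.
have [W3 w3] := swap_int LQ3 LY; have [W4 w4] := swap_int LQ4 LZ.
have [W5 w5] := swap_int LQ5 LZt.
have Eo o : trim T (pairing xv yv zv ztv v) (t, o) - trim T (pairing xu yu zu ztu u) (t, o) +
    trim T (run_slope M P lv xu u xv v) (t, o) =
  (lin_slope t o + lv_slope t o) +
  swap P (fun o => (ma_b M t)^T *m p t o + lxbu t o) (fun o => xv t o - xu t o) o -
  swap P (fun o => (mal_b M t)^T *m kk t o) (fun o => xv t o - xu t o) o -
  swap P (fun o => (mbe_b M t)^T *m kk t o) (fun o => yv t o - yu t o) o -
  swap P (fun o => gappT (mga_b M) t (kk t o)) (fun o => zv t o - zu t o) o -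
  swap P (fun o => gappT (mgat_b M) t (kk t o)) (fun o => ztv t o - ztu t o) o.
  rewrite /trim /= tT /swap !meanB// (mean_mul _ Hk) (mean_mul (mbe_b M t)^T Hk) !mean_gappT//.
  exact: pair_int_diff.
rewrite (eq_Rintegral _ (fun o _ => Eo o)).
have K0 := L1D Jl Jlv; have K1 := L1D K0 W1; have K2 := L1B K1 W2; have K3 := L1B K2 W3.
have K4 := L1B K3 W4.
by rewrite intB// intB// intB// intB// intD// intD// w1 w2 w3 w4 w5 addr0 !subr0.
Qed.

Let TT : 0 <= T <= T. Proof. by rewrite lexx ltW. Qed.
Let ZT : 0 <= (0 : R) <= T. Proof. by rewrite lexx ltW. Qed.

Let L2m_diff pp (X D : R -> Omega -> 'cV[R]_pp) Z Zt t : 0 <= t <= T ->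
  L2_differential P T F w wt X D Z Zt -> L2m P (X t).
Proof. by move=> tT dX i j; rewrite (ord1 j); exact: (differential_L2 T0 cF bW dX i tT). Qed.

Let Lk0 : L2m P (kk 0). Proof. exact: L2m_diff ZT multiplier_differential. Qed.
Let LkT : L2m P (kk T). Proof. exact: L2m_diff TT multiplier_differential. Qed.
Let LpT : L2m P (p T). Proof. exact: L2m_diff TT costate_differential. Qed.
Let Lp0 : L2m P (p 0). Proof. exact: L2m_diff ZT costate_differential. Qed.

Let L2m_state t : 0 <= t <= T -> [/\ L2m P (xu t), L2m P (xv t), L2m P (yu t) & L2m P (yv t)].
Proof.
move=> tT; split.
- exact: L2m_diff tT (state_differential mok bok Lbt Lbb mbE admu).
- exact: L2m_diff tT (state_differential mok bok Lbt Lbb mbE admv).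
- exact: L2m_diff tT (backward_differential mok bok Lpsit Lpsib mpsiE admu).
- exact: L2m_diff tT (backward_differential mok bok Lpsit Lpsib mpsiE admv).
Qed.

(** The pairing is known at both ends: the terminal values of the costate and
    of the backward state combine into the slope of the terminal cost, the
    forward states start from the same point, and the initial value of the
    multiplier is minus the slope of the initial cost. *)
Lemma pairing_ends :
  \int[LP]_s trim T (pairing xv yv zv ztv v) s -
  \int[LP]_s trim T (pairing xu yu zu ztu u) s =
  \int[P]_o (inner (phix M (xu T o) (E (xu T))) (xv T o - xu T o) +
             inner (phixb M (xu T o) (E (xu T))) (E (xv T) - E (xu T))) +
  \int[P]_o inner (vphiy M (yu 0 o)) (yv 0 o - yu 0 o).
Proof.
have [_ <-] := pairing_product admv; have [_ <-] := pairing_product admu.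
have [LxuT LxvT LyuT LyvT] := L2m_state TT; have [Lxu0 Lxv0 Lyu0 Lyv0] := L2m_state ZT.
have [_ [_ _ k0 pT]] := adj.
have [_ [_ [_ _ xu0 yuT]] _ _] := admu; have [_ [_ [_ _ xv0 yvT]] _ _] := admv.
have [_ [_ okphi _]] := mok.
have Ix0 : \int[P]_o inner (p 0 o) (xv 0 o) = \int[P]_o inner (p 0 o) (xu 0 o).
  apply: int_ae_eq; [exact: L1_meas (inner_L2m Lp0 Lxv0)|exact: L1_meas (inner_L2m Lp0 Lxu0)|].
  by apply: filterS (ae_and xu0 xv0) => o [-> ->].
have Iy0 : \int[P]_o inner (kk 0 o) (yv 0 o) - \int[P]_o inner (kk 0 o) (yu 0 o) =
    - \int[P]_o inner (vphiy M (yu 0 o)) (yv 0 o - yu 0 o).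
  have LY := inner_L2m Lk0 (L2mB Lyv0 Lyu0).
  have LYN : L1 P (fun o => - inner (kk 0 o) (yv 0 o - yu 0 o)) by exact: L1N.
  rewrite -intB; [|exact: inner_L2m|exact: inner_L2m].
  under eq_Rintegral => o _ do rewrite -innerBr.
  rewrite -[LHS]opprK -intN//; congr (- _); apply: int_ae_eq; first exact: L1_meas LYN.
    have [_ [_ _ okv]] := mok.
    under [X in measurable_fun _ X]funext => o do rewrite inner_col.
    apply: measurable_sum => i; apply: measurable_funM; first exact: vphiy_meas.
    exact: L2_meas (L2mB Lyv0 Lyu0 i 0).
  by apply: filterS k0 => o ->; rewrite innerNl opprK.
have IT : (\int[P]_o inner (p T o) (xv T o) - \int[P]_o inner (p T o) (xu T o)) +
    (\int[P]_o inner (kk T o) (yv T o) - \int[P]_o inner (kk T o) (yu T o)) =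
    \int[P]_o (inner (phix M (xu T o) (E (xu T))) (xv T o - xu T o) +
             inner (phixb M (xu T o) (E (xu T))) (E (xv T) - E (xu T))).
  have LX := L2mB LxvT LxuT.
  have Lphix := phix_L2m okphi (E (xu T)) LxuT; have Lphixb := phixb_L2m okphi (E (xu T)) LxuT.
  have LQ := L2m_mul (mrho_b M)^T LkT.
  have [W1 w1] := swap_int Lphixb LX; have [W2 w2] := swap_int LQ LX.
  have J1 := inner_L2m LpT LxvT; have J2 := inner_L2m LpT LxuT.
  have J3 := inner_L2m LkT LyvT; have J4 := inner_L2m LkT LyuT.
  have J12 := L1B J1 J2; have J34 := L1B J3 J4.
  have Js := L1D (inner_L2m Lphix LX) (inner_L2m Lphixb (L2m_cst P (E (xv T) - E (xu T)))).
  rewrite -intB// -intB// -intD//.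
  transitivity (\int[P]_o ((inner (phix M (xu T o) (E (xu T))) (xv T o - xu T o) +
        inner (phixb M (xu T o) (E (xu T))) (E (xv T) - E (xu T))) -
      swap P (fun o => phixb M (xu T o) (E (xu T))) (fun o => xv T o - xu T o) o +
      swap P (fun o => (mrho_b M)^T *m kk T o) (fun o => xv T o - xu T o) o)); last first.
    have JW := L1B Js W1.
    by rewrite intD// intB// w1 w2 subr0 addr0.
  apply: int_ae_eq.
  - exact: L1_meas (L1D J12 J34).
  - exact: L1_meas (L1D (L1B Js W1) W2).
  - apply: filterS (ae_and pT (ae_and yuT yvT)) => o [-> [-> ->]].
    rewrite /swap !meanB// (mean_mul _ LkT).
    rewrite !(innerBl, innerDl, innerNl, inner_adjT) !(innerBr, innerDr, innerNr, mulmxBr).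
    by ring.
rewrite Ix0 -IT.
have -> : forall a b c e f g h : R, a - b + (c - e) - (f - b + (g - h)) =
    (a - f) + (c - g) + - (e - h) by move=> *; ring.
by rewrite Iy0 opprK.
Qed.

Let costE x y vv : L1 LP (trim T (fun t o => ml M t (x t o) (E (x t)) (vv t o))) ->
  L1 P (fun o => mphi M (x T o) (E (x T))) -> L1 P (fun o => mvphi M (y 0 o)) ->
  cost M P vv x y = (\int[LP]_s trim T (fun t o => ml M t (x t o) (E (x t)) (vv t o)) s +
    \int[P]_o mphi M (x T o) (E (x T)) + \int[P]_o mvphi M (y 0 o))%:E.
Proof.
move=> Jl Jp Jv; have [Jo ->] := fub2 Jl.
pose run o := \int[lam]_t trim T (fun t o => ml M t (x t o) (E (x t)) (vv t o)) (t, o).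
have Er o : \int[lebesgue_measure]_(t in `[0, T]) ml M t (x t o) (E (x t)) (vv t o) = run o.
  rewrite [LHS]Rintegral_mkcond; apply: eq_Rintegral => t _.
  rewrite patchE /trim /= (_ : (t \in `[0, T]%classic) = (0 <= t <= T)); last first.
    by apply/idP/idP; rewrite inE /= in_itv.
  by case: ifP.
have J := L1D (L1D Jo Jp) Jv.
rewrite -intD// -intD//; last exact: L1D.
rewrite (EFin_int J) /cost unlock.
by apply: eq_integral => o _; rewrite Er.
Qed.

(** Convexity bounds the difference of the costs below by the sum of the slopes
    of the three costs. By pairing_ends the slopes of the terminal and initial
    costs are an integral over time, and slope_ge0 concludes. *)
Lemma cost_le : (cost M P u xu yu <= cost M P v xv yv)%E.
Proof.
have [v0 Uv0] := Uex; have [cl cphi cvphi] := ccx.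
have [_ [_ okphi okv]] := mok.
have [LxuT LxvT _ _] := L2m_state TT; have [_ _ Lyu0 Lyv0] := L2m_state ZT.
have [_ slope] := running_slope T0 ok ml_meas cU cl Uv0 (adaptedL2_mPL2 nxu) (adaptedL2_mPL2 nu)
  (adaptedL2_mPL2 nxv) (adaptedL2_mPL2 nv) Uu Uv.
have tslope := terminal_slope okphi cphi (E (xu T)) (E (xv T)) LxuT LxvT.
have Lg : L2m P (fun o => vphiy M (yu 0 o)).
  move=> i j; rewrite (ord1 j).
  have [_ [_ _ k0 _]] := adj.
  apply: L2_ae_eq (L2N (Lk0 i 0)); first exact: vphiy_meas.
  by apply: filterS k0 => o ->; rewrite mxE opprK.
have islope := initial_slope okv cvphi Lyu0 Lyv0 Lg.
have pos := slope_ge0; rewrite pairing_ends in pos.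
rewrite !costE.
- by rewrite lee_fin; lra.
- exact: (running_L1 T0 ok ml_meas Uv0 (adaptedL2_mPL2 nxv) (adaptedL2_mPL2 nv) Uv).
- exact: terminal_L1.
- exact: initial_L1.
- exact: (running_L1 T0 ok ml_meas Uv0 (adaptedL2_mPL2 nxu) (adaptedL2_mPL2 nu) Uu).
- exact: terminal_L1.
- exact: initial_L1.
Qed.

End Competitor.
End Duality.

Theorem theorem3p2 (R : realType) (n m r rt k : nat)
    (M : model R n m r rt k)
    (d : measure_display) (Omega : measurableType d)
    (P : probability Omega R) (F : R -> set (set Omega))
    (w : R -> Omega -> 'cV[R]_r) (wt : R -> Omega -> 'cV[R]_rt)
    (xi : Omega -> 'cV[R]_n)
    (x0 : R -> Omega -> 'cV[R]_n) (Y0 : R -> Omega -> 'cV[R]_rt)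
    (bt : R -> 'M[R]_(n, k)) (bb : R -> 'cV[R]_n)
    (psit : R -> 'M[R]_(m, k)) (psib : R -> 'cV[R]_m)
    (u : R -> Omega -> 'cV[R]_k)
    (xu : R -> Omega -> 'cV[R]_n) (yu : R -> Omega -> 'cV[R]_m)
    (zu : R -> Omega -> 'M[R]_(m, r)) (ztu : R -> Omega -> 'M[R]_(m, rt))
    (Yu : R -> Omega -> 'cV[R]_rt)
    (kk : R -> Omega -> 'cV[R]_m) (p : R -> Omega -> 'cV[R]_n)
    (q : R -> Omega -> 'M[R]_(n, r)) (qt : R -> Omega -> 'M[R]_(n, rt)) :
  model_ok M ->
  basis_ok M P F w wt xi ->
  uncontrolled_eq M P F w wt xi x0 Y0 ->
  (forall v, Uad0 M P Y0 v ->
     (sqint P (mT M) (fun t o => mg M t (v t o)) < +oo)%E) ->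
  costs_convex M ->
  [/\ Linf (mT M) bt, Linf (mT M) bb, Linf (mT M) psit & Linf (mT M) psib] ->
  (forall t v, 0 <= t <= mT M -> mb M t v = bt t *m v + bb t) ->
  (forall t v, 0 <= t <= mT M -> mpsi M t v = psit t *m v + psib t) ->
  admissible M P F w wt xi Y0 u xu yu zu ztu Yu ->
  adjoint_eq M P F w wt u xu yu kk p q qt ->
  minimum_condition M P u xu yu zu ztu Yu kk p q ->
  cost M P u xu yu =
  ereal_inf [set J | exists v x y z zt Y,
    admissible M P F w wt xi Y0 v x y z zt Y /\ J = cost M P v x y].
Proof.
move=> mok bok unc gfin ccx [Lbt Lbb Lpsit Lpsib] mbE mpsiE admu adj minc.
have [_ [[mlm [lv [C ok]]] _ _]] := mok.
apply/eqP; rewrite eq_le; apply/andP; split.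
  apply: le_ereal_inf_tmp => _ [v [x [y [z [zt [Y [adm ->]]]]]]].
  exact: (cost_le mok bok unc gfin ccx Lbt Lbb Lpsit Lpsib mbE mpsiE admu adj minc ok mlm adm).
by apply: ereal_inf_lbound; exists u, xu, yu, zu, ztu, Yu.
Qed.
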